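(* Let $n\ge 3$ and let $\Gamma\le \mathrm{SL}(n,\mathbf{Z})$ be a finite-index subgroup. Then for every $r>2$ and for $r=\omega$ there exist uncountably many $C^r$ actions of $\Gamma$ on the $n$-torus $\mathbf{T}^n$, none of which is $C^1$-conjugate to another.
   Context: $\mathbf{T}^n=\mathbf{R}^n/\mathbf{Z}^n$. A $C^r$ action of $\Gamma$ is a homomorphism $\Gamma\to \mathrm{Diff}^r(\mathbf{T}^n)$, with $r=\omega$ meaning real-analytic. Two actions $\rho_1,\rho_2$ are $C^1$-conjugate if there is a $C^1$ diffeomorphism $f$ of $\mathbf{T}^n$ with $f\circ\rho_1(\gamma)=\rho_2(\gamma)\circ f$ for all $\gamma\in\Gamma$. *)

(* Defs.v *)
From HB Require Import structures.
From mathcomp Require Import all_boot all_order all_algebra finmap.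
From mathcomp Require Import all_classical all_reals all_analysis.
From mathcomp.analysis.showcase Require Import summability.
Import Order.TTheory GRing.Theory Num.Theory.
Import numFieldNormedType.Exports.
Set Implicit Arguments.
Unset Strict Implicit.
Unset Printing Implicit Defensive.
Local Open Scope classical_set_scope.
Local Open Scope ring_scope.

(* Cfin r is C^r for a real r >= 0: for r = k + alpha with k a natural number
   and 0 < alpha < 1, this is the Hoelder class C^{k,alpha}. *)
Inductive regularity (R : Type) := Cfin of R | Cinfty | Comega.
Arguments Cinfty {R}.
Arguments Comega {R}.

Definition regularity_gt (R : realType) (a : R) (r : regularity R) : Prop :=
  if r is Cfin s then a < s else True.

Section Regularity.
Context {R : realType} {n : nat} {W : normedModType R}.
Implicit Types (U : set 'rV[R]_n) (f : 'rV[R]_n -> W).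

Definition locally_holder_on (alpha : R) U f : Prop :=
  forall x, U x -> exists C e : R, 0 < e /\
    forall y z, ball x e y -> ball x e z ->
      `|f y - f z| <= C * `|y - z| `^ alpha.

(* The functions x |-> 'd f x v, for all vectors v, carry the same information
   as the derivative Df, so that the recursion below is on the order of Df. *)
Fixpoint Ck_on (k : nat) (alpha : R) U f : Prop :=
  if k is k'.+1 then
    (forall x, U x -> differentiable f x) /\
    (forall v : 'rV[R]_n, Ck_on k' alpha U (fun x => 'd f x v))
  else
    (forall x, U x -> {for x, continuous f}) /\
    (0 < alpha -> locally_holder_on alpha U f).

(* Near each point of U, f is the sum of a power series, indexed by the
   multi-indices a, that converges unconditionally. *)
Definition analytic_on U f : Prop :=
  forall x, U x -> exists (c : {ffun 'I_n -> nat} -> W) (e : R), 0 < e /\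
    forall y, ball x e y ->
      partial_sum (fun a : {ffun 'I_n -> nat} =>
        (\prod_(i < n) (y - x) 0 i ^+ a i) *: c a) J @[J --> totally] --> f y.

Definition class_on (r : regularity R) U f : Prop :=
  match r with
  | Cfin s => Ck_on (Num.truncn s) (s - (Num.truncn s)%:R) U f
  | Cinfty => forall k, Ck_on k 0 U f
  | Comega => analytic_on U f
  end.

End Regularity.

Section Torus.
Variables (R : realType) (n : nat).

Definition torus_rel : rel 'rV[R]_n :=
  fun x y => [forall i, (x - y) 0 i \is a Num.int].

Lemma torus_rel_refl : reflexive torus_rel.
Proof. by move=> x; apply/forallP => i; rewrite subrr mxE rpred0. Qed.

Lemma torus_rel_sym : symmetric torus_rel.
Proof.
by move=> x y; apply: eq_forallb => i; rewrite -opprB mxE rpredN.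
Qed.

Lemma torus_rel_trans : transitive torus_rel.
Proof.
move=> y x z /forallP xy /forallP yz; apply/forallP => i.
have -> : x - z = (x - y) + (y - z) by rewrite addrA subrK.
by rewrite mxE rpredD.
Qed.

Canonical torus_equiv :=
  EquivRel torus_rel torus_rel_refl torus_rel_sym torus_rel_trans.

Definition torus := {eq_quot torus_equiv}%qT.

Definition torus_proj (x : 'rV[R]_n) : torus := (\pi_torus x)%qT.

(* The charts of the torus are the local inverses of the covering torus_proj:
   f is of class C^r when it has, near each point, a lift of class C^r. *)
Definition torus_class (r : regularity R) (f : torus -> torus) : Prop :=
  forall x : 'rV[R]_n, exists (U : set 'rV[R]_n) (F : 'rV[R]_n -> 'rV[R]_n),
    [/\ open U, U x, class_on r U F &
        forall y, U y -> torus_proj (F y) = f (torus_proj y)].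

Definition torus_diffeo (r : regularity R) (f : torus -> torus) : Prop :=
  torus_class r f /\
  exists g, [/\ torus_class r g, cancel f g & cancel g f].

End Torus.

Definition SLZ (n : nat) : set 'M[int]_n := [set g | \det g = 1].

Definition SLZ_subgroup (n : nat) (G : set 'M[int]_n) : Prop :=
  [/\ G `<=` @SLZ n, G 1%:M, forall g h, G g -> G h -> G (g *m h) &
      forall g, G g -> G (invmx g)].

Definition finite_index (n : nat) (G : set 'M[int]_n) : Prop :=
  finite_set [set [set g *m h | h in G] | g in @SLZ n].

Section Actions.
Context {R : realType} {n : nat} {G : set 'M[int]_n}.
Implicit Types rho : G -> torus R n -> torus R n.

Definition torus_action (r : regularity R) rho : Prop :=
  (forall g, torus_diffeo r (rho g)) /\
  (forall g h k : G, val k = val g *m val h -> rho k = rho g \o rho h).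

Definition C1_conjugate rho1 rho2 : Prop :=
  exists f : torus R n -> torus R n,
    torus_diffeo (Cfin 1) f /\ forall g, f \o rho1 g = rho2 g \o f.

End Actions.

(* Main.v *)
(* A small ball around the origin of the torus is cut by the two spheres kf = 0 and kf = - b. Off the
   spheres the matrices act linearly in an analytic coordinate Px, with values in R^n / per Z^n outside
   the ball and in R^n on the shell and in the center, and on the spheres they act on the directions of
   a vector Qx. Near a sphere with equation kappa = 0, Px is the product of |kappa|^m and a nonvanishing
   analytic vector Q, where m is the parameter lam on the outer sphere and - 1 on the inner one; in the
   variables (kappa exp(s t), exp(- t) Q) with s m = 1 the linear action is visibly analytic across the
   sphere. The coordinate is built from the integral prof of Re (k + exp(2 pi i u))^(- lam) because
   k^lam prof(1/2, k) does not depend on k > 1, which makes Px compatible with integer translations.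

   Some power of a hyperbolic matrix lies in Gamma. It has an eigenvalue chi > 1, hence a fixed point on
   the outer sphere, at which the derivative of kf is an eigenvector of the transposed differential with
   eigenvalue chi^(1 / lam). At a fixed point of the action with parameter lam' the eigenvalues of the
   differential are among chi^j, |j| <= 2, and chi^(+-1 / lam'). They are invariant under C^1 conjugacy,
   so that lam = lam' when both lie between 1 and 3/2. *)
Require Import Defs.
From HB Require Import structures.
From mathcomp Require Import all_boot all_order all_algebra finmap.
From mathcomp Require Import all_classical all_reals all_analysis.
From mathcomp.analysis.showcase Require Import summability.
From mathcomp Require Import ring lra.
Import Order.TTheory GRing.Theory Num.Theory.
Import numFieldNormedType.Exports.
Set Implicit Arguments.
Unset Strict Implicit.
Unset Printing Implicit Defensive.
Local Open Scope classical_set_scope.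
Local Open Scope ring_scope.

(** * Analytic functions of several variables *)

Section UnconditionalSums.
Context {R : realType}.

(** Analyticity excludes cut-off functions, so nothing can be pasted into the linear action: one
    formula for the coordinate has to work on both sides of each sphere. The origin, a fixed point
    of the linear action, is blown up to its sphere of directions, where [Px] tends to 0. The
    exponent with which the radial variable enters there is a free choice of the gluing, and it
    survives as the transverse eigenvalue. Continued analytically through the sphere, [Px] leaves 0
    again and grows inwards, so it cannot be the linear coordinate of a ball with its fixed point in
    the middle. The pole of [Px] on the inner sphere repairs this: the shell becomes R^n without 0,
    and beyond infinity the center becomes all of R^n.

    Most estimates show that in each region [Px] is injective, onto and a local diffeomorphism. All
    coordinates of [Px x] are values of one function [fH] at (x_i, [kf x]), so injectivity and the
    Jacobian are controlled by the signs of its partial derivatives; in the shell, where [fH]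
    decreases in k, weights adding up to [kf + 2 b] replace the plain signs. *)

Definition hsum (T : choiceType) (f : T -> R) (l : R) : Prop :=
  forall e : R, 0 < e -> exists A : {fset T}, forall B : {fset T}, (A `<=` B)%fset ->
    `|l - \sum_(i <- B) f i| <= e.

(** Absolute convergence with an explicit bound, which later serves as the norm of a power
    series. *)
Definition abs_bounded (T : choiceType) (f : T -> R) (M : R) : Prop :=
  forall B : {fset T}, \sum_(i <- B) `|f i| <= M.

Lemma hsum_unique (T : choiceType) (f : T -> R) l l' :
  hsum f l -> hsum f l' -> l = l'.
Proof.
move=> h h'; apply/eqP; rewrite -subr_eq0 -normr_le0; apply/ler_addgt0Pl => e e0.
have e2 : 0 < e / 2 by rewrite divr_gt0.
have [A hA] := h _ e2; have [A' hA'] := h' _ e2.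
have := hA (A `|` A')%fset (fsubsetUl _ _); have := hA' (A `|` A')%fset (fsubsetUr _ _).
set s := \sum_(i <- _) _; rewrite addr0 => h1 h2.
by have := ler_normD (l - s) (s - l'); rewrite subrKA (distrC s); lra.
Qed.

Lemma eq_hsum (T : choiceType) (f g : T -> R) l : f =1 g -> hsum f l -> hsum g l.
Proof.
move=> fg h e e0; have [A hA] := h _ e0; exists A => B AB.
by rewrite -(eq_bigr _ (fun i _ => fg i)); apply: hA.
Qed.

Lemma hsumD (T : choiceType) (f g : T -> R) l m :
  hsum f l -> hsum g m -> hsum (fun t => f t + g t) (l + m).
Proof.
move=> hf hg e e0; have e2 : 0 < e / 2 by rewrite divr_gt0.
have [A hA] := hf _ e2; have [A' hA'] := hg _ e2.
exists (A `|` A')%fset => B; rewrite fsubUset => /andP[/hA h1 /hA' h2].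
rewrite big_split /= opprD addrACA.
by apply: le_trans (ler_normD _ _) _; lra.
Qed.

Lemma hsumZ (T : choiceType) (f : T -> R) l a :
  hsum f l -> hsum (fun t => a * f t) (a * l).
Proof.
move=> hf e e0; have e2 : 0 < e / (1 + `|a|) by rewrite divr_gt0 // ltr_pwDl.
have [A hA] := hf _ e2; exists A => B /hA h.
rewrite -mulr_sumr -mulrBr normrM.
apply: le_trans (_ : (1 + `|a|) * (e / (1 + `|a|)) <= _).
  by apply: ler_pM => //; rewrite lerDr.
by rewrite mulrCA divff ?mulr1 // gt_eqF // ltr_pwDl.
Qed.

Lemma hsum_single (T : choiceType) (f : T -> R) t0 :
  (forall t, t != t0 -> f t = 0) -> hsum f (f t0).
Proof.
move=> f0 e e0; exists [fset t0]%fset => B; rewrite fsub1set => tB.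
rewrite (big_fsetD1 t0) //= big1_seq; first by rewrite addr0 subrr normr0 ltW.
by move=> i /andP[_]; rewrite !inE => /andP[/f0].
Qed.

Lemma hsum_le (T : choiceType) (f : T -> R) l M :
  hsum f l -> (forall B : {fset T}, `|\sum_(i <- B) f i| <= M) -> `|l| <= M.
Proof.
move=> hf bM; apply/ler_addgt0Pl => e e0; have [A /(_ A (fsubset_refl _)) h] := hf _ e0.
have := bM A; set s := \sum_(_ <- _) _ in h * => h2.
by have := ler_normD (l - s) s; rewrite subrK; lra.
Qed.

Lemma abs_bounded_sum (T : choiceType) (f : T -> R) M (B : {fset T}) :
  abs_bounded f M -> `|\sum_(i <- B) f i| <= M.
Proof. by move=> /(_ B); apply: le_trans; apply: ler_norm_sum. Qed.

Lemma hsum_bound (T : choiceType) (f : T -> R) l M :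
  hsum f l -> abs_bounded f M -> `|l| <= M.
Proof. by move=> h b; apply: hsum_le h _ => B; apply: abs_bounded_sum. Qed.

Lemma psum_subset (T : choiceType) (f : T -> R) (A B : {fset T}) :
  (forall t, 0 <= f t) -> (A `<=` B)%fset ->
  \sum_(i <- A) f i <= \sum_(i <- B) f i.
Proof.
move=> f0 AB; rewrite (big_fsetID _ (fun x => x \in A) B) /=.
have -> : [fset x | x in B & x \in A]%fset = A.
  by apply/fsetP => x; rewrite !inE /= andbC; case: (boolP (x \in A)) => // /(fsubsetP AB).
by rewrite lerDl sumr_ge0.
Qed.

Lemma abs_bounded_eq_hsum_ge0 (T : choiceType) (f : T -> R) M :
  (forall t, 0 <= f t) -> abs_bounded f M -> exists l, hsum f l.
Proof.
move=> f0 bM; pose E := [set x | exists B : {fset T}, x = \sum_(i <- B) f i].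
have E0 : E !=set0 by exists 0, fset0; rewrite big_seq_fset0.
have Eub : ubound E M.
  move=> x [B ->]; apply: le_trans (bM B); apply: ler_sum => i _; exact: ler_norm.
have hsE : has_sup E by split=> //; exists M.
exists (sup E) => e e0; have [x [A ->] hA] := sup_adherent e0 hsE.
exists A => B AB.
have h1 : \sum_(i <- B) f i <= sup E by apply: ub_le_sup; [exists M | exists B].
have h2 := psum_subset f0 AB.
by rewrite ger0_norm; lra.
Qed.

Lemma abs_bounded_le (T : choiceType) (f g : T -> R) M :
  (forall t, `|g t| <= `|f t|) -> abs_bounded f M -> abs_bounded g M.
Proof. by move=> gf h B; apply: le_trans (h B); apply: ler_sum. Qed.

(** The positive and negative parts are nonnegative families bounded by M, and each converges to the
    supremum of its finite sums. *)
Lemma hsum_ex (T : choiceType) (f : T -> R) M : abs_bounded f M -> exists l, hsum f l.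
Proof.
move=> bM; pose p t := (`|f t| + f t) / 2; pose q t := (`|f t| - f t) / 2.
have p0 t : 0 <= p t by rewrite /p; have := ler_norm (- f t); rewrite normrN; lra.
have q0 t : 0 <= q t by rewrite /q; have := ler_norm (f t); lra.
have [|l hl] := @abs_bounded_eq_hsum_ge0 T p M p0.
  apply: abs_bounded_le bM => t; rewrite (ger0_norm (p0 t)) /p.
  by have := ler_norm (f t); lra.
have [|m hm] := @abs_bounded_eq_hsum_ge0 T q M q0.
  apply: abs_bounded_le bM => t; rewrite (ger0_norm (q0 t)) /q.
  by have := ler_norm (- f t); rewrite normrN; lra.
exists (l + -1 * m); apply: eq_hsum (hsumD hl (hsumZ (-1) hm)) => t.
by rewrite /p /q; lra.
Qed.

(** Partial sums of F over a product of finite sets are close to l, and the second factor can be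
    taken large enough for each of the finitely many rows at once. *)
Lemma hsum_fubini (I J : choiceType) (F : I * J -> R) (g : I -> R) l :
  hsum F l -> (forall i, hsum (fun j => F (i, j)) (g i)) -> hsum g l.
Proof.
move=> hF hg e e0; have e2 : 0 < e / 2 by rewrite divr_gt0.
have [A hA] := hF _ e2; exists [fset x.1 | x in A]%fset => B1 AB1.
(* The error allowed in each row of [B1]; the [+ 1] keeps the divisor positive when there are no
   rows. *)
pose d := e / 2 / (#|`B1|%:R + 1).
have d0 : 0 < d by rewrite divr_gt0 // ltr_wpDl.
have hC i : exists C : {fset J}, forall B, (C `<=` B)%fset ->
   `|g i - \sum_(j <- B) F (i, j)| <= d by exact: hg.
have /choice[C hCC] := hC.
pose C0 := ([fset x.2 | x in A] `|` \bigcup_(i <- B1) C i)%fset.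
have := hA [fset ((i, j) : (I * J)%type) | i in B1, j in C0]%fset.
have sub : (A `<=` [fset ((i, j) : (I * J)%type) | i in B1, j in C0])%fset.
  apply/fsubsetP => -[i j] ijA; apply/imfset2P; exists i => /=.
    by apply: (fsubsetP AB1); apply/imfsetP; exists (i, j).
  by exists j => //=; rewrite !inE; apply/orP; left; apply/imfsetP; exists (i, j).
move=> /(_ sub).
rewrite big_imfset2 /=; last by move=> [? ?] [? ?] _ _ /= [-> ->].
set S := \sum_(i <- B1) \sum_(j <- C0) _ => h1.
have h2 : `|S - \sum_(i <- B1) g i| <= e / 2.
  rewrite /S -sumrB; apply: le_trans (ler_norm_sum _ _ _) _.
  apply: le_trans (_ : \sum_(i <- B1) d <= _).
    rewrite big_seq [leRHS]big_seq; apply: ler_sum => i iB; rewrite distrC; apply: hCC.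
    by apply: fsubset_trans (fsubsetUr _ _); apply: bigfcup_sup.
  rewrite big_const_seq count_predT iter_addr_0 -[leLHS]mulr_natr /d mulrAC ler_pdivrMr ?ltr_wpDl //.
  by rewrite ler_pM2l // lerDl.
have := ler_normD (l - S) (S - \sum_(i <- B1) g i); rewrite subrKA => h3.
by apply: le_trans h3 _; lra.
Qed.

Lemma hsum_swap (I J : choiceType) (F : I * J -> R) l :
  hsum F l -> hsum (fun x : J * I => F (x.2, x.1)) l.
Proof.
move=> hF e e0; have [A hA] := hF _ e0.
exists [fset ((x.2, x.1) : (J * I)%type) | x in A]%fset => B AB.
have := hA [fset ((x.2, x.1) : (I * J)%type) | x in B]%fset.
rewrite big_imfset /=; last by move=> [? ?] [? ?] _ _ [-> ->].
apply; apply/fsubsetP => -[i j] ijA; apply/imfsetP; exists (j, i) => //=.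
by apply: (fsubsetP AB); apply/imfsetP; exists (i, j).
Qed.

(** Reindexing of a countable family by [nat]: numbers that encode no element contribute 0. *)
Lemma sum_pickle (T : countType) (f : T -> R) (B : {fset nat}) :
  \sum_(m <- B) (if pickle_inv m is Some t then f t else 0) =
  \sum_(t <- [fset t in pmap (pickle_inv) B]%fset) f t.
Proof.
have u : @uniq T (pmap (pickle_inv) B).
  by apply: (pmap_uniq (@pickle_invK T)); apply: fset_uniq.
rewrite [RHS](perm_big (pmap (pickle_inv) B)) /=; last first.
  apply: uniq_perm => //; first exact: fset_uniq.
  by move=> x; rewrite !inE.
elim: (B : seq nat) => [|m s IH]; first by rewrite !big_nil.
rewrite big_cons /=; case: (pickle_inv m) => [t|] /=; last by rewrite add0r.
by rewrite big_cons IH.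
Qed.

Lemma hsum_pickle (T : countType) (f : T -> R) l :
  hsum f l -> hsum (fun m => if pickle_inv m is Some t then f t else 0) l.
Proof.
move=> hf e e0; have [A hA] := hf _ e0.
exists [fset (choice.pickle t : nat) | t in A]%fset => B AB; rewrite sum_pickle; apply: hA.
apply/fsubsetP => t tA; rewrite !inE mem_pmap; apply/mapP; exists (choice.pickle t).
  by apply: (fsubsetP AB); apply/imfsetP; exists t.
by rewrite pickleK_inv.
Qed.

Lemma abs_bounded_pickle (T : countType) (f : T -> R) M :
  abs_bounded f M -> abs_bounded (fun m => if pickle_inv m is Some t then f t else 0) M.
Proof.
move=> bM B; apply: le_trans (bM [fset t in pmap (pickle_inv) B]%fset).
rewrite -(sum_pickle (fun t => `|f t|)); apply: ler_sum => m _.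
by case: pickle_inv => //; rewrite normr0.
Qed.

Lemma abs_bounded_prod (I J : choiceType) (F : I * J -> R) (M : I -> R) N :
  (forall i, abs_bounded (fun j => F (i, j)) (M i)) -> abs_bounded M N ->
  abs_bounded F N.
Proof.
move=> hF hM B.
apply: le_trans (_ : \sum_(x <- [fset ((i, j) : (I * J)%type) | i in [fset x.1 | x in B], j in [fset x.2 | x in B]]%fset) `|F x| <= _).
  apply: psum_subset => //; apply/fsubsetP => -[i j] ijB.
  apply/imfset2P; exists i; first by apply/imfsetP; exists (i, j).
  by exists j => //; apply/imfsetP; exists (i, j).
rewrite big_imfset2 /=; last by move=> [? ?] [? ?] _ _ /= [-> ->].
apply: le_trans (hM [fset x.1 | x in B]%fset); apply: ler_sum => i _.
exact: le_trans (hF i _) (ler_norm _).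
Qed.

End UnconditionalSums.

(** * Absolutely convergent power series on a polydisc *)

Section PowerSeries.
Context {R : realType}.

Lemma hsum_fin (T : finType) (f : T -> R) : hsum f (\sum_t f t).
Proof.
move=> e e0; exists [fset t | t in T]%fset => B /fsubsetP AB.
have -> : \sum_(i <- B) f i = \sum_t f t.
  apply: perm_big; apply: uniq_perm; rewrite ?fset_uniq ?index_enum_uniq //.
  by move=> t; rewrite mem_index_enum AB // !inE.
by rewrite subrr normr0 ltW.
Qed.

Lemma hsum0 (T : choiceType) : hsum (fun _ : T => 0 : R) 0.
Proof. by move=> e e0; exists fset0 => B _; rewrite big1 // subrr normr0 ltW. Qed.

Lemma hsum_sum (T : choiceType) (I : Type) (r : seq I) (P : pred I) (f : I -> T -> R) (l : I -> R) :
  (forall i, hsum (f i) (l i)) ->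
  hsum (fun t => \sum_(i <- r | P i) f i t) (\sum_(i <- r | P i) l i).
Proof.
move=> h; elim: r => [|i r IH].
  by rewrite big_nil; apply: eq_hsum (hsum0 T) => t; rewrite big_nil.
rewrite big_cons; case: ifP => Pi; last first.
  by apply: eq_hsum IH => t; rewrite big_cons Pi.
by apply: eq_hsum (hsumD (h i) IH) => t; rewrite big_cons Pi.
Qed.

Definition word_mono n (w : seq 'I_n) (y : 'rV[R]_n) : R := \prod_(i <- w) y 0 i.

Definition polydisc n (rho : R) (y : 'rV[R]_n) : Prop := forall i, `|y 0 i| <= rho.

(* Noncommutative words as exponents: a monomial may occur many times in the
   series, so that products and compositions need no regrouping of terms. *)
Definition pseries n (rho M : R) (f : 'rV[R]_n -> R) : Prop :=
  exists (c : nat -> R) (w : nat -> seq 'I_n),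
    abs_bounded (fun m => c m * rho ^+ size (w m)) M /\
    forall y, polydisc rho y -> hsum (fun m => c m * word_mono (w m) y) (f y).

Lemma word_mono_bound n rho (w : seq 'I_n) y :
  polydisc rho y -> `|word_mono w y| <= rho ^+ size w.
Proof.
move=> hy; elim: w => [|i w IH]; first by rewrite /word_mono big_nil normr1.
rewrite /word_mono big_cons normrM exprS; apply: ler_pM => //.
Qed.

Lemma polydisc_le n rho rho' (y : 'rV[R]_n) : rho <= rho' -> polydisc rho y -> polydisc rho' y.
Proof. by move=> h hy i; apply: le_trans (hy i) h. Qed.

(** Sums and products produce series indexed by pairs. The encoding of a countable type in [nat]
    keeps the definition of [pseries] free of a quantifier over index types. *)
Lemma pseries_intro n rho M (f : 'rV[R]_n -> R) (T : countType) (c : T -> R) (w : T -> seq 'I_n) :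
  abs_bounded (fun t => c t * rho ^+ size (w t)) M ->
  (forall y, polydisc rho y -> hsum (fun t => c t * word_mono (w t) y) (f y)) ->
  pseries rho M f.
Proof.
move=> hb hs.
exists (fun m => if @pickle_inv T m is Some t then c t else 0).
exists (fun m => if @pickle_inv T m is Some t then w t else [::]); split.
  apply: abs_bounded_le (abs_bounded_pickle hb) => m.
  by case: pickle_inv => //; rewrite mul0r.
move=> y /hs/hsum_pickle; apply: eq_hsum => m.
by case: pickle_inv => //; rewrite mul0r.
Qed.

Lemma pseries_ge0 n rho M (f : 'rV[R]_n -> R) : pseries rho M f -> 0 <= M.
Proof. by move=> [c [w [/(_ fset0) + _]]]; rewrite big_seq_fset0. Qed.

Lemma pseries_bound n rho M (f : 'rV[R]_n -> R) y : 0 <= rho ->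
  pseries rho M f -> polydisc rho y -> `|f y| <= M.
Proof.
move=> r0 [c [w [hb hs]]] hy; apply: hsum_bound (hs y hy) _.
apply: abs_bounded_le hb => m; rewrite !normrM ler_wpM2l //.
by apply: le_trans (word_mono_bound _ hy) _; rewrite ger0_norm // exprn_ge0.
Qed.

Lemma eq_pseries n rho M (f g : 'rV[R]_n -> R) :
  (forall y, polydisc rho y -> f y = g y) -> pseries rho M f -> pseries rho M g.
Proof.
by move=> fg [c [w [hb hs]]]; exists c, w; split=> // y hy; rewrite -fg //; apply: hs.
Qed.

Lemma pseries_le n rho M M' (f : 'rV[R]_n -> R) : M <= M' -> pseries rho M f -> pseries rho M' f.
Proof.
by move=> MM [c [w [hb hs]]]; exists c, w; split=> // B; apply: le_trans (hb B) MM.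
Qed.

Lemma abs_bounded_sum_fin (T : finType) (M : T -> R) :
  (forall t, 0 <= M t) -> abs_bounded M (\sum_t M t).
Proof.
move=> M0 B; have hsub : (B `<=` [fset t | t in T])%fset.
  by apply/fsubsetP => t _; rewrite !inE.
apply: le_trans (psum_subset (f := fun t => `|M t|) _ hsub) _ => //.
rewrite (perm_big (index_enum T)); last first.
  apply: uniq_perm; rewrite ?fset_uniq ?index_enum_uniq //.
  by move=> t; rewrite mem_index_enum !inE.
by rewrite (eq_bigr M) // => t _; rewrite ger0_norm.
Qed.

Lemma pseries_const n rho (a : R) : pseries rho `|a| (fun _ : 'rV[R]_n => a).
Proof.
apply: (@pseries_intro _ _ _ _ unit (fun=> a) (fun=> [::])).
  have := @abs_bounded_sum_fin unit (fun=> `|a|) (fun=> normr_ge0 _).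
  by rewrite (big_pred1 tt) => [|[]]//; apply: abs_bounded_le => t; rewrite expr0 mulr1 normr_id.
move=> y _; have := hsum_fin (fun _ : unit => a); rewrite (big_pred1 tt) => [|[]]//.
by apply: eq_hsum => t; rewrite /word_mono big_nil mulr1.
Qed.

Lemma pseries_coord n rho (i : 'I_n) : 0 <= rho -> pseries rho rho (fun y : 'rV[R]_n => y 0 i).
Proof.
move=> r0; apply: (@pseries_intro _ _ _ _ unit (fun=> 1) (fun=> [:: i])).
  have := @abs_bounded_sum_fin unit (fun=> rho) (fun=> r0).
  by rewrite (big_pred1 tt) => [|[]]//; apply: abs_bounded_le => t; rewrite mul1r.
move=> y _; have := hsum_fin (fun _ : unit => y 0 i); rewrite (big_pred1 tt) => [|[]]//.
by apply: eq_hsum => t; rewrite /word_mono big_seq1 mul1r.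
Qed.

(** An infinite sum of series that converges absolutely in norm is a double family, summed over
    pairs without collecting equal monomials. *)
Lemma pseries_hsum n rho (I : countType) (f : I -> 'rV[R]_n -> R) (M : I -> R) N g :
  0 <= rho ->
  (forall i, pseries rho (M i) (f i)) -> abs_bounded M N ->
  (forall y, polydisc rho y -> hsum (fun i => f i y) (g y)) -> pseries rho N g.
Proof.
move=> r0 hf hM hg; have /choice[c /choice[w hcw]] := hf.
have hb : abs_bounded (fun x : I * nat => c x.1 x.2 * rho ^+ size (w x.1 x.2)) N.
  by apply: abs_bounded_prod hM => i; have [] := hcw i.
apply: (@pseries_intro _ _ _ _ (I * nat)%type (fun x => c x.1 x.2) (fun x => w x.1 x.2)) => //.
move=> y hy.
have [|l hl] := @hsum_ex _ _ (fun x : I * nat => c x.1 x.2 * word_mono (w x.1 x.2) y) N.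
  apply: abs_bounded_le hb => x; rewrite !normrM ler_wpM2l //.
  by apply: le_trans (word_mono_bound _ hy) _; rewrite ger0_norm // exprn_ge0.
suff <- : l = g y by [].
apply: hsum_unique (hg y hy); apply: hsum_fubini hl _ => i /=.
by have [_ /(_ y hy)] := hcw i.
Qed.

Lemma pseries_sum n rho (I : finType) (f : I -> 'rV[R]_n -> R) (M : I -> R) :
  0 <= rho -> (forall i, pseries rho (M i) (f i)) ->
  pseries rho (\sum_i M i) (fun y => \sum_i f i y).
Proof.
move=> r0 hf; apply: (pseries_hsum r0 hf); last by move=> y _; exact: hsum_fin.
by apply: abs_bounded_sum_fin => t; apply: pseries_ge0 (hf t).
Qed.

Lemma pseriesD n rho (f g : 'rV[R]_n -> R) M N : 0 <= rho ->
  pseries rho M f -> pseries rho N g -> pseries rho (M + N) (fun y => f y + g y).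
Proof.
move=> r0 hf hg; have := @pseries_sum n rho bool (fun b => if b then f else g) (fun b => if b then M else N) r0.
rewrite big_bool /= => h; apply: eq_pseries (h _); last by case.
by move=> y _; rewrite big_bool.
Qed.

(** Concatenation of words multiplies monomials, so the product is a family indexed by pairs, and
    the bound is submultiplicative as in a Banach algebra. *)
Lemma pseriesM n rho (f g : 'rV[R]_n -> R) M N : 0 <= rho ->
  pseries rho M f -> pseries rho N g -> pseries rho (M * N) (fun y => f y * g y).
Proof.
move=> r0 [c [w [hb hs]]] hg; have [d [v [hb' hs']]] := hg.
have N0 := pseries_ge0 hg.
have hB : abs_bounded (fun x : nat * nat => (c x.1 * d x.2) * rho ^+ size (w x.1 ++ v x.2)) (M * N).
  apply: (@abs_bounded_prod _ _ _ _ (fun i => `|c i * rho ^+ size (w i)| * N)) => [i B|B] /=.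
    rewrite (eq_bigr (fun j => `|c i * rho ^+ size (w i)| * `|d j * rho ^+ size (v j)|)); last first.
      by move=> j _; rewrite size_cat exprD -normrM mulrACA.
    by rewrite -mulr_sumr ler_wpM2l.
  rewrite (eq_bigr (fun i => `|c i * rho ^+ size (w i)| * N)) => [|i _].
    by rewrite -mulr_suml ler_wpM2r.
  by rewrite normrM (ger0_norm N0) normr_id.
apply: (@pseries_intro _ _ _ _ (nat * nat)%type (fun x => c x.1 * d x.2) (fun x => w x.1 ++ v x.2)) => //.
move=> y hy.
have [|l hl] := @hsum_ex _ _ (fun x : nat * nat => c x.1 * d x.2 * word_mono (w x.1 ++ v x.2) y) (M * N).
  apply: abs_bounded_le hB => x; rewrite !normrM ler_wpM2l //.
  by apply: le_trans (word_mono_bound _ hy) _; rewrite ger0_norm // exprn_ge0.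
suff <- : l = f y * g y by [].
apply: (@hsum_unique _ _ (fun i => g y * (c i * word_mono (w i) y))).
  apply: hsum_fubini hl _ => i /=.
  rewrite mulrC; apply: eq_hsum (hsumZ (c i * word_mono (w i) y) (hs' y hy)) => j.
  by rewrite /word_mono big_cat /= mulrACA.
by rewrite [X in hsum _ X]mulrC; apply: hsumZ; exact: hs.
Qed.

Lemma pseriesZ n rho (f : 'rV[R]_n -> R) M a : 0 <= rho ->
  pseries rho M f -> pseries rho (`|a| * M) (fun y => a * f y).
Proof. by move=> r0; apply: pseriesM => //; apply: pseries_const. Qed.

Lemma pseries_word n m rho rho' (G : 'I_m -> 'rV[R]_n -> R) (w : seq 'I_m) : 0 <= rho ->
  (forall i, pseries rho rho' (G i)) ->
  pseries rho (rho' ^+ size w) (fun y => \prod_(i <- w) G i y).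
Proof.
move=> r0 hG; elim: w => [|i w IH] /=.
  by have := pseries_const n rho 1; rewrite normr1 expr0; apply: eq_pseries => y _; rewrite big_nil.
by rewrite exprS; apply: eq_pseries (pseriesM r0 (hG i) IH) => y _; rewrite big_cons.
Qed.

(** Each word of F becomes a product of the [G i], whose norm is at most the corresponding power of
    [rho']. This is why the bound controls the absolute values of the terms and not the supremum of
    the function. *)
Lemma pseries_comp n m rho rho' M (F : 'rV[R]_m -> R) (G : 'I_m -> 'rV[R]_n -> R) :
  0 <= rho -> 0 <= rho' -> pseries rho' M F -> (forall i, pseries rho rho' (G i)) ->
  pseries rho M (fun y => F (\row_i G i y)).
Proof.
move=> r0 r0' [c [w [hb hs]]] hG.
apply: (@pseries_hsum _ _ nat (fun k y => c k * \prod_(i <- w k) G i y) (fun k => `|c k| * rho' ^+ size (w k)) _ _ r0).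
- by move=> k; apply: pseriesZ => //; apply: pseries_word.
- by apply: abs_bounded_le hb => k; rewrite !normrM normr_id.
- move=> y hy; apply: eq_hsum (hs (\row_i G i y) _) => [k|i].
    by rewrite /word_mono; congr (_ * _); apply: eq_bigr => i _; rewrite mxE.
  by rewrite mxE; apply: pseries_bound (hG i) hy.
Qed.

(** Without the constant term every monomial has a letter, which contributes a factor [t] when the
    radius shrinks by [t]. This smallness drives both the composition of germs and the contraction
    argument. *)
Lemma pseries_shrink n rho M (f : 'rV[R]_n -> R) t : 0 <= rho -> 0 < t <= 1 ->
  pseries rho M f -> pseries (t * rho) (t * M) (fun y => f y - f 0).
Proof.
move=> r0 /andP[t0 t1] [c [w [hb hs]]].
have hd (y : 'rV[R]_n) : polydisc (t * rho) y -> polydisc rho y.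
  by apply: polydisc_le; rewrite ler_piMl.
(* Several terms may carry the empty word; all of them are dropped, since together they sum to
   [f 0]. *)
exists (fun m => if w m == [::] then 0 else c m), w; split.
  have h : abs_bounded (fun m => t * (c m * rho ^+ size (w m))) (t * M).
    move=> B; rewrite (eq_bigr (fun m => t * `|c m * rho ^+ size (w m)|)) => [|m _].
      by rewrite -mulr_sumr ler_wpM2l // ltW.
    by rewrite normrM (gtr0_norm t0).
  apply: abs_bounded_le h => m; case: (w m) => [|i v] /=; first by rewrite mul0r normr0.
  rewrite exprMn mulrCA normrM [leRHS]normrM ler_wpM2r // normrX gtr0_norm // exprS.
  by rewrite ler_piMr ?(ltW t0) // exprn_ile1 // ltW.
move=> y /hd hy; have h0 : polydisc rho (0 : 'rV[R]_n) by move=> i; rewrite mxE normr0.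
have := hsumD (hs y hy) (hsumZ (-1) (hs 0 h0)); rewrite mulN1r.
apply: eq_hsum => m; case: (w m) => [|i v] /=.
  by rewrite /word_mono !big_nil mul0r mulN1r subrr.
by rewrite {2}/word_mono big_cons mxE mul0r mulr0 mulr0 addr0.
Qed.

Lemma pseries_le_radius n rho rho' M (f : 'rV[R]_n -> R) : 0 <= rho' <= rho ->
  pseries rho M f -> pseries rho' M f.
Proof.
move=> /andP[r0 rr] [c [w [hb hs]]]; exists c, w; split.
  apply: abs_bounded_le hb => m; rewrite !normrM ler_wpM2l //.
  by rewrite !ger0_norm ?exprn_ge0 ?lerXn2r ?nnegrE // (le_trans r0).
by move=> y hy; apply: hs; apply: polydisc_le hy.
Qed.

(** Each word with a letter in S is charged to its first such letter i, which is split off as a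
    factor [y 0 i]; the words without such letters give the value with these coordinates set to
    0. *)
Lemma pseries_hadamard n rho M (f : 'rV[R]_n -> R) (S : {set 'I_n}) :
  0 < rho -> pseries rho M f ->
  exists g : 'I_n -> 'rV[R]_n -> R, (forall i, pseries rho (M / rho) (g i)) /\
    forall y, polydisc rho y ->
      f y = f (\row_i (if i \in S then 0 else y 0 i)) + \sum_(i in S) y 0 i * g i y.
Proof.
move=> r0 [c [w [hb hs]]].
pose fst_in (v : seq 'I_n) i := (ohead [seq j <- v | j \in S] == Some i).
have hfst v i : fst_in v i -> (i \in v) && (i \in S).
  rewrite /fst_in; elim: v => // j v IH /=; case: (boolP (j \in S)) => jS /=.
    by move=> /eqP[<-]; rewrite inE eqxx.
  by move=> /IH/andP[iv ->]; rewrite inE iv orbT.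
have hrem i v (y : 'rV[R]_n) : i \in v -> word_mono v y = y 0 i * word_mono (rem i v) y.
  by move=> iv; rewrite /word_mono (perm_big _ (perm_to_rem iv)) big_cons.
pose d i m := if fst_in (w m) i then c m else 0.
have hbd i : abs_bounded (fun m => d i m * rho ^+ size (rem i (w m))) (M / rho).
  move=> B; rewrite ler_pdivlMr // mulr_suml; apply: le_trans (hb B); apply: ler_sum => m _.
  rewrite /d; case: ifP => h; last by rewrite mul0r normr0 mul0r.
  have /andP[iw _] := hfst _ _ h.
  rewrite -[X in _ * X <= _](gtr0_norm r0) -normrM -mulrA -exprSr.
  by rewrite size_rem // prednK // lt0n size_eq0; case: (w m) iw.
have hex i y : exists l, polydisc rho y -> hsum (fun m => d i m * word_mono (rem i (w m)) y) l.
  have [hy|] := pselect (polydisc rho y); last by exists 0.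
  have [|l hl] := @hsum_ex _ _ (fun m => d i m * word_mono (rem i (w m)) y) (M / rho).
    apply: abs_bounded_le (hbd i) => m; rewrite !normrM ler_wpM2l //.
    apply: le_trans (word_mono_bound _ hy) _; rewrite ger0_norm // exprn_ge0 //; exact: ltW.
  by exists l.
have /choice[g hg] : forall i, exists g : 'rV[R]_n -> R, forall y, polydisc rho y ->
    hsum (fun m => d i m * word_mono (rem i (w m)) y) (g y).
  by move=> i; have /choice[g hg] := hex i; exists g.
exists g; split.
  by move=> i; exists (d i), (fun m => rem i (w m)); split => // y hy; apply: hg.
move=> y hy; set y0 := \row_i _.
have hy0 : polydisc rho y0 by move=> i; rewrite mxE; case: ifP => // _; rewrite normr0 ltW.
apply: hsum_unique (hs y hy) _.
have := hsumD (hs y0 hy0) (hsum_sum (index_enum 'I_n) (mem S) (fun i => hsumZ (y 0 i) (hg i y hy))).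
apply: eq_hsum => m.
have [hS|hS] := boolP (has (mem S) (w m)).
- have [i hi] : exists i, fst_in (w m) i.
    move: hS; rewrite /fst_in has_filter; case: [seq _ <- _ | _] => // i s _.
    by exists i => /=.
  have /andP[iw iS] := hfst _ _ hi.
  rewrite [word_mono (w m) y0](hrem i) // mxE iS mul0r mulr0 add0r.
  rewrite (bigD1 i) //= /d hi big1 => [|j /andP[_ ji]].
    by rewrite addr0 (hrem i (w m)) // mulrCA.
  case: ifP => hj; last by rewrite mul0r mulr0.
  by move: hi hj ji; rewrite /fst_in => /eqP -> /eqP[->]; rewrite eqxx.
- rewrite [X in _ + X]big1 => [|i iS]; last first.
    rewrite /d; case: ifP => [/hfst/andP[iw _]|]; last by rewrite mul0r mulr0.
    by case/hasP: hS; exists i.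
  rewrite addr0; congr (_ * _); rewrite /word_mono !big_seq; apply: eq_bigr => i iw.
  rewrite mxE; case: ifP => // iS; by case/hasP: hS; exists i.
Qed.

End PowerSeries.

(** * Taylor formula and differentials of power series *)

Section Differentials.
Context {R : realType}.

Lemma polydiscP n (r : R) (y : 'rV[R]_n) : 0 <= r -> polydisc r y <-> `|y| <= r.
Proof.
move=> r0; have -> : `|y| = \big[Num.max/0]_ij `|y ij.1 ij.2| by exact: mx_normrE.
split.
  by move=> h; apply/bigmax_leP; split=> // -[i j] _ /=; rewrite ord1.
by move=> /bigmax_leP[_ h] i; apply: (h (0, i)).
Qed.

Lemma coord_le_norm n (y : 'rV[R]_n) i : `|y 0 i| <= `|y|.
Proof. by apply: (polydiscP y (normr_ge0 _)).2. Qed.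

Definition lin_comb n (W : normedModType R) (w : 'I_n -> W) (h : 'rV[R]_n) : W :=
  \sum_i h 0 i *: w i.

Lemma lin_comb_is_linear n (W : normedModType R) (w : 'I_n -> W) : linear (lin_comb w).
Proof.
move=> a u v; rewrite scaler_sumr -big_split; apply: eq_bigr => i _ /=.
by rewrite !mxE scalerDl scalerA.
Qed.

HB.instance Definition _ n (W : normedModType R) (w : 'I_n -> W) :=
  GRing.isLinear.Build R 'rV[R]_n W _ (lin_comb w) (lin_comb_is_linear w).

Lemma near0_norm_le (V : normedModType R) (d : R) : 0 < d -> \forall h \near (0 : V), `|h| <= d.
Proof.
move=> d0; apply/nbhs_normP; exists d => //= z /=.
by rewrite sub0r normrN => /ltW.
Qed.

Lemma near_normP (V : normedModType R) (x : V) (P : V -> Prop) :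
  (\forall y \near x, P y) <-> exists2 e : R, 0 < e & forall h, `|h| <= e -> P (x + h).
Proof.
split=> [/nbhs_normP[e /= e0 he]|[e e0 he]].
  exists (e / 2) => [|h hh]; first by rewrite divr_gt0.
  by apply: he => /=; rewrite opprD addNKr normrN; lra.
apply/nbhs_normP; exists e => // z /= hz; rewrite -(subrKC x z); apply: he.
by rewrite distrC ltW.
Qed.

(** A quadratic remainder identifies the differential, and the linear candidate is continuous
    because the source has finite dimension. *)
Lemma quadratic_diff n (W : normedModType R) (f : 'rV[R]_n -> W) x (w : 'I_n -> W) K e :
  0 < e -> (forall h : 'rV[R]_n, `|h| <= e ->
    `|f (x + h) - f x - \sum_i h 0 i *: w i| <= K * `|h| ^+ 2) ->
  differentiable f x /\ forall h, 'd f x h = \sum_i h 0 i *: w i.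
Proof.
move=> e0 hf.
pose L : {linear 'rV[R]_n -> W} := lin_comb w.
have Lc : continuous L.
  apply: bounded_linear_continuous; apply/linear_boundedP.
  exists (\sum_i `|w i|); split=> [|r hr y]; first exact: num_real.
  apply: le_trans (ler_norm_sum _ _ _) _.
  apply: le_trans (_ : (\sum_i `|w i|) * `|y| <= _); last by rewrite ler_wpM2r // ltW.
  rewrite mulr_suml; apply: ler_sum => i _; rewrite normrZ mulrC ler_wpM2l //.
  exact: coord_le_norm.
have Lo eps : 0 < eps -> \forall h \near (0 : 'rV[R]_n), `|f (x + h) - f x - L h| <= eps * `|h|.
  move=> eps0; pose d := Num.min e (eps / (`|K| + 1)).
  have d0 : 0 < d by rewrite lt_min e0 divr_gt0 // ltr_wpDl.
  move: (near0_norm_le 'rV[R]_n d0); apply: filterS => h; rewrite le_min => /andP[he hd].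
  apply: le_trans (hf h he) _.
  apply: le_trans (_ : `|K| * `|h| ^+ 2 <= _).
    by rewrite ler_wpM2r ?exprn_ge0 // ler_norm.
  rewrite expr2 mulrA ler_wpM2r //.
  apply: le_trans (_ : (`|K| + 1) * `|h| <= _); first by rewrite ler_wpM2r // lerDl.
  by rewrite mulrC -ler_pdivlMr ?ltr_wpDl.
have hh h : (f \o shift x - (cst (f x) + L)) h = f (x + h) - f x - L h.
  by rewrite -[LHS]/(f (h + x) - (f x + L h)) opprD addrA (addrC h).
have hd : 'd f x = L :> (_ -> _).
  apply: diff_unique Lc _; apply/eqaddoP => eps /Lo.
  by apply: filterS => h; rewrite hh.
split; last by move=> h; rewrite hd.
apply/diff_locallyP; rewrite hd; split => //; apply/eqaddoP => eps /Lo.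
by apply: filterS => h; rewrite hh.
Qed.

Lemma polydisc_row_mx n m rho (y : 'rV[R]_n) (h : 'rV[R]_m) :
  polydisc rho y -> polydisc rho h -> polydisc rho (row_mx y h).
Proof.
move=> hy hh i; case: (splitP i) => j ij.
  by rewrite (_ : i = lshift m j) ?row_mxEl //; apply: val_inj.
by rewrite (_ : i = rshift n j) ?row_mxEr //; apply: val_inj.
Qed.

Lemma pseries_hadamard_right n m rho M (F : 'rV[R]_(n + m) -> R) : 0 < rho -> pseries rho M F ->
  exists g : 'I_m -> 'rV[R]_(n + m) -> R, (forall i, pseries rho (M / rho) (g i)) /\
    forall y h, polydisc rho y -> polydisc rho h ->
      F (row_mx y h) = F (row_mx y 0) + \sum_j h 0 j * g j (row_mx y h).
Proof.
move=> r0 hF; pose S := [set i : 'I_(n + m) | (n <= i)%N]%SET.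
have lS j : (lshift m j \in S) = false by rewrite inE /= leqNgt ltn_ord.
have rS j : rshift n j \in S by rewrite inE /= leq_addr.
have [g [hg hfg]] := pseries_hadamard S r0 hF.
exists (fun i => g (rshift n i)); split=> // y h hy hh.
rewrite (hfg _ (polydisc_row_mx hy hh)); congr (F _ + _).
  apply/rowP => i; rewrite mxE; case: (splitP i) => j ij.
    by rewrite (_ : i = lshift m j) ?lS ?row_mxEl //; apply: val_inj.
  by rewrite (_ : i = rshift n j) ?rS ?row_mxEr ?mxE //; apply: val_inj.
rewrite big_mkcond big_split_ord /= big1 ?add0r => [|i _]; last by rewrite lS.
by apply: eq_bigr => i _; rewrite rS row_mxEr.
Qed.

Lemma pseries_restrict_left n m rho M (F : 'rV[R]_(n + m) -> R) : 0 <= rho ->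
  pseries rho M F -> pseries rho M (fun y : 'rV[R]_n => F (row_mx y 0)).
Proof.
move=> r0 hF.
pose G (i : 'I_(n + m)) (y : 'rV[R]_n) := if fintype.split i is inl j then y 0 j else 0.
have hG i : pseries rho rho (G i).
  rewrite /G; case: (fintype.split i) => j; first exact: pseries_coord.
  by apply: pseries_le (pseries_const n rho 0); rewrite normr0.
apply: eq_pseries (pseries_comp r0 r0 hF hG) => y _; congr F.
apply/rowP => i; rewrite mxE /G; case: (splitP i) => j ij.
  by rewrite (_ : i = lshift m j) ?row_mxEl //; apply: val_inj.
by rewrite (_ : i = rshift n j) ?row_mxEr ?mxE //; apply: val_inj.
Qed.

(* First order Taylor formula in both points, obtained by expanding f (y + h) as
   a power series in the 2n variables (y, h) and factoring out the h. *)
Lemma pseries_taylor1 n rho M (f : 'rV[R]_n -> R) : 0 < rho -> pseries rho M f ->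
  exists (g : 'I_n -> 'rV[R]_(n + n) -> R) K,
    (forall i, pseries (rho / 2) K (g i)) /\
    forall y h, polydisc (rho / 2) y -> polydisc (rho / 2) h ->
      f (y + h) = f y + \sum_i h 0 i * g i (row_mx y h).
Proof.
move=> r0 hf; have r2 : 0 < rho / 2 by rewrite divr_gt0.
have hF : pseries (rho / 2) M (fun z : 'rV[R]_(n + n) =>
    f (\row_i (z 0 (lshift n i) + z 0 (rshift n i)))).
  apply: pseries_comp (ltW r2) (ltW r0) hf _ => i.
  by rewrite {2}[rho]splitr; apply: pseriesD; rewrite ?ltW //; apply: pseries_coord; rewrite ltW.
have [g [hg hfg]] := pseries_hadamard_right r2 hF.
exists g, (M / (rho / 2)); split=> // y h hy hh; have := hfg _ _ hy hh.
have e (k : 'rV[R]_n) : (\row_i (row_mx y k 0 (lshift n i) + row_mx y k 0 (rshift n i))) = y + k.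
  by apply/rowP => i; rewrite [LHS]mxE row_mxEl row_mxEr mxE.
by rewrite !e addr0.
Qed.

Lemma norm_sum_coord n (h : 'rV[R]_n) (g : 'I_n -> R) K : (forall i, `|g i| <= K) ->
  `|\sum_i h 0 i * g i| <= n%:R * K * `|h|.
Proof.
move=> hK; apply: le_trans (ler_norm_sum _ _ _) _.
apply: le_trans (_ : \sum_(i < n) `|h| * K <= _); last first.
  by rewrite sumr_const card_ord -[leLHS]mulr_natl (mulrC `|h|) mulrA.
by apply: ler_sum => i _; rewrite normrM ler_pM // coord_le_norm.
Qed.

(** Expanding the coefficients [g i] once more in h gives the quadratic remainder required by
    [quadratic_diff]. The differential is then again given by power series in y. *)
Lemma pseries_taylor n rho M (f : 'rV[R]_n -> R) x : 0 < rho ->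
  pseries rho M (fun y => f (x + y)) ->
  exists (g : 'I_n -> 'rV[R]_(n + n) -> R) K, (forall i, pseries (rho / 2) K (g i)) /\
    forall y, polydisc (rho / 2) y ->
      [/\ forall h, polydisc (rho / 2) h ->
            f (x + y + h) = f (x + y) + \sum_i h 0 i * g i (row_mx y h),
          differentiable f (x + y) &
          forall h, 'd f (x + y) h = \sum_i h 0 i * g i (row_mx y 0)].
Proof.
move=> r0 hf; have r2 : 0 < rho / 2 by rewrite divr_gt0.
have [g [K [hg hfg0]]] := pseries_taylor1 r0 hf.
have hfg y h : polydisc (rho / 2) y -> polydisc (rho / 2) h ->
    f (x + y + h) = f (x + y) + \sum_i h 0 i * g i (row_mx y h).
  by move=> hy hh; rewrite -addrA hfg0.
exists g, K; split=> // y hy.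
have /choice[g2 hg2] := fun i => pseries_hadamard_right r2 (hg i).
set K1 := K / (rho / 2) in hg2.
have [|df dfE] := @quadratic_diff n R f (x + y) (fun i => g i (row_mx y 0)) (n%:R * (n%:R * K1)) _ r2.
  move=> h h2; have hh := (polydiscP h (ltW r2)).2 h2.
  rewrite hfg // [f _ + _]addrC addrK -sumrB.
  rewrite (eq_bigr (fun i => h 0 i * \sum_j h 0 j * g2 i j (row_mx y h))); last first.
    move=> i _; rewrite -[_ *: _]/(h 0 i * g i (row_mx y 0)) -mulrBr; have [_ ->] := hg2 i => //.
    by rewrite [X in X - _]addrC addrK.
  apply: le_trans (norm_sum_coord h (K := n%:R * K1 * `|h|) _) _ => [i|].
    apply: norm_sum_coord => j; have [q1 _] := hg2 i.
    by apply: pseries_bound (q1 j) _; [exact: ltW | exact: polydisc_row_mx].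
  by rewrite expr2 !mulrA.
by split=> // h; exact: hfg.
Qed.

End Differentials.

(** * Germs of analytic functions *)

Section AnalyticAt.
Context {R : realType}.

Definition analytic_at n (f : 'rV[R]_n -> R) (x : 'rV[R]_n) : Prop :=
  exists rho M, 0 < rho /\ pseries rho M (fun y => f (x + y)).

Lemma pseries_shift n rho M (f : 'rV[R]_n -> R) (a : 'rV[R]_n) : 0 < rho ->
  polydisc (rho / 2) a -> pseries rho M f -> pseries (rho / 2) M (fun y => f (a + y)).
Proof.
move=> r0 ha hf; have r2 : 0 <= rho / 2 by rewrite divr_ge0 // ltW.
apply: eq_pseries (pseries_comp (G := fun i y => a 0 i + y 0 i) r2 (ltW r0) hf _) => [y _|i].
  by congr f; apply/rowP => i; rewrite !mxE.
rewrite {2}[rho]splitr; apply: pseriesD => //; last exact: pseries_coord.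
by apply: pseries_le (pseries_const _ _ _).
Qed.

Lemma analytic_at_near n (f : 'rV[R]_n -> R) x :
  analytic_at f x -> \forall y \near x, analytic_at f y.
Proof.
move=> [rho [M [r0 hf]]]; have r2 : 0 < rho / 2 by rewrite divr_gt0.
apply/near_normP; exists (rho / 2) => // h /(polydiscP _ (ltW r2)) hh.
exists (rho / 2), M; split=> //; apply: eq_pseries (pseries_shift r0 hh hf) => y _.
by rewrite addrA.
Qed.

Lemma near_analytic_at n (f g : 'rV[R]_n -> R) x :
  (\forall y \near x, f y = g y) -> analytic_at f x -> analytic_at g x.
Proof.
move=> /near_normP[e e0 fg] [rho [M [r0 hf]]].
exists (Num.min rho e), M; split; first by rewrite lt_min r0.
apply: eq_pseries (pseries_le_radius _ hf) => [y hy|]; last first.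
  by rewrite le_min (ltW r0) (ltW e0) ge_min lexx.
apply: fg; apply/polydiscP; first exact: ltW.
by apply: polydisc_le hy; rewrite ge_min lexx orbT.
Qed.

Lemma eq_analytic_at n (f g : 'rV[R]_n -> R) x : f =1 g -> analytic_at f x -> analytic_at g x.
Proof. by move=> fg; apply: near_analytic_at; near=> y; apply: fg.
Unshelve. all: by end_near. Qed.

Lemma analytic_at_cst n (a : R) (x : 'rV[R]_n) : analytic_at (fun=> a) x.
Proof. by exists 1, `|a|; split=> //; apply: pseries_const. Qed.

Lemma analytic_at_coord n i (x : 'rV[R]_n) : analytic_at (fun y => y 0 i) x.
Proof.
exists 1, (`|x 0 i| + 1); split=> //.
apply: eq_pseries (pseriesD ler01 (pseries_const n 1 (x 0 i)) (pseries_coord i ler01)) => y _.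
by rewrite mxE.
Qed.

Lemma analytic_at_common n m (f : 'I_m -> 'rV[R]_n -> R) x :
  (forall i, analytic_at (f i) x) ->
  exists2 rho, 0 < rho & exists M, forall i, pseries rho M (fun y => f i (x + y)).
Proof.
move=> /choice[r /choice[M hM]].
pose rho := \big[Num.min/1]_i r i.
have r0 : 0 < rho by rewrite /rho; elim/big_ind: _ => // [a b a0 b0|i _]; [rewrite lt_min a0 | case: (hM i)].
exists rho => //; exists (\sum_i M i) => i; have [_ hi] := hM i.
apply: pseries_le (pseries_le_radius _ hi).
  rewrite (bigD1 i) //= lerDl sumr_ge0 // => j _; have [_ hj] := hM j; exact: pseries_ge0 hj.
by rewrite ltW //= /rho; apply: bigmin_le_cond.
Qed.

(** On a smaller polydisc the increments of the inner functions have norm at most the radius of the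
    outer series, so that [pseries_comp] applies. *)
Lemma analytic_at_comp n m (F : 'rV[R]_m -> R) (g : 'I_m -> 'rV[R]_n -> R) x :
  analytic_at F (\row_i g i x) -> (forall i, analytic_at (g i) x) ->
  analytic_at (fun y => F (\row_i g i y)) x.
Proof.
move=> [rho [M [r0 hF]]] /analytic_at_common[r r1 [N hN]].
(* [t] is chosen so that [t * N'] is at most [rho]. The maximum with 0 serves the case m = 0, where
   nothing makes [N] nonnegative. *)
pose N' := Num.max N 0; pose t := Num.min 1 (rho / (N' + 1)).
have N0 : 0 <= N' by rewrite le_max lexx orbT.
have hN' i : pseries r N' (fun y => g i (x + y)) by apply: pseries_le (hN i); rewrite le_max lexx.
have t0 : 0 < t by rewrite lt_min ltr01 divr_gt0 // ltr_wpDl.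
have t1 : t <= 1 by rewrite ge_min lexx.
have tN : t * N' <= rho.
  apply: le_trans (_ : rho / (N' + 1) * N' <= _).
    by rewrite ler_wpM2r // ge_min lexx orbT.
  by rewrite mulrAC ler_pdivrMr ?ltr_wpDl // ler_pM2l // lerDl.
exists (t * r), M; split; first exact: mulr_gt0.
have tr : 0 <= t * r by rewrite mulr_ge0 ?ltW.
apply: eq_pseries (pseries_comp (G := fun i y => g i (x + y) - g i (x + 0)) tr (ltW r0) hF _) => [y _|i].
  congr F; apply/rowP => i; rewrite !mxE addr0.
  by rewrite [X in X = _]addrC subrK.
apply: pseries_le tN _; apply: pseries_shrink (hN' i); first exact: ltW.
by rewrite t0.
Qed.

Lemma analytic_at_comp1 n (phi : R -> R) (g : 'rV[R]_n -> R) x :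
  analytic_at (fun y : 'rV[R]_1 => phi (y 0 0)) (const_mx (g x)) -> analytic_at g x ->
  analytic_at (fun y => phi (g y)) x.
Proof.
move=> hphi hg.
have e y : (\row_(i < 1) g y) = const_mx (g y) by apply/rowP => i; rewrite !mxE.
have := @analytic_at_comp n 1 (fun y => phi (y 0 0)) (fun=> g) x.
by rewrite e => /(_ hphi (fun=> hg)); apply: eq_analytic_at => y; rewrite mxE.
Qed.

Lemma analytic_atD n (f g : 'rV[R]_n -> R) x :
  analytic_at f x -> analytic_at g x -> analytic_at (fun y => f y + g y) x.
Proof.
move=> hf hg; have [|r r0 [M hM]] := @analytic_at_common n 2 (fun i => if i == 0 then f else g) x.
  by move=> i; case: ifP.
exists r, (M + M); split=> //; apply: pseriesD; first exact: ltW.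
  exact: (hM 0).
exact: (hM 1).
Qed.

Lemma analytic_atM n (f g : 'rV[R]_n -> R) x :
  analytic_at f x -> analytic_at g x -> analytic_at (fun y => f y * g y) x.
Proof.
move=> hf hg; have [|r r0 [M hM]] := @analytic_at_common n 2 (fun i => if i == 0 then f else g) x.
  by move=> i; case: ifP.
exists r, (M * M); split=> //; apply: pseriesM; first exact: ltW.
  exact: (hM 0).
exact: (hM 1).
Qed.

Lemma analytic_atN n (f : 'rV[R]_n -> R) x :
  analytic_at f x -> analytic_at (fun y => - f y) x.
Proof.
move=> hf; apply: eq_analytic_at (analytic_atM (analytic_at_cst (-1) x) hf) => y.
by rewrite mulN1r.
Qed.

Lemma analytic_atB n (f g : 'rV[R]_n -> R) x :
  analytic_at f x -> analytic_at g x -> analytic_at (fun y => f y - g y) x.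
Proof. by move=> hf hg; apply: analytic_atD => //; apply: analytic_atN. Qed.

Lemma analytic_at_sum n (I : Type) (r : seq I) (f : I -> 'rV[R]_n -> R) x :
  (forall i, analytic_at (f i) x) -> analytic_at (fun y => \sum_(i <- r) f i y) x.
Proof.
move=> hf; elim: r => [|i r IH].
  by apply: eq_analytic_at (analytic_at_cst 0 x) => y; rewrite big_nil.
by apply: eq_analytic_at (analytic_atD (hf i) IH) => y; rewrite big_cons.
Qed.

Lemma analytic_at_diff n (f : 'rV[R]_n -> R) x : analytic_at f x ->
  differentiable f x /\ forall v, analytic_at (fun y => 'd f y v) x.
Proof.
move=> [rho [M [r0 hf]]]; have r2 : 0 < rho / 2 by rewrite divr_gt0.
have [g [K [hg hd]]] := pseries_taylor r0 hf.
have key y : polydisc (rho / 2) y -> differentiable f (x + y) /\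
    forall h, 'd f (x + y) h = \sum_i h 0 i * g i (row_mx y 0).
  by move=> /hd[].
have p0 : polydisc (rho / 2) (0 : 'rV[R]_n) by move=> i; rewrite mxE normr0 ltW.
split; first by have [] := key _ p0; rewrite addr0.
move=> v; apply: (@near_analytic_at _ (fun y => \sum_i v 0 i * g i (row_mx (y - x) 0))).
  apply/near_normP; exists (rho / 2) => // h /(polydiscP _ (ltW r2))/key[_ ->].
  by rewrite addrAC subrr add0r.
apply: analytic_at_sum => i; apply: analytic_atM; first exact: analytic_at_cst.
exists (rho / 2), K; split=> //.
apply: eq_pseries (pseries_restrict_left (ltW r2) (hg i)) => y _.
by rewrite addrAC subrr add0r.
Qed.

Lemma analytic_at_continuous n (f : 'rV[R]_n -> R) x : analytic_at f x -> {for x, continuous f}.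
Proof. by move=> /analytic_at_diff[/differentiable_continuous]. Qed.

Definition analytic_map n m (F : 'rV[R]_n -> 'rV[R]_m) (x : 'rV[R]_n) : Prop :=
  forall i, analytic_at (fun y => F y 0 i) x.

Lemma analytic_map_comp n m (F : 'rV[R]_m -> R) (g : 'rV[R]_n -> 'rV[R]_m) x :
  analytic_at F (g x) -> analytic_map g x -> analytic_at (fun y => F (g y)) x.
Proof.
move=> hF hg; have e y : \row_i g y 0 i = g y by apply/rowP => i; rewrite mxE.
have := @analytic_at_comp n m F (fun i y => g y 0 i) x; rewrite e => /(_ hF hg).
by apply: eq_analytic_at => y; rewrite e.
Qed.

Lemma lipschitz_half_eq n (a b : 'rV[R]_n) :
  `|a - b| <= 2^-1 * `|a - b| -> a = b.
Proof. by move=> h; apply/eqP; rewrite -subr_eq0 -normr_eq0; have := normr_ge0 (a - b); lra. Qed.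

(** * Fixed points of analytic contractions with parameters *)

Section FixedPoint.
Variables (n : nat) (N : 'rV[R]_n -> 'rV[R]_n).
Hypotheses (hN : analytic_map N 0) (N0 : N 0 = 0).
Hypothesis dN0 : forall i v, 'd (fun y => N y 0 i) 0 v = 0.

(** Since the differential of N vanishes at 0, so do the coefficients [g i j] of the Taylor formula,
    and their norms become small with the radius. The factor 1 / 2 holds both for points and in the
    norm of power series; the second form makes the limit of the iteration analytic. *)
Lemma analytic_contraction : exists2 s, 0 < s &
  (forall a b, polydisc s b -> polydisc s (a - b) -> `|N a - N b| <= 2^-1 * `|a - b|) /\
  (forall m sg dt (u v : 'rV[R]_m -> 'rV[R]_n), 0 <= sg -> 0 <= dt <= s ->
    (forall i, pseries sg s (fun y => v y 0 i)) ->
    (forall i, pseries sg dt (fun y => (u y - v y) 0 i)) ->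
    forall i, pseries sg (2^-1 * dt) (fun y => (N (u y) - N (v y)) 0 i)).
Proof.
have [rho r0 [M hM]] := analytic_at_common hN.
have /choice[g /choice[K hg]] := fun i =>
  @pseries_taylor R n rho M (fun y => N y 0 i) 0 r0 (hM i).
pose r := rho / 2; have r2 : 0 < r by rewrite divr_gt0.
pose K' := \sum_i `|K i|.
have hgK i j : pseries r K' (g i j).
  have [h _] := hg i; apply: pseries_le (h j); rewrite /K' (bigD1 i) //=.
  by apply: le_trans (ler_norm _) _; rewrite lerDl sumr_ge0.
have K0 : 0 <= K' by rewrite sumr_ge0.
have p0 m : polydisc r (0 : 'rV[R]_m) by move=> i; rewrite mxE normr0 ltW.
have g0 i j : g i j 0 = 0.
  have [_ /(_ 0 (p0 n))[_ _ /(_ (delta_mx 0 j))]] := hg i.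
  rewrite addr0 dN0 row_mx0 (bigD1 j) //= big1 => [|k kj].
    by rewrite addr0 mxE !eqxx mul1r.
  by rewrite mxE (negPf kj) andbF mul0r.
have hNT i b h : polydisc r b -> polydisc r h ->
    N (b + h) 0 i = N b 0 i + \sum_j h 0 j * g i j (row_mx b h).
  by move=> hb hh; have [_ /(_ b hb)[/(_ h hh)]] := hg i; rewrite add0r.
(* With this radius the n terms of the Taylor sum, of norm at most [t * K'] each, add up to a factor
   at most 1 / 2. *)
pose t := (2 * (n%:R + 1) * (K' + 1))^-1.
have D0 : 0 < 2 * (n%:R + 1) * (K' + 1) by rewrite !mulr_gt0 // ltr_wpDl.
have t0 : 0 < t by rewrite invr_gt0.
have t1 : t <= 1.
  rewrite invf_le1 //; have := ler0n R n; nra.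
have tn : n%:R * (t * K') <= 2^-1.
  rewrite mulrCA /t mulrC ler_pdivrMr //; have := ler0n R n; nra.
have hgs i j : pseries (t * r) (t * K') (g i j).
  apply: eq_pseries (pseries_shrink (ltW r2) _ (hgK i j)) => [y _|]; last by rewrite t0.
  by rewrite g0 subr0.
have s0 : 0 < t * r by rewrite mulr_gt0.
have sr : t * r <= r by rewrite ler_piMl // ltW.
exists (t * r) => //; split.
  move=> a b hb hab.
  apply/polydiscP => [|i]; first by rewrite mulr_ge0.
  have := hNT i b (a - b) (polydisc_le sr hb) (polydisc_le sr hab); rewrite subrKC => e.
  have -> : (N a - N b) 0 i = N a 0 i - N b 0 i by rewrite !mxE.
  rewrite e [N b 0 i + _]addrC addrK.
  apply: le_trans (norm_sum_coord (a - b) (K := t * K') _) _ => [j|].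
    by apply: pseries_bound (hgs i j) _; [exact: ltW | exact: polydisc_row_mx].
  by rewrite ler_wpM2r.
move=> m sg dt u v sg0 /andP[dt0 dts] hv huv i.
have hrow j : pseries sg (t * r) (fun y => row_mx (v y) (u y - v y) 0 j).
  case: (splitP j) => k jk.
    apply: eq_pseries (hv k) => y _; rewrite (_ : j = lshift n k) ?row_mxEl //; exact: val_inj.
  apply: eq_pseries (pseries_le dts (huv k)) => y _.
  by rewrite (_ : j = rshift n k) ?row_mxEr //; exact: val_inj.
have hcomp j : pseries sg (t * K') (fun y => g i j (row_mx (v y) (u y - v y))).
  apply: eq_pseries (pseries_comp sg0 (ltW s0) (hgs i j) hrow) => y _.
  by congr (g i j _); apply/rowP => k; rewrite mxE.
have := pseries_sum sg0 (fun j => pseriesM sg0 (huv j) (hcomp j)).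
rewrite sumr_const card_ord => hsm.
apply: eq_pseries (pseries_le _ hsm) => [y hy|].
  have hvy : polydisc r (v y).
    by move=> j; apply: le_trans (pseries_bound sg0 (hv j) hy) sr.
  have hdy : polydisc r (u y - v y).
    by move=> j; apply: le_trans (pseries_bound sg0 (huv j) hy) (le_trans dts sr).
  have := hNT i _ _ hvy hdy; rewrite subrKC => e.
  have -> : (N (u y) - N (v y)) 0 i = N (u y) 0 i - N (v y) 0 i by rewrite !mxE.
  by rewrite e [N (v y) 0 i + _]addrC addrK.
rewrite -[leLHS]mulr_natl mulrCA mulrC ler_wpM2r //.
Qed.

(** Picard iteration [u k.+1 z = z + N (u k z)] with z as a parameter: the increments have norm at
    most s / 2^k, so their sum is a power series in z. Uniqueness is the contraction on points. *)
Lemma analytic_fixed_point : exists2 s, 0 < s &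
  exists G : 'rV[R]_n -> 'rV[R]_n, [/\ analytic_map G 0,
    forall z, polydisc s z -> polydisc (2 * s) (G z) /\ G z = z + N (G z) &
    forall a z, polydisc s z -> polydisc (2 * s) a -> a = z + N a -> a = G z].
Proof.
have [s4 s40 [hlip hcon]] := analytic_contraction.
(* The iterates stay in the polydisc of radius 2 s and their differences in that of radius 4 s =
   [s4], where the contraction is available. *)
pose s := s4 / 4; have s0 : 0 < s by rewrite divr_gt0.
have s4E : s4 = 4 * s by rewrite /s; field.
have [u [u0 uS]] : exists u : nat -> 'rV[R]_n -> 'rV[R]_n,
    (forall z, u 0%N z = 0) /\ (forall k z, u k.+1 z = z + N (u k z)).
  by exists (fix u k z := if k is k'.+1 then z + N (u k' z) else 0).
pose D k := s * 2^-1 ^+ k.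
have D0 k : 0 <= D k by rewrite mulr_ge0 ?exprn_ge0 ?invr_ge0 // ltW.
have DS k : D k.+1 = 2^-1 * D k by rewrite /D exprS mulrCA.
(* 2 s - 2 D k is the partial sum D 0 + ... + D (k - 1) of the geometric series. *)
have step k : (forall i, pseries s (2 * s - 2 * D k) (fun z => u k z 0 i)) /\
    (forall i, pseries s (D k) (fun z => (u k.+1 z - u k z) 0 i)).
  elim: k => [|k [IH1 IH2]]; split=> i.
  - apply: eq_pseries (pseries_le _ (pseries_const _ _ 0)) => [z _|]; first by rewrite u0 mxE.
    by rewrite normr0 /D expr0 mulr1 subrr.
  - apply: eq_pseries (pseries_le _ (pseries_coord i (ltW s0))) => [z _|].
      by rewrite uS u0 N0 addr0 subr0.
    by rewrite /D expr0 mulr1.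
  - apply: eq_pseries (pseries_le _ (pseriesD (ltW s0) (IH1 i) (IH2 i))) => [z _|].
      by rewrite !mxE subrKC.
    by rewrite DS; lra.
  - rewrite DS; apply: eq_pseries (hcon _ s (D k) (u k.+1) (u k) (ltW s0) _ _ IH2 i) => [z _||j].
    + by rewrite !uS opprD addrACA subrr add0r.
    + rewrite D0 s4E /D; apply: le_trans (_ : s <= _); last by lra.
      by rewrite ler_piMr ?(ltW s0) // exprn_ile1 // ?invr_ge0 // invf_le1 // ler1n.
    + by apply: pseries_le (IH1 j); have := D0 k; lra.
have D_sum m : \sum_(k < m) D k <= 2 * s.
  suff -> : \sum_(k < m) D k = 2 * s - 2 * D m by have := D0 m; lra.
  elim: m => [|m IH]; first by rewrite big_ord0 /D expr0 mulr1 subrr.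
  by rewrite big_ord_recr /= IH DS; lra.
have bump (B : {fset nat}) : exists m0, forall m, (m0 <= m)%N -> (B `<=` [fset k | k in iota 0 m])%fset.
  exists (\max_(k <- B) k.+1)%N => m hm; apply/fsubsetP => k kB.
  rewrite !inE /= mem_iota /= add0n; apply: leq_trans hm.
  by apply: (leq_bigmax_seq (F := S)).
have D_abs : abs_bounded D (2 * s).
  move=> B; have [m /(_ m (leqnn m)) Bm] := bump B.
  apply: le_trans (psum_subset (f := fun k => `|D k|) _ Bm) _ => //.
  rewrite (perm_big (iota 0 m)) /=; last first.
    by apply: uniq_perm; rewrite ?fset_uniq ?iota_uniq // => x; rewrite !inE.
  rewrite (eq_bigr D) => [|k _]; last by rewrite ger0_norm.
  by rewrite -[m]subn0 -/(index_iota 0 m) big_mkord.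
have hex i z : exists l, polydisc s z -> hsum (fun k => (u k.+1 z - u k z) 0 i) l.
  have [hz|] := pselect (polydisc s z); last by exists 0.
  have [|l hl] := @hsum_ex _ _ (fun k => (u k.+1 z - u k z) 0 i) (2 * s).
    apply: abs_bounded_le D_abs => k; rewrite [leRHS]ger0_norm //.
    by have [_ h] := step k; apply: pseries_bound (h i) hz; exact: ltW.
  by exists l.
have /choice[G0 hG0] : forall i, exists g : 'rV[R]_n -> R, forall z, polydisc s z ->
    hsum (fun k => (u k.+1 z - u k z) 0 i) (g z).
  by move=> i; have /choice[g hg] := hex i; exists g.
pose G z := \row_i G0 i z.
have hG i : pseries s (2 * s) (fun z => G z 0 i).
  apply: (@pseries_hsum _ _ _ nat _ D _ _ (ltW s0) (fun k => (step k).2 i) D_abs).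
  by move=> z hz; rewrite mxE; apply: hG0.
have p0 : polydisc s (0 : 'rV[R]_n) by move=> i; rewrite mxE normr0 ltW.
have G_pd z : polydisc s z -> polydisc (2 * s) (G z).
  by move=> hz i; apply: pseries_bound (hG i) hz; exact: ltW.
have u_pd k z : polydisc s z -> polydisc (2 * s) (u k z).
  move=> hz i; have [h _] := step k; apply: le_trans (pseries_bound (ltW s0) (h i) hz) _.
  by have := D0 k; lra.
have lip a b : polydisc (2 * s) a -> polydisc (2 * s) b -> `|N a - N b| <= 2^-1 * `|a - b|.
  move=> ha hb; apply: hlip => i; first by apply: le_trans (hb i) _; lra.
  rewrite !mxE; apply: le_trans (ler_normB _ _) _; have := ha i; have := hb i; lra.
have u_cvg z e : polydisc s z -> 0 < e -> exists m0, forall m, (m0 <= m)%N -> `|G z - u m z| <= e.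
  move=> hz e0.
  have h i : exists m0, forall m, (m0 <= m)%N -> `|(G z - u m z) 0 i| <= e.
    have [B hB] := hG0 i z hz e e0; have [m0 hm0] := bump B.
    exists m0 => m /hm0/hB; rewrite (perm_big (iota 0 m)) /=; last first.
      by apply: uniq_perm; rewrite ?fset_uniq ?iota_uniq // => x; rewrite !inE.
    have -> : \sum_(k <- iota 0 m) (u k.+1 z - u k z) 0 i = u m z 0 i.
      rewrite (eq_bigr (fun k => u k.+1 z 0 i - u k z 0 i)) => [|k _]; last by rewrite !mxE.
      rewrite -{1}[m]subn0 -/(index_iota 0 m) telescope_sumr //.
      by rewrite u0 mxE subr0.
    by rewrite !mxE.
  have /choice[m0 hm0] := h; exists (\max_i m0 i)%N => m hm.
  apply/polydiscP => [|i]; first exact: ltW.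
  by apply: hm0; apply: leq_trans hm; apply: leq_bigmax.
have Gfix z : polydisc s z -> G z = z + N (G z).
  move=> hz; apply/eqP; rewrite -subr_eq0 -normr_le0; apply/ler_addgt0Pl => e e0.
  have e2 : 0 < e / 2 by rewrite divr_gt0.
  have [m hm] := u_cvg z _ hz e2.
  have h1 := hm m.+1 (leqnSn m); have h2 := hm m (leqnn m).
  rewrite addr0 -(subrKA (u m.+1 z)) uS.
  apply: le_trans (ler_normD _ _) _.
  have -> : z + N (u m z) - (z + N (G z)) = N (u m z) - N (G z).
    by rewrite opprD addrACA subrr add0r.
  have := lip _ _ (u_pd m z hz) (G_pd z hz); rewrite (distrC (u m z)) -uS; lra.
exists s => //; exists G; split.
- move=> i; exists s, (2 * s); split=> //.
  by apply: eq_pseries (hG i) => z _; rewrite add0r.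
- by move=> z hz; split; [exact: G_pd | exact: Gfix].
- move=> a z hz ha ea; apply: lipschitz_half_eq.
  apply: le_trans (lip _ _ ha (G_pd z hz)).
  by rewrite {1}ea {1}(Gfix z hz) opprD addrACA subrr add0r.
Qed.

End FixedPoint.

End AnalyticAt.

(** * Inverse functions and regularity *)

Section Inverse.
Context {R : realType}.

Lemma diffB_at (V W : normedModType R) (f g : V -> W) x v :
  differentiable f x -> differentiable g x ->
  'd (fun y => f y - g y) x v = 'd f x v - 'd g x v.
Proof. by move=> df dg; have /(congr1 (fun h => h v)) := diffB df dg. Qed.

Lemma diff_comp_at (U V W : normedModType R) (f : U -> V) (g : V -> W) x v :
  differentiable f x -> differentiable g (f x) ->
  'd (fun y => g (f y)) x v = 'd g (f x) ('d f x v).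
Proof. by move=> df dg; have /(congr1 (fun h => h v)) := diff_comp df dg. Qed.

Lemma diff_cst_at (V W : normedModType R) (c : W) (x v : V) : 'd (fun _ : V => c) x v = 0.
Proof. by have /(congr1 (fun h => h v)) := diff_cst c x. Qed.

Lemma differentiable_comp_at (U V W : normedModType R) (f : U -> V) (g : V -> W) x :
  differentiable f x -> differentiable g (f x) -> differentiable (fun y => g (f y)) x.
Proof. exact: differentiable_comp. Qed.

Lemma differentiableB_at (V W : normedModType R) (f g : V -> W) x :
  differentiable f x -> differentiable g x -> differentiable (fun y => f y - g y) x.
Proof. exact: differentiableB. Qed.

Lemma near_continuous (T U : topologicalType) (f : T -> U) x (P : U -> Prop) :
  {for x, continuous f} -> (\forall z \near f x, P z) -> \forall y \near x, P (f y).
Proof. by move=> /[apply]. Qed.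

Lemma diff_newton (V : normedModType R) (F t L : V -> V) c x v :
  differentiable t x -> (forall h, 'd t x h = h) -> differentiable F (t x) ->
  differentiable L (F (t x) - c) -> (forall h, 'd L (F (t x) - c) h = L h) ->
  'd (fun y => y - L (F (t y) - c)) x v = v - L ('d F (t x) v).
Proof.
move=> dt dtE dF dL dLE.
have dFt := differentiable_comp_at dt dF.
have dc : differentiable (fun _ : V => c) x by exact: differentiable_cst.
have dG := differentiableB_at dFt dc.
have dLG := differentiable_comp_at dG dL.
have did : differentiable (fun y : V => y) x by apply: ex_diff; exact: is_diff_id.
apply: etrans (diffB_at v did dLG) _; congr (_ - _).
  by have /(congr1 (fun h => h v)) := @diff_val _ _ _ _ _ _ _ (is_diff_id x).
apply: etrans (diff_comp_at v dG dL) _; apply: etrans (dLE _) _; congr (L _).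
apply: etrans (diffB_at v dFt dc) _.
apply: etrans (f_equal2 (fun a z => a - z) (diff_comp_at v dt dF) (diff_cst_at c x v)) _.
by rewrite subr0 dtE.
Qed.

Lemma linear_diff n (W : normedModType R) (L : {linear 'rV[R]_n -> W}) x :
  differentiable L x /\ forall h, 'd L x h = L h.
Proof.
have LE h : L h = \sum_i h 0 i *: L (delta_mx 0 i).
  by rewrite {1}[h]row_sum_delta linear_sum; apply: eq_bigr => i _; rewrite linearZ.
have [|d dE] := @quadratic_diff _ n W L x (fun i => L (delta_mx 0 i)) 0 1 ltr01.
  by move=> h _; rewrite linearD [L x + _]addrC addrK -LE subrr normr0 mul0r.
by split=> // h; rewrite dE -LE.
Qed.

Lemma translation_diff n (c : 'rV[R]_n) x :
  differentiable (fun y => c + y) x /\ forall h, 'd (fun y => c + y) x h = h.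
Proof.
have [|d dE] := @quadratic_diff _ n 'rV[R]_n (fun y => c + y) x (fun i => delta_mx 0 i) 0 1 ltr01.
  by move=> h _; rewrite -row_sum_delta addrA [c + x + h]addrC addrK subrr normr0 mul0r.
by split=> // h; rewrite dE -row_sum_delta.
Qed.

Lemma coord_diff n m (F : 'rV[R]_n -> 'rV[R]_m) x i v :
  differentiable F x -> 'd (fun y => F y 0 i) x v = ('d F x v) 0 i.
Proof.
move=> dF.
pose c : {linear 'rV[R]_m -> R^o} := lin_comb (fun j => (j == i)%:R : R^o).
have cE z : c z = z 0 i.
  rewrite /c /= /lin_comb (bigD1 i) //= big1 => [|j /negPf ji].
    by rewrite eqxx addr0 -[LHS]/(z 0 i * 1) mulr1.
  by rewrite ji scaler0.
have -> : (fun y => F y 0 i) = c \o F by apply/funext => y; rewrite /= cE.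
have [dc dcE] := linear_diff c (F x).
by rewrite diff_comp //= dcE cE.
Qed.

Lemma analytic_map_diff n m (F : 'rV[R]_n -> 'rV[R]_m) x :
  analytic_map F x -> differentiable F x.
Proof.
move=> hF.
have -> : F = \sum_i (fun y => F y 0 i *: (delta_mx 0 i : 'rV[R]_m)).
  by apply/funext => y; rewrite fct_sumE -row_sum_delta.
apply: differentiable_sum => i; apply: differentiableZl.
by have [] := analytic_at_diff (hF i).
Qed.

Lemma analytic_at_translation n (f : 'rV[R]_n -> R) c x :
  analytic_at f (c + x) -> analytic_at (fun y => f (c + y)) x.
Proof.
by move=> [r [M [r0 h]]]; exists r, M; split=> //; apply: eq_pseries h => y _; rewrite addrA.
Qed.

Lemma analytic_map_continuous n m (F : 'rV[R]_n -> 'rV[R]_m) x :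
  analytic_map F x -> {for x, continuous F}.
Proof. by move=> /analytic_map_diff/differentiable_continuous. Qed.

Lemma analytic_map_mulmx n m p (F : 'rV[R]_n -> 'rV[R]_m) (B : 'M[R]_(m, p)) x :
  analytic_map F x -> analytic_map (fun y => F y *m B) x.
Proof.
move=> hF i; apply: (@eq_analytic_at _ _ (fun y => \sum_j F y 0 j * B j i)).
  by move=> y; rewrite mxE.
apply: analytic_at_sum => j; apply: analytic_atM => //; exact: analytic_at_cst.
Qed.

Lemma near_polydisc n (x : 'rV[R]_n) s : 0 < s -> \forall y \near x, polydisc s (y - x).
Proof.
move=> s0; apply/near_normP; exists s => // h hh.
by rewrite addrAC subrr add0r; apply/polydiscP => //; exact: ltW.
Qed.

(** With B the inverse of the differential, F x = y says that a = x - x0 satisfies a = (y - F x0) B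
    + N a, where the Newton remainder N has zero differential at 0. The fixed point depends
    analytically on the first summand. *)
Theorem analytic_inverse n (F : 'rV[R]_n -> 'rV[R]_n) x0 :
  analytic_map F x0 -> (forall v, 'd F x0 v = 0 -> v = 0) ->
  exists g : 'rV[R]_n -> 'rV[R]_n, [/\ analytic_map g (F x0), g (F x0) = x0,
    \forall x \near x0, g (F x) = x & \forall y \near F x0, F (g y) = y].
Proof.
move=> hF injF.
pose A := lin1_mx ('d F x0).
have AE v : v *m A = 'd F x0 v by rewrite mul_rV_lin1.
have Au : A \in unitmx.
  rewrite -row_free_unit -kermx_eq0; apply/eqP/row_matrixP => i; rewrite row0.
  apply: injF; rewrite -AE -row_mul mulmx_ker row0 //.
pose B := invmx A.
pose N x := x - (F (x0 + x) - F x0) *m B.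
have hN : analytic_map N 0.
  move=> i; apply: (@eq_analytic_at _ _ (fun y => y 0 i - ((F (x0 + y) - F x0) *m B) 0 i)).
    by move=> y; rewrite !mxE.
  apply: analytic_atB; first exact: analytic_at_coord.
  apply: analytic_map_mulmx => j.
  apply: (@eq_analytic_at _ _ (fun y => F (x0 + y) 0 j - F x0 0 j)); first by move=> y; rewrite !mxE.
  apply: analytic_atB; last exact: analytic_at_cst.
  apply: (@analytic_at_translation _ (fun z => F z 0 j)); rewrite addr0; exact: hF.
have N0 : N 0 = 0 by rewrite /N addr0 subrr mul0mx subr0.
have dF := analytic_map_diff hF.
have dN i v : 'd (fun y => N y 0 i) 0 v = 0.
  rewrite coord_diff; last exact: analytic_map_diff.
  have [dt dtE] := translation_diff x0 0.
  have dF0 : differentiable F (x0 + 0) by rewrite addr0.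
  have [dB dBE] := @linear_diff n _ (mulmxr B) (F (x0 + 0) - F x0).
  have e := @diff_newton 'rV[R]_n F (fun y => x0 + y) (mulmxr B) (F x0) 0 v dt dtE dF0 dB dBE.
  apply: etrans (congr1 (fun z : 'rV[R]_n => z 0 i) e) _.
  by rewrite /= addr0 -AE mulmxK // subrr mxE.
have [s s0 [G [hG G1 G2]]] := analytic_fixed_point hN N0 dN.
pose g y := x0 + G ((y - F x0) *m B).
have lin_an : analytic_map (fun y => (y - F x0) *m B) (F x0).
  apply: analytic_map_mulmx => i.
  apply: (@eq_analytic_at _ _ (fun y => y 0 i - F x0 0 i)); first by move=> y; rewrite !mxE.
  by apply: analytic_atB; [exact: analytic_at_coord | exact: analytic_at_cst].
have p0 : polydisc s (0 : 'rV[R]_n) by move=> i; rewrite mxE normr0 ltW.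
have p02 : polydisc (2 * s) (0 : 'rV[R]_n) by move=> i; rewrite mxE normr0 mulr_ge0 // ltW.
have near_lin : \forall y \near F x0, polydisc s ((y - F x0) *m B).
  apply: (near_continuous (analytic_map_continuous lin_an) (P := polydisc s)).
  rewrite subrr mul0mx; have := near_polydisc (0 : 'rV[R]_n) s0.
  by apply: filterS => y; rewrite subr0.
have G0 : G 0 = 0 by rewrite -(G2 0 0 p0 p02) // N0 addr0.
exists g; split.
- move=> i; apply: (@eq_analytic_at _ _ (fun y => x0 0 i + G ((y - F x0) *m B) 0 i)).
    by move=> y; rewrite !mxE.
  apply: analytic_atD; first exact: analytic_at_cst.
  apply: (@analytic_map_comp _ _ _ (fun z => G z 0 i)) => //.
  by rewrite subrr mul0mx; apply: hG.
- by rewrite /g subrr mul0mx G0 addr0.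
- have cF := analytic_map_continuous hF.
  have h1 := near_continuous cF near_lin.
  have s2 : 0 < 2 * s by rewrite mulr_gt0.
  near=> x.
  have hx : polydisc s ((F x - F x0) *m B) by near: x.
  rewrite /g -(G2 (x - x0) _ hx) ?subrKC //; first by near: x; apply: near_polydisc.
  by rewrite /N (subrKC x0 x) [RHS]addrC subrK.
- near=> y.
  have hy : polydisc s ((y - F x0) *m B) by near: y.
  have [_] := G1 _ hy; rewrite /g; set a := G _; rewrite /N => e.
  have : (F (x0 + a) - F x0) *m B = (y - F x0) *m B.
    move: e; rewrite addrCA -{1}[a]addr0 => /addrI/esym/eqP.
    by rewrite subr_eq0 => /eqP ->.
  move=> /(congr1 (fun z => z *m A)); rewrite !mulmxKV //.
  by move=> /(congr1 (fun z => z + F x0)); rewrite !subrK.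
Unshelve. all: by end_near. Qed.

End Inverse.

(** * Analytic maps belong to every regularity class *)

Section Regularity.
Context {R : realType}.

Lemma analytic_map_near n m (F : 'rV[R]_n -> 'rV[R]_m) x :
  analytic_map F x -> \forall y \near x, analytic_map F y.
Proof.
move=> /analytic_at_common[rho r0 [M hM]]; have r2 : 0 < rho / 2 by rewrite divr_gt0.
apply/near_normP; exists (rho / 2) => // h /(polydiscP _ (ltW r2)) hh i.
exists (rho / 2), M; split=> //; apply: eq_pseries (pseries_shift r0 hh (hM i)) => y _.
by rewrite addrA.
Qed.

Lemma analytic_map_derive n m (F : 'rV[R]_n -> 'rV[R]_m) x v :
  analytic_map F x -> analytic_map (fun y => 'd F y v) x.
Proof.
move=> hF i; apply: (@near_analytic_at _ _ (fun y => 'd (fun z => F z 0 i) y v)).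
  apply: filterS (analytic_map_near hF) => y /analytic_map_diff dF.
  exact: coord_diff.
by have [_] := analytic_at_diff (hF i).
Qed.

Lemma analytic_at_lipschitz n (f : 'rV[R]_n -> R) x : analytic_at f x ->
  exists C e, [/\ 0 <= C, 0 < e &
    forall y z, `|y - x| <= e -> `|z - x| <= e -> `|f y - f z| <= C * `|y - z|].
Proof.
move=> [rho [M [r0 hf]]]; have [g [K [hg hd]]] := pseries_taylor r0 hf.
have r2 : 0 < rho / 2 by rewrite divr_gt0.
exists `|n%:R * K|, (rho / 4); split; [by [] | by rewrite divr_gt0 |].
move=> y z hy hz.
have pz : polydisc (rho / 2) (z - x) by apply/polydiscP; [exact: ltW | lra].
have pyz : polydisc (rho / 2) (y - z).
  apply/polydiscP; first exact: ltW.
  rewrite -(subrKA x) -[x - z]opprB; apply: le_trans (ler_normB _ _) _; lra.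
have [h _ _] := hd _ pz; have := h _ pyz; rewrite !subrKC => ->.
rewrite [f z + _]addrC addrK; apply: le_trans (_ : n%:R * K * `|y - z| <= _); last first.
  by rewrite ler_wpM2r // ler_norm.
apply: norm_sum_coord => i; by apply: pseries_bound (hg i) _; [exact: ltW | exact: polydisc_row_mx].
Qed.

Lemma le_powR_le1 (t a : R) : 0 <= t <= 1 -> 0 < a <= 1 -> t <= t `^ a.
Proof.
move=> /andP[t0 t1] /andP[a0 a1]; have [->|tn0] := eqVneq t 0; first exact: powR_ge0.
have {tn0}t0 : 0 < t by rewrite lt_def tn0.
rewrite /powR gt_eqF // -[leLHS]lnK ?posrE // ler_expR.
by have := ln_le0 t1; nra.
Qed.

(** In a ball of radius at most 1 / 2 distances are at most 1, hence bounded by their powers of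
    exponent a; the local Lipschitz bound is therefore a Hoelder bound. *)
Lemma analytic_map_holder n m (F : 'rV[R]_n -> 'rV[R]_m) x a : 0 < a <= 1 ->
  analytic_map F x -> exists C e : R, 0 < e /\
    forall y z, ball x e y -> ball x e z -> `|F y - F z| <= C * `|y - z| `^ a.
Proof.
move=> ha hF; have /choice[C /choice[e he]] := fun i => analytic_at_lipschitz (hF i).
pose E := Num.min (1 / 2) (\big[Num.min/1]_i e i).
have E0 : 0 < E.
  rewrite lt_min divr_gt0 //=; elim/big_ind: _ => // [u v u0 v0|i _]; first by rewrite lt_min u0.
  by have [] := he i.
exists (\sum_i `|C i|), E; split=> // y z.
rewrite -!ball_normE /ball_ /= => hy hz.
have yz1 : `|y - z| <= 1.
  have E2 : E <= 1 / 2 by rewrite ge_min lexx.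
  rewrite -(subrKA x) -[y - x]opprB; apply: le_trans (ler_normD _ _) _; rewrite normrN; lra.
have hC0 : 0 <= \sum_i `|C i| by rewrite sumr_ge0.
apply: le_trans (_ : (\sum_i `|C i|) * `|y - z| <= _); last first.
  by rewrite ler_wpM2l // le_powR_le1 // normr_ge0.
apply/polydiscP; first by rewrite mulr_ge0.
move=> i; rewrite !mxE; have [_ _ hi] := he i.
have Ei : E <= e i by rewrite ge_min; apply/orP; right; apply: bigmin_le_cond.
have hyx : `|y - x| <= e i by rewrite distrC; lra.
have hzx : `|z - x| <= e i by rewrite distrC; lra.
apply: le_trans (hi y z hyx hzx) _.
rewrite ler_wpM2r // (bigD1 i) //=; apply: le_trans (ler_norm _) _.
by rewrite lerDl sumr_ge0.
Qed.

Lemma analytic_Ck_on n m k a (U : set 'rV[R]_n) (F : 'rV[R]_n -> 'rV[R]_m) : a <= 1 ->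
  (forall x, U x -> analytic_map F x) -> Ck_on k a U F.
Proof.
move=> a1; elim: k F => [|k IH] F hF /=.
  split=> [x /hF/analytic_map_continuous //|a0 x /hF].
  by apply: analytic_map_holder; rewrite a0.
by split=> [x /hF/analytic_map_diff //|v]; apply: IH => x /hF; apply: analytic_map_derive.
Qed.

(** Words with equal letter counts carry the same monomial. Their coefficients are summed, and
    Fubini for the pairs (term, multi-index) shows that the total is unchanged. *)
Lemma pseries_multi_index n rho M (f : 'rV[R]_n -> R) : 0 < rho -> pseries rho M f ->
  exists C : {ffun 'I_n -> nat} -> R, forall y, polydisc rho y ->
    hsum (fun a : {ffun 'I_n -> nat} => C a * \prod_(i < n) y 0 i ^+ a i) (f y).
Proof.
move=> r0 [c [w [hb hs]]].
pose deg (v : seq 'I_n) : {ffun 'I_n -> nat} := [ffun i => count_mem i v].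
have monoE (v : seq 'I_n) (y : 'rV[R]_n) : word_mono v y = \prod_(i < n) y 0 i ^+ deg v i.
  elim: v => [|j v IH]; first by rewrite /word_mono big_nil big1 // => i _; rewrite ffunE.
  rewrite /word_mono big_cons -/(word_mono v y) IH (bigD1 j) //= [RHS](bigD1 j) //= mulrA.
  rewrite !ffunE /= eqxx exprS; congr (_ * _); apply: eq_bigr => i ij.
  by rewrite !ffunE /= eq_sym (negPf ij).
have degE v : rho ^+ size v = \prod_(i < n) rho ^+ deg v i.
  transitivity (word_mono v (const_mx rho)).
    elim: v => [|j v IH]; first by rewrite /word_mono big_nil.
    by rewrite /word_mono big_cons -/(word_mono v _) -IH mxE exprS.
  by rewrite monoE; apply: eq_bigr => i _; rewrite mxE.
pose C0 a m := if deg (w m) == a then c m else 0.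
have hC a : exists l, hsum (C0 a) l.
  pose ra := \prod_(i < n) rho ^+ a i.
  have ra0 : 0 < ra by apply: prodr_gt0 => i _; rewrite exprn_gt0.
  apply: (@hsum_ex _ _ _ (M / ra)) => B; rewrite ler_pdivlMr // mulr_suml.
  apply: le_trans (hb B); apply: ler_sum => m _; rewrite /C0; case: eqP => [e|_].
    by rewrite degE e -/ra normrM (gtr0_norm ra0).
  by rewrite normr0 mul0r.
have /choice[C hCC] := hC; exists C => y hy.
pose F (x : nat * {ffun 'I_n -> nat}) := C0 x.2 x.1 * \prod_(i < n) y 0 i ^+ x.2 i.
have hF1 m : hsum (fun a => F (m, a)) (c m * word_mono (w m) y).
  have := @hsum_single R _ (fun a => F (m, a)) (deg (w m)).
  by rewrite /F /C0 /= eqxx -monoE; apply => a /negPf; rewrite eq_sym => ->; rewrite mul0r.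
have [|l hl] := @hsum_ex R _ F M.
  apply: (@abs_bounded_prod _ _ _ _ (fun m => `|c m * word_mono (w m) y|)) => [m B|].
    have [h|h] := boolP (deg (w m) \in B); last first.
      rewrite big1_seq // => a /andP[_ aB]; rewrite /F /C0 /=; case: eqP => [e|_].
        by rewrite e aB in h.
      by rewrite mul0r normr0.
    rewrite (big_fsetD1 _ h) /= big1_seq => [|a]; last first.
      by rewrite !inE => /andP[_ /andP[/negPf ad _]]; rewrite /F /C0 /= eq_sym ad mul0r normr0.
    by rewrite /F /C0 /= eqxx addr0 -monoE.
  apply: abs_bounded_le hb => m; rewrite normr_id !normrM ler_wpM2l //.
  by apply: le_trans (word_mono_bound _ hy) _; rewrite ger0_norm // exprn_ge0 // ltW.
have lE : l = f y by apply: hsum_unique (hsum_fubini hl hF1) (hs y hy).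
rewrite -lE; apply: hsum_fubini (hsum_swap hl) _ => a /=.
rewrite mulrC; apply: eq_hsum (hsumZ _ (hCC a)) => m; by rewrite /F mulrC.
Qed.

Lemma hsum_partial_sum (T : choiceType) m (f : T -> 'rV[R]_m) (l : 'rV[R]_m) :
  (forall i, hsum (fun t => f t 0 i) (l 0 i)) ->
  partial_sum f J @[J --> totally] --> l.
Proof.
move=> hf; have totF : Filter (@totally T) by apply: filter_filter; exact: totally_filter.
apply/cvgrPdist_le => e e0.
have /choice[A hA] := fun i => hf i e e0.
exists (\bigcup_(i <- index_enum 'I_m) A i)%fset => // B /= AB.
apply/polydiscP => [|i]; first exact: ltW.
have := hA i B; rewrite /partial_sum !mxE summxE.
rewrite -(big_seq_fsetE _ _ xpredT (fun t => f t 0 i)) /=; apply.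
by apply: fsubset_trans AB; apply: bigfcup_sup; rewrite ?mem_index_enum.
Qed.

Lemma analytic_analytic_on n m (U : set 'rV[R]_n) (F : 'rV[R]_n -> 'rV[R]_m) :
  (forall x, U x -> analytic_map F x) -> analytic_on U F.
Proof.
move=> hF x /hF/analytic_at_common[rho r0 [M hM]].
have /choice[C hC] := fun i => pseries_multi_index r0 (hM i).
exists (fun a => \row_i C i a), rho; split=> // y; rewrite -ball_normE /ball_ /= distrC => hy.
apply: hsum_partial_sum => i; have := hC i (y - x); rewrite subrKC.
move=> /(_ ((polydiscP _ (ltW r0)).2 (ltW hy))); apply: eq_hsum => a.
by rewrite !mxE mulrC; congr (_ * _).
Qed.

Lemma analytic_class_on n m (U : set 'rV[R]_n) (F : 'rV[R]_n -> 'rV[R]_m) (r : regularity R) :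
  regularity_gt 0 r -> (forall x, U x -> analytic_map F x) -> class_on r U F.
Proof.
case: r => [s s0|_|_] hF /=; last exact: analytic_analytic_on.
  apply: analytic_Ck_on hF; have := truncnS_gt s; rewrite -natr1; lra.
by move=> k; apply: analytic_Ck_on hF.
Qed.

End Regularity.

(** * Analyticity of the elementary functions *)

Section Elementary.
Context {R : realType}.

Definition analytic1 (phi : R -> R) (t : R) : Prop :=
  analytic_at (fun y : 'rV[R]_1 => phi (y 0 0)) (const_mx t).

(** An absolutely bounded family has an unconditional sum, and its ordinary partial sums converge to
    that sum. This transfers the expansions of exp, sin and cos. *)
Lemma hsum_series (f : nat -> R) M l :
  abs_bounded f M -> series f @ \oo --> l -> hsum f l.
Proof.
move=> bM fl; have [l' hl'] := hsum_ex bM.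
suff h : series f @ \oo --> l'.
  by rewrite -(cvg_lim (@norm_hausdorff _ R) fl) (cvg_lim (@norm_hausdorff _ R) h).
apply/cvgrPdist_le => e e0; have [A hA] := hl' _ e0.
exists (\max_(k <- A) k.+1)%N => // m /= hm.
have := hA [fset k | k in iota 0 m]%fset.
rewrite (perm_big (iota 0 m)) /=; last first.
  by apply: uniq_perm; rewrite ?fset_uniq ?iota_uniq // => x; rewrite !inE.
rewrite /series /= /index_iota subn0; apply; apply/fsubsetP => k kA.
rewrite !inE /= mem_iota /= add0n; apply: leq_trans hm.
by apply: (leq_bigmax_seq (F := S)).
Qed.

Lemma abs_bounded_exp_coeff (t : R) : 0 <= t -> abs_bounded (exp_coeff t) (expR t).
Proof.
move=> t0 B.
pose m := (\max_(k <- B) k.+1)%N.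
have Bm : (B `<=` [fset k | k in iota 0 m])%fset.
  apply/fsubsetP => k kB; rewrite !inE /= mem_iota /= add0n.
  by apply: (leq_bigmax_seq (F := S)).
apply: le_trans (psum_subset (f := fun k => `|exp_coeff t k|) _ Bm) _ => //.
rewrite (perm_big (iota 0 m)) /=; last first.
  by apply: uniq_perm; rewrite ?fset_uniq ?iota_uniq // => x; rewrite !inE.
rewrite (eq_bigr (exp_coeff t)) => [|k _]; last by rewrite ger0_norm // exp_coeff_ge0.
have := nondecreasing_cvgn_le _ (is_cvg_series_exp_coeff t) m.
rewrite /series /= /index_iota subn0; apply.
by apply/nondecreasing_series => k _ _; apply: exp_coeff_ge0.
Qed.

Lemma entire_pseries (c : nat -> R) (phi : R -> R) :
  (forall k, `|c k| <= (k`!%:R)^-1) ->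
  (forall t, series (fun k => c k * t ^+ k) @ \oo --> phi t) ->
  pseries 1 (expR 1) (fun y : 'rV[R]_1 => phi (y 0 0)).
Proof.
move=> hc hphi; apply: (@pseries_intro _ _ _ _ _ nat c (fun k => nseq k ord0)).
  apply: abs_bounded_le (abs_bounded_exp_coeff ler01) => k.
  by rewrite size_nseq expr1n mulr1 /exp_coeff /= expr1n mul1r [leRHS]ger0_norm // invr_ge0.
move=> y hy.
have e k : word_mono (nseq k ord0) y = y 0 0 ^+ k.
  by elim: k => [|k IH]; rewrite /word_mono ?big_nil //= big_cons -/(word_mono _ y) IH exprS.
apply: eq_hsum (hsum_series (M := expR 1) _ (hphi (y 0 0))) => [k|]; first by rewrite e.
apply: abs_bounded_le (abs_bounded_exp_coeff ler01) => k.
rewrite /exp_coeff /= expr1n mul1r [leRHS]ger0_norm ?invr_ge0 // normrM -[leRHS]mulr1.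
by apply: ler_pM => //; rewrite normrX exprn_ile1 // hy.
Qed.

(** The expansion at 0 is carried to t by the functional equation; sine and cosine use their
    addition formulas in the same way. *)
Lemma analytic1_expR t : analytic1 expR t.
Proof.
have h0 : analytic1 expR 0.
  exists 1, (expR 1); split=> //.
  apply: eq_pseries (@entire_pseries (fun k => k`!%:R^-1) expR _ _) => [y _|k|s].
  - by rewrite !mxE add0r.
  - by rewrite ger0_norm // invr_ge0.
  - by rewrite -exp_coeffE; exact: is_cvg_series_exp_coeff.
apply: (@eq_analytic_at _ _ (fun y : 'rV[R]_1 => expR t * expR ((- const_mx t + y) 0 0))).
  by move=> y; rewrite -expRD !mxE addrA subrr add0r.
apply: analytic_atM; first exact: analytic_at_cst.
by apply: (@analytic_at_translation _ _ (fun y => expR (y 0 0))); rewrite addNr.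
Qed.

Lemma analytic1_sin0 : analytic1 sin 0.
Proof.
exists 1, (expR 1); split=> //.
apply: eq_pseries (@entire_pseries (fun k => (odd k)%:R * (-1) ^+ k.-1./2 / k`!%:R) sin _ _) => [y _|k|s].
- by rewrite !mxE add0r.
- rewrite normrM [X in _ * X]ger0_norm ?invr_ge0 // ler_piMl ?invr_ge0 //.
  by case: odd; rewrite ?mul1r ?mul0r ?normr0 // normrX normrN1 expr1n.
- by have := @is_cvg_series_sin_coeff R s; rewrite sinE sin_coeffE.
Qed.

Lemma analytic1_cos0 : analytic1 cos 0.
Proof.
exists 1, (expR 1); split=> //.
apply: eq_pseries (@entire_pseries (fun k => (~~ odd k)%:R * (-1) ^+ k./2 / k`!%:R) cos _ _) => [y _|k|s].
- by rewrite !mxE add0r.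
- rewrite normrM [X in _ * X]ger0_norm ?invr_ge0 // ler_piMl ?invr_ge0 //.
  by case: odd; rewrite ?mul1r ?mul0r ?normr0 // normrX normrN1 expr1n.
- by have := @is_cvg_series_cos_coeff R s; rewrite cosE cos_coeffE.
Qed.

Lemma analytic1_shift (phi : R -> R) t :
  analytic1 phi 0 -> analytic_at (fun y : 'rV[R]_1 => phi ((- const_mx t + y) 0 0)) (const_mx t).
Proof.
by move=> h; apply: (@analytic_at_translation _ _ (fun y => phi (y 0 0))); rewrite addNr.
Qed.

Lemma analytic1_sin t : analytic1 sin t.
Proof.
apply: (@eq_analytic_at _ _ (fun y : 'rV[R]_1 =>
  sin t * cos ((- const_mx t + y) 0 0) + cos t * sin ((- const_mx t + y) 0 0))).
  by move=> y; rewrite -sinD !mxE addrA subrr add0r.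
by apply: analytic_atD; apply: analytic_atM; (try exact: analytic_at_cst);
  apply: analytic1_shift; [exact: analytic1_cos0 | exact: analytic1_sin0].
Qed.

Lemma analytic1_cos t : analytic1 cos t.
Proof.
apply: (@eq_analytic_at _ _ (fun y : 'rV[R]_1 =>
  cos t * cos ((- const_mx t + y) 0 0) - sin t * sin ((- const_mx t + y) 0 0))).
  by move=> y; rewrite -cosD !mxE addrA subrr add0r.
by apply: analytic_atB; apply: analytic_atM; (try exact: analytic_at_cst);
  apply: analytic1_shift; [exact: analytic1_cos0 | exact: analytic1_sin0].
Qed.

Lemma diff_is_derive (V W : normedModType R) (f : V -> W) x v :
  differentiable f x -> is_derive x v f ('d f x v).
Proof. by move=> df; split; [exact: diff_derivable | rewrite deriveE]. Qed.

Lemma diff_coord n (x v : 'rV[R]_n) i : 'd (fun y : 'rV[R]_n => y 0 i) x v = v 0 i.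
Proof.
have did : differentiable (id : 'rV[R]_n -> 'rV[R]_n) x by apply: ex_diff; exact: is_diff_id.
rewrite (coord_diff i v did).
by have /(congr1 (fun h => h v)) := @diff_val _ _ _ _ _ _ _ (is_diff_id x) => ->.
Qed.

Lemma diff_comp_scalar (V : normedModType R) (phi : R -> R) (f : V -> R) x v d :
  differentiable f x -> is_derive (f x) 1 phi d ->
  differentiable (fun y => phi (f y)) x /\ 'd (fun y => phi (f y)) x v = d * 'd f x v.
Proof.
move=> df hphi; have dphi : derivable phi (f x) 1 by case: hphi.
have Dphi : differentiable phi (f x) by apply/derivable1_diffP.
split; first exact: differentiable_comp_at.
apply: etrans (diff_comp_at v df Dphi) _.
have /(congr1 (fun h => h ('d f x v))) := deriv1E dphi.
by rewrite derive1E; have [_ ->] := hphi => ->; rewrite -[LHS]/('d f x v * d) mulrC.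
Qed.

(** The inverse function theorem in dimension one; continuity of [psi] identifies it with the
    analytic local inverse. *)
Lemma analytic1_inverse (phi psi : R -> R) t d : analytic1 phi (psi t) ->
  is_derive (psi t) 1 phi d -> d != 0 -> {for t, continuous psi} -> phi (psi t) = t ->
  (\forall s \near t, phi (psi s) = s) -> analytic1 psi t.
Proof.
move=> hphi hd d0 cpsi e0 hs.
pose F (y : 'rV[R]_1) : 'rV[R]_1 := const_mx (phi (y 0 0)).
pose p0 : 'rV[R]_1 := const_mx (psi t).
have hF : analytic_map F p0.
  by move=> i; apply: eq_analytic_at hphi => y; rewrite !mxE.
have F0 : F p0 = const_mx t by rewrite /F mxE e0.
have [|g [hg _ gF _]] := analytic_inverse hF.
  move=> v hv; apply/rowP => i; rewrite ord1 mxE.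
  have : ('d F p0 v) 0 0 = 0 by rewrite hv mxE.
  rewrite -(coord_diff _ _ (analytic_map_diff hF)).
  have dc : differentiable (fun y : 'rV[R]_1 => y 0 0) p0.
    by have [] := analytic_at_diff (analytic_at_coord 0 p0).
  have hd' : is_derive (p0 0 0) 1 phi d by rewrite mxE.
  have [_] := diff_comp_scalar v dc hd'; rewrite diff_coord => e.
  have -> : (fun y => F y 0 0) = (fun y : 'rV[R]_1 => phi (y 0 0)) by apply/funext => y; rewrite mxE.
  by rewrite e => /eqP; rewrite mulf_eq0 (negPf d0) => /eqP.
rewrite F0 in hg.
have hpsi : \forall s \near t, g (const_mx s) = const_mx (psi s).
  have /near_normP[r r0 hr] := gF.
  have h1 : \forall s \near t, `|psi s - psi t| <= r.
    by move/cvgrPdist_le: cpsi => /(_ r r0); apply: filterS => s; rewrite distrC.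
  near=> s.
  have := hr (const_mx (psi s - psi t)); rewrite /p0 -raddfD subrKC /F mxE.
  have -> : phi (psi s) = s by near: s.
  apply; apply/polydiscP; first exact: ltW.
  by move=> i; rewrite mxE; near: s.
apply: near_analytic_at (hg 0).
have cc : {for const_mx t, continuous (fun y : 'rV[R]_1 => y 0 0)}.
  exact: analytic_at_continuous (analytic_at_coord 0 _).
have := @near_continuous _ _ (fun y : 'rV[R]_1 => y 0 0) (const_mx t)
  (fun s => g (const_mx s) = const_mx (psi s)) cc; rewrite mxE => /(_ hpsi).
apply: filterS => y; rewrite (_ : const_mx (y 0 0) = y) => [->|]; first by rewrite mxE.
by apply/rowP => i; rewrite ord1 mxE.
Unshelve. all: by end_near. Qed.

Lemma analytic1_ln (t : R) : 0 < t -> analytic1 (@ln R) t.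
Proof.
move=> t0; apply: (@analytic1_inverse expR (@ln R) t (expR (ln t))).
- exact: analytic1_expR.
- by rewrite gt_eqF // expR_gt0.
- exact: continuous_ln.
- by rewrite lnK.
- by apply: filterS (lt_nbhsr t0) => s s0; rewrite lnK.
Qed.

Lemma analytic1_atan t : analytic1 atan t.
Proof.
have c0 : 0 < cos (atan t) by apply: cos_gt0_pihalf; rewrite atan_gtNpi2 atan_ltpi2.
have hinv : analytic1 (fun s => s^-1) (cos (atan t)).
  apply: (@near_analytic_at _ _ (fun y => expR (- ln (y 0 0)))).
    have cc : {for const_mx (cos (atan t)), continuous (fun y : 'rV[R]_1 => y 0 0)}.
      exact: analytic_at_continuous (analytic_at_coord 0 _).
    have := @near_continuous _ _ (fun y : 'rV[R]_1 => y 0 0) _ (fun s => 0 < s) cc.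
    rewrite mxE => /(_ (lt_nbhsr c0)); apply: filterS => y y0.
    by rewrite expRN lnK.
  apply: (@analytic_at_comp1 _ _ expR (fun y => - ln (y 0 0))); first exact: analytic1_expR.
  by apply: analytic_atN; apply: analytic1_ln.
apply: (@analytic1_inverse tan atan t ((cos (atan t)) ^- 2)).
- apply: analytic_atM; first exact: analytic1_sin.
  apply: (@analytic_at_comp1 _ _ (fun s => s^-1) (fun y => cos (y 0 0))); first by rewrite mxE.
  exact: analytic1_cos.
- by apply: is_derive_tan; rewrite gt_eqF.
- by rewrite invr_eq0 expf_eq0 gt_eqF.
- exact: continuous_atan.
- exact: atanK.
- by near=> s; exact: atanK.
Unshelve. all: by end_near. Qed.

(** 1 / f = f exp (- ln (f^2)) holds for both signs of f. *)
Lemma analytic_atV n (f : 'rV[R]_n -> R) x : f x != 0 -> analytic_at f x ->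
  analytic_at (fun y => (f y)^-1) x.
Proof.
move=> f0 hf.
have sq0 : 0 < f x * f x by rewrite -expr2 exprn_even_gt0.
have hsq := analytic_atM hf hf.
apply: (@near_analytic_at _ _ (fun y => f y * expR (- ln (f y * f y)))).
  have c := analytic_at_continuous hsq.
  have := near_continuous c (lt_nbhsr sq0); apply: filterS => y sq.
  rewrite expRN lnK // invfM mulrA divff ?mul1r //.
  by apply: contraTneq sq => ->; rewrite mul0r ltxx.
apply: analytic_atM => //.
apply: (@analytic_at_comp1 _ _ expR (fun y => - ln (f y * f y))); first exact: analytic1_expR.
by apply: analytic_atN; apply: analytic_at_comp1 => //; apply: analytic1_ln.
Qed.

End Elementary.

(** * Primitives in one coordinate and mixed derivatives *)

Section Primitives.
Context {R : realType}.

(** The left side is h^2 times a polynomial in a and h with nonnegative coefficients, hence at most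
    (|h| / s)^2 times its value [T k] at a = r, h = s. The induction uses the recursion that both
    quantities satisfy. *)
Lemma binomial_tail_bound (a h r s : R) k : `|a| <= r -> `|h| <= s -> 0 < s ->
  `|(a + h) ^+ k.+1 - a ^+ k.+1 - k.+1%:R * h * a ^+ k| <= (`|h| / s) ^+ 2 * (r + s) ^+ k.+1.
Proof.
move=> ha hh s0; have r0 : 0 <= r by apply: le_trans ha.
pose T m : R := (r + s) ^+ m.+1 - r ^+ m.+1 - m.+1%:R * s * r ^+ m.
suff: `|(a + h) ^+ k.+1 - a ^+ k.+1 - k.+1%:R * h * a ^+ k| <= (`|h| / s) ^+ 2 * T k.
  move=> /le_trans; apply; rewrite ler_wpM2l ?sqr_ge0 // /T.
  have h1 : 0 <= r ^+ k.+1 by rewrite exprn_ge0.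
  have h2 : 0 <= k.+1%:R * s * r ^+ k by rewrite !mulr_ge0 ?exprn_ge0 // ltW.
  lra.
elim: k => [|k IH].
  rewrite !expr1 expr0 mulr1 mul1r /T !expr1 expr0 mulr1 mul1r.
  by rewrite [a + h]addrC addrK subrr normr0 [r + s]addrC addrK subrr mulr0.
have -> : (a + h) ^+ k.+2 - a ^+ k.+2 - k.+2%:R * h * a ^+ k.+1 =
  (a + h) * ((a + h) ^+ k.+1 - a ^+ k.+1 - k.+1%:R * h * a ^+ k) + k.+1%:R * h ^+ 2 * a ^+ k.
  by rewrite -[k.+2%:R]natr1 !exprS; ring.
apply: le_trans (ler_normD _ _) _; rewrite normrM.
have TE : T k.+1 = (r + s) * T k + k.+1%:R * s ^+ 2 * r ^+ k.
  by rewrite /T -[k.+2%:R]natr1 !exprS; ring.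
rewrite TE mulrDr; apply: lerD.
  rewrite mulrCA; apply: ler_pM => //.
  by apply: le_trans (ler_normD _ _) (lerD ha hh).
rewrite 2!normrM normr_nat 2!normrX.
have -> : (`|h| / s) ^+ 2 * (k.+1%:R * s ^+ 2 * r ^+ k) = k.+1%:R * `|h| ^+ 2 * r ^+ k.
  by field; rewrite gt_eqF.
by rewrite ler_wpM2l ?mulr_ge0 ?exprn_ge0 // lerXn2r // nnegrE.
Qed.

Lemma is_derive_quadratic (V : normedModType R) (f : V -> R) x v l K e : 0 < e ->
  (forall h : R, `|h| <= e -> `|f (x + h *: v) - f x - h * l| <= K * h ^+ 2) ->
  is_derive x v f l.
Proof.
move=> e0 hf.
have cv : (h^-1 *: (f (h *: v + x) - f x)) @[h --> (0 : R)^'] --> l.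
  apply/cvgrPdist_le => d d0.
  pose r := Num.min e (d / (`|K| + 1)).
  have r0 : 0 < r by rewrite lt_min e0 divr_gt0 // ltr_wpDl.
  have h1 : \forall h \near (0 : R)^', `|h| <= r /\ h != 0.
    near=> h; split; last by near: h; exact: nbhs_dnbhs_neq.
    near: h; apply: nbhs_dnbhs; exact: (near0_norm_le R^o r0).
  apply: filterS h1 => h [hr h0].
  have he : `|h| <= e by move: hr; rewrite le_min => /andP[].
  have hd : `|h| <= d / (`|K| + 1) by move: hr; rewrite le_min => /andP[].
  have := hf h he; rewrite [x + _]addrC => hq.
  have -> : l - h^-1 *: (f (h *: v + x) - f x) = - (h^-1 * (f (h *: v + x) - f x - h * l)).
    by rewrite mulrBr mulKf // opprB.
  rewrite normrN normrM normfV ler_pdivrMl ?normr_gt0 //.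
  apply: le_trans hq _; rewrite -[h ^+ 2]ger0_norm ?sqr_ge0 // normrX expr2 mulrCA ler_wpM2l //.
  apply: le_trans (_ : (`|K| + 1) * `|h| <= _); first by rewrite ler_wpM2r // ler_wpDr // ler_norm.
  by rewrite mulrC -ler_pdivlMr // ltr_wpDl.
split; first by apply: cvgP cv.
exact: cvg_lim cv.
Unshelve. all: by end_near. Qed.

Lemma word_mono_count n (w : seq 'I_n) i (y : 'rV[R]_n) :
  word_mono w y = y 0 i ^+ count_mem i w * word_mono [seq j <- w | j != i] y.
Proof.
elim: w => [|j w IH]; first by rewrite /word_mono big_nil mul1r.
rewrite /word_mono big_cons -/(word_mono w y) IH /=; case: eqVneq => [->|ji] /=.
  by rewrite exprS mulrA.
by rewrite add0n big_cons mulrCA.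
Qed.

(** Term by term: a letter i is put in front of each word and the coefficient is divided by the new
    exponent of [y 0 i]. The estimate on each monomial is the binomial tail bound with r = s = rho /
    2. *)
Lemma pseries_primitive n rho M (f : 'rV[R]_n -> R) i : 0 < rho -> pseries rho M f ->
  exists2 F, pseries rho (rho * M) F & forall y h, polydisc (rho / 2) y -> `|h| <= rho / 2 ->
    `|F (y + h *: delta_mx 0 i) - F y - h * f y| <= (4 / rho * M) * h ^+ 2.
Proof.
move=> r0 [c [w [hb hs]]].
pose d m := c m / (count_mem i (w m)).+1%:R.
have hbd : abs_bounded (fun m => d m * rho ^+ size (i :: w m)) (rho * M).
  have h : abs_bounded (fun m => rho * (c m * rho ^+ size (w m))) (rho * M).
    move=> B; rewrite (eq_bigr (fun m => rho * `|c m * rho ^+ size (w m)|)) => [|m _].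
      by rewrite -mulr_sumr ler_wpM2l // ltW.
    by rewrite normrM (gtr0_norm r0).
  apply: abs_bounded_le h => m; rewrite /= exprS mulrCA !normrM ler_wpM2l // ler_wpM2r //.
  rewrite -[leRHS]mulr1 ler_wpM2l // ger0_norm ?invr_ge0 // invf_le1 // ler1n //.
have hex y : exists l, polydisc rho y -> hsum (fun m => d m * word_mono (i :: w m) y) l.
  have [hy|] := pselect (polydisc rho y); last by exists 0.
  have [|l hl] := @hsum_ex _ _ (fun m => d m * word_mono (i :: w m) y) (rho * M).
    apply: abs_bounded_le hbd => m; rewrite !normrM ler_wpM2l //.
    by apply: le_trans (word_mono_bound _ hy) _; rewrite ger0_norm // exprn_ge0 // ltW.
  by exists l.
have /choice[F hF] := hex.
exists F; first by exists d, (fun m => i :: w m).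
move=> y h hy hh.
have r2 : 0 < rho / 2 by rewrite divr_gt0.
have ryl : rho / 2 <= rho by lra.
have hy' := polydisc_le ryl hy.
have hz : polydisc rho (y + h *: delta_mx 0 i).
  move=> j; rewrite !mxE [rho]splitr; apply: le_trans (ler_normD _ _) _; apply: lerD => //.
  by case: (j == i); rewrite /= ?mulr1 // mulr0 normr0 ltW.
have hsm := hsumD (hsumD (hF _ hz) (hsumZ (-1) (hF _ hy'))) (hsumZ (- h) (hs y hy')).
rewrite mulN1r mulNr in hsm.
apply: hsum_bound hsm _.
have hb4 : abs_bounded (fun m => (4 / rho * h ^+ 2) * (c m * rho ^+ size (w m))) (4 / rho * M * h ^+ 2).
  have q0 : 0 <= 4 / rho * h ^+ 2 by rewrite mulr_ge0 ?sqr_ge0 // divr_ge0 // ltW.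
  move=> B; rewrite (eq_bigr (fun m => 4 / rho * h ^+ 2 * `|c m * rho ^+ size (w m)|)) => [|m _].
    by rewrite -mulr_sumr [leRHS]mulrAC ler_wpM2l.
  by rewrite normrM (ger0_norm q0).
apply: abs_bounded_le hb4 => m.
set k := count_mem i (w m); pose v := [seq j <- w m | j != i].
have vz : word_mono v (y + h *: delta_mx 0 i) = word_mono v y.
  rewrite /word_mono !big_seq; apply: eq_bigr => j; rewrite mem_filter => /andP[ji _].
  by rewrite !mxE (negPf ji) andbF mulr0 addr0.
have wE (z : 'rV[R]_n) : word_mono (i :: w m) z = z 0 i ^+ k.+1 * word_mono v z.
  by rewrite /word_mono big_cons -/(word_mono (w m) z) (word_mono_count _ i) exprS mulrA.
rewrite !wE vz (word_mono_count (w m) i) -/v -/k.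
have zi : (y + h *: delta_mx 0 i) 0 i = y 0 i + h by rewrite !mxE !eqxx mulr1.
rewrite zi; set a := y 0 i; set W := word_mono v y.
have k0 : k.+1%:R != 0 :> R by rewrite pnatr_eq0.
have -> : d m * ((a + h) ^+ k.+1 * W) + -1 * (d m * (a ^+ k.+1 * W)) + - h * (c m * (a ^+ k * W)) =
   c m * (k.+1%:R^-1 * ((a + h) ^+ k.+1 - a ^+ k.+1 - k.+1%:R * h * a ^+ k) * W).
  by rewrite /d -/k; field.
have -> : (4 / rho * h ^+ 2) * (c m * rho ^+ size (w m)) = c m * ((`|h| / (rho / 2)) ^+ 2 * rho ^+ k.+1 * rho ^+ size v).
  have -> : size (w m) = (k + size v)%N by rewrite /k /v size_filter -(count_predC (pred1 i)).
  by rewrite exprD expr_div_n real_normK ?num_real // (exprS rho k); field; rewrite gt_eqF.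
rewrite !(normrM (c m)) ler_wpM2l // normrM [leRHS]normrM; apply: ler_pM => //.
  rewrite normrM [leRHS]ger0_norm; last by rewrite mulr_ge0 ?sqr_ge0 // exprn_ge0 // ltW.
  apply: le_trans (_ : 1 * ((`|h| / (rho / 2)) ^+ 2 * rho ^+ k.+1) <= _); last by rewrite mul1r.
  apply: ler_pM => //; first by rewrite ger0_norm ?invr_ge0 // invf_le1 // ler1n.
  by have := binomial_tail_bound k (hy i) hh r2; rewrite -splitr.
by apply: le_trans (word_mono_bound _ hy') _; rewrite ger0_norm // exprn_ge0 // ltW.
Qed.

Lemma analytic_primitive n (f : 'rV[R]_n -> R) x i : analytic_at f x ->
  exists2 F, analytic_at F x &
    \forall y \near x, is_derive y (delta_mx 0 i : 'rV[R]_n) F (f y).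
Proof.
move=> [rho [M [r0 hf]]]; have [F hF hd] := pseries_primitive i r0 hf.
have r2 : 0 < rho / 2 by rewrite divr_gt0.
exists (fun y => F (y - x)).
  exists rho, (rho * M); split=> //; apply: eq_pseries hF => y _.
  by rewrite addrAC subrr add0r.
apply/near_normP; exists (rho / 2) => // y /(polydiscP _ (ltW r2)) hy.
apply: (is_derive_quadratic (K := 4 / rho * M) r2) => h hh.
rewrite [x + y + _ - x]addrAC; have -> : x + y - x = y by rewrite addrAC subrr add0r.
exact: hd.
Qed.

Lemma norm_row_mx_le n m (y : 'rV[R]_n) (h : 'rV[R]_m) c : 0 <= c ->
  `|y| <= c -> `|h| <= c -> `|row_mx y h| <= c.
Proof.
move=> c0 /(polydiscP _ c0) hy /(polydiscP _ c0) hh.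
by apply/polydiscP => //; apply: polydisc_row_mx.
Qed.

(** One factor s comes from the increment s v in the Taylor formula, a second from expanding its
    coefficients along s u, and a third from the Lipschitz bound for what remains. *)
Lemma second_difference n (f : 'rV[R]_n -> R) x u v : analytic_at f x ->
  exists L C e, [/\ L = 'd (fun y => 'd f y v) x u, 0 < e & forall s : R, `|s| <= e ->
    `|f (x + s *: u + s *: v) - f (x + s *: u) - f (x + s *: v) + f x - s ^+ 2 * L| <= C * `|s| ^+ 3].
Proof.
move=> hfx; have [rho [M [r0 hf]]] := hfx.
have [g [K [hg hd]]] := pseries_taylor r0 hf.
have r2 : 0 < rho / 2 by rewrite divr_gt0.
have r4 : 0 < rho / 4 by rewrite divr_gt0.
have r4E : rho / 4 = rho / 2 / 2 by field.
have r42 : rho / 4 <= rho / 2 by lra.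
have h2 i : exists (G : 'I_(n + n) -> 'rV[R]_((n + n) + (n + n)) -> R) K2,
    (forall k, pseries (rho / 4) K2 (G k)) /\
    forall z h, polydisc (rho / 4) z -> polydisc (rho / 4) h ->
      g i (z + h) = g i z + \sum_k h 0 k * G k (row_mx z h).
  by rewrite r4E; apply: pseries_taylor1 (hg i).
have /choice[G /choice[K2 hG]] := h2.
pose U : 'rV[R]_(n + n) := row_mx u 0.
pose E z := \sum_i v 0 i * \sum_k U 0 k * G i k z.
have hE : analytic_at E 0.
  apply: analytic_at_sum => i; apply: analytic_atM; first exact: analytic_at_cst.
  apply: analytic_at_sum => k; apply: analytic_atM; first exact: analytic_at_cst.
  have [h _] := hG i; exists (rho / 4), (K2 i); split=> //.
  by apply: eq_pseries (h k) => z _; rewrite add0r.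
have [C [eE [C0 eE0 hC]]] := analytic_at_lipschitz hE.
pose N0 := `|u| + `|v| + 1.
have N01 : 1 <= N0 by rewrite /N0 lerDr addr_ge0.
have N00 : 0 < N0 by lra.
pose e := Num.min (rho / 4) eE / N0.
have e0 : 0 < e by rewrite divr_gt0 // lt_min r4.
have sN (s : R) : `|s| <= e -> `|s| * N0 <= rho / 4 /\ `|s| * N0 <= eE.
  rewrite ler_pdivlMr // le_min => /andP[]; by split.
have su s : `|s *: u| <= `|s| * N0 by rewrite normrZ ler_wpM2l // /N0; have := normr_ge0 v; lra.
have sv s : `|s *: v| <= `|s| * N0 by rewrite normrZ ler_wpM2l // /N0; have := normr_ge0 u; lra.
have sc0 (s : R) : 0 <= `|s| * N0 by rewrite mulr_ge0 // ltW.
have pd0 m c : 0 <= c -> polydisc c (0 : 'rV[R]_m) by move=> c0 i; rewrite mxE normr0.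
have main (s : R) (w : 'rV[R]_n) : `|s| <= e -> `|w| <= `|s| * N0 ->
    `|\sum_i v 0 i * (g i (row_mx (s *: u) w) - g i (row_mx 0 w)) - s * E 0| <= C * N0 * s ^+ 2.
  move=> hs hw; have [s1 s2] := sN s hs.
  have pw : polydisc (rho / 4) w by apply/polydiscP; [exact: ltW | lra].
  have pu : polydisc (rho / 4) (s *: u) by apply/polydiscP; [exact: ltW | apply: le_trans (su s) s1].
  have zE i : g i (row_mx (s *: u) w) - g i (row_mx 0 w) =
      s * \sum_k U 0 k * G i k (row_mx (row_mx 0 w) (s *: U)).
    have [_ h] := hG i.
    have -> : row_mx (s *: u) w = row_mx 0 w + s *: U.
      by rewrite /U scale_row_mx add_row_mx add0r scaler0 addr0.
    rewrite h; first last.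
    - by rewrite /U scale_row_mx scaler0; apply: polydisc_row_mx => //; apply: pd0; exact: ltW.
    - by apply: polydisc_row_mx => //; apply: pd0; exact: ltW.
    rewrite [X in X - _]addrC addrK mulr_sumr; apply: eq_bigr => k _.
    by rewrite !mxE mulrA.
  rewrite (eq_bigr _ (fun i _ => congr1 _ (zE i))).
  have -> : \sum_i v 0 i * (s * \sum_k U 0 k * G i k (row_mx (row_mx 0 w) (s *: U))) =
     s * E (row_mx (row_mx 0 w) (s *: U)).
    by rewrite mulr_sumr; apply: eq_bigr => i _; rewrite mulrCA.
  rewrite -mulrBr normrM.
  have nz : `|row_mx (row_mx 0 w) (s *: U) : 'rV[R]_((n + n) + (n + n))| <= `|s| * N0.
    apply: norm_row_mx_le => //; first by apply: norm_row_mx_le => //; rewrite normr0.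
    by rewrite /U scale_row_mx scaler0; apply: norm_row_mx_le => //; rewrite normr0.
  apply: le_trans (_ : `|s| * (C * (`|s| * N0)) <= _); last first.
    by rewrite -[s ^+ 2]ger0_norm ?sqr_ge0 // normrX expr2 le_eqVlt; apply/orP; left; apply/eqP; ring.
  rewrite ler_wpM2l //; apply: le_trans (hC _ _ _ _) _; rewrite ?subr0 ?normr0 //; first lra.
    by rewrite ltW.
  by rewrite ler_wpM2l.
pose Dv y := 'd f y v.
have hDv y : polydisc (rho / 2) y -> Dv (x + y) = \sum_i v 0 i * g i (row_mx y 0).
  by move=> hy; have [_ _ h] := hd y hy; exact: h.
have dE : E 0 = 'd Dv x u.
  have [_ /(_ v) hv] := analytic_at_diff hfx.
  have [dv _] := analytic_at_diff hv.
  have d1 := diff_is_derive u dv.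
  have d2 : is_derive x u Dv (E 0).
    apply: (is_derive_quadratic (K := C * N0) e0) => s hs.
    have := main s 0 hs; rewrite normr0 => /(_ (sc0 s)).
    have pu : polydisc (rho / 2) (s *: u).
      by apply/polydiscP; [exact: ltW | have [] := sN s hs; have := su s; lra].
    have := hDv 0 (pd0 _ _ (ltW r2)); rewrite addr0 => ->; rewrite (hDv _ pu).
    by rewrite -sumrB (eq_bigr _ (fun i _ => mulrBr _ _ _)).
  by case: d1 => _ <-; case: d2 => _ <-.
exists (E 0), (C * N0), e; split=> // s hs; have [s1 s2] := sN s hs.
have pu : polydisc (rho / 2) (s *: u) by apply/polydiscP; [exact: ltW | have := su s; lra].
have pv : polydisc (rho / 2) (s *: v) by apply/polydiscP; [exact: ltW | have := sv s; lra].
have [h1 _ _] := hd _ pu; rewrite (h1 _ pv).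
have [h3 _ _] := hd 0 (pd0 _ _ (ltW r2)); have := h3 _ pv; rewrite !addr0 => ->.
have -> : f (x + s *: u) + \sum_i (s *: v) 0 i * g i (row_mx (s *: u) (s *: v)) - f (x + s *: u) -
  (f x + \sum_i (s *: v) 0 i * g i (row_mx 0 (s *: v))) + f x - s ^+ 2 * E 0 =
  s * (\sum_i v 0 i * (g i (row_mx (s *: u) (s *: v)) - g i (row_mx 0 (s *: v))) - s * E 0).
  have eS (w : 'rV[R]_(n + n)) : \sum_i (s *: v) 0 i * g i w = s * \sum_i v 0 i * g i w.
    by rewrite mulr_sumr; apply: eq_bigr => i _; rewrite mxE mulrA.
  rewrite !eS (eq_bigr _ (fun i _ => mulrBr _ _ _)) sumrB.
  set e0' := E 0; ring.
rewrite normrM exprS mulrCA ler_wpM2l //.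
by apply: le_trans (main s _ hs (sv s)) _; rewrite -[s ^+ 2]ger0_norm ?sqr_ge0 // normrX.
Qed.

(* Both mixed derivatives are the limit of the same symmetric second difference. *)
Lemma analytic_mixed_derivative n (f : 'rV[R]_n -> R) x u v : analytic_at f x ->
  'd (fun y => 'd f y v) x u = 'd (fun y => 'd f y u) x v.
Proof.
move=> hf; have [a [C [e [ae e0 h1]]]] := second_difference u v hf.
have [b [C' [e' [be e'0 h2]]]] := second_difference v u hf.
apply: (etrans (esym ae)); apply: (etrans _ be).
apply/eqP; rewrite -subr_eq0 -normr_le0; apply/ler_addgt0Pl => d d0.
pose s := Num.min (Num.min e e') (d / (`|C| + `|C'| + 1)).
have D0 : 0 < `|C| + `|C'| + 1 by rewrite ltr_wpDl // addr_ge0.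
have s0 : 0 < s by rewrite !lt_min e0 e'0 divr_gt0.
have hs : `|s| <= e by rewrite gtr0_norm // !ge_min lexx.
have hs' : `|s| <= e' by rewrite gtr0_norm // !ge_min lexx orbT.
have sd : s * (`|C| + `|C'| + 1) <= d by rewrite -ler_pdivlMr // ge_min lexx orbT.
have := h1 s hs; have := h2 s hs'; rewrite (gtr0_norm s0).
rewrite [x + s *: v + s *: u]addrAC.
set A := f (x + s *: u + s *: v); set B := f (x + s *: u); set D := f (x + s *: v).
move=> k1 k2.
have k3 : s ^+ 2 * `|a - b| <= s ^+ 2 * d.
  have -> : s ^+ 2 * `|a - b| = `|(A - D - B + f x - s ^+ 2 * b) - (A - B - D + f x - s ^+ 2 * a)|.
    have -> : A - D - B + f x - s ^+ 2 * b - (A - B - D + f x - s ^+ 2 * a) = s ^+ 2 * (a - b) by ring.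
    by rewrite normrM ger0_norm ?sqr_ge0.
  apply: le_trans (ler_normB _ _) _.
  apply: le_trans (lerD k1 k2) _; rewrite exprSr mulrA.
  have c1 := ler_norm C; have c2 := ler_norm C'.
  have s20 : 0 <= s ^+ 2 := sqr_ge0 s.
  have : s ^+ 2 * (s * (`|C| + `|C'| + 1)) <= s ^+ 2 * d by rewrite ler_wpM2l.
  apply: le_trans; rewrite mulrA.
  have -> : C' * s ^+ 2 * s + C * s ^+ 2 * s = s ^+ 2 * s * (C + C') by ring.
  rewrite [leRHS]mulrA ler_wpM2l ?mulr_ge0 ?(ltW s0) //; lra.
by rewrite addr0; move: k3; rewrite ler_pM2l // exprn_gt0.
Qed.

End Primitives.

(** * Calculus in one real variable *)

Section OneVariable.
Context {R : realType}.
Implicit Types (f df : R -> R) (a b x : R).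

Lemma mvt_le f df a b : a <= b -> (forall x, a <= x <= b -> is_derive x 1 f (df x)) ->
  exists2 c, a <= c <= b & f b - f a = df c * (b - a).
Proof.
move=> ab h.
have /MVT_segment : forall x, x \in `]a, b[ -> is_derive x 1 f (df x).
  by move=> x; rewrite in_itv /= => /andP[/ltW ax /ltW xb]; apply: h; rewrite ax.
case=> //.
- apply: continuous_in_subspaceT => x; rewrite inE /= in_itv /= => /h dx.
  by apply/differentiable_continuous/derivable1_diffP; case: dx.
- by move=> c; rewrite in_itv /= => cab ->; exists c.
Qed.

Lemma is_derive_ge0_le f df a b : a <= b -> (forall x, a <= x <= b -> is_derive x 1 f (df x)) ->
  (forall x, a <= x <= b -> 0 <= df x) -> f a <= f b.
Proof.
move=> ab h d0; have [c cab e] := mvt_le ab h.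
by rewrite -subr_ge0 e mulr_ge0 ?d0 ?subr_ge0.
Qed.

Lemma is_derive_gt0_lt f df a b : a < b -> (forall x, a <= x <= b -> is_derive x 1 f (df x)) ->
  (forall x, a <= x <= b -> 0 < df x) -> f a < f b.
Proof.
move=> ab h d0; have [c cab e] := mvt_le (ltW ab) h.
by rewrite -subr_gt0 e mulr_gt0 ?d0 ?subr_gt0.
Qed.

Lemma is_derive_eq0_eq f a b : a <= b -> (forall x, a <= x <= b -> is_derive x 1 f 0) -> f a = f b.
Proof.
move=> ab h; have [c cab e] := @mvt_le f (fun=> 0) _ _ ab h.
by apply/eqP; rewrite -subr_eq0 -opprB e mul0r oppr0.
Qed.

Lemma is_derive_subr f x d (c : R) : is_derive x 1 f d -> is_derive x 1 (fun y => f y - c) d.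
Proof. by move=> h; rewrite -[d]subr0; apply: is_deriveB. Qed.

Lemma is_deriveD1 f g x a b : is_derive x 1 f a -> is_derive x 1 g b ->
  is_derive x 1 (fun t => f t + g t) (a + b).
Proof. exact: is_deriveD. Qed.

Lemma is_deriveB1 f g x a b : is_derive x 1 f a -> is_derive x 1 g b ->
  is_derive x 1 (fun t => f t - g t) (a - b).
Proof. exact: is_deriveB. Qed.

Lemma is_deriveM1 f g x a b : is_derive x 1 f a -> is_derive x 1 g b ->
  is_derive x 1 (fun t => f t * g t) (a * g x + f x * b).
Proof.
move=> df dg; apply: is_derive_eq (is_deriveM df dg) _.
by rewrite /GRing.scale /= addrC (mulrC a).
Qed.

Lemma is_deriveZ1 f x a c : is_derive x 1 f a -> is_derive x 1 (fun t => c * f t) (c * a).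
Proof. by move=> df; apply: is_derive_eq (is_deriveZ c df) _. Qed.

Lemma is_derive_mulr f x a c : is_derive x 1 f a -> is_derive x 1 (fun t => f t * c) (a * c).
Proof. by move=> df; apply: is_derive_eq (is_deriveM1 df (is_derive_cst _ _ _)) _; rewrite mulr0 addr0. Qed.

Lemma is_derive_comp1 f g x a b : is_derive (f x) 1 g b -> is_derive x 1 f a ->
  is_derive x 1 (fun t => g (f t)) (b * a).
Proof. exact: is_derive1_comp. Qed.

Lemma is_deriveV1 f x a : f x != 0 -> is_derive x 1 f a ->
  is_derive x 1 (fun t => (f t)^-1) (- a / f x ^+ 2).
Proof.
move=> f0 df; apply: is_derive_eq (is_deriveV f0 df) _.
by rewrite /GRing.scale /=; field.
Qed.

Lemma continuous_primitive f (B : R) : continuous f -> 0 < B ->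
  exists F : R -> R, F 0 = 0 /\ forall x, `|x| < B -> is_derive x 1 F (f x).
Proof.
move=> cf B0.
pose F0 (x : R) := (\int[lebesgue_measure]_(t in `[- B, x]) f t).
exists (fun x => F0 x - F0 0); split; first by rewrite subrr.
move=> x; rewrite ltr_norml => /andP[x1 x2].
have int : lebesgue_measure.-integrable `[- B, B] (EFin \o f).
  apply: continuous_compact_integrable; first exact: segment_compact.
  by apply: continuous_subspaceT.
have [d e] := continuous_FTC1_closed x2 int x1 (cf x).
apply: is_derive_subr; split; first exact: d.
by rewrite -e derive1E.
Qed.

(** Connectedness of [0, 1] as an induction principle: if P spreads locally in both directions, the
    set where it holds is relatively open and closed, and it contains 0. *)
Lemma segment_ind (P : R -> Prop) : P 0 ->
  (forall t : R, 0 <= t <= 1 -> exists2 e, 0 < e & forall s s', 0 <= s <= 1 -> 0 <= s' <= 1 ->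
     `|s - t| < e -> `|s' - t| < e -> P s -> P s') -> P 1.
Proof.
move=> P0 h.
have i0 : 0 <= (0 : R) <= 1 by rewrite lexx ler01.
have i1 : 0 <= (1 : R) <= 1 by rewrite ler01 lexx.
have I (t : R) : (t \in `[0, 1]) = (0 <= t <= 1) by rewrite in_itv.
pose B := [set t | 0 <= t <= 1 /\ P t].
(* The union of the neighbourhoods around points where Q holds. Taken for P and for its negation, it
   exhibits the set as relatively open and as relatively closed. *)
pose O (Q : R -> Prop) := [set t | exists s e, [/\ 0 <= s <= 1, Q s, 0 < e, `|t - s| < e &
  forall s1 s', 0 <= s1 <= 1 -> 0 <= s' <= 1 -> `|s1 - s| < e -> `|s' - s| < e -> P s1 -> P s']].
have oO Q : open (O Q).
  rewrite openE => t [s [e [s01 Qs e0 ts he]]].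
  exists (e - `|t - s|); first by rewrite /= subr_gt0.
  move=> t' /=; rewrite /ball_ /= => tt'; exists s, e; split => //.
  rewrite -(subrK t t') -addrA; apply: le_lt_trans (ler_normD _ _) _.
  by rewrite distrC -ltrBrDr.
have inO (Q : R -> Prop) t : 0 <= t <= 1 -> Q t -> O Q t.
  by move=> t01 Qt; have [e e0 he] := h t t01; exists t, e; rewrite subrr normr0.
have OE (Q : R -> Prop) t : 0 <= t <= 1 -> O Q t -> exists s, [/\ 0 <= s <= 1, Q s, P s -> P t & P t -> P s].
  move=> t01 [s [e [s01 Qs e0 ts he]]]; exists s.
  by split => //; apply: he => //; rewrite subrr normr0.
suff E : B = `[0, 1]%classic.
  have : B 1 by rewrite E /= in_itv.
  by case.
apply: (@segment_connected R 0 1) => //.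
- by exists 0.
- exists (O P) => //; apply/seteqP; split => t /=; rewrite in_itv /=.
    by move=> [t01 Pt]; split => //; apply: inO.
  by move=> [t01 /(OE _ _ t01)[s [_ Ps + _]]] => /(_ Ps).
- exists (~` O (fun t => ~ P t)); first exact: open_closedC.
  apply/seteqP; split => t /=; rewrite in_itv /=.
    by move=> [t01 Pt]; split => // /(OE _ _ t01)[s [_ nPs _ /(_ Pt)]].
  move=> [t01 nO]; split => //.
  by apply: contrapT => nPt; apply: nO; apply: inO.
Qed.

End OneVariable.

(** * Functions of two variables, integrated in the first one *)

Section Plane.
Context {R : realType}.

Definition pt (u k : R) : 'rV[R]_2 := \row_i (if i == 0 then u else k).

Lemma pt0 u k : pt u k 0 0 = u. Proof. by rewrite mxE. Qed.

Lemma pt1 u k : pt u k 0 1 = k. Proof. by rewrite mxE. Qed.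

Lemma pt_eta (y : 'rV[R]_2) : pt (y 0 0) (y 0 1) = y.
Proof. by apply/rowP => i; rewrite mxE; case: i => -[|[|//]] hi; congr (y _ _); exact: val_inj. Qed.

Lemma norm_pt_le u k (e : R) : `|u| <= e -> `|k| <= e -> `|pt u k| <= e.
Proof.
move=> ue ke; have e0 : 0 <= e := le_trans (normr_ge0 u) ue.
by apply/polydiscP => // i; rewrite mxE; case: ifP.
Qed.

Lemma ptB u k u' k' : pt u k - pt u' k' = pt (u - u') (k - k').
Proof. by apply/rowP => i; rewrite !mxE; case: ifP. Qed.

Lemma is_derive_line (V W : normedModType R) (F : V -> W) (G : R -> W) y v u d :
  (forall h, G (h + u) = F (h *: v + y)) -> is_derive y v F d -> is_derive u 1 G d.
Proof.
move=> e [dF <-].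
have E : (fun h : R => h^-1 *: (G (h *: 1 + u) - G u)) = (fun h => h^-1 *: (F (h *: v + y) - F y)).
  apply/funext => h; have := e 0; rewrite add0r scale0r add0r => ->.
  by rewrite /GRing.scale /= mulr1 e.
split; first by rewrite /derivable E.
by rewrite /derive E.
Qed.

Lemma is_derive_pt0 (F : 'rV[R]_2 -> R) u k d :
  is_derive (pt u k) (delta_mx 0 0) F d -> is_derive u 1 (fun s => F (pt s k)) d.
Proof.
apply: is_derive_line => h; congr F; apply/rowP => i; rewrite !mxE eqxx /=.
by case: eqP => _; rewrite ?mulr1 ?mulr0 ?add0r.
Qed.

Lemma is_derive_pt1 (F : 'rV[R]_2 -> R) u k d :
  is_derive (pt u k) (delta_mx 0 1) F d -> is_derive k 1 (fun s => F (pt u s)) d.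
Proof.
apply: is_derive_line => h; congr F; apply/rowP => i; rewrite !mxE eqxx /=.
by case: i => -[|[|//]] hi; rewrite /= ?mulr1 ?mulr0 ?add0r.
Qed.

Lemma analytic_at_pt0 n (F : 'rV[R]_2 -> R) (g h : 'rV[R]_n -> R) x : analytic_at F (pt (g x) (h x)) ->
  analytic_at g x -> analytic_at h x -> analytic_at (fun y => F (pt (g y) (h y))) x.
Proof.
move=> aF ag ah.
apply: (@analytic_at_comp R n 2 F (fun i y => if i == 0 then g y else h y)) => [|i]; first exact: aF.
by case: (i == 0).
Qed.

Section Patch.
Variables (f : 'rV[R]_2 -> R) (p : R -> R -> R) (u0 k0 : R).
Hypothesis af : forall t : R, 0 <= t <= 1 -> analytic_at f (pt (t * u0) k0).
Hypothesis dp : forall t : R, 0 <= t <= 1 ->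
  \forall y \near pt (t * u0) k0, is_derive ((y : 'rV[R]_2) 0 0) 1 (p^~ (y 0 1)) (f y).
Hypothesis p0 : forall k, p 0 k = 0.

(** A local analytic primitive F in u has the same u-derivative as [p], so the difference does not
    depend on u near the point. *)
Lemma patch_primitive t : 0 <= t <= 1 -> exists (F : 'rV[R]_2 -> R),
  exists2 e, 0 < e & forall u k, `|u - t * u0| <= e -> `|k - k0| <= e ->
    analytic_at F (pt u k) /\ forall u', `|u' - t * u0| <= e -> p u' k - p u k = F (pt u' k) - F (pt u k).
Proof.
move=> t01; have [F aF dF] := analytic_primitive 0 (af t01).
exists F; have := dp t01.
move=> /near_normP[e3 e30 h3].
move: (analytic_at_near aF) dF => /near_normP[e1 e10 h1] /near_normP[e2 e20 h2].
pose e := Num.min e1 (Num.min e2 e3).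
have e0 : 0 < e by rewrite !lt_min e10 e20 e30.
have H u k : `|u - t * u0| <= e -> `|k - k0| <= e ->
    [/\ analytic_at F (pt u k), is_derive u 1 (fun s => F (pt s k)) (f (pt u k)) &
        is_derive u 1 (p^~ k) (f (pt u k))].
  move=> ue ke; have := norm_pt_le ue ke; rewrite -ptB !le_min => /and3P[n1 n2 n3].
  have E : pt (t * u0) k0 + (pt u k - pt (t * u0) k0) = pt u k by rewrite addrC subrK.
  split; first by have := h1 _ n1; rewrite E.
    by apply: is_derive_pt0; have := h2 _ n2; rewrite E.
  by have := h3 _ n3; rewrite E pt0 pt1.
exists e => // u k ue ke; split; first by case: (H u k).
have C a c : a <= c -> `|a - t * u0| <= e -> `|c - t * u0| <= e ->
    p a k - F (pt a k) = p c k - F (pt c k).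
  rewrite !ler_norml => ac /andP[a1 a2] /andP[c1 c2].
  apply: (@is_derive_eq0_eq R (fun s => p s k - F (pt s k))) => // x /andP[ax xc].
  have [||] := H x k; rewrite ?ler_norml; [by apply/andP; split; lra|by rewrite -ler_norml|].
  by move=> _ d1 d2; rewrite -[0](subrr (f (pt x k))); apply: is_deriveB.
move=> u' u'e; suff : p u k - F (pt u k) = p u' k - F (pt u' k) by move=> ?; lra.
by have [uu|uu] := leP u u'; [apply: C|symmetry; apply: C => //; exact: ltW].
Qed.

(** Only the u-derivative of [p] is known to be analytic. On u = 0 analyticity holds because [p]
    vanishes there, and the local primitives carry it along the segment: if p (s u0, k) is analytic
    in k for one s, then p is analytic at the nearby points (s' u0, k0). *)
Lemma analytic_at_patch : analytic_at (fun y => p (y 0 0) (y 0 1)) (pt u0 k0).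
Proof.
pose P t := analytic_at (fun y => p (y 0 0) (y 0 1)) (pt (t * u0) k0).
have step t : 0 <= t <= 1 -> exists2 e, 0 < e & forall s s', `|s - t| < e -> `|s' - t| < e ->
    analytic_at (fun y => p (s * u0) (y 0 1)) (pt (s' * u0) k0) -> P s'.
  move=> t01; have [F [e e0 hF]] := patch_primitive t01.
  exists (e / 2 / (`|u0| + 1)); first by rewrite !divr_gt0 // ltr_wpDl.
  have S s : `|s - t| < e / 2 / (`|u0| + 1) -> `|s * u0 - t * u0| <= e / 2.
    rewrite ltr_pdivlMr ?ltr_wpDl // => /ltW le1; rewrite -mulrBl normrM.
    by apply: le_trans le1; rewrite ler_wpM2l // lerDl.
  move=> s s' /S hs /S hs' ap.
  have e2e : e / 2 <= e by rewrite ler_pdivrMr // ler_pMr // ler1n.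
  have kk : `|k0 - k0| <= e by rewrite subrr normr0 ltW.
  have [aF' _] := hF (s' * u0) k0 (le_trans hs' e2e) kk.
  have [aFs _] := hF (s * u0) k0 (le_trans hs e2e) kk.
  apply: (@near_analytic_at R 2 (fun y => F y - F (pt (s * u0) (y 0 1)) + p (s * u0) (y 0 1))).
    apply/near_normP; exists (e / 2); first exact: divr_gt0.
    move=> h /polydiscP hh; have {}hh := hh (divr_ge0 (ltW e0) (ler0n _ 2)).
    set y := _ + h.
    have y0 : `|y 0 0 - t * u0| <= e.
      rewrite /y mxE pt0 -addrA (addrC (h 0 0)) addrA.
      by rewrite (splitr e); apply: le_trans (ler_normD _ _) (lerD hs' (hh 0)).
    have y1 : `|y 0 1 - k0| <= e.
      by rewrite /y mxE pt1 addrAC subrr add0r; apply: le_trans (hh 1) e2e.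
    have [_ /(_ (y 0 0) y0)] := hF (s * u0) (y 0 1) (le_trans hs e2e) y1.
    by rewrite pt_eta => <-; rewrite subrK.
  apply: analytic_atD => //; apply: analytic_atB; first exact: aF'.
  apply: (@analytic_at_pt0 2 F (fun=> s * u0) (fun y => y 0 1)); rewrite ?pt1.
  - exact: aFs.
  - exact: analytic_at_cst.
  - exact: analytic_at_coord.
have E0 : analytic_at (fun y : 'rV[R]_2 => p (0 * u0) (y 0 1)) (pt (0 * u0) k0).
  by apply: eq_analytic_at (analytic_at_cst 0 _) => y; rewrite mul0r p0.
suff : P 1 by rewrite /P mul1r.
apply: segment_ind.
  have [|e e0 he] := step 0; first by rewrite lexx ler01.
  by apply: (he 0 0) => //; rewrite subrr normr0.
move=> t t01; have [e e0 he] := step t t01; exists e => // s s' _ _ hs hs' Ps.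
apply: (he s) => //.
apply: eq_analytic_at (@analytic_at_pt0 2 (fun y => p (y 0 0) (y 0 1)) (fun=> s * u0) (fun y => y 0 1)
  (pt (s' * u0) k0) _ _ _) => [y|||]; rewrite ?pt0 ?pt1 //.
- exact: analytic_at_cst.
- exact: analytic_at_coord.
Qed.

End Patch.

End Plane.

(** * The complex power (X + i Y)^(- lam) *)

Section Power.
Context {R : realType}.
Variable lam : R.

(* [powU X Y - i powV X Y] is the principal value of [(X + i Y)^(- lam)] for [X > 0]. *)
Definition powU (X Y : R) : R := expR (- (lam / 2) * ln (X ^+ 2 + Y ^+ 2)) * cos (lam * atan (Y / X)).
Definition powV (X Y : R) : R := expR (- (lam / 2) * ln (X ^+ 2 + Y ^+ 2)) * sin (lam * atan (Y / X)).

Lemma sqr_sum_gt0 (X Y : R) : 0 < X -> 0 < X ^+ 2 + Y ^+ 2.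
Proof. by move=> X0; rewrite ltr_wpDr ?sqr_ge0 ?exprn_gt0. Qed.

Section Derivatives.
Variables (X Y : R -> R) (s X' Y' : R).
Hypotheses (dX : is_derive s 1 X X') (dY : is_derive s 1 Y Y') (X0 : 0 < X s).
Let r2 := X s ^+ 2 + Y s ^+ 2.

Lemma is_derive_log_modulus : is_derive s 1 (fun t => - (lam / 2) * ln (X t ^+ 2 + Y t ^+ 2))
  (- lam * (X s * X' + Y s * Y') / r2).
Proof.
have r0 : 0 < r2 by exact: sqr_sum_gt0.
have dr : is_derive s 1 (fun t => X t ^+ 2 + Y t ^+ 2) (2 * (X s * X' + Y s * Y')).
  have -> : (fun t => X t ^+ 2 + Y t ^+ 2) = (fun t => X t * X t + Y t * Y t).
    by apply/funext => t; rewrite !expr2.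
  apply: is_derive_eq (is_deriveD1 (is_deriveM1 dX dX) (is_deriveM1 dY dY)) _; ring.
have dl : is_derive r2 1 (@ln R) r2^-1 by exact: is_derive1_ln.
apply: is_derive_eq (is_deriveZ1 (- (lam / 2)) (is_derive_comp1 (f := fun t => X t ^+ 2 + Y t ^+ 2) dl dr)) _.
by field; exact: lt0r_neq0.
Qed.

Lemma is_derive_argument : is_derive s 1 (fun t => lam * atan (Y t / X t))
  (lam * (Y' * X s - Y s * X') / r2).
Proof.
have r0 : 0 < r2 by exact: sqr_sum_gt0.
have dq : is_derive s 1 (fun t => Y t / X t) ((Y' * X s - Y s * X') / X s ^+ 2).
  apply: is_derive_eq (is_deriveM1 dY (is_deriveV1 (lt0r_neq0 X0) dX)) _.
  by field; exact: lt0r_neq0.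
apply: is_derive_eq (is_deriveZ1 lam (is_derive_comp1 (is_derive1_atan _) dq)) _.
have := lt0r_neq0 r0; rewrite /r2 => n0.
have n0' : Y s ^+ 2 + X s ^+ 2 != 0 by rewrite addrC.
by field; rewrite ?n0 ?n0' (lt0r_neq0 X0).
Qed.

(** The real part of - lam (X + i Y)^(- lam - 1) (X' + i Y'); [is_derive_powV] is minus the
    imaginary part. *)
Lemma is_derive_powU : is_derive s 1 (fun t => powU (X t) (Y t))
  (- lam * ((X s * powU (X s) (Y s) - Y s * powV (X s) (Y s)) * X' +
            (Y s * powU (X s) (Y s) + X s * powV (X s) (Y s)) * Y') / r2).
Proof.
have r0 : 0 < r2 by exact: sqr_sum_gt0.
have d1 := is_derive_comp1 (is_derive_expR _) is_derive_log_modulus.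
have d2 := is_derive_comp1 (is_derive_cos _) is_derive_argument.
apply: is_derive_eq (is_deriveM1 d1 d2) _.
rewrite /powU /powV; field; exact: lt0r_neq0.
Qed.

Lemma is_derive_powV : is_derive s 1 (fun t => powV (X t) (Y t))
  (lam * ((X s * powU (X s) (Y s) - Y s * powV (X s) (Y s)) * Y' -
          (Y s * powU (X s) (Y s) + X s * powV (X s) (Y s)) * X') / r2).
Proof.
have r0 : 0 < r2 by exact: sqr_sum_gt0.
have d1 := is_derive_comp1 (is_derive_expR _) is_derive_log_modulus.
have d2 := is_derive_comp1 (is_derive_sin _) is_derive_argument.
apply: is_derive_eq (is_deriveM1 d1 d2) _.
rewrite /powU /powV; field; exact: lt0r_neq0.
Qed.

End Derivatives.

Lemma analytic_at_pow n (X Y : 'rV[R]_n -> R) x : 0 < X x -> analytic_at X x -> analytic_at Y x ->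
  analytic_at (fun y => powU (X y) (Y y)) x /\ analytic_at (fun y => powV (X y) (Y y)) x.
Proof.
move=> X0 aX aY.
have r0 := sqr_sum_gt0 (Y x) X0.
have ar : analytic_at (fun y => X y ^+ 2 + Y y ^+ 2) x.
  apply: analytic_atD; apply: (eq_analytic_at (fun y => esym (expr2 _))); exact: analytic_atM.
have a1 : analytic_at (fun y => expR (- (lam / 2) * ln (X y ^+ 2 + Y y ^+ 2))) x.
  apply: (analytic_at_comp1 (phi := expR)); first exact: analytic1_expR.
  apply: analytic_atM; first exact: analytic_at_cst.
  by apply: (analytic_at_comp1 (phi := @ln R)) => //; exact: analytic1_ln.
have a2 : analytic_at (fun y => lam * atan (Y y / X y)) x.
  apply: analytic_atM; first exact: analytic_at_cst.
  apply: (analytic_at_comp1 (phi := atan)); first exact: analytic1_atan.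
  by apply: analytic_atM => //; apply: analytic_atV => //; exact: lt0r_neq0.
split; apply: analytic_atM => //.
- by apply: (analytic_at_comp1 (phi := cos)) => //; exact: analytic1_cos.
- by apply: (analytic_at_comp1 (phi := sin)) => //; exact: analytic1_sin.
Qed.

Lemma powU_continuous (X Y : R -> R) : continuous X -> continuous Y -> (forall t, 0 < X t) ->
  continuous (fun t => powU (X t) (Y t)).
Proof.
move=> cX cY X0 t; rewrite /powU.
have r0 := sqr_sum_gt0 (Y t) (X0 t).
have c2 : (X x ^+ 2 + Y x ^+ 2) @[x --> t] --> X t ^+ 2 + Y t ^+ 2.
  by apply: cvgD; [exact: (cvgM (cX t) (cX t))|exact: (cvgM (cY t) (cY t))].
have c3 : ln (X x ^+ 2 + Y x ^+ 2) @[x --> t] --> ln (X t ^+ 2 + Y t ^+ 2).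
  by apply: continuous_cvg c2; exact: continuous_ln.
have c4 : (Y x / X x) @[x --> t] --> Y t / X t.
  by apply: cvgM; [exact: cY|apply: cvgV; [exact: lt0r_neq0|exact: cX]].
have c5 : atan (Y x / X x) @[x --> t] --> atan (Y t / X t).
  by apply: continuous_cvg c4; exact: continuous_atan.
have c6 : expR (- (lam / 2) * ln (X x ^+ 2 + Y x ^+ 2)) @[x --> t] -->
    expR (- (lam / 2) * ln (X t ^+ 2 + Y t ^+ 2)).
  apply: continuous_cvg; first exact: continuous_expR.
  by apply: cvgM c3; exact: cvg_cst.
have c7 : cos (lam * atan (Y x / X x)) @[x --> t] --> cos (lam * atan (Y t / X t)).
  apply: continuous_cvg; first exact: continuous_cos.
  by apply: cvgM c5; exact: cvg_cst.
exact: cvgM c6 c7.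
Qed.

End Power.

(** * The profile of the coordinate *)

Section Elementary.
Context {R : realType}.
Implicit Types x t : R.

Lemma sin_le x : 0 <= x -> sin x <= x.
Proof.
move=> x0; suff : 0 - sin 0 <= x - sin x by rewrite sin0 subr0 subr_ge0.
apply: (@is_derive_ge0_le R (fun s => s - sin s) (fun s => 1 - cos s) 0 x x0) => s _.
by rewrite subr_ge0 cos_le1.
Qed.

Lemma cos_ge_quadratic x : 0 <= x -> 1 - x ^+ 2 / 2 <= cos x.
Proof.
move=> x0; suff : cos 0 + 0 * 0 / 2 <= cos x + x * x / 2.
  by rewrite cos0 mul0r mul0r addr0 lerBlDr expr2.
apply: (@is_derive_ge0_le R (fun s => cos s + s * s / 2) (fun s => - sin s + s) 0 x x0) => s /andP[s0 _].
  apply: is_deriveD1.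
  apply: is_derive_eq (is_derive_mulr _ (is_deriveM1 (is_derive_id _ _) (is_derive_id _ _))) _.
  by field.
by rewrite addrC subr_ge0 sin_le.
Qed.

Lemma sin_ge x : 0 <= x <= pi -> x * cos x <= sin x.
Proof.
move=> /andP[x0 xpi]; suff : sin 0 - 0 * cos 0 <= sin x - x * cos x by rewrite sin0 mul0r subr0 subr_ge0.
apply: (@is_derive_ge0_le R (fun s => sin s - s * cos s) (fun s => s * sin s) 0 x x0) => s /andP[s0 sx].
  apply: is_derive_eq (is_deriveB1 (is_derive_sin _) (is_deriveM1 (is_derive_id _ _) (is_derive_cos _))) _.
  ring.
by rewrite mulr_ge0 // sin_ge0_pi // s0 (le_trans sx).
Qed.

Lemma atan_le x : 0 <= x -> atan x <= x.
Proof.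
move=> x0; suff : 0 - atan 0 <= x - atan x by rewrite atan0 subr0 subr_ge0.
apply: (@is_derive_ge0_le R (fun s => s - atan s) (fun s => 1 - (1 + s ^+ 2)^-1) 0 x x0) => s _.
by rewrite subr_ge0 invf_le1 ?lerDl ?sqr_ge0 // ltr_wpDr ?sqr_ge0.
Qed.

Lemma atan_ge0 x : 0 <= x -> 0 <= atan x.
Proof.
move=> x0; rewrite -(@atan0 R).
apply: (@is_derive_ge0_le R (@atan R) (fun s => (1 + s ^+ 2)^-1) 0 x x0) => s _.
by rewrite invr_ge0 addr_ge0 ?sqr_ge0.
Qed.

End Elementary.

(** * Size and argument of the complex power *)

Section PowerBounds.
Context {R : realType}.
Variable lam : R.
Hypothesis lamP : 1 < lam < 3 / 2.

Lemma lam_gt0 : 0 < lam. Proof. by move: lamP; lra. Qed.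

(** The argument is at most lam atan (7 / 10) <= 21 / 20 in absolute value, where the cosine is at
    least 2 / 5: here lam < 3 / 2 keeps the real part positive. The modulus r^(- lam) lies between 1
    and r^(- 2) because 1 < lam < 2. *)
Lemma powU_bounds (X Y : R) : 0 < X -> 0 <= Y <= 7 / 10 * X ->
  [/\ 0 <= powV lam X Y,
      2 / 5 * Num.min 1 (X ^+ 2 + Y ^+ 2)^-1 <= powU lam X Y,
      powU lam X Y <= Num.max 1 (X ^+ 2 + Y ^+ 2)^-1 &
      (1 - 9 / 8 * (Y / X) ^+ 2) * Num.min 1 (X ^+ 2 + Y ^+ 2)^-1 <= powU lam X Y
      /\ powV lam X Y <= 5 / 2 * lam * (Y / X) * powU lam X Y ].
Proof.
move=> X0 /andP[Y0 YX]; rewrite /powU /powV.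
have r0 := sqr_sum_gt0 Y X0.
set r2 := X ^+ 2 + Y ^+ 2 in r0 *; set m := expR _.
have m0 : 0 < m by exact: expR_gt0.
have [mL mU] : Num.min 1 r2^-1 <= m /\ m <= Num.max 1 r2^-1.
  have e : r2^-1 = expR (- ln r2) by rewrite expRN lnK.
  have [r1|r1] := leP 1 r2.
    have l0 : 0 <= ln r2 by exact: ln_ge0.
    have h1 : r2^-1 <= m by rewrite e ler_expR; move: lamP; nra.
    have h2 : m <= 1 by rewrite -expR0 ler_expR; move: lamP; nra.
    by split; [apply: le_trans h1; rewrite ge_min lexx orbT|apply: le_trans h2 _; rewrite le_max lexx].
  have l0 : ln r2 <= 0 by apply: ln_le0; exact: ltW.
  have h1 : m <= r2^-1 by rewrite e ler_expR; move: lamP; nra.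
  have h2 : 1 <= m by rewrite -expR0 ler_expR; move: lamP; nra.
  by split; [apply: le_trans h2; rewrite ge_min lexx|apply: le_trans h1 _; rewrite le_max lexx orbT].
have min0 : 0 <= Num.min 1 r2^-1 by rewrite le_min ler01 invr_ge0 ltW.
set q := Y / X.
have q0 : 0 <= q by rewrite divr_ge0 // ltW.
have q1 : q <= 7 / 10 by rewrite ler_pdivrMr.
have t0 : 0 <= lam * atan q by rewrite mulr_ge0 ?atan_ge0 // ltW ?lam_gt0.
have tq : lam * atan q <= lam * q by rewrite ler_wpM2l ?atan_le // ltW ?lam_gt0.
have t1 : lam * atan q <= 21 / 20 by move: lamP => /andP[l1 l2]; nra.
have l15 : lam * q <= 3 / 2 * q by move: lamP => /andP[l1 l2]; nra.
have t2 : lam * atan q <= 3 / 2 * q by lra.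
have C0 : 1 - (lam * atan q) ^+ 2 / 2 <= cos (lam * atan q) by exact: cos_ge_quadratic.
have C1 : 2 / 5 <= cos (lam * atan q) by nra.
have C2 : 1 - 9 / 8 * q ^+ 2 <= cos (lam * atan q) by nra.
have C3 := cos_le1 (lam * atan q).
have pi2 : 2 <= pi :> R := pi_ge2 R.
have S0 : 0 <= sin (lam * atan q) by apply: sin_ge0_pi; lra.
have S1 : sin (lam * atan q) <= lam * q by apply: le_trans tq; exact: sin_le.
split.
- by rewrite mulr_ge0 // ltW.
- by rewrite mulrC ler_pM.
- by apply: le_trans mU; rewrite ler_piMr // ltW.
- split.
    have [h|h] := leP 0 (1 - 9 / 8 * q ^+ 2); first by rewrite mulrC ler_pM.
    apply: (@le_trans _ _ 0); first by rewrite mulr_le0_ge0 // ltW.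
    by rewrite mulr_ge0 ?(ltW m0) //; lra.
  rewrite mulrCA ler_wpM2l ?(ltW m0) //.
  have q0' : 0 <= lam * q by lra.
  by apply: le_trans S1 _; nra.
Qed.

End PowerBounds.

(** * Cosine and sine with period 1 *)

Section Turn.
Context {R : realType}.
Implicit Types u v : R.

Definition ct u : R := cos (2 * pi * u).
Definition st u : R := sin (2 * pi * u).

Lemma pi2_gt0 : 0 < 2 * pi :> R. Proof. by rewrite mulr_gt0 // pi_gt0. Qed.

Lemma is_derive_turn u : is_derive u 1 (fun s => 2 * pi * s) (2 * pi : R).
Proof. by apply: is_derive_eq (is_deriveZ1 _ (is_derive_id _ _)) _; rewrite mulr1. Qed.

Lemma is_derive_ct u : is_derive u 1 ct (- (2 * pi) * st u).
Proof.
by apply: is_derive_eq (is_derive_comp1 (is_derive_cos _) (is_derive_turn u)) _; rewrite /st mulrC mulrN mulNr.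
Qed.

Lemma is_derive_st u : is_derive u 1 st (2 * pi * ct u).
Proof.
by apply: is_derive_eq (is_derive_comp1 (is_derive_sin _) (is_derive_turn u)) _; rewrite mulrC.
Qed.

Lemma ct_continuous : continuous ct.
Proof.
by move=> u; apply: differentiable_continuous; apply/derivable1_diffP; case: (is_derive_ct u).
Qed.

Lemma st_continuous : continuous st.
Proof.
by move=> u; apply: differentiable_continuous; apply/derivable1_diffP; case: (is_derive_st u).
Qed.

Lemma ctN u : ct (- u) = ct u. Proof. by rewrite /ct mulrN cosN. Qed.
Lemma stN u : st (- u) = - st u. Proof. by rewrite /st mulrN sinN. Qed.
Lemma ct0 : ct 0 = 1. Proof. by rewrite /ct mulr0 cos0. Qed.
Lemma st0 : st 0 = 0. Proof. by rewrite /st mulr0 sin0. Qed.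

Lemma turnD1 u : 2 * pi * (u + 1) = 2 * pi * u + pi *+ 2.
Proof. by rewrite mulrDr mulr1 mulr_natl. Qed.

Lemma ctD1 u : ct (u + 1) = ct u. Proof. by rewrite /ct turnD1 cosD2pi. Qed.
Lemma stD1 u : st (u + 1) = st u. Proof. by rewrite /st turnD1 sinD2pi. Qed.

Lemma turn_half : 2 * pi * (1 / 2) = pi :> R. Proof. by field. Qed.

Lemma ct_half : ct (1 / 2) = -1. Proof. by rewrite /ct turn_half cospi. Qed.
Lemma st_half : st (1 / 2) = 0. Proof. by rewrite /st turn_half sinpi. Qed.

Lemma turn_itv u : 0 <= u <= 1 / 2 -> 0 <= 2 * pi * u <= pi.
Proof.
move=> /andP[u0 u1]; rewrite mulr_ge0 ?(ltW pi2_gt0) //=.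
by rewrite -[leRHS]turn_half ler_pM2l ?pi2_gt0.
Qed.

Lemma ct_lt u v : 0 <= u -> u < v -> v <= 1 / 2 -> ct v < ct u.
Proof.
move=> u0 uv v1; rewrite /ct ltr_cos ?in_itv /= ?ltr_pM2l ?pi2_gt0 //; apply: turn_itv; lra.
Qed.

Lemma ct_le u v : 0 <= u -> u <= v -> v <= 1 / 2 -> ct v <= ct u.
Proof. by move=> u0; rewrite le_eqVlt => /predU1P[->//|uv] v1; apply/ltW/ct_lt. Qed.

Lemma ct_normr u : ct `|u| = ct u.
Proof. by have [u0|/ltW u0] := ler0P u; rewrite // ctN. Qed.

(** Keeps the segment from (0, k) to (u, k) in the domain 1 / 2 < k + ct u as soon as its end lies
    there. *)
Lemma ct_scale u t : `|u| <= 1 / 2 -> 0 <= t <= 1 -> ct u <= ct (t * u).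
Proof.
move=> u1 /andP[t0 t1]; rewrite -(ct_normr u) -(ct_normr (t * u)) normrM (ger0_norm t0).
by apply: ct_le => //; [rewrite mulr_ge0|rewrite ler_piMl].
Qed.

Lemma st_ge0 u : 0 <= u <= 1 / 2 -> 0 <= st u.
Proof. by move=> /turn_itv h; exact: sin_ge0_pi. Qed.

Lemma st_gt0 u : 0 < u < 1 / 2 -> 0 < st u.
Proof.
move=> /andP[u0 u1]; apply: sin_gt0_pi; rewrite mulr_gt0 ?pi2_gt0 //=.
by rewrite -[ltRHS]turn_half ltr_pM2l ?pi2_gt0.
Qed.

Lemma ct2Dst2 u : ct u ^+ 2 + st u ^+ 2 = 1. Proof. exact: cos2Dsin2. Qed.

Lemma ct_le1 u : ct u <= 1. Proof. exact: cos_le1. Qed.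
Lemma ct_geN1 u : -1 <= ct u. Proof. exact: cos_geN1. Qed.

Lemma analytic_at_turn n (g : 'rV[R]_n -> R) x : analytic_at g x ->
  analytic_at (fun y => ct (g y)) x /\ analytic_at (fun y => st (g y)) x.
Proof.
move=> ag; have a1 : analytic_at (fun y => 2 * pi * g y) x by apply: analytic_atM => //; exact: analytic_at_cst.
split; first by apply: (analytic_at_comp1 (phi := cos)) => //; exact: analytic1_cos.
by apply: (analytic_at_comp1 (phi := sin)) => //; exact: analytic1_sin.
Qed.

End Turn.

(** * The profile as an integral of the complex power *)

Section Profile.
Context {R : realType}.
Variable lam : R.
Implicit Types u k : R.

Definition profU u k := powU lam (k + ct u) (st u).
Definition profV u k := powV lam (k + ct u) (st u).

(* Truncating [k + ct s] from below makes the integrand continuous on the whole line. *)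
Let integrand k (s : R) := powU lam (Num.max (k + ct s) (1 / 2)) (st s).

Lemma integrand_continuous k : continuous (integrand k).
Proof.
apply: powU_continuous => [s||s]; last by rewrite lt_max; apply/orP; right; lra.
  apply: (@continuous_max R R (fun s : R => k + ct s) (fun=> 1 / 2)); last exact: cst_continuous.
  by apply: cvgD; [exact: cvg_cst|exact: ct_continuous].
exact: st_continuous.
Qed.

(** The primitive is taken on |u| < 2, which leaves room for u + 1 with |u| < 1 in the shift by a
    period. *)
Definition prof u k : R := sval (cid (continuous_primitive (@integrand_continuous k) (ltr0n R 2))) u.

Lemma prof0 k : prof 0 k = 0.
Proof. by rewrite /prof; case: cid => F []. Qed.

Let is_derive_integrand u k : `|u| < 2 -> is_derive u 1 (prof^~ k) (integrand k u).
Proof. by rewrite /prof; case: (cid _) => F [_ h] u2 /=; exact: h. Qed.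

Lemma is_derive_prof u k : `|u| < 2 -> 1 / 2 < k + ct u -> is_derive u 1 (prof^~ k) (profU u k).
Proof.
move=> u2 /ltW /max_idPl X1.
by have := is_derive_integrand k u2; rewrite /integrand X1.
Qed.

Lemma powU_oppr (X Y : R) : powU lam X (- Y) = powU lam X Y.
Proof. by rewrite /powU sqrrN (mulNr Y) atanN (mulrN lam) cosN. Qed.

Lemma profUN u k : profU (- u) k = profU u k.
Proof. by rewrite /profU ctN stN powU_oppr. Qed.

Lemma profV0 k : profV 0 k = 0.
Proof. by rewrite /profV st0 /powV mul0r atan0 (mulr0 lam) sin0 mulr0. Qed.

Lemma profN u k : `|u| < 2 -> prof (- u) k = - prof u k.
Proof.
suff P v : 0 <= v < 2 -> prof (- v) k = - prof v k.
  move=> u2; have [u0|u0] := leP 0 u; first by apply: P; rewrite u0 -[ltLHS](ger0_norm u0).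
  have := P (- u); rewrite opprK => ->; first by rewrite opprK.
  by rewrite oppr_ge0 ltW //= -[ltLHS](ltr0_norm u0).
move=> /andP[v0 v2]; apply/eqP; rewrite -addr_eq0 -[0](addr0 0) -{1}(prof0 k) -{1}oppr0 -{2}(prof0 k).
apply/eqP/esym; apply: (@is_derive_eq0_eq R (fun s => prof (- s) k + prof s k)) => // s /andP[s0 sv].
have s2 : `|s| < 2 by rewrite ger0_norm // (le_lt_trans sv).
have d1 := is_derive_integrand k s2.
have d2 : is_derive (- s) 1 (prof^~ k) (integrand k (- s)) by apply: is_derive_integrand; rewrite normrN.
have d3 : is_derive s 1 (fun t : R => - t) (- 1) by exact: is_deriveN.
apply: is_derive_eq (is_deriveD1 (is_derive_comp1 d2 d3) d1) _.
by rewrite /integrand ctN stN powU_oppr mulrN1 addNr.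
Qed.

(** The integrand is even and has period 1, so its integral over any period is twice the integral
    over [0, 1 / 2]. *)
Lemma profB1 u k : -1 < u < 1 -> prof (u + 1) k - prof u k = 2 * prof (1 / 2) k.
Proof.
move=> /andP[u1 u2]; pose f s := prof (s + 1) k - prof s k.
have df (s : R) : -1 < s < 1 -> is_derive s 1 f 0.
  move=> /andP[s1 s2].
  have d1 : is_derive s 1 (prof^~ k) (integrand k s).
    by apply: is_derive_integrand; rewrite ltr_norml; apply/andP; split; lra.
  have d2 : is_derive (s + 1) 1 (prof^~ k) (integrand k (s + 1)).
    by apply: is_derive_integrand; rewrite ltr_norml; apply/andP; split; lra.
  have d3 : is_derive s 1 (fun t : R => t + 1) 1.
    by apply: is_derive_eq (is_deriveD1 (is_derive_id _ _) (is_derive_cst _ _ _)) _; rewrite addr0.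
  apply: is_derive_eq (is_deriveB1 (is_derive_comp1 (f := fun t => t + 1) (g := prof^~ k) d2 d3) d1) _.
  by rewrite /integrand ctD1 stD1 mulr1 subrr.
have -> : prof (u + 1) k - prof u k = f (- (1 / 2)).
  have [le1|le1] := leP u (- (1 / 2)).
    by apply: (is_derive_eq0_eq le1) => s /andP[? ?]; apply: df; lra.
  by apply/esym; apply: (is_derive_eq0_eq (ltW le1)) => s /andP[? ?]; apply: df; lra.
have e : - (1 / 2) + 1 = 1 / 2 :> R by field.
rewrite /f e profN; first by ring.
by rewrite ger0_norm; lra.
Qed.

Lemma analytic_at_profUV n (g h : 'rV[R]_n -> R) x : analytic_at g x -> analytic_at h x ->
  0 < h x + ct (g x) ->
  analytic_at (fun y => profU (g y) (h y)) x /\ analytic_at (fun y => profV (g y) (h y)) x.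
Proof.
move=> ag ah X0; have [ac as_] := analytic_at_turn ag.
by apply: analytic_at_pow => //; apply: analytic_atD.
Qed.

Definition prof_pt (y : 'rV[R]_2) := prof (y 0 0) (y 0 1).

Lemma near_prof_dom u k : `|u| <= 1 / 2 -> 1 / 2 < k + ct u ->
  \forall y \near pt u k, `|(y : 'rV[R]_2) 0 0| < 2 /\ 1 / 2 < y 0 1 + ct (y 0 0).
Proof.
move=> u1 X1.
have c0 : {for pt u k, continuous (fun y : 'rV[R]_2 => y 0 0)}.
  by apply: analytic_at_continuous; exact: analytic_at_coord.
have c1 : {for pt u k, continuous (fun y : 'rV[R]_2 => y 0 1 + ct (y 0 0))}.
  apply: analytic_at_continuous; apply: analytic_atD; first exact: analytic_at_coord.
  by have [] := analytic_at_turn (analytic_at_coord 0 (pt u k)).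
near=> y; split.
  near: y; apply: (near_continuous (P := fun z => `|z| < 2) c0).
  rewrite pt0; apply: (near_continuous (f := fun z : R => `|z|) (P := fun z => z < 2)).
    exact: norm_continuous.
  by apply: lt_nbhsl; apply: le_lt_trans u1 _; lra.
near: y; apply: (near_continuous (f := fun y : 'rV[R]_2 => y 0 1 + ct (y 0 0)) (P := fun z => 1 / 2 < z) c1).
by rewrite pt0 pt1; exact: lt_nbhsr.
Unshelve. all: by end_near. Qed.

(** The definition as an integral for each k separately says nothing about the dependence on k; the
    patching argument supplies it from the analytic integrand. *)
Lemma analytic_prof u k : `|u| <= 1 / 2 -> 1 / 2 < k + ct u -> analytic_at prof_pt (pt u k).
Proof.
move=> u1 X1.
have D t : 0 <= t <= 1 -> `|t * u| <= 1 / 2 /\ 1 / 2 < k + ct (t * u).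
  move=> t01; split.
    by case/andP: (t01) => t0 t1; rewrite normrM (ger0_norm t0); apply: le_trans u1; rewrite ler_piMl.
  by apply: lt_le_trans X1 _; rewrite lerD2l ct_scale.
apply: (@analytic_at_patch R (fun y => profU (y 0 0) (y 0 1)) prof) => [t t01|t t01|]; last exact: prof0.
  have [_ X] := D t t01.
  have := @analytic_at_profUV 2 (fun y => y 0 0) (fun y => y 0 1) (pt (t * u) k).
  by rewrite pt0 pt1 => -[| | |//]; [exact: analytic_at_coord|exact: analytic_at_coord|lra].
have [t1 X] := D t t01.
by apply: filterS (near_prof_dom t1 X) => y [y1 y2]; exact: is_derive_prof.
Qed.

Definition profk u k : R := 'd prof_pt (pt u k) (delta_mx 0 1).

Lemma is_derive_profk u k : `|u| <= 1 / 2 -> 1 / 2 < k + ct u -> is_derive k 1 (prof u) (profk u k).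
Proof.
move=> u1 X1; have [dp _] := analytic_at_diff (analytic_prof u1 X1).
have := is_derive_pt1 (diff_is_derive (delta_mx 0 1) dp).
by rewrite /prof_pt; under eq_fun do rewrite pt0 pt1.
Qed.

Lemma is_derive_profU u k s' k' (g h : R -> R) t : g t = u -> h t = k -> 0 < k + ct u ->
  is_derive t 1 g s' -> is_derive t 1 h k' ->
  is_derive t 1 (fun s => profU (g s) (h s))
   (- lam * (((k + ct u) * profU u k - st u * profV u k) * (k' - 2 * pi * st u * s') +
            (st u * profU u k + (k + ct u) * profV u k) * (2 * pi * ct u * s')) / ((k + ct u) ^+ 2 + st u ^+ 2)).
Proof.
move=> gu hk X0 dg dh.
have dc : is_derive t 1 (fun s => h s + ct (g s)) (k' + - (2 * pi) * st u * s').
  by apply: is_deriveD1 => //; rewrite -gu; apply: is_derive_comp1 => //; exact: is_derive_ct.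
have ds : is_derive t 1 (fun s => st (g s)) (2 * pi * ct u * s').
  by rewrite -gu; apply: is_derive_comp1 => //; exact: is_derive_st.
have := @is_derive_powU R lam _ _ t _ _ dc ds; rewrite gu hk => /(_ X0) d.
by apply: is_derive_eq d _; rewrite /profU /profV !mulNr.
Qed.

Lemma is_derive_profV u k s' k' (g h : R -> R) t : g t = u -> h t = k -> 0 < k + ct u ->
  is_derive t 1 g s' -> is_derive t 1 h k' ->
  is_derive t 1 (fun s => profV (g s) (h s))
   (lam * (((k + ct u) * profU u k - st u * profV u k) * (2 * pi * ct u * s') -
            (st u * profU u k + (k + ct u) * profV u k) * (k' - 2 * pi * st u * s')) / ((k + ct u) ^+ 2 + st u ^+ 2)).
Proof.
move=> gu hk X0 dg dh.
have dc : is_derive t 1 (fun s => h s + ct (g s)) (k' + - (2 * pi) * st u * s').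
  by apply: is_deriveD1 => //; rewrite -gu; apply: is_derive_comp1 => //; exact: is_derive_ct.
have ds : is_derive t 1 (fun s => st (g s)) (2 * pi * ct u * s').
  by rewrite -gu; apply: is_derive_comp1 => //; exact: is_derive_st.
have := @is_derive_powV R lam _ _ t _ _ dc ds; rewrite gu hk => /(_ X0) d.
by apply: is_derive_eq d _; rewrite /profU /profV !mulNr.
Qed.

Lemma prof_diff_u u k : `|u| < 2 -> 1 / 2 < k + ct u -> differentiable prof_pt (pt u k) ->
  'd prof_pt (pt u k) (delta_mx 0 0) = profU u k.
Proof.
move=> u2 X1 dp; have d := is_derive_pt0 (diff_is_derive (delta_mx 0 0) dp).
have d' : is_derive u 1 (fun s => prof_pt (pt s k)) (profU u k).
  by rewrite /prof_pt; under eq_fun do rewrite pt0 pt1; exact: is_derive_prof.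
by case: d => _ <-; case: d' => _ <-.
Qed.

(* [k U_k + lam U = V_u / (2 pi)], integrated in [u]. *)
Lemma prof_identity u k : `|u| <= 1 / 2 -> 1 / 2 < k + ct u ->
  k * profk u k = - lam * prof u k + profV u k / (2 * pi).
Proof.
move=> u1 X1.
(* For W = (k + exp (2 pi i s))^(- lam) one has k W_k + lam W = i W_s / (2 pi). The real part of
   this makes [G] constant. *)
pose G s := k * profk s k + lam * prof s k - profV s k / (2 * pi).
have pi0 : (pi : R) != 0 by rewrite lt0r_neq0 ?pi_gt0.
have dG t : 0 <= t <= 1 -> is_derive (t * u) 1 G 0.
  move=> t01.
  have t1 : `|t * u| <= 1 / 2.
    by case/andP: (t01) => t0 t1; rewrite normrM (ger0_norm t0); apply: le_trans u1; rewrite ler_piMl.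
  have X : 1 / 2 < k + ct (t * u) by apply: lt_le_trans X1 _; rewrite lerD2l ct_scale.
  set v := t * u in t1 X *.
  have ap := analytic_prof t1 X.
  have [_ adp] := analytic_at_diff ap.
  have [d1 _] := analytic_at_diff (adp (delta_mx 0 1)).
  (* The u-derivative of [profk] is the k-derivative of [profU], by symmetry of the mixed
     derivatives. *)
  have dk : is_derive v 1 (profk^~ k) (- lam * ((k + ct v) * profU v k - st v * profV v k) /
      ((k + ct v) ^+ 2 + st v ^+ 2)).
    apply: is_derive_eq (is_derive_pt0 (diff_is_derive (delta_mx 0 0) d1)) _.
    rewrite (analytic_mixed_derivative _ _ ap).
    have [d0 _] := analytic_at_diff (adp (delta_mx 0 0)).
    have e : \forall y \near pt v k, 'd prof_pt y (delta_mx 0 0) = profU (y 0 0) (y 0 1).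
      move: (analytic_at_near ap) (near_prof_dom t1 X); apply: filterS2 => y ay [y1 y2].
      have := @prof_diff_u (y 0 0) (y 0 1) y1 y2; rewrite pt_eta; apply.
      by case: (analytic_at_diff ay).
    have [_ <-] := near_eq_is_derive e (diff_is_derive (delta_mx 0 1) d0).
    have [a _] : analytic_at (fun y => profU (y 0 0) (y 0 1)) (pt v k) /\
        analytic_at (fun y => profV (y 0 0) (y 0 1)) (pt v k).
      apply: (@analytic_at_profUV 2 (fun y => y 0 0) (fun y => y 0 1)); rewrite ?pt0 ?pt1.
      - exact: analytic_at_coord.
      - exact: analytic_at_coord.
      - lra.
    have [da _] := analytic_at_diff a.
    have [_ ->] := diff_is_derive (delta_mx 0 1) da.
    have := is_derive_pt1 (diff_is_derive (delta_mx 0 1) da).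
    under eq_fun do rewrite pt0 pt1.
    have dU := @is_derive_profU v k 0 1 (fun=> v) id k erefl erefl _ (is_derive_cst _ _ _) (is_derive_id _ _).
    have X0 : 0 < k + ct v by lra.
    move=> [_ <-]; have [_ ->] := dU X0.
    by rewrite !mulr0 subr0 addr0 mulr1.
  have t2 : `|v| < 2 by apply: le_lt_trans t1 _; lra.
  have X0 : 0 < k + ct v by lra.
  have dp := is_derive_prof t2 X.
  have dV := @is_derive_profV v k 1 0 id (fun=> k) v erefl erefl X0 (is_derive_id _ _) (is_derive_cst _ _ _).
  apply: is_derive_eq (is_deriveB1 (is_deriveD1 (is_deriveZ1 k dk) (is_deriveZ1 lam dp))
    (is_derive_mulr _ dV)) _.
  have rn := lt0r_neq0 (sqr_sum_gt0 (st v) X0).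
  by move: (pi : R) pi0 => q q0; field; rewrite ?rn ?q0.
have : G 0 = G u.
  have := @is_derive_eq0_eq R (fun t => G (t * u)) 0 1 ler01.
  rewrite mul0r mul1r; apply=> t /dG d.
  apply: is_derive_eq (is_derive_comp1 (f := fun t => t * u) d (is_derive_mulr u (is_derive_id t 1))) _.
  by rewrite mul0r.
have X01 : 1 / 2 < k + ct 0 by rewrite ct0; have := ct_le1 u; lra.
have u01 : `|0 : R| <= 1 / 2 by rewrite normr0; lra.
have p0k : profk 0 k = 0.
  have [_ <-] := is_derive_profk u01 X01.
  rewrite (_ : prof 0 = cst 0); first exact: derive_cst.
  by apply/funext => x; rewrite prof0.
rewrite /G p0k prof0 profV0 !mulr0 mul0r subr0 addr0 mulNr.
by move: (k * profk u k) (lam * _) (_ / (2 * pi)) => x y z h; lra.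
Qed.

End Profile.

(** * Monotonicity of the coordinate in one variable *)

Section ProfileBounds.
Context {R : realType}.
Variables (lam b : R).
Hypothesis lamP : 1 < lam < 3 / 2.
Hypothesis bP : 0 < b <= 1 / 768.
Implicit Types u v k : R.
Local Notation prof := (prof lam).
Local Notation profU := (profU lam).
Local Notation profV := (profV lam).
Local Notation profk := (profk lam).

(** The pairs (x_i, [kf x]) satisfy this: the terms of the sum [kf] that belong to the other
    coordinates are nonnegative. *)
Definition dom u k : Prop := `|u| <= 1 / 2 /\ 2 * (1 - ct u) - 2 * b <= k.

Lemma dom_X u k : dom u k -> 2 - ct u - 2 * b <= k + ct u /\ 1 / 2 < k + ct u.
Proof. by move=> [_]; have := ct_le1 u; move: bP (ct u) => ? c ? ?; split; lra. Qed.

Lemma dom_le u v k k' : dom u k -> `|v| <= `|u| -> k <= k' -> dom v k'.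
Proof.
move=> [u1 uk] vu kk; split; first exact: le_trans vu u1.
have := ct_le (normr_ge0 v) vu u1; rewrite !ct_normr.
by move: uk; move: (ct u) (ct v) => c d; lra.
Qed.

Lemma domN u k : dom u k -> dom (- u) k.
Proof. by move=> d; apply: dom_le d _ _ => //; rewrite normrN. Qed.

Lemma dom_ge0 u v k : dom u k -> 0 <= v <= u -> dom v k.
Proof.
move=> d /andP[v0 vu]; apply: dom_le d _ (lexx k).
by rewrite !ger0_norm // (le_trans v0).
Qed.

Lemma dom_itv u k : dom u k -> 0 <= u -> 0 <= u <= 1 / 2.
Proof. by move=> [u1 _] u0; rewrite u0; move: u1; rewrite ger0_norm. Qed.

Lemma dom_small u k : dom u k -> `|u| < 2.
Proof. by move=> [u1 _]; apply: le_lt_trans u1 _; lra. Qed.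

(** On this domain k + ct u is at least 2 - ct u - 2 b, and sin / (2 - cos) is at most 1 / sqrt 3 <
    7 / 10; the slack absorbs b. *)
Lemma dom_ratio u k : dom u k -> 0 <= u -> 0 <= st u <= 7 / 10 * (k + ct u).
Proof.
move=> d u0; have [X _] := dom_X d; rewrite st_ge0 ?(dom_itv d) //=.
have := ct2Dst2 u; move: X; move: (ct u) (st u) bP => c s b0 X cs.
have : s + 7 / 10 * c <= 139 / 100.
  rewrite leNgt; apply/negP => h.
  have : (s + 7 / 10 * c) ^+ 2 <= 149 / 100.
    by have := sqr_ge0 (c - 7 / 10 * s); nra.
  by nra.
by lra.
Qed.

Lemma profU_gt0 u k : dom u k -> 0 < profU u k.
Proof.
move=> d; wlog u0 : u d / 0 <= u => [W|].
  have [u0|u0] := leP 0 u; first exact: W.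
  rewrite -profUN; apply: W; first exact: domN.
  by rewrite oppr_ge0 ltW.
have [_ X] := dom_X d; have X0 : 0 < k + ct u by move: X; lra.
have [_ h _ _] := powU_bounds lamP X0 (dom_ratio d u0).
apply: lt_le_trans h; rewrite mulr_gt0 // lt_min ltr01 invr_gt0; exact: sqr_sum_gt0.
Qed.

Lemma profV_ge0 u k : dom u k -> 0 <= u -> 0 <= profV u k.
Proof.
move=> d u0; have [_ X] := dom_X d; have X0 : 0 < k + ct u by move: X; lra.
by have [] := powU_bounds lamP X0 (dom_ratio d u0).
Qed.

Lemma dom_is_derive_prof u k : dom u k -> is_derive u 1 (prof^~ k) (profU u k).
Proof. by move=> d; apply: is_derive_prof; [exact: dom_small d|case: (dom_X d)]. Qed.

Lemma dom_is_derive_profk u k : dom u k -> is_derive k 1 (prof u) (profk u k).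
Proof. by move=> d; apply: is_derive_profk; [case: d|case: (dom_X d)]. Qed.

Lemma prof_ge0 u k : dom u k -> 0 <= u -> 0 <= prof u k.
Proof.
move=> d u0; rewrite -(prof0 lam k).
by apply: (is_derive_ge0_le u0) => v /(dom_ge0 d) dv; [exact: dom_is_derive_prof|exact/ltW/profU_gt0].
Qed.

(* [k <= 0] confines the point to a small ball around the origin. *)
Lemma ball_ct u k : dom u k -> k <= 0 -> 1 - b <= ct u.
Proof. by move=> [_]; move: (ct u) => c; lra. Qed.

(** In the ball k + ct u is within 2 b of 1 and [st u ^+ 2] is at most 2 b, so the power is close to
    1. The third bound gives the sign of the real part of the power - lam - 1, which governs
    [profk]. *)
Lemma ball_U u k : dom u k -> k <= 0 -> 0 <= u ->
  [/\ 9 / 10 <= profU u k, profU u k <= 11 / 10 &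
      0 <= (k + ct u) * profU u k - st u * profV u k].
Proof.
move=> d k0 u0; have [X1 X] := dom_X d; have X0 : 0 < k + ct u by move: X; lra.
have c1 := ball_ct d k0; have cle := ct_le1 u.
have := powU_bounds lamP X0 (dom_ratio d u0).
rewrite -/(profU u k) -/(profV u k) => -[V0 _ Uu [Ul VU]].
have U0 := profU_gt0 d; have := ct2Dst2 u; have := dom_ratio d u0.
have X2 : k + ct u <= ct u by rewrite gerDr.
move: (profU u k) (profV u k) (ct u) (st u) (k + ct u) U0 V0 Uu Ul VU X1 X X0 c1 cle X2 bP lamP.
move=> U V c s X U0 V0 Uu Ul VU X1 X12 X0 c1 cle X2 b0 /andP[l1 l2] /andP[s0 _] cs.
have Xl : 1 - 2 * b <= X by lra.
have s2 : s ^+ 2 <= 2 * b by nra.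
have X2l : 99 / 100 <= X ^+ 2 by nra.
have X2u : X ^+ 2 <= 1 by nra.
move: Uu Ul VU; set ri := (X ^+ 2 + s ^+ 2)^-1; set q := s / X => Uu Ul VU.
have rie : ri * (X ^+ 2 + s ^+ 2) = 1 by rewrite mulVf // lt0r_neq0 // sqr_sum_gt0.
have ri0 : 0 < ri by rewrite invr_gt0 sqr_sum_gt0.
have s20 := sqr_ge0 s.
have riu : ri <= 11 / 10 by nra.
have ril : 99 / 100 <= ri by nra.
have qe : q * X = s by rewrite divfK // lt0r_neq0.
have q0 : 0 <= q by rewrite divr_ge0 // ltW.
have q2 : q ^+ 2 <= 1 / 300.
  have e : q ^+ 2 * X ^+ 2 = s ^+ 2 by rewrite -exprMn qe.
  by have := sqr_ge0 q; nra.
split.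
- apply: le_trans Ul.
  have : 99 / 100 <= Num.min 1 ri by rewrite le_min ril andbT; lra.
  by nra.
- by apply: le_trans Uu _; rewrite ge_max riu andbT; lra.
- have : s * V <= s * (5 / 2 * lam * q * U) by exact: ler_wpM2l.
  have e : s * (5 / 2 * lam * q * U) = (5 / 2 * lam * q ^+ 2) * (X * U) by rewrite -qe; ring.
  have : 0 < X * U by exact: mulr_gt0.
  rewrite e; have : 5 / 2 * lam * q ^+ 2 <= 1 by have := sqr_ge0 q; nra.
  by move: (5 / 2 * lam * q ^+ 2) (X * U) (s * V) => x y z ? ? ?; nra.
Qed.

Lemma ball_prof u k : dom u k -> k <= 0 -> 0 <= u -> 9 / 10 * u <= prof u k <= 11 / 10 * u.
Proof.
move=> d k0 u0; apply/andP; split.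
  suff : prof 0 k - 9 / 10 * 0 <= prof u k - 9 / 10 * u by rewrite prof0 mulr0 subr0 subr_ge0.
  apply: (@is_derive_ge0_le R (fun v => prof v k - 9 / 10 * v) (fun v => profU v k - 9 / 10) 0 u u0)
    => v vu; have dv := dom_ge0 d vu; have v0 : 0 <= v by case/andP: vu.
    apply: is_deriveB1; first exact: dom_is_derive_prof.
    by apply: is_derive_eq (is_deriveZ1 _ (is_derive_id _ _)) _; rewrite mulr1.
  by rewrite subr_ge0; case: (ball_U dv k0 v0).
suff : 11 / 10 * 0 - prof 0 k <= 11 / 10 * u - prof u k by rewrite prof0 mulr0 subr0 subr_ge0.
apply: (@is_derive_ge0_le R (fun v => 11 / 10 * v - prof v k) (fun v => 11 / 10 - profU v k) 0 u u0)
  => v vu; have dv := dom_ge0 d vu; have v0 : 0 <= v by case/andP: vu.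
  apply: is_deriveB1; last exact: dom_is_derive_prof.
  by apply: is_derive_eq (is_deriveZ1 _ (is_derive_id _ _)) _; rewrite mulr1.
by rewrite subr_ge0; case: (ball_U dv k0 v0).
Qed.

(** By [prof_identity], k [profk] is the integral in u of - lam k Re (k + exp (2 pi i v))^(- lam -
    1), whose sign in the ball is known from [ball_U]. *)
Lemma ball_profk_le0 u k : dom u k -> k < 0 -> 0 <= u -> profk u k <= 0.
Proof.
move=> d k0 u0; have [_ X] := dom_X d.
suff : 0 <= k * profk u k by rewrite nmulr_rge0.
rewrite prof_identity //; last by case: d.
pose G v := profV v k / (2 * pi) - lam * prof v k.
have G0 : G 0 = 0 by rewrite /G profV0 mul0r prof0 mulr0 subr0.
rewrite mulNr addrC -/(G u) -G0.
have pi0 : (pi : R) != 0 by rewrite lt0r_neq0 ?pi_gt0.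
apply: (@is_derive_ge0_le R G (fun v => k * (- lam * ((k + ct v) * profU v k - st v * profV v k) /
      ((k + ct v) ^+ 2 + st v ^+ 2))) 0 u u0) => v vu; have dv := dom_ge0 d vu;
  have v0 : 0 <= v by case/andP: vu.
  have [_ Xv] := dom_X dv; have X0 : 0 < k + ct v by move: Xv; lra.
  have dV := @is_derive_profV R lam v k 1 0 id (fun=> k) v erefl erefl X0 (is_derive_id _ _) (is_derive_cst _ _ _).
  apply: is_derive_eq (is_deriveB1 (is_derive_mulr _ dV) (is_deriveZ1 lam (dom_is_derive_prof dv))) _.
  have rn := lt0r_neq0 (sqr_sum_gt0 (st v) X0).
  by move: (pi : R) pi0 => q q0; field; rewrite ?rn ?q0.
have [_ _ h] := ball_U dv (ltW k0) v0.
have [_ Xv] := dom_X dv; have X0 : 0 < k + ct v by move: Xv; lra.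
have rn := sqr_sum_gt0 (st v) X0.
rewrite nmulr_rge0 // pmulr_lle0 ?invr_gt0 // mulNr oppr_le0 mulr_ge0 //.
by case/andP: lamP => l1 _; apply: le_trans (ltW l1); exact: ler01.
Qed.

(* Near the spheres [k = 0] and [k = - b], where [fE] vanishes resp. blows up, [fQ] is analytic and gives
   the direction of the coordinate [fH]; the [st] term keeps it nonzero at [k = - b]. *)
Definition fE k : R := `|k| `^ lam / `|k + b|.
Definition fQ u k : R := (k + b) * prof u k + b * st u.
Definition fQu u k : R := (k + b) * profU u k + 2 * pi * b * ct u.
Definition fQk u k : R := prof u k + (k + b) * profk u k.
Definition fH u k : R := fE k * fQ u k.
Definition fHu u k : R := fE k * fQu u k.
Definition fHk u k : R := fE k * ((lam / k - (k + b)^-1) * fQ u k + fQk u k).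

(* Partial applications of these functions are abbreviated by local notations of the same name below,
   so that they are unfolded by rewriting. *)
Lemma fEE k : fE k = `|k| `^ lam / `|k + b|. Proof. by []. Qed.
Lemma fQE u k : fQ u k = (k + b) * prof u k + b * st u. Proof. by []. Qed.
Lemma fQuE u k : fQu u k = (k + b) * profU u k + 2 * pi * b * ct u. Proof. by []. Qed.
Lemma fHE u k : fH u k = fE k * fQ u k. Proof. by []. Qed.
Lemma fHuE u k : fHu u k = fE k * fQu u k. Proof. by []. Qed.
Lemma fHkE u k : fHk u k = fE k * ((lam / k - (k + b)^-1) * fQ u k + fQk u k). Proof. by []. Qed.

Lemma fE_gt0 k : k != 0 -> k + b != 0 -> 0 < fE k.
Proof. by move=> k0 kb; rewrite divr_gt0 ?normr_gt0 // powR_gt0 // normr_gt0. Qed.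

Lemma is_derive_normr k : k != 0 -> is_derive k 1 (fun x : R => `|x|) (Num.sg k).
Proof.
move=> k0; case: (ltgtP k 0) => [kp|kp|kn]; last by rewrite kn eqxx in k0.
  rewrite ltr0_sg //; apply: near_eq_is_derive (is_deriveN (is_derive_id k 1)).
  by near=> x; rewrite ltr0_norm //; near: x; exact: lt_nbhsl.
rewrite gtr0_sg //; apply: near_eq_is_derive (is_derive_id k 1).
by near=> x; rewrite gtr0_norm //; near: x; exact: lt_nbhsr.
Unshelve. all: by end_near. Qed.

Lemma is_derive_fE k : k != 0 -> k + b != 0 -> is_derive k 1 fE (fE k * (lam / k - (k + b)^-1)).
Proof.
move=> k0 kb0.
have d1 : is_derive k 1 (fun x : R => `|x| `^ lam) (lam * `|k| `^ (lam - 1) * Num.sg k).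
  apply: (is_derive_comp1 (f := fun x : R => `|x|) (g := fun x => x `^ lam)).
    by apply: is_derive1_powR; rewrite normr_gt0.
  exact: is_derive_normr.
have d2 : is_derive k 1 (fun x : R => `|x + b|) (Num.sg (k + b) * 1).
  apply: (is_derive_comp1 (f := fun x : R => x + b) (g := fun x : R => `|x|)).
    exact: is_derive_normr.
  by apply: is_derive_eq (is_deriveD1 (is_derive_id _ _) (is_derive_cst _ _ _)) _; rewrite addr0.
have nb0 : `|k + b| != 0 by rewrite normr_eq0.
have d3 := is_deriveV1 (f := fun x : R => `|x + b|) nb0 d2.
apply: is_derive_eq (is_deriveM1 d1 d3) _.
have e1 : `|k| `^ lam = `|k| * `|k| `^ (lam - 1).
  rewrite -{2}(powRr1 (normr_ge0 k)) -powRD; first by congr (_ `^ _); ring.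
  by rewrite normr_eq0 k0 implybT.
have e2 (x : R) : x != 0 -> Num.sg x = x / `|x|.
  case: (ltgtP x 0) => // h _; first by rewrite ltr0_sg // ltr0_norm // invrN mulrN divff // ltr0_neq0.
  by rewrite gtr0_sg // gtr0_norm // divff // lt0r_neq0.
rewrite /fE e1 !e2 //.
have sq x : `|x| ^+ 2 = x ^+ 2 :> R by rewrite real_normK // num_real.
have [s1|s1|s1] := ltgtP k 0; last by rewrite s1 eqxx in k0.
- rewrite (ltr0_norm s1).
  have [s2|s2|s2] := ltgtP (k + b) 0; last by rewrite s2 eqxx in kb0.
    by rewrite (ltr0_norm s2); field; rewrite k0 kb0.
  by rewrite (gtr0_norm s2); field; rewrite k0 kb0.
- rewrite (gtr0_norm s1).
  have [s2|s2|s2] := ltgtP (k + b) 0; last by rewrite s2 eqxx in kb0.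
    by rewrite (ltr0_norm s2); field; rewrite k0 kb0.
  by rewrite (gtr0_norm s2); field; rewrite k0 kb0.
Qed.

Lemma is_derive_fQu u k : dom u k -> is_derive u 1 (fQ^~ k) (fQu u k).
Proof.
move=> d.
apply: is_derive_eq (is_deriveD1 (is_deriveZ1 _ (dom_is_derive_prof d)) (is_deriveZ1 b (is_derive_st u))) _.
by rewrite /fQu; move: (pi : R) => q; ring.
Qed.

Lemma is_derive_fQk u k : dom u k -> is_derive k 1 (fQ u) (fQk u k).
Proof.
move=> d; have d1 : is_derive k 1 (fun x => x + b) 1.
  by apply: is_derive_eq (is_deriveD1 (is_derive_id _ _) (is_derive_cst _ _ _)) _; rewrite addr0.
apply: is_derive_eq (is_deriveD1 (is_deriveM1 d1 (dom_is_derive_profk d)) (is_derive_cst (b * st u) _ _)) _.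
by rewrite /fQk addr0 mul1r.
Qed.

Lemma is_derive_fHu u k : dom u k -> is_derive u 1 (fH^~ k) (fHu u k).
Proof. by move=> d; apply: is_deriveZ1; exact: is_derive_fQu. Qed.

Lemma is_derive_fHk u k : dom u k -> k != 0 -> k + b != 0 -> is_derive k 1 (fH u) (fHk u k).
Proof.
move=> d k0 kb0; apply: is_derive_eq (is_deriveM1 (is_derive_fE k0 kb0) (is_derive_fQk d)) _.
by rewrite /fHk; ring.
Qed.

Lemma fQN u k : dom u k -> fQ (- u) k = - fQ u k.
Proof. by move=> d; rewrite /fQ profN ?(dom_small d) // stN; ring. Qed.

Lemma fHN u k : dom u k -> fH (- u) k = - fH u k.
Proof. by move=> d; rewrite /fH fQN // mulrN. Qed.

Lemma fQ0 k : fQ 0 k = 0. Proof. by rewrite /fQ prof0 st0 !mulr0 addr0. Qed.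
Lemma fH0 k : fH 0 k = 0. Proof. by rewrite /fH fQ0 mulr0. Qed.

Lemma dom_k u k : dom u k -> - (2 * b) <= k.
Proof. by move=> [_]; have := ct_le1 u; move: (ct u) => c; lra. Qed.

(** For k <= 0 the term 2 pi b [ct u] is at least 3 b and beats (k + b) U, which is at least - 11 b
    / 10. Where [ct u] is negative, that term is at least - 8 b, while k U is at least 1 / (5 k);
    the bound k b <= 1 / 64 makes 8 b at most 1 / (8 k). *)
Lemma fQu_gt0 u k : dom u k -> k * b <= 1 / 64 -> 0 < fQu u k.
Proof.
move=> d kb; wlog u0 : u d / 0 <= u => [W|].
  have [u0|u0] := leP 0 u; first exact: W.
  have := W (- u) (domN d); rewrite /fQu ctN profUN; apply.
  by rewrite oppr_ge0 ltW.
have U0 := profU_gt0 d; have pi2 : 2 <= pi :> R := pi_ge2 R; have pi4 : pi <= 4 :> R by have := pihalf_lt2 R; lra.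
have [X1 X] := dom_X d; have X0 : 0 < k + ct u by move: X; lra.
rewrite /fQu; have [k0|k0] := leP k 0.
  have c1 := ball_ct d k0; have [_ U1 _] := ball_U d k0 u0; have k2 := dom_k d.
  move: (ct u) (profU u k) (pi : R) bP c1 U1 U0 pi2 => c U q /andP[b0 b1] c1 U1 U0 pi2.
  have h1 : - (11 / 10 * b) <= (k + b) * U by nra.
  have h2 : 3 * b <= 2 * q * b * c.
    have : 3 / 2 <= q * c by nra.
    by rewrite (_ : 2 * q * b * c = 2 * b * (q * c)); [nra|ring].
  by lra.
have [c0|c0] := leP 0 (ct u).
  have [b0 _] := andP bP; apply: ltr_wpDr; last by apply: mulr_gt0 => //; exact: addr_gt0.
  by rewrite !mulr_ge0 ?(ltW b0) ?pi_ge0.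
have [_ Ul _ _] := powU_bounds lamP X0 (dom_ratio d u0).
have := ct2Dst2 u; have cN := ct_geN1 u; move: Ul; rewrite -/(profU u k).
case: (d) => _ kc.
move: (ct u) (st u) (profU u k) (pi : R) bP c0 kc U0 pi2 pi4 X1 X0 X cN.
move=> c s U q /andP[b0 b1] c0 kc U0 pi2 pi4 X1 X0 X cN Ul cs.
have k1 : 199 / 100 <= k by lra.
have r1 : 1 <= (k + c) ^+ 2 + s ^+ 2 by nra.
have r2 : (k + c) ^+ 2 + s ^+ 2 <= 2 * k ^+ 2 by nra.
have m : Num.min 1 ((k + c) ^+ 2 + s ^+ 2)^-1 = ((k + c) ^+ 2 + s ^+ 2)^-1.
  by apply/min_idPr; rewrite invf_le1 // (lt_le_trans ltr01).
have iv : (2 * k ^+ 2)^-1 <= ((k + c) ^+ 2 + s ^+ 2)^-1.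
  by rewrite lef_pV2 // posrE; [nra|apply: lt_le_trans r1].
have kU : (5 * k)^-1 <= k * U.
  have : (2 / 5) * (2 * k ^+ 2)^-1 <= U by apply: le_trans Ul; rewrite m ler_pM2l // ; lra.
  move=> h; have -> : (5 * k)^-1 = k * (2 / 5 * (2 * k ^+ 2)^-1) by field; lra.
  by rewrite ler_pM2l //; lra.
have kb8 : 8 * b <= (8 * k)^-1.
  by rewrite -[(8 * k)^-1]mul1r ler_pdivlMr; [nra|lra].
have lt58 : (8 * k)^-1 < (5 * k)^-1 by rewrite ltf_pV2 ?posrE; lra.
have h : - (8 * b) <= 2 * q * b * c.
  have : 2 * q * b <= 8 * b by nra.
  have : 0 <= 2 * q * b by nra.
  by move: (2 * q * b) => w; nra.
have bU : 0 < b * U by exact: mulr_gt0.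
rewrite mulrDl; move: (b * U) (k * U) (2 * q * b * c) ((5 * k)^-1) ((8 * k)^-1) bU kU h kb8 lt58 => *.
by lra.
Qed.

Lemma dom_lt u v k : dom v k -> k * b <= 1 / 64 -> 0 <= u -> u < v -> fQ u k < fQ v k.
Proof.
move=> d kb u0 uv.
apply: (@is_derive_gt0_lt R (fQ^~ k) (fQu^~ k)) => // w /andP[w1 w2];
  (have dw : dom w k by apply: dom_ge0 d _; rewrite w2 (le_trans u0)).
  exact: is_derive_fQu.
exact: fQu_gt0.
Qed.

Lemma fQ_gt0 u k : dom u k -> k * b <= 1 / 64 -> 0 < u -> 0 < fQ u k.
Proof. by move=> d kb u0; rewrite -(fQ0 k); exact: dom_lt. Qed.

Lemma fQ_ge0 u k : dom u k -> k * b <= 1 / 64 -> 0 <= u -> 0 <= fQ u k.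
Proof.
move=> d kb; rewrite le_eqVlt => /predU1P[<-|u0]; first by rewrite fQ0.
by apply/ltW/fQ_gt0.
Qed.

(** After substitution of [prof_identity] the terms in [prof] cancel, and V and [st u] remain with
    coefficients that are nonnegative because lam > 1. *)
Lemma fHk_outer u k : dom u k -> 0 < k -> 0 <= u -> 0 <= fHk u k.
Proof.
move=> d k0 u0; have V0 := profV_ge0 d u0; have [_ X] := dom_X d; have [u1 _] := d.
have s0 := st_ge0 (dom_itv d u0); have id := prof_identity lam u1 X.
rewrite /fHk mulr_ge0 //; first by rewrite divr_ge0 ?powR_ge0.
rewrite /fQ /fQk.
have pk : profk u k = (- lam * prof u k + profV u k / (2 * pi)) / k.
  by rewrite -id mulrAC mulfV ?mul1r // lt0r_neq0.
rewrite pk; have W0 : 0 <= profV u k / (2 * pi) by rewrite divr_ge0 // ltW // pi2_gt0.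
move: (profV u k / (2 * pi)) (prof u k) (st u) s0 W0 lamP bP => W p s s0 W0 /andP[l1 _] /andP[b0 _].
have kb0 : 0 < k + b by rewrite addr_gt0.
have -> : (lam / k - (k + b)^-1) * ((k + b) * p + b * s) + (p + (k + b) * ((- lam * p + W) / k)) =
   (k + b) / k * W + b * s * ((lam * (k + b) - k) / (k * (k + b))).
  by field; rewrite !lt0r_neq0.
rewrite addr_ge0 // mulr_ge0 //.
- by rewrite divr_ge0 // ltW.
- by rewrite mulr_ge0 // ltW.
- by rewrite divr_ge0 //; [nra|rewrite mulr_ge0 // ltW].
Qed.

(** On [- 2 b, - b] the number lam (k + b) - k is nonnegative because lam < 2, and (k + b) [profk]
    is a product of two nonpositive factors. *)
Lemma fHk_center u k : dom u k -> k < - b -> 0 <= u -> 0 <= fHk u k.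
Proof.
move=> d kb u0; have b0 : 0 < b by case/andP: bP.
have k0 : k < 0 by apply: lt_le_trans kb _; rewrite oppr_le0 ltW.
have Q0 : 0 <= fQ u k.
  apply: fQ_ge0 => //; apply: (@le_trans _ _ 0); last by lra.
  by rewrite nmulr_rle0 // ltW.
have pk := ball_profk_le0 d k0 u0; have p0 := prof_ge0 d u0; have k2 := dom_k d.
rewrite /fHk mulr_ge0 //; first by rewrite divr_ge0 ?powR_ge0.
rewrite addr_ge0 //; last by rewrite /fQk; nra.
rewrite mulr_ge0 //; case/andP: lamP => l1 l2.
have kb0 : k + b < 0 by rewrite -ltrBrDr sub0r.
have -> : lam / k - (k + b)^-1 = (lam * (k + b) - k) / (k * (k + b)).
  by field; rewrite !ltr0_neq0.
by rewrite divr_ge0 //; nra.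
Qed.

(** The left side is the k-derivative of (k + 2 b) [fH]. The weight k + 2 b is the sum of the [tau]
    over all coordinates, which lets the comparison of two points be summed. The sign comes from lam
    / k < 0 and from [prof u k <= st u], with k + b < b. *)
Lemma fHk_shell u k : dom u k -> - b < k < 0 -> 0 < u -> (k + 2 * b) * fHk u k + fH u k < 0.
Proof.
move=> d /andP[kb k0] u0; have b0 : 0 < b by case/andP: bP.
have Q0 : 0 < fQ u k.
  apply: fQ_gt0 => //; apply: (@le_trans _ _ 0); last by lra.
  by rewrite nmulr_rle0 // ltW.
have E0 : 0 < fE k by apply: fE_gt0; [exact: ltr0_neq0|apply: lt0r_neq0; rewrite -ltrBlDr sub0r].
have pk := ball_profk_le0 d k0 (ltW u0).
have /andP[_ pu] := ball_prof d (ltW k0) (ltW u0).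
have /andP[t0 t1] := turn_itv (dom_itv d (ltW u0)).
have sg : 2 * pi * u * ct u <= st u by apply: sin_ge; rewrite t0.
have c1 := ball_ct d (ltW k0).
have sp : prof u k <= st u.
  have pi2 : 2 <= pi :> R := pi_ge2 R.
  have : 4 * u <= 2 * pi * u by nra.
  move: (2 * pi * u) (ct u) (st u) sg c1 bP => x c s sg c1 /andP[_ b1] h.
  by nra.
have -> : (k + 2 * b) * fHk u k + fH u k = (k + 2 * b) * fE k *
    ((lam / k - (k + b)^-1) * fQ u k + fQk u k + fQ u k / (k + 2 * b)).
  have n2 : k + 2 * b != 0 by apply: lt0r_neq0; lra.
  rewrite /fHk /fH; move: (k + 2 * b) (fE k) (fQ u k) ((lam / k - (k + b)^-1) * fQ u k + fQk u k) n2 => x y z w x0.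
  by field.
rewrite pmulr_rlt0; last by rewrite mulr_gt0 //; lra.
have D0 : 0 < k + b by lra.
have -> : (lam / k - (k + b)^-1) * fQ u k + fQk u k + fQ u k / (k + 2 * b) =
    lam / k * fQ u k + (k + b) * profk u k +
    ((k + b) ^+ 2 * prof u k - b ^+ 2 * st u) / ((k + b) * (k + 2 * b)).
  rewrite /fQ /fQk; field; rewrite (ltr0_neq0 k0) (lt0r_neq0 D0) /= andbT.
  by apply: lt0r_neq0; lra.
have h1 : lam / k * fQ u k < 0.
  by rewrite pmulr_llt0 // pmulr_rlt0 ?invr_lt0 //; case/andP: lamP => l1 _; apply: lt_trans l1.
have h2 : (k + b) * profk u k <= 0 by rewrite pmulr_rle0.
have h3 : ((k + b) ^+ 2 * prof u k - b ^+ 2 * st u) / ((k + b) * (k + 2 * b)) <= 0.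
  rewrite pmulr_lle0; last by rewrite invr_gt0 mulr_gt0 //; lra.
  have s0 := st_ge0 (dom_itv d (ltW u0)).
  have p0 := prof_ge0 d (ltW u0); rewrite subr_le0; apply: ler_pM; rewrite ?sqr_ge0 //.
  by rewrite ler_sqr ?nnegrE; lra.
by lra.
Qed.

(** Equivalently, [fH / tau] does not increase in u: in the ball [tau] is nearly quadratic and [fH]
    nearly linear. *)
Lemma shell_tau u k : dom u k -> - b < k < 0 -> 0 <= u ->
  2 * (1 - ct u) * fHu u k <= 4 * pi * st u * fH u k.
Proof.
move=> d /andP[kb k0] u0; have b0 : 0 < b by case/andP: bP.
have E0 : 0 < fE k by apply: fE_gt0; [exact: ltr0_neq0|apply: lt0r_neq0; rewrite -ltrBlDr sub0r].
rewrite /fHu /fH mulrCA [leRHS]mulrCA ler_pM2l // /fQu /fQ.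
have c1 := ball_ct d (ltW k0); have [_ U1 _] := ball_U d (ltW k0) u0.
have /andP[p9 _] := ball_prof d (ltW k0) u0.
have /andP[t0 t1] := turn_itv (dom_itv d u0).
have sl : st u <= 2 * pi * u by exact: sin_le.
have s0 := st_ge0 (dom_itv d u0); have cs := ct2Dst2 u; have cl := ct_le1 u.
have U0 := profU_gt0 d.
have pi0 := pi_gt0 R.
have D0 : 0 < k + b by lra.
have h1 : 2 * (1 - ct u) * profU u k <= 4 * pi * st u * prof u k.
  have e : (1 - ct u) * (19 / 10) <= st u * (2 * pi * u).
    case/andP: bP => _ b1; apply: (@le_trans _ _ (st u ^+ 2)); last by rewrite expr2 ler_wpM2l.
    by move: (ct u) (st u) c1 s0 cs cl => c s c1 s0 cs cl; nra.
  have e2 : 2 * (1 - ct u) * profU u k <= 2 * (1 - ct u) * (11 / 10).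
    by rewrite ler_wpM2l //; lra.
  have e3 : 4 * pi * st u * (9 / 10 * u) <= 4 * pi * st u * prof u k.
    by rewrite ler_wpM2l // !mulr_ge0 // ltW.
  have e4 : 4 * pi * st u * (9 / 10 * u) = 18 / 10 * (st u * (2 * pi * u)) by move: (pi : R) => q; ring.
  have c0 : 0 <= 1 - ct u by lra.
  by apply: le_trans e2 (le_trans _ e3); rewrite e4; move: (st u * _) (1 - ct u) e c0 => x y; lra.
have h2 : 2 * (1 - ct u) * (2 * pi * b * ct u) <= 4 * pi * st u * (b * st u).
  have -> : 2 * (1 - ct u) * (2 * pi * b * ct u) = 4 * pi * b * ((1 - ct u) * ct u) by move: (pi : R) => q; ring.
  have -> : 4 * pi * st u * (b * st u) = 4 * pi * b * (st u ^+ 2) by move: (pi : R) => q; ring.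
  rewrite ler_pM2l; last by rewrite !mulr_gt0.
  by move: (ct u) (st u) cs cl => c s; nra.
rewrite [leLHS]mulrDr [leRHS]mulrDr; apply: lerD h2.
have -> : 2 * (1 - ct u) * ((k + b) * profU u k) = (k + b) * (2 * (1 - ct u) * profU u k) by ring.
have -> : 4 * pi * st u * ((k + b) * prof u k) = (k + b) * (4 * pi * st u * prof u k) by move: (pi : R) => q; ring.
by rewrite ler_pM2l.
Qed.

(** For u >= 0 and in these regions [fH] does not decrease in k and increases in u, so a larger k
    has to be compensated by a smaller u. *)
Lemma compare_mono x y k k' : dom x k -> dom y k' -> 0 <= x -> 0 <= y -> k < k' ->
  k' * b <= 1 / 64 -> (0 < k \/ k' < - b) -> fH x k = fH y k' -> y <= x.
Proof.
move=> dx dy x0 y0 kk kb reg e.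
have nz z : k <= z <= k' -> z != 0 /\ z + b != 0.
  have b0 : 0 < b by case/andP: bP.
  move=> /andP[z1 z2]; case: reg => [k0|k0].
    by split; apply: lt0r_neq0; lra.
  by split; apply: ltr0_neq0; lra.
have m : fH x k <= fH x k'.
  apply: (@is_derive_ge0_le R (fH x) (fHk x)) => [|z zk|z zk]; first exact: ltW.
    have [z0 zb0] := nz z zk; apply: is_derive_fHk => //.
    by apply: dom_le dx _ _ => //; case/andP: zk.
  have dz : dom x z by apply: dom_le dx _ _ => //; case/andP: zk.
  case/andP: zk => z1 z2; case: reg => [k0|k0].
    by apply: fHk_outer => //; apply: lt_le_trans z1.
  by apply: fHk_center => //; apply: le_lt_trans z2 _.
rewrite leNgt; apply/negP => xy.
have [z0 zb0] : k' != 0 /\ k' + b != 0 by apply: nz; rewrite (ltW kk) lexx.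
have : fH x k' < fH y k' by rewrite ltr_pM2l ?fE_gt0 //; exact: dom_lt.
by rewrite -e ltNge m.
Qed.

Definition tau u : R := 2 * (1 - ct u).

Lemma tau_ge0 u : 0 <= tau u.
Proof. by rewrite /tau; have := ct_le1 u; move: (ct u) => c; lra. Qed.

Lemma tau_inj u : 0 < u <= 1 / 2 -> 0 < tau u.
Proof. by move=> /andP[u0 u1]; have := ct_lt (lexx 0) u0 u1; rewrite ct0 /tau; lra. Qed.

Lemma is_derive_tau u : is_derive u 1 tau (4 * pi * st u).
Proof.
have d1 := is_deriveB1 (f := fun=> 1 : R) (is_derive_cst (1 : R) u 1) (is_derive_ct u).
by apply: is_derive_eq (is_deriveZ1 2 d1) _; move: (pi : R) => q; ring.
Qed.

Lemma shell_ratio x y k : dom x k -> - b < k < 0 -> 0 < y <= x -> fH x k * tau y <= fH y k * tau x.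
Proof.
move=> dx kb /andP[y0 yx].
have tx z : y <= z <= x -> 0 < tau z.
  move=> /andP[z1 z2]; apply: tau_inj; rewrite (lt_le_trans y0) //=.
  by have /andP[_] := dom_itv dx (le_trans (ltW y0) yx); exact: le_trans.
have dz z : y <= z <= x -> dom z k.
  by move=> /andP[z1 z2]; apply: dom_ge0 dx _; rewrite z2 ltW ?(lt_le_trans y0).
have D z : y <= z <= x -> is_derive z 1 (fun z => - (fH z k / tau z))
    ((fH z k * (4 * pi * st z) - tau z * fHu z k) / tau z ^+ 2).
  move=> zz; have n0 := lt0r_neq0 (tx z zz).
  have d1 := is_deriveM1 (is_derive_fHu (dz z zz)) (is_deriveV1 n0 (is_derive_tau z)).
  by apply: is_derive_eq (is_deriveN d1) _; move: (pi : R) => q; field.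
suff : - (fH y k / tau y) <= - (fH x k / tau x).
  by rewrite lerN2 ler_pdivlMr ?tx ?lexx ?yx // mulrAC ler_pdivrMr ?tx ?lexx ?yx // mulrC [leRHS]mulrC.
apply: (is_derive_ge0_le yx D) => z zz.
rewrite divr_ge0 ?sqr_ge0 // subr_ge0 [leRHS]mulrC.
by apply: shell_tau => //; [exact: dz|case/andP: zz => yz _; rewrite ltW // (lt_le_trans y0)].
Qed.

Lemma shell_decr u k k' : dom u k -> - b < k -> k < k' -> k' < 0 -> 0 < u ->
  (k' + 2 * b) * fH u k' < (k + 2 * b) * fH u k.
Proof.
move=> d kb kk k0 u0; rewrite -ltrN2.
have dz z : k <= z <= k' -> dom u z by move=> /andP[z1 z2]; apply: dom_le d _ _.
have zn z : k <= z <= k' -> - b < z < 0.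
  by move=> /andP[z1 z2]; rewrite (lt_le_trans kb) //=; exact: le_lt_trans k0.
have D z : k <= z <= k' -> is_derive z 1 (fun z => - ((z + 2 * b) * fH u z))
    (- ((z + 2 * b) * fHk u z + fH u z)).
  move=> zz; have /andP[z1 z2] := zn z zz.
  have z0 : z != 0 by exact: ltr0_neq0.
  have zb : z + b != 0 by apply: lt0r_neq0; move: z1; lra.
  have d1 : is_derive z 1 (fun x => x + 2 * b) 1.
    by apply: is_derive_eq (is_deriveD1 (is_derive_id _ _) (is_derive_cst _ _ _)) _; rewrite addr0.
  have d2 := is_deriveN (is_deriveM1 d1 (is_derive_fHk (dz z zz) z0 zb)).
  by apply: is_derive_eq d2 _; rewrite mul1r addrC.
apply: (is_derive_gt0_lt kk D) => z zz.
by rewrite oppr_gt0; apply: fHk_shell => //; [exact: dz|exact: zn].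
Qed.

Lemma tau_surj s : 0 <= s <= 4 -> exists2 u, 0 <= u <= 1 / 2 & tau u = s.
Proof.
move=> /andP[s0 s4].
have [|||u] := @IVT R tau 0 (1 / 2) s.
- by lra.
- apply: continuous_subspaceT => u; apply: differentiable_continuous.
  by apply/derivable1_diffP; case: (is_derive_tau u).
- rewrite /tau ct0 ct_half; apply/andP; split.
    by rewrite ge_min; apply/orP; left; lra.
  by rewrite le_max; apply/orP; right; lra.
- by rewrite in_itv /= => u01 <-; exists u.
Qed.

(** In the shell the monotonicity of (k + 2 b) [fH] in k and of [fH / tau] in u turns the comparison
    into one between values of [tau], in a form that can be summed over the coordinates. *)
Lemma compare_shell x y k k' : dom x k -> dom y k' -> 0 <= x -> 0 <= y -> k < k' ->
  - b < k -> k' < 0 -> fH x k <= fH y k' ->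
  (k' + 2 * b) * tau x <= (k + 2 * b) * tau y /\ (0 < y -> (k' + 2 * b) * tau x < (k + 2 * b) * tau y).
Proof.
move=> dx dy x0 y0 kk kb k0 e; have b0 : 0 < b by case/andP: bP.
have nz z : - b < z < 0 -> 0 < fE z.
  by move=> /andP[z1 z2]; apply: fE_gt0; [exact: ltr0_neq0|apply: lt0r_neq0; lra].
have kbneg z : z < 0 -> z * b <= 1 / 64.
  by move=> z0; apply: (@le_trans _ _ 0); [rewrite nmulr_rle0 // ltW|lra].
have kn : k < 0 := lt_trans kk k0; have kb' : - b < k' := lt_trans kb kk.
suff S : 0 < y -> (k' + 2 * b) * tau x < (k + 2 * b) * tau y.
  split => //; move: y0; rewrite le_eqVlt => /predU1P[y0|/S/ltW//].
  move: e; rewrite -y0 fH0 => e.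
  have {x0} -> : x = 0.
    apply/eqP; rewrite eq_le x0 andbT leNgt; apply/negP => xp.
    by have := mulr_gt0 (nz k _) (fQ_gt0 dx (kbneg k kn) xp); rewrite kb kn => /(_ isT); rewrite ltNge e.
  by rewrite /tau ct0 subrr !mulr0.
move=> yp; have /andP[_ y12] := dom_itv dy y0.
have ka : 0 < k + 2 * b by lra. have ka' : 0 < k' + 2 * b by lra.
have ty : 0 < tau y by apply: tau_inj; rewrite yp.
(* The claim is exactly [tau x < s]; below, z is the point with [tau z = s]. *)
pose s := (k + 2 * b) / (k' + 2 * b) * tau y.
have r0 : 0 < (k + 2 * b) / (k' + 2 * b) by rewrite divr_gt0.
have r1 : (k + 2 * b) / (k' + 2 * b) < 1 by rewrite ltr_pdivrMr // mul1r; lra.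
have s0 : 0 < s by rewrite mulr_gt0.
have sy : s < tau y by rewrite -[ltRHS]mul1r ltr_pM2r.
have ty4 : tau y <= 4 by rewrite /tau; have := ct_geN1 y; move: (ct y) => c; lra.
have [|z /andP[z0 z12] zs] := @tau_surj s; first by rewrite ltW //= ltW // (lt_le_trans sy).
have zp : 0 < z.
  by move: z0; rewrite le_eqVlt => /predU1P[z0|//]; move: s0; rewrite -zs -z0 /tau ct0 subrr mulr0 ltxx.
have mono u v : 0 <= v -> u <= 1 / 2 -> tau u < tau v -> u < v.
  move=> v0 u1; rewrite ltNge [in X in _ -> X]ltNge; apply: contra => vu.
  by rewrite /tau ler_pM2l // lerD2l lerN2 ct_le.
have zy : z < y by apply: mono => //; rewrite zs.
have dzk : dom z k.
  split; first by rewrite ger0_norm.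
  rewrite -/(tau z) zs /s lerBlDr mulrAC ler_pdivrMr // ler_pM2l //.
  by case: dy => _; rewrite -/(tau y); lra.
have dzk' : dom z k' by apply: dom_le dzk _ (ltW kk).
have h1 := shell_decr dzk kb kk k0 zp.
have h2 : fH y k' * tau z <= fH z k' * tau y.
  by apply: shell_ratio => //; rewrite ?kb' ?k0 // zp ltW.
have h3 : fH x k < fH z k.
  apply: le_lt_trans e _.
  have : fH y k' * s * (k' + 2 * b) < fH z k * (k + 2 * b) * tau y.
    apply: (@le_lt_trans _ _ (fH z k' * tau y * (k' + 2 * b))).
      by rewrite ler_pM2r // -zs.
    by rewrite mulrAC ltr_pM2r // mulrC [ltRHS]mulrC.
  have -> : fH y k' * s * (k' + 2 * b) = fH y k' * (k + 2 * b) * tau y.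
    by rewrite /s; field; exact: lt0r_neq0.
  by rewrite ltr_pM2r // ltr_pM2r.
have xz : x < z.
  rewrite ltNge; apply/negP => zx; move: h3; apply/negP; rewrite -leNgt.
  move: zx; rewrite le_eqVlt => /predU1P[->//|zx]; apply: ltW.
  rewrite ltr_pM2l ?nz ?kb ?kn //; apply: dom_lt => //; exact: kbneg.
have : tau x < tau z.
  have /andP[_ x12] := dom_itv dx x0.
  by rewrite /tau ltr_pM2l // ltrD2l ltrN2; apply: ct_lt.
by rewrite zs /s mulrAC ltr_pdivlMr // mulrC.
Qed.

End ProfileBounds.

(** * The coordinate and its regions *)

Section OneDim.
Context {R : realType}.
Variables (lam b : R).
Hypothesis lamP : 1 < lam < 3 / 2.
Hypothesis bP : 0 < b <= 1 / 768.
Implicit Types u v k : R.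
Local Notation prof := (prof lam).
Local Notation fE := (fE lam b).
Local Notation fQ := (fQ lam b).
Local Notation fH := (fH lam b).
Local Notation dom := (dom b).

Let b0 : 0 < b. Proof. by case/andP: bP. Qed.

Lemma prof_le u k : dom u k -> 0 <= u -> prof u k <= 4 * u.
Proof.
move=> d u0.
suff : 4 * 0 - prof 0 k <= 4 * u - prof u k by rewrite prof0 mulr0 subr0 subr_ge0.
have D v : 0 <= v <= u -> is_derive v 1 (fun v => 4 * v - prof v k) (4 - profU lam v k).
  move=> vu; have dv := dom_ge0 d vu.
  apply: is_deriveB1; last exact: (dom_is_derive_prof lam bP dv).
  by apply: is_derive_eq (is_deriveZ1 _ (is_derive_id _ _)) _; rewrite mulr1.
apply: (is_derive_ge0_le u0 D) => v vu; have dv := dom_ge0 d vu; have v0 : 0 <= v by case/andP: vu.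
rewrite subr_ge0; have [_ X] := dom_X bP dv; have X0 : 0 < k + ct v by move: X; lra.
have [_ _ h _] := powU_bounds lamP X0 (dom_ratio bP dv v0).
apply: le_trans h _; rewrite ge_max; apply/andP; split; first by lra.
rewrite invf_ple ?posrE ?sqr_sum_gt0 //.
by move: (k + ct v) (st v) X => x y X; have := sqr_ge0 y; nra.
Qed.

Lemma fQ_normr u k : dom u k -> k * b <= 1 / 64 -> fQ `|u| k = `|fQ u k|.
Proof.
move=> d kb; have [u0|u0] := ger0P u.
  by rewrite ger0_norm //; apply: fQ_ge0.
rewrite fQN // ltr0_norm // -oppr_gt0 -fQN //.
by apply: fQ_gt0 => //; [exact: domN|rewrite oppr_gt0].
Qed.

Lemma fQ_le_normr u v k : dom u k -> dom v k -> k * b <= 1 / 64 -> `|fQ u k| <= `|fQ v k| -> `|u| <= `|v|.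
Proof.
move=> du dv kb; rewrite -!fQ_normr //; apply: contraTT; rewrite -!ltNge => vu.
by apply: dom_lt => //; apply: dom_le du _ (lexx k); rewrite normr_id.
Qed.

Lemma fQ_lt u v k : dom u k -> dom v k -> k * b <= 1 / 64 -> u < v -> fQ u k < fQ v k.
Proof.
move=> du dv kb uv; have [u0|u0] := leP 0 u; first exact: dom_lt.
have [v0|v0] := leP v 0.
  rewrite -ltrN2 -!fQN //; apply: dom_lt => //; rewrite ?ltrN2 ?oppr_ge0 //; exact: domN.
apply: (@lt_trans _ _ 0); last exact: fQ_gt0.
by rewrite -oppr_gt0 -fQN //; apply: fQ_gt0; rewrite ?oppr_gt0 //; exact: domN.
Qed.

Lemma fQ_inj u v k : dom u k -> dom v k -> k * b <= 1 / 64 -> fQ u k = fQ v k -> u = v.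
Proof.
move=> du dv kb e; case: (ltgtP u v) => // h; [have := fQ_lt du dv kb h|have := fQ_lt dv du kb h];
  by rewrite e ltxx.
Qed.

Lemma fE_small k : 0 < `|k| <= b / 2 -> fE k <= 2 / b * `|k|.
Proof.
move=> /andP[k0 kb].
have k1 : `|k| <= 1 by apply: le_trans kb _; case/andP: bP; lra.
have h1 : `|k| `^ lam <= `|k|.
  by rewrite -[leRHS]powRr1 // ger_powR // ?k0 //; case/andP: lamP => /ltW.
have h2 : b / 2 <= `|k + b|.
  by rewrite (le_trans _ (ler_norm _)) //; move: kb; rewrite ler_norml => /andP[]; lra.
rewrite !fEE ler_pdivrMr; last by rewrite (lt_le_trans _ h2) // divr_gt0.
apply: le_trans h1 _.
have -> : 2 / b * `|k| * `|k + b| = `|k| * (2 / b * `|k + b|) by ring.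
by rewrite ler_peMr // -(invf_div b 2) ler_pdivlMl ?mulr1 // divr_gt0.
Qed.

Lemma fE_large k e : 0 < e -> b / 2 <= `|k| -> 0 < `|k + b| <= e -> (b / 2) ^+ 2 / e <= fE k.
Proof.
move=> e0 kb /andP[k0 ke].
have b1 : b / 2 <= 1 by case/andP: bP; lra.
have b20 : 0 < b / 2 by rewrite divr_gt0.
have h1 : (b / 2) ^+ 2 <= `|k| `^ lam.
  rewrite -(powR_mulrn _ (ltW b20)).
  apply: (@le_trans _ _ ((b / 2) `^ lam)).
    by apply: ger_powR; rewrite ?b20 //; case/andP: lamP; lra.
  by apply: ge0_ler_powR => //; rewrite ?nnegrE ?(ltW b20) ?normr_ge0 //; case/andP: lamP; lra.
have h2 : e^-1 <= `|k + b|^-1 by rewrite lef_pV2 ?posrE.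
by apply: ler_pM h1 h2; rewrite ?invr_ge0 ?sqr_ge0 ?(ltW e0).
Qed.

Lemma fQ_ball_ge u k : dom u k -> k <= 0 -> 0 <= u -> b * u <= fQ u k.
Proof.
move=> d k0 u0.
suff : fQ 0 k - b * 0 <= fQ u k - b * u by rewrite fQ0 mulr0 subr0 subr_ge0.
have D v : 0 <= v <= u -> is_derive v 1 (fun v => fQ v k - b * v) (fQu lam b v k - b).
  move=> vu; have dv := dom_ge0 d vu.
  apply: is_deriveB1; first exact: is_derive_fQu.
  by apply: is_derive_eq (is_deriveZ1 _ (is_derive_id _ _)) _; rewrite mulr1.
apply: (is_derive_ge0_le u0 D) => v vu; have dv := dom_ge0 d vu; have v0 : 0 <= v by case/andP: vu.
rewrite subr_ge0 /fQu.
have c1 := ball_ct dv k0; have [U9 U1 _] := ball_U lamP bP dv k0 v0; have k2 := dom_k dv.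
have pi2 : 2 <= pi :> R := pi_ge2 R.
move: (ct v) (profU lam v k) (pi : R) c1 U1 U9 pi2 => c U q c1 U1 U9 pi2.
have h1 : - (11 / 10 * b) <= (k + b) * U by move: b0; nra.
have h2 : 3 * b <= 2 * q * b * c.
  have : 3 / 2 <= q * c by case/andP: bP => _ b1; nra.
  by rewrite (_ : 2 * q * b * c = 2 * b * (q * c)); [move: b0; nra|ring].
by lra.
Qed.

Lemma ball_lt u k : dom u k -> k <= 0 -> `|u| < 1 / 2.
Proof.
move=> d k0; have c1 := ball_ct d k0; have [u1 _] := d.
rewrite lt_neqAle u1 andbT; apply/eqP => e.
by move: c1; rewrite -ct_normr e ct_half; case/andP: bP; lra.
Qed.

(** Twice the constant value of k^lam [prof (1 / 2) k], read off at k = 2. *)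
Definition per : R := 2 * (2 `^ lam * prof (1 / 2) 2).

(** V vanishes at u = 1 / 2, so [prof_identity] says there that the k-derivative of the product is
    0. *)
Lemma half_prof k : 3 / 2 < k -> k `^ lam * prof (1 / 2) k = per / 2.
Proof.
move=> k1; have -> : per / 2 = 2 `^ lam * prof (1 / 2) 2 by rewrite /per mulrC mulKf.
have D (z : R) : 3 / 2 < z -> is_derive z 1 (fun z => z `^ lam * prof (1 / 2) z) 0.
  move=> z1; have z0 : 0 < z by lra.
  have u1 : `|1 / 2 : R| <= 1 / 2 by rewrite ger0_norm //; lra.
  have X : 1 / 2 < z + ct (1 / 2) by rewrite ct_half; lra.
  have d1 : is_derive z 1 (fun z => z `^ lam) (lam * z `^ (lam - 1)) by exact: is_derive1_powR.
  apply: is_derive_eq (is_deriveM1 d1 (is_derive_profk lam u1 X)) _.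
  have id := prof_identity lam u1 X.
  have V0 : profV lam (1 / 2) z = 0.
    by rewrite /profV st_half /powV mul0r atan0 (mulr0 lam) sin0 mulr0.
  rewrite V0 mul0r addr0 in id.
  have -> : z `^ lam = z `^ (lam - 1) * z.
    rewrite -{3}(powRr1 (ltW z0)) -powRD; first by congr (_ `^ _); ring.
    by rewrite lt0r_neq0 // implybT.
  by rewrite -(mulrA (z `^ _) z) id; ring.
have [k2|k2] := leP k 2.
  by apply: (@is_derive_eq0_eq R (fun z => z `^ lam * prof (1 / 2) z) _ _ k2) => z /andP[z1 _]; apply: D; lra.
by apply/esym/(@is_derive_eq0_eq R (fun z => z `^ lam * prof (1 / 2) z) _ _ (ltW k2)) => z /andP[z1 _]; apply: D; lra.
Qed.

Lemma dom_half k : 4 - 2 * b <= k -> dom (1 / 2) k.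
Proof. by move=> k1; split; [rewrite ger0_norm //; lra|rewrite ct_half; lra]. Qed.

Lemma per_gt0 : 0 < per.
Proof.
have d : dom (1 / 2) 4 by apply: dom_half; move: b0; lra.
suff : 0 < per / 2 by rewrite pmulr_lgt0 // invr_gt0.
rewrite -(@half_prof 4); last by lra.
rewrite mulr_gt0 ?powR_gt0 // -(prof0 lam 4).
apply: (@is_derive_gt0_lt R (prof^~ 4) (fun v => profU lam v 4)) => [|v vu|v vu]; first by lra.
  exact: (dom_is_derive_prof lam bP (dom_ge0 d vu)).
by apply: (profU_gt0 lamP bP); exact: dom_ge0 d vu.
Qed.

(** [st] has period 1 and the factors k + b cancel, so the change is k^lam times the integral of the
    profile over a full period. *)
Lemma fH_shift u k : 3 / 2 < k -> -1 < u < 1 -> fH (u + 1) k = fH u k + per.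
Proof.
move=> k1 u1; have := profB1 lam k u1; have := half_prof k1.
have k0 : 0 < k by lra. have kb : 0 < k + b by rewrite addr_gt0.
rewrite !fHE !fEE !fQE stD1 (gtr0_norm k0) (gtr0_norm kb).
set e := k `^ lam; set p1 := prof (u + 1) k; set p0 := prof u k; set p := prof (1 / 2) k => h1 h2.
have -> : p1 = p0 + 2 * p by lra.
have -> : per = 2 * (e * p) by lra.
by field; exact: lt0r_neq0.
Qed.

Lemma fH_half k : 4 - 2 * b <= k -> fH (1 / 2) k = per / 2.
Proof.
move=> k1; have d := dom_half k1.
have k32 : 3 / 2 < k by apply: lt_le_trans k1; case/andP: bP; lra.
have := @fH_shift (- (1 / 2)) k k32; have -> : - (1 / 2) + 1 = 1 / 2 :> R by field.
by rewrite fHN // => h; have := h _; lra.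
Qed.

(** Raising k to at least 4 does not decrease [fH] at |u|. There u = 1 / 2 belongs to the domain,
    with value per / 2, and [fH] is strictly increasing in u. *)
Lemma fH_lt_half u k : dom u k -> 0 < k -> k * b <= 1 / 64 -> `|u| < 1 / 2 -> `|fH u k| < per / 2.
Proof.
move=> d k0 kb u1.
have E0 z : 0 < z -> 0 < fE z.
  by move=> z0; apply: fE_gt0; [exact: lt0r_neq0|apply: lt0r_neq0; rewrite addr_gt0].
rewrite !fHE normrM (gtr0_norm (E0 k k0)) -fQ_normr // -/(fH `|u| k).
have dn : dom `|u| k by apply: dom_le d _ (lexx k); rewrite normr_id.
pose k' := Num.max k 4.
have kk : k <= k' by rewrite le_max lexx.
have k4 : 4 - 2 * b <= k' by rewrite le_max; apply/orP; right; move: b0; lra.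
have k'b : k' * b <= 1 / 64.
  by rewrite /k' maxEle; case: ifP => // _; case/andP: bP; lra.
have k'0 : 0 < k' := lt_le_trans k0 kk.
rewrite -(fH_half k4); apply: (@le_lt_trans _ _ (fH `|u| k')).
  have D z : k <= z <= k' -> is_derive z 1 (fH `|u|) (fHk lam b `|u| z).
    move=> /andP[z1 z2]; have z0 : 0 < z := lt_le_trans k0 z1.
    apply: is_derive_fHk => //; [exact: dom_le dn _ z1|exact: lt0r_neq0|].
    by apply: lt0r_neq0; rewrite addr_gt0.
  apply: (is_derive_ge0_le kk D) => z /andP[z1 z2].
  by apply: fHk_outer => //; [exact: dom_le dn _ z1|exact: lt_le_trans z1].
rewrite ltr_pM2l ?E0 //; apply: dom_lt => //; exact: dom_half.
Qed.

End OneDim.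

(** * Level sets, regions and injectivity of the coordinate *)

Section Geometry.
Context {R : realType} {n : nat}.
Variable lam : R.
Hypothesis lamP : 1 < lam < 3 / 2.
Hypothesis n3 : (3 <= n)%N.
Implicit Types x y v : 'rV[R]_n.

(** [kf] is at most 4 n, so this value gives [kf x * b <= 1 / 64], the bound under which [fQ]
    increases in u. *)
Definition gb : R := (256 * n%:R)^-1.
Local Notation b := gb.
Local Notation fE := (fE lam b).
Local Notation fQ := (fQ lam b).
Local Notation fH := (fH lam b).
Local Notation dom := (dom b).

(** [tau u] is |exp (2 pi i u) - 1|^2. Hence [kf] is analytic with period 1 in each coordinate and
    has its minimum - 2 b at the lattice points. *)
Definition kf x : R := \sum_i tau (x 0 i) - 2 * b.
Definition inbox x : Prop := forall i, `|x 0 i| <= 1 / 2.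
Definition Px x : 'rV[R]_n := \row_i fH (x 0 i) (kf x).
Definition Qx x : 'rV[R]_n := \row_i fQ (x 0 i) (kf x).

Lemma gbP : 0 < b <= 1 / 768.
Proof.
have n0 : 3 <= n%:R :> R by rewrite (ler_nat R 3 n).
have q0 : 0 < 256 * n%:R :> R by lra.
by rewrite /gb invr_gt0 q0 -[X in X <= _]mul1r ler_pdivrMr //; lra.
Qed.

Lemma gb_gt0 : 0 < b. Proof. by case/andP: gbP. Qed.

Lemma kf_tau x : kf x + 2 * b = \sum_i tau (x 0 i). Proof. by rewrite /kf subrK. Qed.

Lemma dom_box x i : inbox x -> dom (x 0 i) (kf x).
Proof.
move=> bx; split; first exact: bx.
rewrite -/(tau (x 0 i)) /kf lerD2r (bigD1 i) //= lerDl; apply: sumr_ge0 => j _; exact: tau_ge0.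
Qed.

Lemma kf_b x : kf x * b <= 1 / 64.
Proof.
have b0 := gb_gt0; apply: (@le_trans _ _ ((4 * n%:R) * b)); last first.
  rewrite /gb; have : (n%:R : R) != 0 by rewrite pnatr_eq0; case: n n3.
  by move=> n0; rewrite le_eqVlt; apply/orP; left; apply/eqP; field.
rewrite ler_pM2r // /kf lerBlDr; apply: (@le_trans _ _ (4 * n%:R)); last by rewrite lerDl mulr_ge0 // ltW.
apply: (@le_trans _ _ (\sum_(i < n) 4)); last by rewrite sumr_const card_ord mulr_natr.
by apply: ler_sum => i _; rewrite /tau; have := ct_geN1 (x 0 i); move: (ct _) => c; lra.
Qed.

Lemma tau_normr (u : R) : tau `|u| = tau u. Proof. by rewrite /tau ct_normr. Qed.

Lemma tau_le (u v : R) : `|u| <= `|v| -> `|v| <= 1 / 2 -> tau u <= tau v.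
Proof.
move=> uv v1; rewrite -(tau_normr u) -(tau_normr v) /tau ler_pM2l // lerD2l lerN2.
by apply: ct_le.
Qed.

Lemma tau_eq (u v : R) : `|u| <= `|v| -> `|v| <= 1 / 2 -> tau u = tau v -> `|u| = `|v|.
Proof.
move=> uv v1; rewrite -(tau_normr u) -(tau_normr v) /tau => e.
apply/eqP; rewrite eq_le uv /= leNgt; apply/negP => vu.
by have := ct_lt (normr_ge0 u) vu v1; move: e; move: (ct _) (ct _) => c d; lra.
Qed.

Lemma ler_sum_eq (I : finType) (f g : I -> R) : (forall i, f i <= g i) ->
  \sum_i g i <= \sum_i f i -> forall i, f i = g i.
Proof.
move=> fg s i; have d0 j : 0 <= g j - f j by rewrite subr_ge0.
have : \sum_j (g j - f j) = 0.
  by apply/eqP; rewrite eq_le sumr_ge0 // andbT sumrB subr_le0.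
move=> /psumr_eq0P => /(_ (fun j _ => d0 j) i isT) /eqP.
by rewrite subr_eq0 => /eqP.
Qed.

Lemma kf_eq_normr x y : inbox y -> (forall i, `|x 0 i| <= `|y 0 i|) -> kf y <= kf x ->
  forall i, `|x 0 i| = `|y 0 i|.
Proof.
move=> byx xy k i; apply: tau_eq => //.
apply: (@ler_sum_eq _ (fun i => tau (x 0 i)) (fun i => tau (y 0 i))) => [j|].
  exact: tau_le.
by rewrite -!kf_tau lerD2r.
Qed.

Lemma kf_lt0 x y : (forall i, `|x 0 i| <= `|y 0 i|) -> inbox y -> kf x <= kf y.
Proof. by move=> xy byx; rewrite lerD2r; apply: ler_sum => i _; exact: tau_le. Qed.

Lemma Px_scale x : Px x = fE (kf x) *: Qx x.
Proof. by apply/rowP => i; rewrite !mxE. Qed.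

Lemma fH_normr (u k : R) : dom u k -> k * b <= 1 / 64 -> k != 0 -> k + b != 0 ->
  fH `|u| k = `|fH u k|.
Proof.
move=> d kb k0 kb0; rewrite !fHE (fQ_normr lamP gbP) // normrM.
by rewrite [X in _ = X * _]gtr0_norm //; exact: fE_gt0.
Qed.

Lemma dom_normr (u k : R) : dom u k -> dom `|u| k.
Proof. by move=> d; apply: dom_le d _ (lexx k); rewrite normr_id. Qed.

(* The regions of the torus cut out by the two spheres [kf = 0] and [kf = - b]. *)
Definition outer x := 0 < kf x.
Definition shell x := - b < kf x < 0.
Definition center x := kf x < - b.

Lemma region_neq x : outer x \/ shell x \/ center x -> kf x != 0 /\ kf x + b != 0.
Proof.
have b0 := gb_gt0.
case=> [ho|[ /andP[s1 s2]|hc]].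
- by split; apply: lt0r_neq0 => //; rewrite addr_gt0.
- by split; [exact: ltr0_neq0|apply: lt0r_neq0; rewrite -ltrBlDr sub0r].
- by split; apply: ltr0_neq0; move: hc; rewrite /center; lra.
Qed.

(** A larger [kf] at y would force |y_i| <= |x_i| for all i, hence a value of [kf] at y that is not
    larger. *)
Lemma outer_center_cmp x y : inbox x -> inbox y -> (outer x /\ outer y) \/ (center x /\ center y) ->
  (forall i, `|Px x 0 i| = `|Px y 0 i|) -> ~ kf x < kf y.
Proof.
move=> bx byx reg e kk.
have [x0 xb0] : kf x != 0 /\ kf x + b != 0 by apply: region_neq; case: reg => -[]; tauto.
have [y0 yb0] : kf y != 0 /\ kf y + b != 0 by apply: region_neq; case: reg => -[]; tauto.
suff : kf y <= kf x by rewrite leNgt kk.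
apply: kf_lt0 => // i.
apply: (compare_mono lamP gbP (dom_normr (dom_box i bx)) (dom_normr (dom_box i byx)) _ _ kk (kf_b y)) => //.
  by case: reg => -[rx ry]; [left|right].
rewrite !fH_normr ?kf_b //; try exact: dom_box.
by have := e i; rewrite !mxE.
Qed.

(** The inequalities of [compare_shell] sum to an equality, since the [tau] add up to kf + 2 b. Each
    of them is then an equality, which leaves only y = 0, and 0 is not in the shell. *)
Lemma shell_cmp x y : inbox x -> inbox y -> shell x -> shell y ->
  (forall i, `|Px x 0 i| <= `|Px y 0 i|) -> ~ kf x < kf y.
Proof.
move=> bx byx sx sy e kk; have b0 := gb_gt0.
have [x0 xb0] := region_neq (or_intror (or_introl sx)).
have [y0 yb0] := region_neq (or_intror (or_introl sy)).
have C i : (kf y + 2 * b) * tau (x 0 i) <= (kf x + 2 * b) * tau (y 0 i) /\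
    (0 < `|y 0 i| -> (kf y + 2 * b) * tau (x 0 i) < (kf x + 2 * b) * tau (y 0 i)).
  rewrite -(tau_normr (x 0 i)) -(tau_normr (y 0 i)).
  have [sx1 sx2] := andP sx; have [sy1 sy2] := andP sy.
  apply: (compare_shell lamP gbP (dom_normr (dom_box i bx)) (dom_normr (dom_box i byx)) _ _ kk) => //.
  rewrite !fH_normr ?kf_b //; try exact: dom_box.
  by have := e i; rewrite !mxE.
have E : forall i, (kf y + 2 * b) * tau (x 0 i) = (kf x + 2 * b) * tau (y 0 i).
  apply: ler_sum_eq => [i|]; first by case: (C i).
  have T (z : 'rV[R]_n) c : \sum_i c * tau (z 0 i) = c * (kf z + 2 * b) by rewrite kf_tau mulr_sumr.
  by rewrite !T mulrC.
have Y i : y 0 i = 0.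
  apply/eqP; rewrite -normr_eq0 -[_ == 0]negbK -normr_gt0 normr_id; apply/negP => yi.
  by have [_ /(_ yi)] := C i; rewrite E ltxx.
have : kf y + 2 * b = 0 by rewrite kf_tau big1 // => i _; rewrite Y /tau ct0 subrr mulr0.
by case/andP: sy => s1 _; move: s1; lra.
Qed.

Lemma Px_inj x y : inbox x -> inbox y ->
  (outer x /\ outer y) \/ (shell x /\ shell y) \/ (center x /\ center y) -> Px x = Px y -> x = y.
Proof.
move=> bx byx reg e.
have K : kf x = kf y.
  case: (ltgtP (kf x) (kf y)) => // kk; exfalso; move: kk.
    by case: reg => [r|[[r1 r2]|r]]; [apply: outer_center_cmp; rewrite ?e //; tauto|
      apply: shell_cmp; rewrite ?e //|apply: outer_center_cmp; rewrite ?e //; tauto].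
  by case: reg => [[r1 r2]|[[r1 r2]|[r1 r2]]]; [apply: outer_center_cmp; rewrite ?e //; tauto|
      apply: shell_cmp; rewrite ?e //|apply: outer_center_cmp; rewrite ?e //; tauto].
have [x0 xb0] : kf x != 0 /\ kf x + b != 0 by apply: region_neq; case: reg => [|[|]] []; tauto.
apply/rowP => i; apply: (fQ_inj lamP gbP (dom_box i bx) _ (kf_b x)); first by rewrite K; exact: dom_box.
have := congr1 (fun z : 'rV_n => z 0 i) e; rewrite !mxE K !fHE => /mulfI; apply.
by rewrite lt0r_neq0 // fE_gt0 -?K.
Qed.

(** On one level of [kf], a shorter vector [Qx] of the same direction has all coordinates smaller in
    absolute value. Equality of the sums of [tau] then gives |x_i| = |y_i|, and a nonzero coordinate
    gives c = 1. *)
Lemma Qx_ray_inj x y c : inbox x -> inbox y -> kf x = kf y -> - (2 * b) < kf x -> 0 < c ->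
  Qx y = c *: Qx x -> x = y.
Proof.
wlog c1 : x y c / c <= 1 => [W|].
  have [c1|c1] := leP c 1; first exact: W c1.
  move=> bx byx k kx c0 e; apply/esym; apply: (W y x c^-1) => //.
  - by rewrite invf_le1 // ltW.
  - by rewrite -k.
  - by rewrite invr_gt0.
  - by rewrite e scalerA mulVf ?scale1r // lt0r_neq0.
move=> bx byx k kx c0 e.
have N i : `|y 0 i| <= `|x 0 i|.
  apply: (fQ_le_normr lamP gbP (k := kf x)); rewrite ?kf_b //.
  - by rewrite k; exact: dom_box.
  - exact: dom_box.
  have := congr1 (fun z : 'rV_n => z 0 i) e; rewrite !mxE -k => ->.
  by rewrite normrM ler_piMl // gtr0_norm.
have NE := kf_eq_normr bx N; rewrite -k lexx in NE; have {}NE := NE isT.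
have [i xi] : exists i, x 0 i != 0.
  apply: contrapT => /forallNP h.
  have : kf x + 2 * b = 0.
    rewrite kf_tau big1 // => i _; have /negP := h i; rewrite negbK => /eqP ->.
    by rewrite /tau ct0 subrr mulr0.
  by move: kx; lra.
have dx := dom_box i bx; have dy := dom_box i byx; rewrite -k in dy.
have c_1 : c = 1.
  have := congr1 (fun z : 'rV_n => `|z 0 i|) e.
  rewrite !mxE -k normrM -(fQ_normr lamP gbP dx) ?kf_b // -(fQ_normr lamP gbP dy) ?kf_b // NE gtr0_norm //.
  rewrite -[LHS]mul1r => /mulIf <- //.
  by rewrite lt0r_neq0 // (fQ_gt0 lamP gbP) ?kf_b ?normr_gt0 //; exact: dom_normr.
apply/rowP => j; apply: (fQ_inj lamP gbP (dom_box j bx) _ (kf_b x)).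
  by rewrite k; exact: dom_box.
by have := congr1 (fun z : 'rV_n => z 0 j) e; rewrite c_1 scale1r !mxE -k.
Qed.

End Geometry.

(** * Chain rule for functions of two variables *)

Section ChainRule.
Context {R : realType}.

Lemma diff_pt m (F : 'rV[R]_2 -> R) (g h : 'rV[R]_m -> R) x v :
  analytic_at F (pt (g x) (h x)) -> analytic_at g x -> analytic_at h x ->
  'd (fun y => F (pt (g y) (h y))) x v =
    'd F (pt (g x) (h x)) (delta_mx 0 0) * 'd g x v + 'd F (pt (g x) (h x)) (delta_mx 0 1) * 'd h x v.
Proof.
move=> aF ag ah; have [dF _] := analytic_at_diff aF.
pose G y := pt (g y) (h y).
have aG : analytic_map G x.
  by move=> i; apply: (@eq_analytic_at _ _ (fun y => if i == 0 then g y else h y)) => [y|];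
    [rewrite mxE|case: (i == 0)].
have dG := analytic_map_diff aG.
apply: etrans (diff_comp_at (f := G) v dG dF) _.
have -> : 'd G x v = 'd g x v *: delta_mx 0 0 + 'd h x v *: delta_mx 0 1.
  have e0 : 'd (fun y => G y 0 0) x v = 'd g x v by congr ('d _ x v); apply/funext => y; rewrite /G pt0.
  have e1 : 'd (fun y => G y 0 1) x v = 'd h x v by congr ('d _ x v); apply/funext => y; rewrite /G pt1.
  apply/rowP => i; apply: etrans (esym (coord_diff i v dG)) _.
  have [->|->] : i = 0 \/ i = 1 by case: i => -[|[|//]] hi; [left|right]; exact: val_inj.
    apply: etrans e0 _; rewrite !mxE !eqxx /=; move: ('d g x v) ('d h x v) => a c.
    by rewrite mulr1 mulr0 addr0.
  apply: etrans e1 _; rewrite !mxE !eqxx /=; move: ('d g x v) ('d h x v) => a c.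
  by rewrite mulr1 mulr0 add0r.
by rewrite linearD !linearZ /= mulrC [X in _ + X]mulrC.
Qed.

Lemma analytic_at_normr m (g : 'rV[R]_m -> R) x : g x != 0 -> analytic_at g x ->
  analytic_at (fun y => `|g y|) x.
Proof.
move=> g0 ag; have cg := analytic_at_continuous ag.
case: (ltgtP (g x) 0) => gx; last by rewrite gx eqxx in g0.
  apply: (near_analytic_at _ (analytic_atN ag)).
  have := near_continuous (P := fun z : R => z < 0) cg (lt_nbhsl gx).
  by apply: filterS => y /ltr0_norm.
apply: (near_analytic_at _ ag).
have := near_continuous (P := fun z : R => 0 < z) cg (lt_nbhsr gx).
by apply: filterS => y /gtr0_norm.
Qed.

Lemma analytic_at_powR m (g : 'rV[R]_m -> R) x s : g x != 0 -> analytic_at g x ->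
  analytic_at (fun y => `|g y| `^ s) x.
Proof.
move=> g0 ag; have an := analytic_at_normr g0 ag.
have n0 : 0 < `|g x| by rewrite normr_gt0.
apply: (@near_analytic_at _ _ (fun y => expR (s * ln `|g y|))).
  have := near_continuous (P := fun z : R => 0 < z) (analytic_at_continuous an) (lt_nbhsr n0).
  by apply: filterS => y y0; rewrite /powR gt_eqF.
apply: (analytic_at_comp1 (phi := expR)); first exact: analytic1_expR.
apply: analytic_atM; first exact: analytic_at_cst.
by apply: (analytic_at_comp1 (phi := @ln R)) => //; exact: analytic1_ln.
Qed.

End ChainRule.

(** * Invertibility of the differential of the coordinate *)

Section Derivative.
Context {R : realType} {n : nat}.
Variable lam : R.
Hypothesis lamP : 1 < lam < 3 / 2.
Hypothesis n3 : (3 <= n)%N.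
Implicit Types x y v : 'rV[R]_n.
Local Notation b := (@gb R n).
Local Notation fE := (fE lam b).
Local Notation fQ := (fQ lam b).
Local Notation fH := (fH lam b).
Local Notation fQu := (fQu lam b).
Local Notation fHu := (fHu lam b).
Local Notation fHk := (fHk lam b).
Local Notation dom := (dom b).
Let bP : 0 < b <= 1 / 768 := gbP n3.

Definition dkf x v : R := \sum_i 4 * pi * st (x 0 i) * v 0 i.

Lemma analytic_kf x : analytic_at kf x.
Proof.
apply: analytic_atB; last exact: analytic_at_cst.
apply: analytic_at_sum => i; apply: analytic_atM; first exact: analytic_at_cst.
apply: analytic_atB; first exact: analytic_at_cst.
by have [] := analytic_at_turn (analytic_at_coord i x).
Qed.

Lemma diff_kf x v : 'd kf x v = dkf x v.
Proof.
have [dk _] := analytic_at_diff (analytic_kf x).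
have d1 : is_derive (0 : R) 1 (fun t => kf (t *: v + x)) ('d kf x v).
  apply: is_derive_line (diff_is_derive v dk) => h.
  by rewrite addr0.
have d2 : is_derive (0 : R) 1 (fun t => kf (t *: v + x)) (dkf x v).
  apply: is_derive_subr.
  have -> : (fun t : R => \sum_i tau ((t *: v + x) 0 i)) = \sum_i (fun t : R => tau (t * v 0 i + x 0 i)).
    by apply/funext => t; rewrite fct_sumE; apply: eq_bigr => i _; rewrite !mxE.
  apply: is_derive_sum => i.
  have di : is_derive (0 : R) 1 (fun t : R => t * v 0 i + x 0 i) (v 0 i).
    apply: is_derive_eq (is_deriveD1 (is_derive_mulr (v 0 i) (is_derive_id _ _)) (is_derive_cst _ _ _)) _.
    by rewrite mul1r addr0.
  have e0 : 0 * v 0 i + x 0 i = x 0 i by rewrite mul0r add0r.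
  have dt := is_derive_tau (x 0 i); rewrite -{1}e0 in dt.
  exact: (is_derive_comp1 (f := fun t => t * v 0 i + x 0 i) dt di).
by case: d1 => _ <-; case: d2 => _ <-.
Qed.

Definition fQpt (y : 'rV[R]_2) : R := fQ (y 0 0) (y 0 1).

Lemma analytic_fQpt u k : dom u k -> analytic_at fQpt (pt u k).
Proof.
move=> d; have [u1 _] := d; have [_ X] := dom_X bP d.
apply: analytic_atD; last first.
  apply: analytic_atM; first exact: analytic_at_cst.
  by have [] := analytic_at_turn (analytic_at_coord 0 (pt u k)).
apply: analytic_atM; last exact: analytic_prof.
by apply: analytic_atD; [exact: analytic_at_coord|exact: analytic_at_cst].
Qed.

Lemma diff_fQpt0 u k : dom u k -> 'd fQpt (pt u k) (delta_mx 0 0) = fQu u k.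
Proof.
move=> d; have [dF _] := analytic_at_diff (analytic_fQpt d).
have := is_derive_pt0 (diff_is_derive (delta_mx 0 0) dF); rewrite /fQpt.
under eq_fun do rewrite pt0 pt1.
by move=> [_ <-]; case: (is_derive_fQu lam bP d).
Qed.

Lemma diff_fQpt1 u k : dom u k -> 'd fQpt (pt u k) (delta_mx 0 1) = fQk lam b u k.
Proof.
move=> d; have [dF _] := analytic_at_diff (analytic_fQpt d).
have := is_derive_pt1 (diff_is_derive (delta_mx 0 1) dF); rewrite /fQpt.
under eq_fun do rewrite pt0 pt1.
by move=> [_ <-]; case: (is_derive_fQk lam bP d).
Qed.

Definition fHpt (y : 'rV[R]_2) : R := fH (y 0 0) (y 0 1).

Lemma analytic_fE m (g : 'rV[R]_m -> R) (x : 'rV[R]_m) : g x != 0 -> g x + b != 0 -> analytic_at g x ->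
  analytic_at (fun y : 'rV[R]_m => fE (g y)) x.
Proof.
move=> g0 gb0 ag; apply: analytic_atM; first exact: analytic_at_powR.
have a1 : analytic_at (fun y : 'rV[R]_m => g y + b) x by apply: analytic_atD => //; exact: analytic_at_cst.
by apply: analytic_atV; [rewrite normr_eq0|exact: analytic_at_normr].
Qed.

Lemma analytic_fHpt u k : dom u k -> k != 0 -> k + b != 0 -> analytic_at fHpt (pt u k).
Proof.
move=> d k0 kb0; apply: analytic_atM; last exact: analytic_fQpt.
by apply: (@analytic_fE _ (fun y : 'rV[R]_2 => y 0 1)); rewrite ?pt1 //; exact: analytic_at_coord.
Qed.

Lemma diff_fHpt0 u k : dom u k -> k != 0 -> k + b != 0 -> 'd fHpt (pt u k) (delta_mx 0 0) = fHu u k.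
Proof.
move=> d k0 kb0; have [dF _] := analytic_at_diff (analytic_fHpt d k0 kb0).
have := is_derive_pt0 (diff_is_derive (delta_mx 0 0) dF); rewrite /fHpt.
under eq_fun do rewrite pt0 pt1.
by move=> [_ <-]; case: (is_derive_fHu lam bP d).
Qed.

Lemma diff_fHpt1 u k : dom u k -> k != 0 -> k + b != 0 -> 'd fHpt (pt u k) (delta_mx 0 1) = fHk u k.
Proof.
move=> d k0 kb0; have [dF _] := analytic_at_diff (analytic_fHpt d k0 kb0).
have := is_derive_pt1 (diff_is_derive (delta_mx 0 1) dF); rewrite /fHpt.
under eq_fun do rewrite pt0 pt1.
by move=> [_ <-]; case: (is_derive_fHk lam bP d k0 kb0).
Qed.

Lemma analytic_Qx x : inbox x -> analytic_map (Qx lam) x.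
Proof.
move=> bx i; have ac := analytic_at_coord i x.
apply: eq_analytic_at (analytic_at_pt0 (analytic_fQpt (dom_box i bx)) ac (analytic_kf x)) => y.
by rewrite /fQpt pt0 pt1 mxE.
Qed.

Lemma diff_Qx x v i : inbox x ->
  'd (fun y => Qx lam y 0 i) x v = fQu (x 0 i) (kf x) * v 0 i + fQk lam b (x 0 i) (kf x) * dkf x v.
Proof.
move=> bx; have ac := analytic_at_coord i x; have d := dom_box i bx.
have -> : (fun y => Qx lam y 0 i) = (fun y => fQpt (pt (y 0 i) (kf y))).
  by apply/funext => y; rewrite /fQpt pt0 pt1 mxE.
apply: etrans (diff_pt v (analytic_fQpt d) ac (analytic_kf x)) _.
by congr (_ * _ + _ * _); [exact: diff_fQpt0|exact: diff_coord|exact: diff_fQpt1|exact: diff_kf].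
Qed.

Lemma analytic_Px x : inbox x -> kf x != 0 -> kf x + b != 0 -> analytic_map (Px lam) x.
Proof.
move=> bx k0 kb0 i; have ac := analytic_at_coord i x.
apply: eq_analytic_at (analytic_at_pt0 (analytic_fHpt (dom_box i bx) k0 kb0) ac (analytic_kf x)) => y.
by rewrite /fHpt pt0 pt1 mxE.
Qed.

Lemma diff_Px x v i : inbox x -> kf x != 0 -> kf x + b != 0 ->
  'd (fun y => Px lam y 0 i) x v = fHu (x 0 i) (kf x) * v 0 i + fHk (x 0 i) (kf x) * dkf x v.
Proof.
move=> bx k0 kb0; have ac := analytic_at_coord i x; have d := dom_box i bx.
have -> : (fun y => Px lam y 0 i) = (fun y => fHpt (pt (y 0 i) (kf y))).
  by apply/funext => y; rewrite /fHpt pt0 pt1 mxE.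
apply: etrans (diff_pt v (analytic_fHpt d k0 kb0) ac (analytic_kf x)) _.
by congr (_ * _ + _ * _); [exact: diff_fHpt0|exact: diff_coord|exact: diff_fHpt1|exact: diff_kf].
Qed.

Lemma profkN u k : dom u k -> profk lam (- u) k = - profk lam u k.
Proof.
move=> d; have [_ <-] := dom_is_derive_profk lam bP (domN d).
have [_ <-] := is_deriveN (dom_is_derive_profk lam bP d).
by congr ('D_1 _ k); apply/funext => z; rewrite profN //; exact: dom_small d.
Qed.

Lemma fHkN u k : dom u k -> fHk (- u) k = - fHk u k.
Proof.
move=> d; rewrite !fHkE fQN // /fQk profkN // profN ?(dom_small d) //; ring.
Qed.

Lemma fQuN u k : fQu (- u) k = fQu u k.
Proof. by rewrite !fQuE ctN profUN. Qed.

Lemma fHuN u k : fHu (- u) k = fHu u k.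
Proof. by rewrite !fHuE fQuN. Qed.

Lemma fHu_gt0 u k : dom u k -> k * b <= 1 / 64 -> k != 0 -> k + b != 0 -> 0 < fHu u k.
Proof. by move=> d kb k0 kb0; rewrite mulr_gt0 ?fE_gt0 //; exact: (fQu_gt0 lamP bP). Qed.

Lemma st_fHk_normr u k : dom u k ->
  st u * fHk u k / fHu u k = st `|u| * fHk `|u| k / fHu `|u| k.
Proof. by move=> d; have [//|u0] := ger0P u; rewrite stN fHkN // fHuN mulrNN. Qed.

Lemma nonzero_coord x : - (2 * b) < kf x -> exists i, x 0 i != 0.
Proof.
move=> kx; apply: contrapT => /forallNP h.
have : kf x + 2 * b = 0.
  rewrite kf_tau big1 // => i _; have /negP := h i; rewrite negbK => /eqP ->.
  by rewrite /tau ct0 subrr mulr0.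
by move: kx; lra.
Qed.

Lemma st_ball u k : dom u k -> k <= 0 -> 0 < u -> 0 < st u.
Proof.
move=> d k0 u0; apply: st_gt0; rewrite u0 /=.
by have := ball_lt bP d k0; rewrite ger0_norm // ltW.
Qed.

(** [fHk] is below - [fH] / (k + 2 b) by [fHk_shell], and [fH] is at least [tau] [fHu] / (4 pi [st])
    by [shell_tau]. *)
Lemma shell_factor u k : dom u k -> - b < k < 0 -> 0 < u ->
  4 * pi * (st u * fHk u k / fHu u k) < - (tau u / (k + 2 * b)).
Proof.
move=> d kb u0; have [kb1 k0] := andP kb; have b0 : 0 < b by case/andP: bP.
have kk : k * b <= 1 / 64 by apply: (@le_trans _ _ 0); [rewrite nmulr_rle0 // ltW|lra].
have Hu : 0 < fHu u k.
  by apply: fHu_gt0 => //; [exact: ltr0_neq0|apply: lt0r_neq0; lra].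
have h1 := fHk_shell lamP bP d kb u0; have h2 := shell_tau lamP bP d kb (ltW u0).
have s0 := st_ball d (ltW k0) u0; have ka : 0 < k + 2 * b by lra.
have p0 : 0 < 4 * pi * st u by rewrite !mulr_gt0 // pi_gt0.
rewrite -mulNr ltr_pdivlMr // -subr_lt0 opprK.
have -> : 4 * pi * (st u * fHk u k / fHu u k) * (k + 2 * b) + tau u =
   (4 * pi * st u * ((k + 2 * b) * fHk u k) + tau u * fHu u k) / fHu u k.
  by move: (pi : R) => q; field; exact: lt0r_neq0.
rewrite pmulr_llt0 ?invr_gt0 //.
have : 4 * pi * st u * ((k + 2 * b) * fHk u k + fH u k) < 0 by rewrite pmulr_rlt0.
rewrite -/(tau u) in h2.
by rewrite mulrDr; move: (4 * pi * st u * _) (4 * pi * st u * fH u k) (tau u * _) h2 => p q r; lra.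
Qed.

(** The matrix is diagonal plus rank one: eliminating v leaves one scalar equation for d, with the
    number in the last hypothesis as coefficient. *)
Lemma kernel_linear x v (d : R) (Hu Hk : 'I_n -> R) : (forall i, 0 < Hu i) ->
  d = dkf x v -> (forall i, Hu i * v 0 i + Hk i * d = 0) ->
  1 + \sum_i 4 * pi * (st (x 0 i) * Hk i / Hu i) != 0 -> v = 0.
Proof.
move=> Hu0 dE H S0.
have vE i : v 0 i = - (Hk i / Hu i * d).
  have n0 := lt0r_neq0 (Hu0 i); apply: (mulfI n0).
  have -> : Hu i * - (Hk i / Hu i * d) = - (Hk i * d) by field.
  by apply/eqP; rewrite -subr_eq0 opprK; apply/eqP.
have d0 : d = 0.
  have : (1 + \sum_i 4 * pi * (st (x 0 i) * Hk i / Hu i)) * d = 0.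
    rewrite mulrDl mul1r mulr_suml {1}dE /dkf -big_split big1 //= => i _.
    by rewrite vE; move: (pi : R) => q; ring.
  by move=> /eqP; rewrite mulf_eq0 (negPf S0) => /eqP.
by apply/rowP => i; rewrite mxE vE d0 mulr0 oppr0.
Qed.

(** The coefficient in [kernel_linear] is positive where [fHk] has the sign of u. In the shell it is
    negative: each nonzero coordinate contributes less than - tau / (kf + 2 b), and these bounds add
    up to - 1. *)
Lemma Px_kernel x v : inbox x -> outer x \/ shell x \/ center x ->
  (forall i, 'd (fun y => Px lam y 0 i) x v = 0) -> v = 0.
Proof.
move=> bx reg H; have [k0 kb0] := region_neq n3 reg.
have Hu i : 0 < fHu (x 0 i) (kf x) by apply: fHu_gt0; rewrite ?kf_b //; exact: dom_box.
apply: (@kernel_linear x v (dkf x v) _ (fun i => fHk (x 0 i) (kf x)) Hu erefl) => [i|]; first by rewrite -diff_Px.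
have s0 i : 0 <= st `|x 0 i| by apply: st_ge0; rewrite normr_ge0 /=; exact: bx.
have Hu' i : 0 < fHu `|x 0 i| (kf x).
  by apply: fHu_gt0; rewrite ?kf_b //; apply: dom_normr; exact: dom_box.
have pos : (forall i, 0 <= fHk `|x 0 i| (kf x)) ->
    1 + \sum_i 4 * pi * (st (x 0 i) * fHk (x 0 i) (kf x) / fHu (x 0 i) (kf x)) != 0.
  move=> h; apply: lt0r_neq0; rewrite ltr_pwDl // sumr_ge0 // => i _.
  rewrite st_fHk_normr; last exact: dom_box.
  apply: mulr_ge0; first by rewrite mulr_ge0 ?pi_ge0.
  by apply: divr_ge0; [exact: mulr_ge0|exact: ltW].
case: reg => [ho|[hs|hc]].
- by apply: pos => i; apply: (fHk_outer lamP bP) => //; apply: dom_normr; exact: dom_box.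
- apply: ltr0_neq0.
  have ka : 0 < kf x + 2 * b by case/andP: hs => s1 _; have [b0 _] := andP bP; move: s1 b0; lra.
  have [|j xj] := @nonzero_coord x; first by move: ka; lra.
  have T : \sum_i - (tau (x 0 i) / (kf x + 2 * b)) = -1.
    by rewrite sumrN -mulr_suml -kf_tau mulfV ?lt0r_neq0.
  rewrite -ltrBrDl sub0r -T (bigD1 j) //= [ltRHS](bigD1 j) //=; apply: ltr_leD.
    rewrite st_fHk_normr; last exact: dom_box.
    by rewrite -(tau_normr (x 0 j)) shell_factor ?normr_gt0 //; apply: dom_normr; exact: dom_box.
  apply: ler_sum => i _; have [xi|xi] := eqVneq (x 0 i) 0.
    by rewrite xi st0 !mul0r mulr0 /tau ct0 subrr mulr0 mul0r oppr0.
  rewrite st_fHk_normr; last exact: dom_box.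
  apply: ltW.
  by rewrite -(tau_normr (x 0 i)) shell_factor ?normr_gt0 //; apply: dom_normr; exact: dom_box.
- by apply: pos => i; apply: (fHk_center lamP bP) => //; apply: dom_normr; exact: dom_box.
Qed.

(** Solving for v and inserting it into [dkf x v = 0] leaves t times a sum of nonnegative terms,
    positive at a nonzero coordinate. Thus the direction of [Qx] is an immersion on the level
    set. *)
Lemma Qx_kernel x v t : inbox x -> - (2 * b) < kf x <= 0 -> dkf x v = 0 ->
  (forall i, fQu (x 0 i) (kf x) * v 0 i = t * fQ (x 0 i) (kf x)) -> t = 0 /\ v = 0.
Proof.
move=> bx /andP[kx k0] d0 H.
have Qu i : 0 < fQu (x 0 i) (kf x) by apply: (fQu_gt0 lamP bP); rewrite ?kf_b //; exact: dom_box.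
have vE i : v 0 i = t * (fQ (x 0 i) (kf x) / fQu (x 0 i) (kf x)).
  have n0 := lt0r_neq0 (Qu i); apply: (mulfI n0); rewrite H.
  by rewrite mulrCA [X in _ = _ * X]mulrC divfK.
suff t0 : t = 0 by split => //; apply/rowP => i; rewrite vE t0 mul0r mxE.
have S i : st (x 0 i) * (fQ (x 0 i) (kf x) / fQu (x 0 i) (kf x)) =
    st `|x 0 i| * (fQ `|x 0 i| (kf x) / fQu `|x 0 i| (kf x)).
  have d := dom_box i bx; have [//|u0] := ger0P (x 0 i).
  by rewrite stN fQN // fQuN [X in _ = _ * X]mulNr mulrNN.
have P i : x 0 i != 0 -> 0 < 4 * pi * (st (x 0 i) * (fQ (x 0 i) (kf x) / fQu (x 0 i) (kf x))).
  move=> xi; rewrite S; have d := dom_normr (dom_box i bx); have u0 : 0 < `|x 0 i| by rewrite normr_gt0.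
  rewrite !mulr_gt0 ?pi_gt0 ?invr_gt0 //; first exact: st_ball d k0 u0.
    by apply: (fQ_gt0 lamP bP); rewrite ?kf_b.
  by apply: (fQu_gt0 lamP bP); rewrite ?kf_b.
have : t * \sum_i 4 * pi * (st (x 0 i) * (fQ (x 0 i) (kf x) / fQu (x 0 i) (kf x))) = 0.
  rewrite -[RHS]d0 mulr_sumr; apply: eq_bigr => i _; rewrite vE; move: (pi : R) => q; ring.
have [j xj] := nonzero_coord kx.
move=> /eqP; rewrite mulf_eq0 => /orP[/eqP//|]; rewrite gt_eqF //.
rewrite (bigD1 j) //= ltr_wpDr ?P // sumr_ge0 // => i _.
have [xi|xi] := eqVneq (x 0 i) 0; first by rewrite xi st0 mul0r mulr0.
exact/ltW/P.
Qed.

End Derivative.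

(** * Surjectivity of the coordinate *)

Section Descent.
Context {R : realType} {n : nat}.
Implicit Types x y p : 'rV[R]_n.

Definition nsq x : R := \sum_i x 0 i ^+ 2.

Lemma nsq_ge0 x : 0 <= nsq x. Proof. by apply: sumr_ge0 => i _; exact: sqr_ge0. Qed.

Lemma nsq_eq0 x : nsq x = 0 -> x = 0.
Proof.
move=> /psumr_eq0P h; apply/rowP => i; rewrite mxE; apply/eqP; rewrite -sqrf_eq0; apply/eqP.
by apply: h => // j _; exact: sqr_ge0.
Qed.

Lemma nsqZ c x : nsq (c *: x) = c ^+ 2 * nsq x.
Proof. by rewrite /nsq mulr_sumr; apply: eq_bigr => i _; rewrite mxE exprMn. Qed.

Lemma nsq_sub_ge x p : nsq x / 2 - nsq p <= nsq (x - p).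
Proof.
rewrite /nsq mulr_suml -sumrB; apply: ler_sum => i _; rewrite !mxE.
by have := sqr_ge0 (x 0 i / 2 - p 0 i * 1); move: (x 0 i) (p 0 i) => a c; have := sqr_ge0 (a - 2 * c); nra.
Qed.

(** A local diffeomorphism attains all values near F x, in particular those on the beginning of the
    segment from F x to p. *)
Lemma open_move (F : 'rV[R]_n -> 'rV[R]_n) x p (N : 'rV[R]_n -> Prop) : analytic_map F x ->
  (forall v, (forall i, 'd (fun y => F y 0 i) x v = 0) -> v = 0) -> (\forall y \near x, N y) ->
  exists y s, [/\ N y, 0 < s <= 1 & F y = F x + s *: (p - F x)].
Proof.
move=> aF ker nN; have dF := analytic_map_diff aF.
have [|g [ag gx _ Fg]] := analytic_inverse aF.
  by move=> v dv; apply: ker => i; rewrite (coord_diff i v dF) dv mxE.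
have cg := analytic_map_continuous ag.
have : \forall z \near F x, N (g z) /\ F (g z) = z.
  near=> z; split; near: z; last exact: Fg.
  by apply: (near_continuous (P := N) cg); rewrite gx.
move=> /near_normP[e e0 he].
pose q := `|p - F x| + 1; have q0 : 0 < q by rewrite ltr_wpDl.
pose s := Num.min 1 (e / q).
have s0 : 0 < s by rewrite lt_min ltr01 divr_gt0.
have [|Ng Fgz] := he (s *: (p - F x)).
  rewrite normrZ gtr0_norm //; apply: (@le_trans _ _ (e / q * q)).
    by rewrite ler_pM ?normr_ge0 ?(ltW s0) ?ge_min ?lexx ?orbT // lerDl.
  by rewrite divfK // lt0r_neq0.
by exists (g (F x + s *: (p - F x))), s; split; rewrite // s0 ge_min lexx.
Unshelve. all: by end_near. Qed.

Lemma nsq_move (F : 'rV[R]_n -> 'rV[R]_n) x y p s : 0 < s <= 1 -> F x <> p ->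
  F y = F x + s *: (p - F x) -> nsq (F y - p) < nsq (F x - p).
Proof.
move=> /andP[s0 s1] xp ->.
have -> : F x + s *: (p - F x) - p = (1 - s) *: (F x - p).
  by apply/rowP => i; rewrite !mxE; ring.
have n0 : 0 < nsq (F x - p).
  rewrite lt_neqAle nsq_ge0 andbT eq_sym; apply/eqP => /nsq_eq0/eqP.
  by rewrite subr_eq0 => /eqP.
rewrite nsqZ -[ltRHS]mul1r ltr_pM2r //; nra.
Qed.

Lemma cvg_norm_lt (T : Type) (F : set_system T) (FF : Filter F) (f : T -> R) :
  (forall e, 0 < e -> \forall y \near F, `|f y| < e) -> f @ F --> (0 : R).
Proof. by move=> h; apply/cvgr0Pnorm_lt. Qed.

Lemma cvg_nsq (T : Type) (G : set_system T) (FG : Filter G) (f : T -> 'rV[R]_n) (l p : 'rV[R]_n) :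
  (forall i, f y 0 i @[y --> G] --> l 0 i) -> nsq (f y - p) @[y --> G] --> nsq (l - p).
Proof.
move=> cf.
have h i : (f y 0 i - p 0 i) * (f y 0 i - p 0 i) @[y --> G] --> (l 0 i - p 0 i) * (l 0 i - p 0 i).
  have h1 : (f y 0 i - p 0 i) @[y --> G] --> l 0 i - p 0 i.
    by apply: cvgB; [exact: cf|exact: cvg_cst].
  exact (cvgM h1 h1).
have S (r : seq 'I_n) : (\sum_(i <- r) (f y 0 i - p 0 i) * (f y 0 i - p 0 i)) @[y --> G] -->
    \sum_(i <- r) (l 0 i - p 0 i) * (l 0 i - p 0 i).
  elim: r => [|i r IH].
    by rewrite big_nil; under eq_fun do rewrite big_nil; exact: cvg_cst.
  rewrite big_cons; under eq_fun do rewrite big_cons.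
  exact (cvgD (h i) IH).
have E y : nsq (y - p) = \sum_i (y 0 i - p 0 i) * (y 0 i - p 0 i).
  by apply: eq_bigr => i _; rewrite !mxE expr2.
by rewrite E; under eq_fun do rewrite E; exact: S.
Qed.

(** The distance to p has a minimum on K, and a minimum that can always be improved is 0. Only
    points at least as close to p as x0 have to be improved, which is how boundary points are
    discarded later. *)
Lemma descent (K : set 'rV[R]_n) (F : 'rV[R]_n -> 'rV[R]_n) p x0 : compact K -> K x0 ->
  (forall x i, K x -> {for x, continuous (fun y => F y 0 i)}) ->
  (forall x, K x -> nsq (F x - p) <= nsq (F x0 - p) -> F x <> p ->
     exists2 y, K y & nsq (F y - p) < nsq (F x - p)) ->
  exists2 x, K x & F x = p.
Proof.
move=> cK Kx0 cF H.
have cphi x : K x -> {for x, continuous (fun y => nsq (F y - p))}.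
  move=> Kx; apply: (cvg_nsq (nbhs_filter x)) => i; exact: cF.
have [c cin cmin] : exists2 c, c \in K & forall t, t \in K -> nsq (F c - p) <= nsq (F t - p).
  apply: (@EVT_min_rV R n (fun x => nsq (F x - p)) K) => //; first by exists x0.
  by apply: continuous_in_subspaceT => x; rewrite inE; exact: cphi.
have Kc : K c by rewrite inE in cin.
exists c => //; apply: contrapT => Fc.
have [|y Ky] := H c Kc _ Fc; first by apply: cmin; rewrite inE.
by rewrite ltNge cmin // inE.
Qed.

Lemma closure_ge0 (C : set 'rV[R]_n) (f : 'rV[R]_n -> R) x : closure C x -> {for x, continuous f} ->
  (forall y, C y -> 0 <= f y) -> 0 <= f x.
Proof.
move=> clx cf h; rewrite leNgt; apply/negP => fx.
have := near_continuous (P := fun z : R => z < 0) cf (lt_nbhsl fx) => /clx [y [Cy]] /=.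
by rewrite ltNge h.
Qed.

End Descent.

(** * Surjectivity region by region *)

Section Surjectivity.
Context {R : realType} {n : nat}.
Variable lam : R.
Hypothesis lamP : 1 < lam < 3 / 2.
Hypothesis n3 : (3 <= n)%N.
Implicit Types x y v p : 'rV[R]_n.
Local Notation b := (@gb R n).
Local Notation fE := (fE lam b).
Local Notation fQ := (fQ lam b).
Local Notation fH := (fH lam b).
Local Notation dom := (dom b).
Local Notation Px := (Px lam).
Local Notation Qx := (Qx lam).
Local Notation per := (per lam).
Let bP : 0 < b <= 1 / 768 := gbP n3.
Let b0 : 0 < b := gb_gt0 n3.

Lemma kf_continuous : continuous (@kf R n).
Proof. by move=> x; exact: analytic_at_continuous (analytic_kf x). Qed.

Lemma box_compact (I : set R) : closed I -> compact [set x : 'rV[R]_n | inbox x /\ I (kf x)].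
Proof.
move=> cI.
have -> : [set x : 'rV[R]_n | inbox x /\ I (kf x)] =
    [set x : 'rV[R]_n | forall i, `[(- (1 / 2) : R), 1 / 2]%classic (x ord0 i)] `&` (@kf R n @^-1` I).
  apply/seteqP; split => x /= [bx kx]; split => // i; move: (bx i); by rewrite /= in_itv /= ler_norml.
apply: compact_closedI.
  by apply: (@rV_compact _ _ (fun=> `[(- (1 / 2) : R), 1 / 2]%classic)) => i; exact: segment_compact.
by move/continuous_closedP: kf_continuous; apply.
Qed.

Lemma tau_quadratic (u : R) : tau u <= 64 * u ^+ 2.
Proof.
have h := cos_ge_quadratic (normr_ge0 (2 * pi * u)).
have e : cos `|2 * pi * u| = ct u by have [//|_] := ger0P (2 * pi * u); rewrite cosN.
rewrite e real_normK ?num_real // in h.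
have p2 : pi ^+ 2 <= 16 :> R.
  by have := pihalf_lt2 R; have := pi_gt0 R; move: (pi : R) => q; nra.
have e2 : (2 * pi * u) ^+ 2 = 4 * pi ^+ 2 * u ^+ 2 by move: (pi : R) => q; ring.
rewrite e2 in h; have u2 := sqr_ge0 u.
by rewrite /tau; move: (pi ^+ 2) (u ^+ 2) (ct u) h p2 u2 => q w c; nra.
Qed.

(** Each |Qx_i| is at least b |x_i| and [tau] is at most 64 x_i^2, so the squared norm of [Qx] is
    bounded below by a multiple of the sum of the [tau]. *)
Lemma nsq_Px_ge x : inbox x -> kf x <= 0 -> fE (kf x) ^+ 2 * (b ^+ 2 / 64 * (kf x + 2 * b)) <= nsq (Px x).
Proof.
move=> bx k0; rewrite Px_scale nsqZ ler_wpM2l ?sqr_ge0 // kf_tau mulr_sumr /nsq.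
apply: ler_sum => i _; rewrite mxE; have d := dom_box i bx.
rewrite -[leRHS]real_normK ?num_real // -(fQ_normr lamP bP) ?kf_b //.
have h := fQ_ball_ge lamP bP (dom_normr d) k0 (normr_ge0 _).
have t := tau_quadratic (x 0 i).
have : (b * `|x 0 i|) ^+ 2 <= fQ `|x 0 i| (kf x) ^+ 2.
  by rewrite ler_sqr // nnegrE; [rewrite mulr_ge0 // ltW|apply: le_trans h; rewrite mulr_ge0 // ltW].
apply: le_trans; rewrite exprMn real_normK ?num_real // mulrAC.
by have := sqr_ge0 b; move: (b ^+ 2) (x 0 i ^+ 2) (tau _) t => c w t; nra.
Qed.

(** [Px] has a pole along kf = - b, uniformly in the direction; this keeps the points of the descent
    away from that sphere. *)
Lemma Px_large (M : R) : exists e : R, [/\ 0 < e, e <= b / 2 &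
  forall x, inbox x -> 0 < `|kf x + b| <= e -> M < nsq (Px x)].
Proof.
pose C := ((b / 2) ^+ 2) ^+ 2 * (b ^+ 2 / 64 * (b / 2)).
have b20 : 0 < b / 2 by rewrite divr_gt0.
have C0 : 0 < C by rewrite !mulr_gt0 ?exprn_gt0 // ?invr_gt0.
pose e := Num.min (b / 2) (C / (`|M| + 1)).
have M1 : 0 < `|M| + 1 by rewrite ltr_wpDl.
have e0 : 0 < e by rewrite lt_min b20 divr_gt0.
have eb : e <= b / 2 by rewrite ge_min lexx.
exists e; split => // x bx ke; have /andP[k0 k1] := ke.
have : `|kf x + b| <= b / 2 := le_trans k1 eb.
rewrite ler_norml => /andP[h1 h2].
have kn : kf x <= 0 by lra.
have ka : b / 2 <= `|kf x| by rewrite ler0_norm //; lra.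
apply: lt_le_trans (nsq_Px_ge bx kn).
have EL := fE_large lamP bP e0 ka ke.
have e1 : e <= 1 by apply: le_trans eb _; case/andP: bP; lra.
have h3 : b ^+ 2 / 64 * (b / 2) <= b ^+ 2 / 64 * (kf x + 2 * b).
  by apply: ler_wpM2l; [rewrite divr_ge0 ?sqr_ge0|lra].
have h4 : ((b / 2) ^+ 2 / e) ^+ 2 <= fE (kf x) ^+ 2.
  by rewrite ler_sqr // nnegrE; [rewrite divr_ge0 ?sqr_ge0 // ltW|
    apply: le_trans EL; rewrite divr_ge0 ?sqr_ge0 // ltW].
have h5 : C / e ^+ 2 <= fE (kf x) ^+ 2 * (b ^+ 2 / 64 * (kf x + 2 * b)).
  have -> : C / e ^+ 2 = ((b / 2) ^+ 2 / e) ^+ 2 * (b ^+ 2 / 64 * (b / 2)).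
    by rewrite /C; field; exact: lt0r_neq0.
  by apply: ler_pM; rewrite ?sqr_ge0 // !mulr_ge0 ?sqr_ge0 // ltW.
apply: lt_le_trans h5; rewrite ltr_pdivlMr ?exprn_gt0 //.
have h6 : e * (`|M| + 1) <= C by rewrite -ler_pdivlMr // ge_min lexx orbT.
have := ler_norm M; have := normr_ge0 M; move: (`|M|) h6 => m h6 m0 Mm.
by move: (e) e0 e1 h6 => z z0 z1; nra.
Qed.

(** A starting point for the descent close to the sphere kf = 0, where [fE] vanishes and [Px] is
    small: it lies on a coordinate axis and its sign is prescribed. *)
Lemma axis_point j (s k : R) : `|s| = 1 -> 0 < `|k| <= b / 2 ->
  exists x h, [/\ inbox x, kf x = k, 0 < h <= 8 * `|k| & Px x = (s * h) *: delta_mx 0 j].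
Proof.
move=> s1 kk; have /andP[k0 kb] := kk.
have kb' := kb; rewrite ler_norml in kb'; have /andP[k1 k2] := kb'.
have [|u /andP[u0 u1] tu] := @tau_surj R (k + 2 * b).
  by apply/andP; split; [lra|case/andP: bP; lra].
have up : 0 < u.
  move: u0; rewrite le_eqVlt => /predU1P[u0|//].
  by move: tu; rewrite -u0 /tau ct0 subrr mulr0; lra.
pose x : 'rV[R]_n := (s * u) *: delta_mx 0 j.
have xE i : x 0 i = if i == j then s * u else 0.
  by rewrite !mxE eqxx /=; case: eqP => _; rewrite ?mulr1 ?mulr0.
have nx i : `|x 0 i| = if i == j then u else 0.
  by rewrite xE; case: ifP => _; rewrite ?normr0 // normrM s1 mul1r ger0_norm.
have bx : inbox x by move=> i; rewrite nx; case: ifP => // _; lra.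
have kx : kf x = k.
  apply/eqP; rewrite -subr_eq0; apply/eqP; have := kf_tau x.
  rewrite (bigD1 j) //= big1 => [|i ij]; last first.
    by rewrite -tau_normr nx (negPf ij) /tau ct0 subrr mulr0.
  by rewrite -tau_normr nx eqxx tu addr0; lra.
have d : dom u k by have := dom_normr (dom_box j bx); rewrite nx eqxx kx.
have kn0 : k != 0 by rewrite -normr_gt0.
have kbn : k + b != 0 by apply: lt0r_neq0; lra.
have kb64 : k * b <= 1 / 64 by rewrite -kx kf_b.
have E0 := fE_gt0 lam kn0 kbn.
exists x, (fH u k); split => //.
- rewrite mulr_gt0 //=; last exact: (fQ_gt0 lamP bP).
  have h1 := fE_small lamP bP kk.
  have Q0 := fQ_ge0 lamP bP d kb64 u0.
  (* k + b <= 3 b / 2 and [prof] <= 2 give 3 b, and the sine term gives b. With [fE] <= 2 |k| / b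
     this is the factor 8. *)
  have h2 : fQ u k <= 4 * b.
    have p4 := prof_le lamP bP d u0; have p0 := prof_ge0 lamP bP d u0.
    have s_1 : st u <= 1 by exact: sin_le1.
    by rewrite !fQE; move: b0; move: (prof lam u k) (st u) p4 p0 s_1 => p w p4 p0 s_1; nra.
  have -> : 8 * `|k| = 2 / b * `|k| * (4 * b) by field; exact: lt0r_neq0.
  by apply: ler_pM => //; exact: ltW.
- apply/rowP => i; rewrite mxE kx xE mxE [in RHS]mxE eqxx /=.
  case: eqP => _; last by rewrite mulr0 fH0.
  have [->|->] : s = 1 \/ s = -1.
    by have [s0|s0] := ger0P s; [left; rewrite -s1 ger0_norm|right; rewrite -s1 ltr0_norm // opprK].
    by rewrite !mul1r mulr1.
  by rewrite !mulN1r mulr1 fHN.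
Qed.

(** A short step along an axis with the sign of p_j is closer to p than 0 is. This separates the
    descent from the sphere kf = 0, where [Px] is 0. *)
Lemma nsq_axis j (s h : R) p : s = Num.sg (p 0 j) -> 0 < h < 2 * `|p 0 j| ->
  nsq ((s * h) *: delta_mx 0 j - p) < nsq p.
Proof.
move=> se /andP[h0 h2]; rewrite /nsq (bigD1 j) //= [ltRHS](bigD1 j) //=.
rewrite (eq_bigr (fun i => p 0 i ^+ 2)) => [|i /negPf ij]; last first.
  by rewrite !mxE eqxx ij /= mulr0 sub0r sqrrN.
rewrite ltrD2r !mxE !eqxx mulr1.
have p0 : p 0 j != 0 by rewrite -normr_gt0 -(pmulr_lgt0 _ (ltr0n R 2)) mulrC (lt_trans h0).
have s2 : s ^+ 2 = 1 by rewrite se sqr_sg p0.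
have ps : s * p 0 j = `|p 0 j| by rewrite se -normrEsg.
have -> : (s * h - p 0 j) ^+ 2 = s ^+ 2 * h ^+ 2 - 2 * h * (s * p 0 j) + p 0 j ^+ 2 by ring.
rewrite s2 ps; move: (`|p 0 j|) h2 => w h2.
by nra.
Qed.

Lemma Px_continuous x i : inbox x -> kf x + b != 0 -> {for x, continuous (fun y => Px y 0 i)}.
Proof.
move=> bx kb0; have [k0|k0] := eqVneq (kf x) 0; last first.
  by apply: analytic_at_continuous; exact: (analytic_Px lam n3 bx k0 kb0 i).
have cQ : {for x, continuous (fun y => Qx y 0 i)}.
  by apply: analytic_at_continuous; exact: (analytic_Qx lam n3 bx i).
have E0 : fE 0 = 0 by rewrite !fEE normr0 powR0 ?mul0r //; apply: lt0r_neq0; exact: lam_gt0.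
have cE : fE (kf y) @[y --> x] --> fE (kf x).
  rewrite k0 E0; apply: (cvg_norm_lt (nbhs_filter x)) => e e0.
  have b20 : 0 < b / 2 by rewrite divr_gt0.
  have h : 0 < Num.min (b / 2) (b / 2 * e) by rewrite lt_min b20 mulr_gt0.
  have H : \forall z \near kf x, `|z| < Num.min (b / 2) (b / 2 * e).
    rewrite k0; have c0 := @norm_continuous R R 0.
    apply: (near_continuous (f := fun z : R => `|z|) (P := fun z => z < Num.min (b / 2) (b / 2 * e)) c0).
    by rewrite normr0; exact: lt_nbhsl.
  have := near_continuous (f := @kf R n) (@kf_continuous x) H.
  apply: filterS => y; rewrite lt_min => /andP[y1 y2].
  have [->|y0] := eqVneq (kf y) 0; first by rewrite E0 normr0.
  have yn : 0 < `|kf y| by rewrite normr_gt0.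
  have h1 := fE_small lamP bP (k := kf y); rewrite yn (ltW y1) in h1.
  rewrite ger0_norm; last by rewrite divr_ge0 ?powR_ge0.
  apply: le_lt_trans (h1 isT) _.
  by rewrite -(invf_div b 2) ltr_pdivrMl ?divr_gt0.
rewrite (_ : (fun y => Px y 0 i) = (fun y => fE (kf y) * Qx y 0 i)).
  exact (cvgM cE cQ).
by apply/funext => y; rewrite Px_scale mxE.
Qed.

Lemma near_coord_lt x i (d : R) : `|x 0 i| < d -> \forall y \near x, `|(y : 'rV[R]_n) 0 i| < d.
Proof.
move=> xi; have c : {for x, continuous (fun y : 'rV[R]_n => y 0 i)}.
  by apply: analytic_at_continuous; exact: analytic_at_coord.
apply: (near_continuous (P := fun z : R => `|z| < d) c).
have c0 := @norm_continuous R R (x 0 i).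
by apply: (near_continuous (f := fun z : R => `|z|) (P := fun z => z < d) c0); exact: lt_nbhsl.
Qed.

Lemma near_inbox x : inbox x -> kf x <= 0 -> \forall y \near x, inbox y.
Proof.
move=> bx k0; have : \forall y \near x, forall i, `|(y : 'rV[R]_n) 0 i| < 1 / 2.
  by apply: (filter_forall (nbhs_filter x)) => i; apply: near_coord_lt; exact: (ball_lt bP (dom_box i bx) k0).
by apply: filterS => y h i; exact/ltW/h.
Qed.

Lemma near_kf_lt x (c : R) : kf x < c -> \forall y \near x, kf y < c.
Proof. by move=> h; exact: near_continuous (@kf_continuous x) (lt_nbhsl h). Qed.

Lemma near_kf_gt x (c : R) : c < kf x -> \forall y \near x, c < kf y.
Proof. by move=> h; exact: near_continuous (@kf_continuous x) (lt_nbhsr h). Qed.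

Lemma far_contra x p : 4 * nsq p < nsq (Px x) -> ~ nsq (Px x - p) <= nsq p.
Proof. by move=> h; have := nsq_sub_ge (Px x) p; lra. Qed.

Lemma fE0 : fE 0 = 0.
Proof. by rewrite !fEE normr0 powR0 ?mul0r //; apply: lt0r_neq0; exact: lam_gt0. Qed.

(** Descent from the origin, where [Px] = 0. Near the sphere kf = - b the squared norm of [Px]
    exceeds 4 [nsq p], so these points are farther from p than the start. *)
Lemma surj_center p : exists x, [/\ inbox x, center x & Px x = p].
Proof.
have [e [e0 eb far]] := Px_large (4 * nsq p).
pose K := [set x : 'rV[R]_n | inbox x /\ kf x <= - b - e].
have k00 : kf (0 : 'rV[R]_n) = - (2 * b).
  by rewrite /kf big1 ?sub0r // => i _; rewrite mxE /tau ct0 subrr mulr0.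
have P0 : Px (0 : 'rV[R]_n) = 0 by apply/rowP => i; rewrite !mxE fH0.
have kb x : kf x <= - b - e -> kf x + b != 0 /\ kf x != 0.
  by move=> h; split; apply: ltr0_neq0; lra.
have [||x i [bx kx]|x [bx kx] near_x xp|x [bx kx] xp] := @descent R n K Px p 0.
- exact: (box_compact (@closed_le R (- b - e))).
- by split => [i|]; [rewrite mxE normr0; lra|rewrite k00; lra].
- by apply: Px_continuous => //; case: (kb x kx).
- rewrite P0 sub0r -[X in _ <= X]mul1r -(expr1n _ 2) -sqrrN -nsqZ scaleN1r opprK in near_x.
  have [kb0 k0] := kb x kx.
  have {}kx : kf x < - b - e.
    rewrite lt_neqAle kx andbT; apply/eqP => ke; apply: (far_contra (x := x) (p := p)) near_x.
    apply: far => //; rewrite ke (_ : - b - e + b = - e) ?normrN ?gtr0_norm ?e0 ?lexx //; ring.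
  have cx : center x by rewrite /center; lra.
  have kn : kf x <= 0 by lra.
  have [|v||y [s [[by_ ky] s01 Fy]]] := @open_move R n Px x p (fun y => inbox y /\ kf y < - b - e).
  + exact: (analytic_Px lam n3).
  + by apply: (Px_kernel lamP n3) => //; right; right.
  + by apply: filterI; [exact: near_inbox|exact: near_kf_lt].
  exists y; first by split => //; exact: ltW.
  exact: nsq_move s01 xp Fy.
- by exists x; split => //; rewrite /center; lra.
Qed.

(** Descent from an axis point. On kf = 0 the image 0 is farther from p than the start, and near kf
    = - b the image is too large. *)
Lemma surj_shell p : p <> 0 -> exists x, [/\ inbox x, shell x & Px x = p].
Proof.
move=> p0; have [j pj] : exists j, p 0 j != 0.
  apply: contrapT => /forallNP h; apply: p0; apply/rowP => i; rewrite mxE.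
  by have /negP := h i; rewrite negbK => /eqP.
have [e [e0 eb far]] := Px_large (4 * nsq p).
pose K := [set x : 'rV[R]_n | inbox x /\ (- b + e <= kf x /\ kf x <= 0)].
pose k := Num.min (b / 2) (`|p 0 j| / 8).
have pj0 : 0 < `|p 0 j| by rewrite normr_gt0.
have k0 : 0 < k by rewrite lt_min !divr_gt0.
have kb2 : k <= b / 2 by rewrite ge_min lexx.
have kp : 8 * k <= `|p 0 j| by rewrite mulrC -ler_pdivlMr // ge_min lexx orbT.
have [||x0 [h [bx0 kx0 /andP[h0 h8] Px0]]] := @axis_point j (Num.sg (p 0 j)) (- k).
- by rewrite normr_sg pj.
- by rewrite normrN gtr0_norm // k0.
have phi0 : nsq (Px x0 - p) < nsq p.
  rewrite Px0; apply: nsq_axis => //; rewrite h0 /=; apply: le_lt_trans h8 _.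
  by rewrite normrN gtr0_norm //; apply: le_lt_trans kp _; lra.
have kb x : - b + e <= kf x -> kf x + b != 0.
  by move=> hh; apply: lt0r_neq0; lra.
have [||x i [bx [kx _]]|x [bx [kx1 kx2]] near_x xp|x [bx [kx1 kx2]] xp] := @descent R n K Px p x0.
- apply: (box_compact (I := [set z | - b + e <= z /\ z <= 0])).
  exact: closedI (@closed_ge R (- b + e)) (@closed_le R 0).
- by split => //; rewrite kx0; lra.
- by apply: Px_continuous => //; exact: kb.
- have {}near_x := le_lt_trans near_x phi0.
  have {}kx2 : kf x < 0.
    rewrite lt_neqAle kx2 andbT; apply/eqP => ke; move: near_x.
    by rewrite Px_scale ke fE0 scale0r sub0r -scaleN1r nsqZ sqrrN expr1n mul1r ltxx.
  have {}kx1 : - b + e < kf x.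
    rewrite lt_neqAle kx1 andbT; apply/eqP => ke; apply: (far_contra (x := x) (p := p)) (ltW near_x).
    apply: far => //; rewrite -ke (_ : - b + e + b = e) ?gtr0_norm ?e0 ?lexx //; ring.
  have sx : shell x by rewrite /shell kx2 andbT; lra.
  have [|v||y [s [[[by_ ky1] ky2] s01 Fy]]] := @open_move R n Px x p
      (fun y => (inbox y /\ - b + e < kf y) /\ kf y < 0).
  + by apply: (analytic_Px lam n3) => //; [exact: ltr0_neq0|apply: kb; exact: ltW].
  + by apply: (Px_kernel lamP n3) => //; right; left.
  + apply: filterI; last exact: near_kf_lt.
    by apply: filterI; [apply: near_inbox => //; exact: ltW|exact: near_kf_gt].
  exists y; first by split => //; split; exact: ltW.
  exact: nsq_move s01 xp Fy.
- exists x; split => //; rewrite /shell; apply/andP; split; first by lra.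
  rewrite lt_neqAle kx2 andbT; apply/eqP => ke; apply: p0.
  by rewrite -xp Px_scale ke fE0 scale0r.
Qed.

Lemma fH_le_half x i : inbox x -> outer x -> `|Px x 0 i| <= per / 2.
Proof.
move=> bx ox; rewrite mxE; have d := dom_box i bx.
have [xi|xi] := ltP `|x 0 i| (1 / 2).
  by apply: ltW; exact: (fH_lt_half lamP bP d ox (kf_b n3 x) xi).
have {}xi : `|x 0 i| = 1 / 2 by apply/eqP; rewrite eq_le xi bx.
have k4 : 4 - 2 * b <= kf x by case: d => _; rewrite -ct_normr xi ct_half; lra.
have [k0 kb0] := region_neq n3 (or_introl ox).
by rewrite -(fH_normr lamP n3 d (kf_b n3 x) k0 kb0) xi (fH_half lam bP k4).
Qed.

(** Here the descent could leave the box through a face. If a coordinate passed 1 / 2 in absolute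
    value, the shift by a period would push the corresponding |[Px]| above per / 2, while the
    segment from [Px x] to p stays within that bound. *)
Lemma surj_outer p : p <> 0 -> (forall i, `|p 0 i| <= per / 2) ->
  exists x, [/\ inbox x, outer x & Px x = p].
Proof.
move=> p0 pp; have [j pj] : exists j, p 0 j != 0.
  apply: contrapT => /forallNP h; apply: p0; apply/rowP => i; rewrite mxE.
  by have /negP := h i; rewrite negbK => /eqP.
pose K := [set x : 'rV[R]_n | inbox x /\ 0 <= kf x].
pose k := Num.min (b / 2) (`|p 0 j| / 8).
have pj0 : 0 < `|p 0 j| by rewrite normr_gt0.
have k0 : 0 < k by rewrite lt_min !divr_gt0.
have kb2 : k <= b / 2 by rewrite ge_min lexx.
have kp : 8 * k <= `|p 0 j| by rewrite mulrC -ler_pdivlMr // ge_min lexx orbT.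
have [||x0 [h [bx0 kx0 /andP[h0 h8] Px0]]] := @axis_point j (Num.sg (p 0 j)) k.
- by rewrite normr_sg pj.
- by rewrite gtr0_norm // k0.
have phi0 : nsq (Px x0 - p) < nsq p.
  rewrite Px0; apply: nsq_axis => //; rewrite h0 /=; apply: le_lt_trans h8 _.
  by rewrite gtr0_norm //; apply: le_lt_trans kp _; lra.
have [||x i [bx kx]|x [bx kx] near_x xp|x [bx kx] xp] := @descent R n K Px p x0.
- exact: (box_compact (@closed_ge R 0)).
- by split => //; rewrite kx0 ltW.
- by apply: Px_continuous => //; apply: lt0r_neq0; rewrite ltr_wpDl.
- have {}near_x := le_lt_trans near_x phi0.
  have {}kx : outer x.
    rewrite /outer lt_neqAle kx andbT; apply/eqP => ke; move: near_x.
    by rewrite Px_scale -ke fE0 scale0r sub0r -scaleN1r nsqZ sqrrN expr1n mul1r ltxx.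
  have [xn0 xnb] := region_neq n3 (or_introl kx).
  (* Coordinates move by less than 1 / 2, interior ones stay interior, and [kf] stays above 3 / 2
     where the shift formula may be needed. *)
  pose N (y : 'rV[R]_n) := [/\ outer y, 3 / 2 < kf x -> 3 / 2 < kf y &
    forall i, `|y 0 i - x 0 i| < 1 / 2 /\ (`|x 0 i| < 1 / 2 -> `|y 0 i| < 1 / 2)].
  have nN : \forall y \near x, N y.
    have n1 : \forall y \near x, 3 / 2 < kf x -> 3 / 2 < kf y.
      have [gt|le] := ltP (3 / 2) (kf x); last by near=> y.
      by have := near_kf_gt gt; apply: filterS => y.
    have n2 : \forall y \near x, forall i, `|(y : 'rV[R]_n) 0 i - x 0 i| < 1 / 2 /\ (`|x 0 i| < 1 / 2 -> `|y 0 i| < 1 / 2).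
      apply: (filter_forall (nbhs_filter x)) => i; apply: filterI.
        have h4 : 0 < (1 / 4 : R) by lra.
        have := near_polydisc x h4; apply: filterS => y /(_ i); rewrite !mxE => hh.
        by apply: le_lt_trans hh _; lra.
      have [lt|ge] := ltP `|x 0 i| (1 / 2); last by near=> y.
      by have := near_coord_lt lt; apply: filterS => y.
    near=> y; split; near: y; [exact: near_kf_gt|exact: n1|exact: n2].
  have [|v|y [s [[oy k32 Ny] s01 Fy]]] := @open_move R n Px x p N _ _ nN.
  + exact: (analytic_Px lam n3).
  + by apply: (Px_kernel lamP n3) => //; left.
  have xi_half i : 1 / 2 <= `|x 0 i| -> 3 / 2 < kf y.
    move=> xi; apply: k32; have [_] := dom_box i bx.
    have -> : ct (x 0 i) = -1.
      by rewrite -ct_normr (_ : `|x 0 i| = 1 / 2) ?ct_half //; apply/eqP; rewrite eq_le xi bx.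
    by case/andP: bP; lra.
  have domy (u : R) i : `|u| <= 1 / 2 -> ct u = ct (y 0 i) -> dom u (kf y).
    move=> u1 e; split => //; rewrite e -/(tau (y 0 i)) /kf lerD2r (bigD1 i) //= lerDl.
    by apply: sumr_ge0 => l _; exact: tau_ge0.
  have Fyi i : `|Px y 0 i| <= per / 2.
    rewrite Fy; case/andP: s01 => s0 s1; rewrite !mxE.
    have := fH_le_half i bx kx; rewrite mxE; have := pp i.
    rewrite !ler_norml; move: (fH _ _) (p 0 i) => z w /andP[w1 w2] /andP[z1 z2].
    by apply/andP; split; clear - s0 s1 w1 w2 z1 z2; nra.
  have byy : inbox y.
    move=> i; have [d1 d2] := Ny i.
    have [lt|ge] := ltP `|x 0 i| (1 / 2); first exact/ltW/d2.
    have k32y := xi_half i ge; have xb := bx i.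
    rewrite leNgt; apply/negP => yi; have := Fyi i; rewrite mxE; apply/negP; rewrite -ltNge.
    have [y0|y0] := leP 0 (y 0 i).
      rewrite ger0_norm // in yi.
      move: d1 xb; rewrite ltr_norml ler_norml => /andP[d1 d1'] /andP[xb1 xb2].
      have u1 : `|y 0 i - 1| < 1 / 2.
        by rewrite ltr_norml; apply/andP; split; clear - yi d1 d1' xb1 xb2; lra.
      have cu : ct (y 0 i - 1) = ct (y 0 i) by rewrite -[in RHS](subrK 1 (y 0 i)) ctD1.
      have du := domy _ i (ltW u1) cu.
      have := fH_lt_half lamP bP du oy (kf_b n3 y) u1.
      have := fH_shift lam bP (u := y 0 i - 1) k32y; rewrite subrK => -> ; last first.
        by move: u1; rewrite ltr_norml => /andP[v1 v2]; apply/andP; split; clear - v1 v2 d1 d1' xb1 xb2 yi; lra.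
      rewrite ltr_norml => /andP[v1 v2]; apply: lt_le_trans (ler_norm _); clear - v1 v2; lra.
    rewrite ltr0_norm // in yi.
    move: d1 xb; rewrite ltr_norml ler_norml => /andP[d1 d1'] /andP[xb1 xb2].
    have u1 : `|y 0 i + 1| < 1 / 2.
      by rewrite ltr_norml; apply/andP; split; clear - yi d1 d1' xb1 xb2; lra.
    have du := domy _ i (ltW u1) (ctD1 _).
    have := fH_lt_half lamP bP du oy (kf_b n3 y) u1.
    have -> := fH_shift lam bP (u := y 0 i) k32y; last first.
      by move: u1; rewrite ltr_norml => /andP[v1 v2]; apply/andP; split; clear - v1 v2 d1 d1' xb1 xb2 yi; lra.
    rewrite ltr_norml => /andP[v1 v2]; rewrite -normrN; apply: lt_le_trans (ler_norm _); clear - v1 v2; lra.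
  exists y; first by split => //; exact: ltW.
  exact: nsq_move s01 xp Fy.
- exists x; split => //; rewrite /outer lt_neqAle kx andbT; apply/eqP => ke; apply: p0.
  by rewrite -xp Px_scale -ke fE0 scale0r.
Unshelve. all: by end_near. Qed.

Lemma Qx_neq0 x : inbox x -> - (2 * b) < kf x -> Qx x <> 0.
Proof.
move=> bx kx /rowP Q0; have [i xi] := nonzero_coord kx; have d := dom_box i bx.
have := Q0 i; rewrite !mxE => /(congr1 (fun z : R => `|z|)); rewrite normr0 -(fQ_normr lamP bP d) ?kf_b //.
apply/eqP/lt0r_neq0; apply: (fQ_gt0 lamP bP) => //; [exact: dom_normr|exact: kf_b|by rewrite normr_gt0].
Qed.

(** For p nonzero: the points of the closed shell whose [Qx] is a nonnegative multiple of p,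
    expressed by closed conditions so that the set is compact. *)
Definition ray p : set 'rV[R]_n := [set x | [/\ inbox x, - b <= kf x <= 0,
  forall i j, Qx x 0 i * p 0 j = Qx x 0 j * p 0 i & 0 <= \sum_i Qx x 0 i * p 0 i]].

Lemma ray_compact p : compact (ray p).
Proof.
apply: (subclosed_compact _ (box_compact (@closedT R))); last by move=> x [].
move=> x cx.
have cc i : {for x, continuous (fun y : 'rV[R]_n => y 0 i)}.
  by apply: analytic_at_continuous; exact: analytic_at_coord.
have aC (a c : R) (f : 'rV[R]_n -> R) : analytic_at f x -> analytic_at (fun y => a + c * f y) x.
  move=> af; apply: analytic_atD; first exact: analytic_at_cst.
  by apply: analytic_atM => //; exact: analytic_at_cst.
have bx : inbox x.
  move=> i; rewrite ler_norml; apply/andP; split.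
    rewrite -subr_ge0 opprK addrC -[x 0 i]mul1r.
    apply: (closure_ge0 (f := fun y => 1 / 2 + 1 * y 0 i) cx).
      by apply: analytic_at_continuous; apply: aC; exact: analytic_at_coord.
    by move=> y [by_ _ _ _]; have := by_ i; rewrite ler_norml => /andP[]; lra.
  rewrite -subr_ge0 -mulN1r.
  apply: (closure_ge0 (f := fun y => 1 / 2 + (- 1) * y 0 i) cx).
    by apply: analytic_at_continuous; apply: aC; exact: analytic_at_coord.
  by move=> y [by_ _ _ _]; have := by_ i; rewrite ler_norml => /andP[]; lra.
have aQ i : analytic_at (fun y => Qx y 0 i) x := analytic_Qx lam n3 bx i.
split => //.
- apply/andP; split.
    rewrite -subr_ge0 opprK addrC -[kf x]mul1r.
    apply: (closure_ge0 (f := fun y => b + 1 * kf y) cx).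
      by apply: analytic_at_continuous; apply: aC; exact: analytic_kf.
    by move=> y [_ /andP[y1 y2] _ _]; lra.
  rewrite -subr_ge0 -mulN1r.
  apply: (closure_ge0 (f := fun y => 0 + (- 1) * kf y) cx).
    by apply: analytic_at_continuous; apply: aC; exact: analytic_kf.
  by move=> y [_ /andP[y1 y2] _ _]; lra.
- have le i j : 0 <= Qx x 0 i * p 0 j - Qx x 0 j * p 0 i.
    apply: (closure_ge0 (f := fun y => Qx y 0 i * p 0 j - Qx y 0 j * p 0 i) cx).
      apply: analytic_at_continuous; apply: analytic_atB; apply: analytic_atM => //; exact: analytic_at_cst.
    by move=> y [_ _ -> _]; rewrite subrr.
  move=> i j; have := le i j; have := le j i; rewrite !subr_ge0 => h1 h2.
  by apply/eqP; rewrite eq_le h1 h2.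
- apply: (closure_ge0 (f := fun y => \sum_i Qx y 0 i * p 0 i) cx).
    apply: analytic_at_continuous; apply: analytic_at_sum => i; apply: analytic_atM => //.
    exact: analytic_at_cst.
  by move=> y [].
Qed.

Lemma rayP p x : p <> 0 -> inbox x -> - b <= kf x <= 0 ->
  ray p x <-> exists2 c, 0 < c & Qx x = c *: p.
Proof.
move=> p0 bx kx; split; last first.
  move=> [c c0 Q]; split => //; first by move=> i j; rewrite Q !mxE; ring.
  by rewrite Q; apply: sumr_ge0 => i _; rewrite mxE -mulrA mulr_ge0 ?(ltW c0) // -expr2 sqr_ge0.
move=> [_ _ col pos].
have [j pj] : exists j, p 0 j != 0.
  apply: contrapT => /forallNP h; apply: p0; apply/rowP => i; rewrite mxE.
  by have /negP := h i; rewrite negbK => /eqP.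
have Q : Qx x = (Qx x 0 j / p 0 j) *: p.
  apply/rowP => i; rewrite [RHS]mxE mulrAC -col mulfK //.
exists (Qx x 0 j / p 0 j) => //.
have c0 : Qx x 0 j / p 0 j != 0.
  apply/eqP => e; apply: (Qx_neq0 bx); last by rewrite Q e scale0r.
  by case/andP: kx => kx _; move: b0; lra.
rewrite lt_neqAle eq_sym c0 /= leNgt; apply/negP => cn; move: pos; apply/negP; rewrite -ltNge.
rewrite (eq_bigr (fun i => (Qx x 0 j / p 0 j) * p 0 i ^+ 2)) => [|i _]; last first.
  by rewrite {1}Q mxE -mulrA expr2.
rewrite -mulr_sumr -/(nsq p) nmulr_rlt0 // lt_neqAle nsq_ge0 andbT eq_sym.
by apply/eqP => /nsq_eq0.
Qed.

(** [shell_cmp] excludes kf x < kf y, and [Qx_ray_inj] excludes equality. *)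
Lemma shell_le_kf x y : inbox x -> inbox y -> shell x -> shell y ->
  (exists2 t, 0 < t < 1 & Px x = t *: Px y) -> kf y < kf x.
Proof.
move=> bx by_ sx sy [t /andP[t0 t1] e]; rewrite ltNge; apply/negP => kk.
have le i : `|Px x 0 i| <= `|Px y 0 i|.
  by rewrite e mxE normrM gtr0_norm // ler_piMl // ltW.
have [ltk|gek] := ltP (kf x) (kf y); first exact: (shell_cmp lamP n3 bx by_ sx sy le ltk).
have k : kf x = kf y by apply/eqP; rewrite eq_le kk gek.
have [k0 kb0] := region_neq n3 (or_intror (or_introl sx)).
have E0 := lt0r_neq0 (fE_gt0 lam k0 kb0).
have Qe : Qx y = t^-1 *: Qx x.
  have : fE (kf x) *: Qx x = fE (kf x) *: (t *: Qx y) by rewrite -Px_scale e Px_scale k !scalerA mulrC.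
  move=> /(scalerI E0) ->; rewrite scalerA mulVf ?scale1r //; exact: lt0r_neq0.
have kx : - (2 * b) < kf x by case/andP: sx => h _; move: h b0; lra.
have xy : x = y by apply: (Qx_ray_inj lamP n3 bx by_ k kx _ Qe); rewrite invr_gt0.
rewrite xy in e.
have : (1 - t) *: Px y = 0 by rewrite scalerBl scale1r -e subrr.
move/eqP; rewrite scaler_eq0 subr_eq0 eq_sym (lt_eqF t1) /= Px_scale -xy scaler_eq0 (negPf E0) /= => /eqP.
exact: Qx_neq0.
Qed.

Lemma shell_Q_P x p c : shell x -> Qx x = c *: p -> 0 < c -> exists2 c', 0 < c' & Px x = c' *: p.
Proof.
move=> sx Q c0; have [k0 kb0] := region_neq n3 (or_intror (or_introl sx)).
exists (fE (kf x) * c); last by rewrite Px_scale Q scalerA.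
by rewrite mulr_gt0 // fE_gt0.
Qed.

Lemma shell_P_Q x p c : shell x -> Px x = c *: p -> 0 < c -> exists2 c', 0 < c' & Qx x = c' *: p.
Proof.
move=> sx P c0; have [k0 kb0] := region_neq n3 (or_intror (or_introl sx)).
have E0 := fE_gt0 lam k0 kb0.
exists ((fE (kf x))^-1 * c); first by rewrite mulr_gt0 ?invr_gt0.
by rewrite -scalerA -P Px_scale scalerA mulVf ?scale1r // lt0r_neq0.
Qed.

(** The shell contains points over the ray of p. On the compact set [ray p] the maximum of [kf] must
    be 0, since halving [Px] would increase [kf], and the minimum must be - b, since doubling [Px]
    would decrease it. *)
Lemma sphere_exists (kap : R) p : kap = 0 \/ kap = - b -> p <> 0 ->
  exists x c, [/\ inbox x, kf x = kap, 0 < c & Qx x = c *: p].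
Proof.
move=> hk p0.
have shell_itv x : shell x -> - b <= kf x <= 0 by move=> /andP[h1 h2]; rewrite !ltW.
have T (t : R) (t0 : 0 < t) : exists x, [/\ inbox x, shell x, Px x = t *: p & ray p x].
  have [|x [bx sx Pxp]] := @surj_shell (t *: p).
    by move=> /eqP; rewrite scaler_eq0 gt_eqF //= => /eqP.
  exists x; split => //; apply/rayP => //; first exact: shell_itv.
  exact: shell_P_Q sx Pxp t0.
have [x1 [bx1 sx1 _ rx1]] := T 1 ltr01.
have ne : ray p !=set0 by exists x1.
have ck (A : set 'rV[R]_n) : {within A, continuous (@kf R n)} by apply: continuous_subspaceT; exact: kf_continuous.
have fin x : ray p x -> kf x = kap -> exists x c, [/\ inbox x, kf x = kap, 0 < c & Qx x = c *: p].
  move=> rx kx; have [bx kx' _ _] := rx.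
  by have [c c0 Q] := (rayP p0 bx kx').1 rx; exists x, c.
have move_ x t : ray p x -> shell x -> 0 < t -> exists y, [/\ inbox y, shell y, Px y = t *: Px x & ray p y].
  move=> rx sx t0; have [bx kx _ _] := rx.
  have [c c0 Q] := (rayP p0 bx kx).1 rx.
  have [c' c'0 P] := shell_Q_P sx Q c0.
  have [|y [by_ sy Py ry]] := T (t * c'); first by rewrite mulr_gt0.
  by exists y; split => //; rewrite Py P scalerA.
case: hk => hk.
- have [x] := EVT_max_rV ne (@ray_compact p) (ck _).
  rewrite inE => rx xm; apply: (fin x rx).
  have [bx /andP[kx1 kx2] _ _] := rx.
  rewrite hk; apply/eqP; rewrite eq_le kx2 /= leNgt; apply/negP => k0.
  have sx : shell x.
    rewrite /shell k0 andbT; case/andP: sx1 => s1 _; apply: lt_le_trans s1 _.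
    by apply: xm; rewrite inE.
  have [|y [by_ sy Py ry]] := move_ x 2^-1 rx sx; first by rewrite invr_gt0.
  have : kf x < kf y.
    by apply: shell_le_kf => //; exists 2^-1 => //; rewrite invr_gt0 ltr0n /= invf_lt1 ?ltr1n.
  by rewrite ltNge xm // inE.
- have [x] := EVT_min_rV ne (@ray_compact p) (ck _).
  rewrite inE => rx xm; apply: (fin x rx).
  have [bx /andP[kx1 kx2] _ _] := rx.
  rewrite hk; apply/eqP; rewrite eq_le kx1 andbT leNgt; apply/negP => k0.
  have sx : shell x.
    rewrite /shell k0 /=; case/andP: sx1 => _ s1; apply: le_lt_trans s1.
    by apply: xm; rewrite inE.
  have [|y [by_ sy Py ry]] := move_ x 2 rx sx; first by [].
  have : kf y < kf x.
    apply: shell_le_kf => //; exists 2^-1; first by rewrite invr_gt0 ltr0n /= invf_lt1 ?ltr1n.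
    by rewrite Py scalerA mulVf ?scale1r.
  by rewrite ltNge xm // inE.
Qed.

End Surjectivity.

(** * The action *)

Section Lattice.
Context {R : realType} {n : nat}.
Implicit Types x y : 'rV[R]_n.

Definition intv (m : 'rV[int]_n) : 'rV[R]_n := map_mx intr m.

Lemma intvD m m' : intv (m + m') = intv m + intv m'. Proof. exact: map_mxD. Qed.
Lemma intvN m : intv (- m) = - intv m. Proof. exact: map_mxN. Qed.
Lemma intvB m m' : intv (m - m') = intv m - intv m'. Proof. exact: map_mxB. Qed.

Lemma torus_projP x y : torus_proj x = torus_proj y <-> exists m, x = y + intv m.
Proof.
rewrite /torus_proj; split.
  move=> /eqP; rewrite piE /= => /forallP xy.
  have /(_ _)/intrP/cid h := xy; exists (\row_i projT1 (h i)).
  apply/rowP => i; rewrite !mxE; case: (h i) => m /= <-.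
  by rewrite !mxE addrC subrK.
move=> [m ->]; apply/eqP; rewrite piE /=; apply/forallP => i.
by rewrite !mxE addrAC subrr add0r; apply/intrP; eexists.
Qed.

Definition wrap (T u : R) : R := u - T * (Num.floor (u / T + 1 / 2))%:~R.

Lemma wrap_itv T u : 0 < T -> - (T / 2) <= wrap T u < T / 2.
Proof.
move=> T0; have /andP[h1 h2] := floor_itv (u / T + 1 / 2).
rewrite /wrap; move: (Num.floor _) h1 h2 => m; rewrite intrD /= => h1 h2.
have e : u = T * (u / T) by rewrite mulrC divfK // lt0r_neq0.
move: e h1 h2; move: (u / T) (m%:~R : R) => z w -> h1 h2.
by apply/andP; split; nra.
Qed.

Lemma wrap_eq (T u v : R) (m : int) : 0 < T -> - (T / 2) <= u < T / 2 -> - (T / 2) <= v < T / 2 ->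
  u = v + T * m%:~R -> u = v.
Proof.
move=> T0 /andP[u1 u2] /andP[v1 v2] e.
have m1 : -1 < m%:~R :> R by rewrite -(ltr_pM2l T0); lra.
have m2 : m%:~R < 1 :> R by rewrite -(ltr_pM2l T0); lra.
have m0 : m = 0.
  case: m m1 m2 {e} => k; first by rewrite -[(Posz k)%:~R]/(k%:R) ltrn1 ltnS leqn0 => _ /eqP ->.
  rewrite NegzE mulrNz ltrN2 -[(Posz k.+1)%:~R]/(k.+1%:R) => h.
  by move: h; rewrite ltrn1.
by rewrite e m0 mulr0 addr0.
Qed.

(** Half-open, so that each point of the torus has exactly one representative. *)
Definition hbox x : Prop := forall i, - (1 / 2) <= x 0 i < 1 / 2.
Definition bxr x : 'rV[R]_n := \row_i wrap 1 (x 0 i).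

Lemma hbox_bxr x : hbox (bxr x).
Proof. by move=> i; rewrite mxE; exact: wrap_itv. Qed.

Lemma bxr_int x : exists m, bxr x = x + intv m.
Proof.
exists (\row_i - Num.floor (x 0 i / 1 + 1 / 2)).
by apply/rowP => i; rewrite !mxE /wrap mul1r mulrNz.
Qed.

Lemma hbox_int_eq x y m : hbox x -> hbox y -> x = y + intv m -> x = y.
Proof.
move=> hx hy e; apply/rowP => i.
apply: (wrap_eq (T := 1) (m := m 0 i)) => //.
by rewrite mul1r e !mxE.
Qed.

Lemma bxr_id x : hbox x -> bxr x = x.
Proof. by move=> hx; have [m e] := bxr_int x; apply: hbox_int_eq e => //; exact: hbox_bxr. Qed.

Lemma bxr_proj x y : torus_proj x = torus_proj y <-> bxr x = bxr y.
Proof.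
have [m ex] := bxr_int x; have [m' ey] := bxr_int y.
split=> [/torus_projP[p e]|e].
  apply: (@hbox_int_eq _ _ (p + m - m')); try exact: hbox_bxr.
  by rewrite ex ey e intvB intvD; apply/rowP => i; rewrite !mxE; ring.
apply/torus_projP; exists (m' - m).
have -> : x = bxr x - intv m by rewrite ex addrK.
by rewrite e ey intvB addrA.
Qed.

Lemma proj_bxr x : torus_proj (bxr x) = torus_proj x.
Proof. by apply/bxr_proj; rewrite bxr_id //; exact: hbox_bxr. Qed.

Lemma hbox_inbox x : hbox x -> inbox x.
Proof. by move=> hx i; have /andP[h1 h2] := hx i; rewrite ler_norml h1 ltW. Qed.

Lemma near_bxr x : inbox x -> (forall i, `|x 0 i| < 1 / 2) -> \forall y \near x, hbox y.
Proof.
move=> bx hx; have : \forall y \near x, forall i, `|(y : 'rV[R]_n) 0 i| < 1 / 2.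
  by apply: (filter_forall (nbhs_filter x)) => i; apply: near_coord_lt; exact: hx.
by apply: filterS => y hy i; have := hy i; rewrite ltr_norml => /andP[/ltW -> ->].
Qed.

(** Matrices act on columns; on row vectors this is right multiplication by the transpose, which
    keeps [act] a left action. *)
Definition act (g : 'M[int]_n) y : 'rV[R]_n := y *m (map_mx intr g)^T.

Lemma actD g x y : act g (x + y) = act g x + act g y. Proof. exact: mulmxDl. Qed.
Lemma actZ g c x : act g (c *: x) = c *: act g x. Proof. by rewrite /act scalemxAl. Qed.
Lemma act0 g : act g 0 = 0. Proof. exact: mul0mx. Qed.
Lemma act1 x : act 1%:M x = x. Proof. by rewrite /act map_mx1 trmx1 mulmx1. Qed.

Lemma actM g h x : act (g *m h) x = act g (act h x).
Proof. by rewrite /act map_mxM trmx_mul mulmxA. Qed.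

Lemma act_intv g m : act g (intv m) = intv (m *m g^T).
Proof. by rewrite /act /intv map_mxM map_trmx. Qed.

Lemma SLZ_unit g : @SLZ n g -> g \in unitmx.
Proof. by rewrite unitmxE /= => ->; exact: unitr1. Qed.

Lemma actK g x : @SLZ n g -> act (invmx g) (act g x) = x.
Proof. by move=> /SLZ_unit gu; rewrite -actM mulVmx // act1. Qed.

Lemma act_neq0 g x : @SLZ n g -> x <> 0 -> act g x <> 0.
Proof. by move=> hg x0 e; apply: x0; rewrite -(actK x hg) e act0. Qed.

End Lattice.

(** * The action as a relation between representatives *)

Section Action.
Context {R : realType} {n : nat}.
Variable lam : R.
Hypothesis lamP : 1 < lam < 3 / 2.
Hypothesis n3 : (3 <= n)%N.
Implicit Types x y p : 'rV[R]_n.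
Implicit Types g h : 'M[int]_n.
Local Notation b := (@gb R n).
Local Notation fE := (fE lam b).
Local Notation fH := (fH lam b).
Local Notation Px := (Px lam).
Local Notation Qx := (Qx lam).
Local Notation per := (per lam).
Let bP : 0 < b <= 1 / 768 := gbP n3.
Let b0 : 0 < b := gb_gt0 n3.
Let per0 : 0 < per := per_gt0 lamP bP.

Definition sphere_level (kap : R) := kap = 0 \/ kap = - b.

(* [Px] is a coordinate with values in [R^n / per Z^n] on the outer region and in [R^n] on the shell
   and in the center, while only the direction of [Qx] matters on the two spheres. *)
Inductive act_rel g x y : Prop :=
| act_outer m : outer x -> outer y -> Px y = act g (Px x) + per *: intv m -> act_rel g x y
| act_sphere kap c : sphere_level kap -> kf x = kap -> kf y = kap -> 0 < c ->
    Qx y = c *: act g (Qx x) -> act_rel g x y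
| act_inner : (shell x /\ shell y) \/ (center x /\ center y) -> Px y = act g (Px x) -> act_rel g x y.

Lemma region_cases x : [\/ outer x, sphere_level (kf x), shell x | center x].
Proof.
rewrite /outer /sphere_level /shell /center.
case: (ltgtP (kf x) 0) => k0; [|by constructor 1|by constructor 2; left].
case: (ltgtP (kf x) (- b)) => k1; [by constructor 4|by constructor 3|by constructor 2; right].
Qed.

Lemma outer_sphere x : outer x -> ~ sphere_level (kf x).
Proof. by rewrite /outer => h [] e; move: h b0; rewrite e; lra. Qed.

Lemma shell_sphere x : shell x -> ~ sphere_level (kf x).
Proof. by move=> /andP[h1 h2] [] e; move: h1 h2; rewrite e ltxx. Qed.

Lemma center_sphere x : center x -> ~ sphere_level (kf x).
Proof.
by rewrite /center => h [] e; move: h b0; rewrite e; lra.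
Qed.

Lemma shell_center x : shell x -> ~ center x.
Proof. by move=> /andP[h _]; rewrite /center => /(lt_trans h); rewrite ltxx. Qed.

Lemma outer_inner x : outer x -> ~ (shell x \/ center x).
Proof.
rewrite /outer => h [/andP[_ h']|]; first by move: (lt_trans h h'); rewrite ltxx.
by rewrite /center; move: h b0; lra.
Qed.

Lemma sphere_kap kap : sphere_level kap -> - (2 * b) < kap <= 0.
Proof. by case=> ->; apply/andP; split; move: b0; lra. Qed.

Lemma hbox_Px x i : hbox x -> outer x -> - (per / 2) <= Px x 0 i < per / 2.
Proof.
move=> hx ox; have bx := hbox_inbox hx; have := fH_le_half lamP n3 i bx ox.
rewrite ler_norml => /andP[h1 h2]; rewrite h1 /=.
have d := dom_box i bx.
have [xi|xi] := ltP `|x 0 i| (1 / 2).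
  by rewrite mxE; apply: le_lt_trans (ler_norm _) _; exact: (fH_lt_half lamP bP d ox (kf_b n3 x) xi).
have e : x 0 i = - (1 / 2).
  have /andP[x1 x2] := hx i; apply/eqP; rewrite eq_le x1 andbT.
  by have [x0|x0] := ler0P (x 0 i); move: xi; [rewrite (ler0_norm x0)|rewrite (gtr0_norm x0)]; lra.
have k4 : 4 - 2 * b <= kf x by case: d => _; rewrite e ctN ct_half; lra.
have -> : Px x 0 i = - (per / 2).
  by rewrite mxE e fHN; [rewrite (fH_half lam bP k4)|exact: dom_half].
by move: per0; lra.
Qed.

(** Injectivity region by region: [Px] modulo per in the half-open cube outside, [Qx] up to a
    positive factor on the spheres, [Px] inside. The mixed cases contradict the disjointness of the
    regions. *)
Lemma act_rel_uniq g x y z : hbox y -> hbox z -> act_rel g x y -> act_rel g x z -> y = z.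
Proof.
move=> hy hz; have by_ := hbox_inbox hy; have bz := hbox_inbox hz.
case=> [m ox oy ey|kap c sk kx ky c0 ey|ry ey]; case=> [m' ox' oz ez|kap' c' sk' kx' kz c'0 ez|rz ez].
- apply: (Px_inj lamP n3) => //; first by left.
  have E : Px y = Px z + per *: intv (m - m').
    by rewrite ey ez intvB scalerBr -addrA; congr (_ + _); rewrite addrC subrK.
  apply/rowP => i; apply: (wrap_eq (T := per) (m := (m - m') 0 i)) => //; try exact: hbox_Px.
  by rewrite [in LHS]E mxE; congr (_ + _); rewrite !mxE.
- by case: (outer_sphere ox); rewrite kx'.
- by case: rz => -[rx _]; case: (outer_inner ox); [left|right].
- by case: (outer_sphere ox'); rewrite kx.
- apply: (Qx_ray_inj lamP n3 (c := c' / c)) => //.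
  + by rewrite ky kz -kx -kx'.
  + by rewrite ky; case/andP: (sphere_kap sk).
  + by rewrite divr_gt0.
  + by rewrite ez ey scalerA divfK // lt0r_neq0.
- by case: rz => -[rx _]; [case: (shell_sphere rx)|case: (center_sphere rx)]; rewrite kx.
- by case: ry => -[rx _]; case: (outer_inner ox'); [left|right].
- by case: ry => -[rx _]; [case: (shell_sphere rx)|case: (center_sphere rx)]; rewrite kx'.
- apply: (Px_inj lamP n3) => //; last by rewrite ey ez.
  by case: ry => -[rx ry]; case: rz => -[rx' rz]; [right; left|case: (shell_center rx rx')|
    case: (shell_center rx' rx)|right; right].
Qed.

Lemma act_rel_id x : act_rel 1%:M x x.
Proof.
have [ox|sx|sx|cx] := region_cases x.
- apply: (@act_outer _ _ _ 0) => //; rewrite act1 (_ : intv 0 = 0) ?scaler0 ?addr0 //.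
  by apply/rowP => i; rewrite !mxE.
- by apply: (@act_sphere _ _ _ (kf x) 1) => //; rewrite act1 scale1r.
- by apply: act_inner; [left|rewrite act1].
- by apply: act_inner; [right|rewrite act1].
Qed.

Lemma act_rel_comp g h x y z : act_rel h x y -> act_rel g y z -> act_rel (g *m h) x z.
Proof.
case=> [m ox oy ey|kap c sk kx ky c0 ey|ry ey]; case=> [m' oy' oz ez|kap' c' sk' ky' kz c'0 ez|rz ez].
- apply: (@act_outer _ _ _ (m *m g^T + m')) => //.
  by rewrite ez ey actD actZ act_intv actM intvD scalerDr addrA.
- by case: (outer_sphere oy); rewrite ky'.
- by case: rz => -[rx _]; case: (outer_inner oy); [left|right].
- by case: (outer_sphere oy'); rewrite ky.
- apply: (@act_sphere _ _ _ kap (c' * c)) => //; first by rewrite kz -ky' ky.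
    exact: mulr_gt0.
  by rewrite ez ey actZ scalerA actM.
- by case: rz => -[rx _]; [case: (shell_sphere rx)|case: (center_sphere rx)]; rewrite ky.
- by case: ry => -[_ rx]; case: (outer_inner oy'); [left|right].
- by case: ry => -[_ rx]; [case: (shell_sphere rx)|case: (center_sphere rx)]; rewrite ky'.
- apply: act_inner; last by rewrite ez ey actM.
  by case: ry => -[rx ry]; case: rz => -[ry' rz]; [left|case: (shell_center ry ry')|
    case: (shell_center ry' ry)|right].
Qed.

(** In the outer region [Px] is not 0 modulo the lattice, the origin having been replaced by the
    sphere. The matrix and its inverse preserve the lattice, so this persists under the action. *)
Lemma scale_intv_neq0 g x : hbox x -> outer x -> @SLZ n g ->
  forall m, act g (Px x) <> per *: intv m.
Proof.
move=> hx ox hg m e.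
have E : Px x = per *: intv (m *m (invmx g)^T) by rewrite -(actK (Px x) hg) e actZ act_intv.
have P0 : Px x = 0.
  apply/rowP => i; rewrite [RHS]mxE; apply: (wrap_eq (T := per) (m := (m *m (invmx g)^T) 0 i)) => //.
  - exact: hbox_Px.
  - by rewrite oppr_le0 !divr_ge0 ?divr_gt0 // ltW.
  - by rewrite add0r {1}E !mxE.
have [k0 kb0] := region_neq n3 (or_introl ox).
apply: (Qx_neq0 lamP n3 (hbox_inbox hx)); first by move: ox b0; rewrite /outer; lra.
by move: P0; rewrite Px_scale => /eqP; rewrite scaler_eq0 gt_eqF ?fE_gt0 //= => /eqP.
Qed.

Lemma act_rel_total g x : hbox x -> @SLZ n g -> exists2 y, hbox y & act_rel g x y.
Proof.
move=> hx hg; have bx := hbox_inbox hx.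
have small y : inbox y -> kf y <= 0 -> hbox y.
  move=> by_ ky i; have := ball_lt bP (dom_box i by_) ky.
  by rewrite ltr_norml => /andP[/ltW -> ->].
have P0 : kf x != 0 -> kf x + b != 0 -> - (2 * b) < kf x -> act g (Px x) <> 0.
  move=> k0 kb0 kx; apply: act_neq0 => //; rewrite Px_scale => /eqP.
  rewrite scaler_eq0 gt_eqF ?fE_gt0 //= => /eqP; exact: (Qx_neq0 lamP n3).
have [ox|sx|sx|cx] := region_cases x.
- pose p := act g (Px x); pose q : 'rV[R]_n := \row_i wrap per (p 0 i).
  pose m : 'rV[int]_n := \row_i - Num.floor (p 0 i / per + 1 / 2).
  have qE : q = p + per *: intv m by apply/rowP => i; rewrite !mxE /wrap mulrNz mulrN.
  have qi i : - (per / 2) <= q 0 i < per / 2 by rewrite mxE; exact: wrap_itv.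
  have q0 : q <> 0.
    rewrite qE => /eqP; rewrite addr_eq0 -scalerN -intvN => /eqP; exact: scale_intv_neq0.
  have [|i|y [by_ oy Py]] := surj_outer lamP n3 (p := q) => //.
    by have /andP[h1 h2] := qi i; rewrite ler_norml h1 ltW.
  exists y; last by apply: (@act_outer _ _ _ m) => //; rewrite Py.
  (* [surj_outer] yields a point of the closed box. A coordinate 1 / 2 would give [Px] the value per
     / 2, outside the half-open cube. *)
  move=> i; have := by_ i; rewrite ler_norml => /andP[-> h2] /=.
  rewrite lt_neqAle h2 andbT; apply/eqP => yi.
  have d := dom_box i by_.
  have k4 : 4 - 2 * b <= kf y by case: d => _; rewrite yi ct_half; lra.
  by have := qi i; rewrite -Py mxE yi (fH_half lam bP k4) ltxx andbF.
- have [k1 k2] := andP (sphere_kap sx).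
  have Q0 : act g (Qx x) <> 0 by apply: act_neq0 => //; exact: (Qx_neq0 lamP n3).
  have [y [c [by_ ky c0 Qy]]] := sphere_exists lamP n3 sx Q0.
  exists y; first by apply: small => //; rewrite ky.
  exact: (@act_sphere _ _ _ (kf x) c).
- have [k0 kb0] := region_neq n3 (or_intror (or_introl sx)).
  have [|y [by_ sy Py]] := surj_shell lamP n3 (p := act g (Px x)).
    by apply: P0 => //; case/andP: sx => h _; move: h b0; lra.
  exists y; first by apply: small => //; case/andP: sy => _ /ltW.
  by apply: act_inner => //; left.
- have [y [by_ cy Py]] := surj_center lamP n3 (act g (Px x)).
  exists y; last by apply: act_inner => //; right.
  by apply: small => //; move: cy b0; rewrite /center; lra.
Qed.

Definition tb (t : torus R n) : 'rV[R]_n := bxr (repr t).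

Lemma tbK t : torus_proj (tb t) = t.
Proof. by rewrite /tb proj_bxr /torus_proj reprK. Qed.

Lemma tb_proj x : tb (torus_proj x) = bxr x.
Proof. by apply/bxr_proj; rewrite /torus_proj reprK. Qed.

Lemma hbox_tb t : hbox (tb t). Proof. exact: hbox_bxr. Qed.

(** The related representative is unique, and it exists for every matrix of determinant 1, so the
    default 0 is then never taken. *)
Definition rho g (t : torus R n) : torus R n :=
  torus_proj (xget 0 [set y | hbox y /\ act_rel g (tb t) y]).

Lemma rhoP g t y : hbox y -> act_rel g (tb t) y -> rho g t = torus_proj y.
Proof.
move=> hy ry; rewrite /rho; congr torus_proj.
case: xgetP => [z -> [hz rz]|/(_ y) []//]; exact: act_rel_uniq hz hy rz ry.
Qed.

Lemma rho_rel g t : @SLZ n g -> act_rel g (tb t) (tb (rho g t)).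
Proof.
move=> hg; have [y hy ry] := act_rel_total (hbox_tb t) hg.
by rewrite (rhoP hy ry) tb_proj bxr_id.
Qed.

Lemma rho_comp g h t : @SLZ n g -> @SLZ n h -> rho (g *m h) t = rho g (rho h t).
Proof.
move=> hg hh; have r1 := rho_rel t hh; have r2 := rho_rel (rho h t) hg.
by rewrite (rhoP (hbox_tb _) (act_rel_comp r1 r2)) tbK.
Qed.

Lemma rho1 t : rho 1%:M t = t.
Proof. by rewrite (rhoP (hbox_tb t) (act_rel_id _)) tbK. Qed.

End Action.

(** * Analytic lifts *)

Section Products.
Context {R : realType}.

Lemma diffM_at n (f g : 'rV[R]_n -> R) x v : analytic_at f x -> analytic_at g x ->
  'd (fun y => f y * g y) x v = 'd f x v * g x + f x * 'd g x v.
Proof.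
move=> af ag; have [df _] := analytic_at_diff af; have [dg _] := analytic_at_diff ag.
have [dfg _] := analytic_at_diff (analytic_atM af ag).
have [_ e1] := diff_is_derive v dfg.
have [_ e2] := is_deriveM (diff_is_derive v df) (diff_is_derive v dg).
apply: etrans (esym e1) (etrans e2 (etrans (addrC _ _) _)).
by apply: (f_equal2 +%R) => //; exact: mulrC.
Qed.

Lemma analytic_map_lsubmx n (z : 'rV[R]_(n + 1)) : analytic_map (@lsubmx R 1 n 1) z.
Proof. by move=> i; apply: eq_analytic_at (analytic_at_coord (lshift 1 i) z) => y; rewrite mxE. Qed.

Lemma diff_lsubmx n (f : 'rV[R]_n -> R) (z v : 'rV[R]_(n + 1)) : analytic_at f (lsubmx z) ->
  analytic_at (fun y : 'rV[R]_(n + 1) => f (lsubmx y)) z /\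
  'd (fun y : 'rV[R]_(n + 1) => f (lsubmx y)) z v = 'd f (lsubmx z) (lsubmx v).
Proof.
move=> af; have al := analytic_map_lsubmx z.
split; first exact: (analytic_map_comp af al).
have dl := analytic_map_diff al; have [df _] := analytic_at_diff af.
rewrite (diff_comp_at (f := @lsubmx R 1 n 1) v dl df); congr ('d f _ _).
apply/rowP => i; rewrite -(coord_diff i v dl) mxE -(diff_coord z v (lshift 1 i)).
by congr ('d _ z v); apply/funext => y; rewrite mxE.
Qed.

Lemma diff_expR_at n (f : 'rV[R]_n -> R) x v : analytic_at f x ->
  analytic_at (fun y => expR (f y)) x /\ 'd (fun y => expR (f y)) x v = expR (f x) * 'd f x v.
Proof.
move=> af; split; first by apply: (analytic_at_comp1 (phi := expR)) => //; exact: analytic1_expR.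
have [df _] := analytic_at_diff af.
by have [_ ->] := diff_comp_scalar v df (is_derive_expR (f x)).
Qed.

End Products.

(** * The analytic chart at a sphere *)

Section SphereChart.
Context {R : realType} {n : nat}.
Variable lam : R.
Hypothesis lamP : 1 < lam < 3 / 2.
Hypothesis n3 : (3 <= n)%N.
Implicit Types x y p : 'rV[R]_n.
Implicit Types g h : 'M[int]_n.
Local Notation b := (@gb R n).
Local Notation Qx := (Qx lam).

Variables (kap s dw : R) (w : R -> R).
Hypothesis level : @sphere_level R n kap.
Hypothesis w0 : 0 < w kap.
Hypothesis dwP : is_derive kap 1 w dw.
Hypothesis aw : forall x, kf x = kap -> analytic_at (fun y => w (kf y)) x.

(* Blowing up the homogeneous coordinate: [kf - kap] scales by [exp (- s t)] when [w Qx] scales by [exp t]. *)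
Definition chart (z : 'rV[R]_(n + 1)) : 'rV[R]_(n + 1) :=
  row_mx (expR (- z 0 (rshift n 0)) *: (w (kf (lsubmx z)) *: Qx (lsubmx z)))
         (const_mx ((kf (lsubmx z) - kap) * expR (s * z 0 (rshift n 0)))).

Lemma chart_l z j : chart z 0 (lshift 1 j) =
  expR (- z 0 (rshift n 0)) * (w (kf (lsubmx z)) * Qx (lsubmx z) 0 j).
Proof. by rewrite /chart row_mxEl 2!mxE. Qed.

Lemma chart_r z j : chart z 0 (rshift n j) = (kf (lsubmx z) - kap) * expR (s * z 0 (rshift n 0)).
Proof. by rewrite /chart row_mxEr mxE. Qed.

Section AtPoint.
Variable z : 'rV[R]_(n + 1).
Hypothesis bz : inbox (lsubmx z).
Hypothesis kz : kf (lsubmx z) = kap.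

Let at_ : analytic_at (fun y : 'rV[R]_(n + 1) => y 0 (rshift n 0)) z := analytic_at_coord _ _.

Let aWQ j : analytic_at (fun y => w (kf y) * Qx y 0 j) (lsubmx z).
Proof. by apply: analytic_atM; [exact: aw|exact: (analytic_Qx lam n3 bz j)]. Qed.

Let akk : analytic_at (fun y => kf y - kap) (lsubmx z).
Proof. by apply: analytic_atB; [exact: analytic_kf|exact: analytic_at_cst]. Qed.

Lemma chart_analytic : analytic_map chart z.
Proof.
move=> i; case: (fintype.splitP i) => j ij.
  have -> : i = lshift 1 j by exact: val_inj.
  apply: (@eq_analytic_at _ _ (fun y : 'rV[R]_(n + 1) => expR (- y 0 (rshift n 0)) * (w (kf (lsubmx y)) * Qx (lsubmx y) 0 j))) => [y|]; first by rewrite chart_l.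
  apply: analytic_atM; last by have [] := diff_lsubmx 0 (aWQ j).
  by have [] := diff_expR_at 0 (analytic_atN at_).
have -> : i = rshift n j by exact: val_inj.
apply: (@eq_analytic_at _ _ (fun y : 'rV[R]_(n + 1) => (kf (lsubmx y) - kap) * expR (s * y 0 (rshift n 0)))) => [y|]; first by rewrite chart_r.
apply: analytic_atM; first by have [] := diff_lsubmx 0 akk.
by have [] := diff_expR_at 0 (analytic_atM (analytic_at_cst s z) at_).
Qed.

Lemma diff_cstM (v : 'rV[R]_(n + 1)) :
  'd (fun y : 'rV[R]_(n + 1) => - y 0 (rshift n 0)) z v = - v 0 (rshift n 0).
Proof.
have [d _] := analytic_at_diff at_.
have [dn _] := analytic_at_diff (analytic_atN at_).
have [_ <-] := diff_is_derive v dn; have [_ ->] := is_deriveN (diff_is_derive v d).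
by rewrite diff_coord.
Qed.

(** At a point of the sphere kf - kap vanishes, so the last coordinate forces dkf = 0 on the x-part;
    the other coordinates then reduce to [Qx_kernel]. *)
Lemma chart_kernel (v : 'rV[R]_(n + 1)) : 'd chart z v = 0 -> v = 0.
Proof.
move=> dv; have dc := analytic_map_diff chart_analytic.
have D i : 'd (fun y : 'rV[R]_(n + 1) => chart y 0 i) z v = 0 by rewrite (coord_diff i v dc) dv mxE.
pose vx : 'rV[R]_n := lsubmx v; pose vt := v 0 (rshift n 0).
have [akl dkl] := diff_lsubmx v akk.
have dk0 : dkf (lsubmx z) vx = 0.
  have := D (rshift n 0).
  have -> : (fun y : 'rV[R]_(n + 1) => chart y 0 (rshift n 0)) =
      (fun y : 'rV[R]_(n + 1) => (kf (lsubmx y) - kap) * expR (s * y 0 (rshift n 0))).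
    by apply/funext => y; rewrite chart_r.
  have [ae _] := diff_expR_at v (analytic_atM (analytic_at_cst s z) at_).
  rewrite (diffM_at v akl ae) kz subrr mul0r addr0 dkl => /eqP.
  rewrite mulf_eq0 [X in _ || X]gt_eqF ?expR_gt0 // orbF => /eqP.
  have [dk _] := analytic_at_diff (analytic_kf (lsubmx z)).
  have [dkk _] := analytic_at_diff akk.
  have [_ <-] := diff_is_derive (vx) dkk.
  have [_ ->] := is_deriveB (diff_is_derive vx dk) (is_derive_cst kap (lsubmx z) vx).
  by rewrite subr0 diff_kf.
have E j : fQu lam b (lsubmx z 0 j) (kf (lsubmx z)) * vx 0 j = vt * fQ lam b (lsubmx z 0 j) (kf (lsubmx z)).
  have [aWl dWl] := diff_lsubmx v (aWQ j).
  have := D (lshift 1 j).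
  have -> : (fun y : 'rV[R]_(n + 1) => chart y 0 (lshift 1 j)) = (fun y : 'rV[R]_(n + 1) =>
      expR (- y 0 (rshift n 0)) * (w (kf (lsubmx y)) * Qx (lsubmx y) 0 j)).
    by apply/funext => y; rewrite chart_l.
  have [ae de] := diff_expR_at v (analytic_atN at_).
  rewrite (diffM_at v ae aWl) de diff_cstM dWl.
  have aQ := analytic_Qx lam n3 bz j.
  rewrite (diffM_at vx (aw kz) aQ) (diff_Qx lam n3 vx j bz) dk0 mulr0 addr0.
  have [dk _] := analytic_at_diff (analytic_kf (lsubmx z)).
  have -> : 'd (fun y => w (kf y)) (lsubmx z) vx = 0.
    have dw' := dwP; rewrite -kz in dw'.
    by have [_ ->] := diff_comp_scalar vx dk dw'; rewrite diff_kf dk0 mulr0.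
  rewrite mul0r add0r -/vt mxE.
  set e := expR _; set W := w _; set q := fQ lam b _ _; set u := fQu lam b _ _ => h.
  have e0 : e * W != 0 by rewrite mulf_neq0 // gt_eqF // ?expR_gt0 // /W kz.
  have : e * W * (u * vx 0 j - vt * q) = 0 by rewrite -h; ring.
  by move/eqP; rewrite mulf_eq0 (negPf e0) subr_eq0 => /eqP.
have [t0 x0] := Qx_kernel lamP n3 bz (eq_ind_r (fun k => is_true (- (2 * b) < k <= 0)) (sphere_kap n3 level) kz) dk0 E.
rewrite -(hsubmxK v) -/vx x0; apply/rowP => i; rewrite [RHS]mxE.
case: (fintype.splitP i) => j ij.
  by have -> : i = lshift 1 j by [exact: val_inj]; rewrite row_mxEl mxE.
have -> : i = rshift n j by exact: val_inj.
by rewrite row_mxEr mxE (ord1 j).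
Qed.

End AtPoint.

(** The pair (F y, T y) is the preimage under [chart] of the pair formed by the linear image of w
    [Qx] and by kf - kap, through the analytic inverse of [chart] at (x1, ln c). *)
Lemma sphere_local_lift g x0 x1 c : inbox x0 -> inbox x1 -> kf x0 = kap -> kf x1 = kap -> 0 < c ->
  Qx x1 = c *: act g (Qx x0) ->
  exists (F : 'rV[R]_n -> 'rV[R]_n) (T : 'rV[R]_n -> R), [/\ analytic_map F x0, analytic_at T x0, F x0 = x1,
    \forall y \near x0, (kf (F y) - kap) * expR (s * T y) = kf y - kap &
    \forall y \near x0, w (kf (F y)) *: Qx (F y) = expR (T y) *: act g (w (kf y) *: Qx y)].
Proof.
move=> bx0 bx1 k0 k1 c0 Q1.
pose z1 : 'rV[R]_(n + 1) := row_mx x1 (const_mx (ln c)).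
have l1 : lsubmx z1 = x1 by rewrite /z1 row_mxKl.
have bz1 : inbox (lsubmx z1) by rewrite l1.
have kz1 : kf (lsubmx z1) = kap by rewrite l1.
have [Psi [aPsi Psi1 _ PsiK]] := analytic_inverse (chart_analytic bz1 kz1) (@chart_kernel _ bz1 kz1).
pose In y : 'rV[R]_(n + 1) := row_mx (act g (w (kf y) *: Qx y)) (const_mx (kf y - kap)).
have In0 : In x0 = chart z1.
  rewrite /In /chart l1 k1 k0 subrr mul0r; congr row_mx.
  rewrite /z1 row_mxEr mxE expRN lnK // Q1 actZ !scalerA; congr (_ *: _).
  by field; exact: lt0r_neq0.
have aIn : analytic_map In x0.
  move=> i; case: (fintype.splitP i) => j ij.
    have -> : i = lshift 1 j by exact: val_inj.
    have aQ : analytic_map (fun y => w (kf y) *: Qx y) x0.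
      move=> l; apply: (@eq_analytic_at _ _ (fun y => w (kf y) * Qx y 0 l)) => [y|]; first by rewrite [RHS]mxE.
      by apply: analytic_atM; [exact: aw|exact: (analytic_Qx lam n3 bx0 l)].
    apply: eq_analytic_at (analytic_map_mulmx _ aQ j) => y; by rewrite /In row_mxEl.
  have -> : i = rshift n j by exact: val_inj.
  apply: (@eq_analytic_at _ _ (fun y => kf y - kap)) => [y|]; first by rewrite /In row_mxEr mxE.
  by apply: analytic_atB; [exact: analytic_kf|exact: analytic_at_cst].
have aPI : analytic_map (fun y => Psi (In y)) x0.
  by move=> i; rewrite -In0 in aPsi; exact: (analytic_map_comp (aPsi i) aIn).
have near : \forall y \near x0, chart (Psi (In y)) = In y.
  by rewrite -In0 in PsiK; exact: near_continuous (analytic_map_continuous aIn) PsiK.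
exists (fun y => lsubmx (Psi (In y))), (fun y => Psi (In y) 0 (rshift n 0)); split.
- move=> i; apply: eq_analytic_at (aPI (lshift 1 i)) => y; by rewrite mxE.
- exact: aPI.
- by rewrite In0 Psi1 l1.
- apply: filterS near => y /(congr1 (fun z : 'rV[R]_(n + 1) => z 0 (rshift n 0))).
  by rewrite chart_r /In row_mxEr mxE.
- apply: filterS near => y /(congr1 (@lsubmx R 1 n 1)); rewrite /chart; set p := Psi (In y); rewrite /In !row_mxKl => <-.
  by rewrite scalerA expRN mulfV ?scale1r // gt_eqF // expR_gt0.
Qed.

End SphereChart.

Section Near.
Variables (T : topologicalType) (x : T).
Implicit Types P Q : T -> Prop.

Lemma nearI P Q : (\forall y \near x, P y) -> (\forall y \near x, Q y) -> \forall y \near x, P y /\ Q y.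
Proof. exact: filterI. Qed.

Lemma nearS P Q : (forall y, P y -> Q y) -> (\forall y \near x, P y) -> \forall y \near x, Q y.
Proof. exact: filterS. Qed.

End Near.

(** * Compatibility of the coordinate with integer translations *)

Section Periodicity.
Context {R : realType} {n : nat}.
Variable lam : R.
Hypothesis lamP : 1 < lam < 3 / 2.
Hypothesis n3 : (3 <= n)%N.
Implicit Types x y p : 'rV[R]_n.
Implicit Types g h : 'M[int]_n.
Local Notation b := (@gb R n).
Local Notation fE := (fE lam b).
Local Notation fH := (fH lam b).
Local Notation Px := (Px lam).
Local Notation Qx := (Qx lam).
Local Notation per := (per lam).
Let bP : 0 < b <= 1 / 768 := gbP n3.
Let b0 : 0 < b := gb_gt0 n3.

Lemma kf_bxr x : kf (bxr x) = kf x.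
Proof.
have [m ->] := bxr_int x; congr (_ - _); apply: eq_bigr => i _; rewrite !mxE /tau.
congr (_ * (1 - _)); move: (x 0 i) (m 0 i) => u k.
have S (v : R) j : ct (v + j%:R) = ct v.
  elim: j => [|j IH]; first by rewrite addr0.
  by rewrite -natr1 addrA ctD1.
case: k => j; first exact: S.
by rewrite NegzE mulrNz -[(Posz j.+1)%:~R]/(j.+1%:R) -[LHS](S _ j.+1) subrK.
Qed.

(** Under [wrap] only a coordinate near - 1 / 2 can jump. There [kf] exceeds 3 / 2, so the jump of
    the coordinate by 1 is a jump of [fH] by per. *)
Lemma near_fH_wrap x i : hbox x -> outer x -> \forall y \near x,
  exists m : int, wrap 1 ((y : 'rV[R]_n) 0 i) = y 0 i + m%:~R /\
    fH (wrap 1 (y 0 i)) (kf y) = fH (y 0 i) (kf y) + per * m%:~R.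
Proof.
move=> hx ox.
have same (u : R) : `|u| < 1 / 2 -> wrap 1 u = u.
  move=> u1.
  apply: (@wrap_eq R 1 _ _ (- Num.floor (u / 1 + 1 / 2))) => //; first exact: wrap_itv.
    by move: u1; rewrite ltr_norml => /andP[/ltW -> ->].
  by rewrite /wrap mulrNz mulrN.
have [xi|xi] := ltP `|x 0 i| (1 / 2).
  have := near_coord_lt xi; apply: nearS => y yi; exists 0.
  by rewrite same // mulr0z mulr0 !addr0.
have e : x 0 i = - (1 / 2).
  have /andP[x1 x2] := hx i; apply/eqP; rewrite eq_le x1 andbT.
  by have [x0|x0] := ler0P (x 0 i); move: xi; [rewrite (ler0_norm x0)|rewrite (gtr0_norm x0)]; lra.
have k4 : 3 / 2 < kf x.
  by case: (dom_box i (hbox_inbox hx)) => _; rewrite e ctN ct_half; case/andP: bP; lra.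
have nk := near_kf_gt k4.
have n1 : \forall y \near x, (y : 'rV[R]_n) 0 i < 0.
  have c : {for x, continuous (fun y : 'rV[R]_n => y 0 i)}.
    by apply: analytic_at_continuous; exact: analytic_at_coord.
  by apply: (near_continuous (P := fun z : R => z < 0) c); apply: lt_nbhsl; rewrite e; lra.
have n2 : \forall y \near x, -1 < (y : 'rV[R]_n) 0 i.
  have c : {for x, continuous (fun y : 'rV[R]_n => y 0 i)}.
    by apply: analytic_at_continuous; exact: analytic_at_coord.
  by apply: (near_continuous (P := fun z : R => -1 < z) c); apply: lt_nbhsr; rewrite e; lra.
have := nearI nk (nearI n1 n2); apply: nearS => y [ky [y1 y2]].
have [yi|yi] := leP (- (1 / 2)) (y 0 i).
  have wE : wrap 1 (y 0 i) = y 0 i.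
    apply: (@wrap_eq R 1 _ _ (- Num.floor (y 0 i / 1 + 1 / 2))) => //; first exact: wrap_itv.
      by rewrite yi /=; lra.
    by rewrite /wrap mulrNz mulrN.
  by exists 0; rewrite wE mulr0z mulr0 !addr0.
have wE : wrap 1 (y 0 i) = y 0 i + 1.
  apply: (@wrap_eq R 1 _ _ (- Num.floor (y 0 i / 1 + 1 / 2) - 1)) => //; first exact: wrap_itv.
    by apply/andP; split; lra.
  by rewrite /wrap !mul1r intrD !mulrNz; ring.
exists 1; rewrite wE mulr1; split => //.
by apply: fH_shift => //; rewrite y2 /=; lra.
Qed.

Lemma near_Px_bxr x : hbox x -> outer x ->
  \forall y \near x, outer (bxr y) /\ exists m, Px (bxr y) = Px y + per *: intv m.
Proof.
move=> hx ox; have nk := near_kf_gt ox.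
have nw : \forall y \near x, forall i, exists m : int, wrap 1 ((y : 'rV[R]_n) 0 i) = y 0 i + m%:~R /\
    fH (wrap 1 (y 0 i)) (kf y) = fH (y 0 i) (kf y) + per * m%:~R.
  by apply: (filter_forall (nbhs_filter x)) => i; exact: near_fH_wrap.
have := nearI nk nw; apply: nearS => y [ky /(_ _)/cid h].
split; first by rewrite /outer kf_bxr.
exists (\row_i sval (h i)); apply/rowP => i; rewrite [LHS]mxE kf_bxr [bxr y 0 i]mxE.
by have [_ ->] := svalP (h i); rewrite !mxE.
Qed.

End Periodicity.

(** * Local analytic lifts of the action *)

Section Lift.
Context {R : realType} {n : nat}.
Variable lam : R.
Hypothesis lamP : 1 < lam < 3 / 2.
Hypothesis n3 : (3 <= n)%N.
Implicit Types x y p : 'rV[R]_n.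
Implicit Types g h : 'M[int]_n.
Local Notation b := (@gb R n).
Local Notation fE := (fE lam b).
Local Notation fH := (fH lam b).
Local Notation Px := (Px lam).
Local Notation Qx := (Qx lam).
Local Notation per := (per lam).
Local Notation act_rel := (act_rel lam).
Local Notation sphere_level := (@sphere_level R n).
Let bP : 0 < b <= 1 / 768 := gbP n3.
Let b0 : 0 < b := gb_gt0 n3.
Let lam0 : 0 < lam. Proof. by case/andP: lamP; lra. Qed.
(** F is the local inverse of [Px] at x1 applied after the affine map; c stands for the lattice
    translation that occurs in the outer region. *)
Lemma generic_local_lift g c x0 x1 : inbox x0 -> inbox x1 ->
  outer x0 \/ shell x0 \/ center x0 -> outer x1 \/ shell x1 \/ center x1 ->
  Px x1 = act g (Px x0) + c ->
  exists F, [/\ analytic_map F x0, F x0 = x1 & \forall y \near x0, Px (F y) = act g (Px y) + c].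
Proof.
move=> bx0 bx1 r0 r1 e; have [k0 kb0] := region_neq n3 r0; have [k1 kb1] := region_neq n3 r1.
have aP1 := analytic_Px lam n3 bx1 k1 kb1; have aP0 := analytic_Px lam n3 bx0 k0 kb0.
have ker v : 'd Px x1 v = 0 -> v = 0.
  move=> dv; apply: (Px_kernel lamP n3 bx1 r1) => i.
  by rewrite (coord_diff i v (analytic_map_diff aP1)) dv mxE.
have [Psi [aPsi Psi1 _ PsiK]] := analytic_inverse aP1 ker.
have aG : analytic_map (fun y => act g (Px y) + c) x0.
  move=> i; apply: (@eq_analytic_at _ _ (fun y => act g (Px y) 0 i + c 0 i)) => [y|]; first by rewrite [RHS]mxE.
  by apply: analytic_atD; [exact: (analytic_map_mulmx _ aP0)|exact: analytic_at_cst].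
exists (fun y => Psi (act g (Px y) + c)); split.
- by move=> i; rewrite e in aPsi; exact: (analytic_map_comp (g := fun y => act g (Px y) + c) (aPsi i) aG).
- by rewrite -e.
- by rewrite e in PsiK; exact: near_continuous (analytic_map_continuous aG) PsiK.
Qed.

(** The reciprocal of the order of [fE] along the sphere, which is lam for kap = 0 and - 1 for kap =
    - b. [wgt] is the remaining factor of [fE], analytic and positive there. *)
Definition sexp (kap : R) : R := if kap == 0 then lam^-1 else -1.
Definition wgt (kap k : R) : R := if kap == 0 then (k + b)^-1 else `|k| `^ lam.

Lemma sexp0 : sexp 0 = lam^-1. Proof. by rewrite /sexp eqxx. Qed.

Lemma sexp_neq0 kap : sexp kap != 0.
Proof. by rewrite /sexp; case: (kap =P 0) => _; [rewrite invr_eq0 gt_eqF|rewrite oppr_eq0 oner_eq0]. Qed.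

Let Nb0 : (- b == 0) = false. Proof. by rewrite oppr_eq0 gt_eqF. Qed.

Lemma wgt_gt0 kap : sphere_level kap -> 0 < wgt kap kap.
Proof.
rewrite /wgt; case=> ->; first by rewrite eqxx add0r invr_gt0.
by rewrite Nb0 powR_gt0 // normr_gt0 oppr_eq0 gt_eqF.
Qed.

Lemma near_fE_wgt kap : sphere_level kap ->
  \forall k \near kap, fE k = `|k - kap| `^ (sexp kap)^-1 * wgt kap k.
Proof.
rewrite /wgt /sexp; case=> ->.
  rewrite eqxx invrK; have : \forall k \near (0 : R), - b < k by apply: lt_nbhsr; rewrite oppr_lt0.
  by apply: nearS => k kb; rewrite fEE subr0 (gtr0_norm (x := k + b)) // -ltrBlDr sub0r.
by rewrite Nb0; apply: filterE => k; rewrite fEE opprK invrN invr1 powR_inv1 // mulrC.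
Qed.

Lemma analytic_wgt kap x : sphere_level kap -> kf x = kap -> analytic_at (fun y => wgt kap (kf y)) x.
Proof.
move=> sk kx; rewrite /wgt; move: sk kx; case=> -> kx.
  rewrite eqxx; apply: analytic_atV; first by rewrite kx add0r gt_eqF.
  by apply: analytic_atD; [exact: analytic_kf|exact: analytic_at_cst].
by rewrite Nb0; apply: analytic_at_powR; [rewrite kx Nb0|exact: analytic_kf].
Qed.

Lemma is_derive_wgt kap : sphere_level kap -> exists dw, is_derive kap 1 (wgt kap) dw.
Proof.
rewrite /wgt; case=> ->.
  exists (- (0 + b) ^- 2 *: (1 + 0 : R)).
  rewrite eqxx; have b1 : 0 + b != 0 :> R by rewrite add0r gt_eqF.
  have D : is_derive (0 : R) 1 (fun k => k + b) (1 + 0) by exact: is_deriveD1.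
  exact: (is_deriveV (f := fun k : R => k + b) b1 D).
have D : is_derive (- b : R) 1 (fun k : R => `|k| `^ lam) (lam * `|- b : R| `^ (lam - 1) * Num.sg (- b : R)).
  have e0 : (- b : R) != 0 by rewrite Nb0.
  have d1 := is_derive_normr e0.
  have d2 : is_derive `|- b : R| 1 (fun z : R => z `^ lam) (lam * `|- b : R| `^ (lam - 1)).
    by apply: is_derive1_powR; rewrite normr_gt0.
  exact: (is_derive_comp1 (f := fun k : R => `|k|) d2 d1).
by eexists; rewrite Nb0; exact: D.
Qed.

(** The equations of the lift near x0, recorded because the differentials at fixed points are
    computed from them. *)
Variant lift_spec g x0 (F : 'rV[R]_n -> 'rV[R]_n) : Prop :=
| lift_generic c : outer x0 \/ shell x0 \/ center x0 ->
    (\forall y \near x0, Px (F y) = act g (Px y) + c) -> lift_spec g x0 F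
| lift_sphere kap T : sphere_level kap -> kf x0 = kap -> analytic_at T x0 ->
    (\forall y \near x0, (kf (F y) - kap) * expR (sexp kap * T y) = kf y - kap) ->
    (\forall y \near x0, wgt kap (kf (F y)) *: Qx (F y) = expR (T y) *: act g (wgt kap (kf y) *: Qx y)) ->
    lift_spec g x0 F.

Lemma near_hbox x : inbox x -> kf x <= 0 -> \forall y \near x, hbox y.
Proof. by move=> bx k0; apply: near_bxr => // i; exact: (ball_lt bP (dom_box i bx)). Qed.

(** |kf - kap|^(1 / s) is multiplied by exp (- T) and w [Qx] by exp T, so their product [Px]
    transforms linearly off the sphere; on the sphere the relation of directions is what remains.
    The bounds by b keep y and F y away from the other sphere. *)
Lemma near_sphere_rel g kap (F : 'rV[R]_n -> 'rV[R]_n) (T : 'rV[R]_n -> R) x0 : sphere_level kap ->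
  kf x0 = kap -> kf (F x0) = kap -> {for x0, continuous F} ->
  (\forall y \near x0, (kf (F y) - kap) * expR (sexp kap * T y) = kf y - kap) ->
  (\forall y \near x0, wgt kap (kf (F y)) *: Qx (F y) = expR (T y) *: act g (wgt kap (kf y) *: Qx y)) ->
  \forall y \near x0, act_rel g y (F y).
Proof.
move=> sk k0 k1 cF hk hq.
have e0 : \forall y \near x0, fE (kf y) = `|kf y - kap| `^ (sexp kap)^-1 * wgt kap (kf y).
  by have := near_fE_wgt sk; rewrite -{1}k0; apply: near_continuous; exact: kf_continuous.
have e1 : \forall y \near x0, fE (kf (F y)) = `|kf (F y) - kap| `^ (sexp kap)^-1 * wgt kap (kf (F y)).
  apply: (near_continuous (P := fun z => fE (kf z) = `|kf z - kap| `^ (sexp kap)^-1 * wgt kap (kf z)) cF).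
  by have := near_fE_wgt sk; rewrite -{1}k1; apply: near_continuous; exact: kf_continuous.
have l0 : \forall y \near x0, kap - b < kf y by apply: near_kf_gt; rewrite k0; move: b0; lra.
have l1 : \forall y \near x0, kap - b < kf (F y).
  by apply: (near_continuous (P := fun z => kap - b < kf z) cF); apply: near_kf_gt; rewrite k1; move: b0; lra.
have u0 : \forall y \near x0, kf y < kap + b by apply: near_kf_lt; rewrite k0; move: b0; lra.
have u1 : \forall y \near x0, kf (F y) < kap + b.
  by apply: (near_continuous (P := fun z => kf z < kap + b) cF); apply: near_kf_lt; rewrite k1; move: b0; lra.
have := nearI (nearI hk hq) (nearI (nearI e0 e1) (nearI (nearI l0 l1) (nearI u0 u1))).
apply: nearS => y [[Hk Hq] [[E0 E1] [[L0 L1] [U0 U1]]]].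
have ep : 0 < expR (sexp kap * T y) := expR_gt0 _.
have [ky|ky] := eqVneq (kf y) kap.
  have kF : kf (F y) = kap.
    move/eqP: Hk; rewrite ky subrr mulf_eq0 [X in _ || X]gt_eqF // orbF subr_eq0 => /eqP //.
  apply: (@act_sphere _ _ _ _ _ _ kap (expR (T y))) => //; first exact: expR_gt0.
  have w0 := lt0r_neq0 (wgt_gt0 sk).
  move: Hq; rewrite kF ky actZ scalerA mulrC -scalerA => /(scalerI w0) //.
have PE : Px (F y) = act g (Px y).
  rewrite !Px_scale E0 E1 -scalerA Hq -Hk normrM (gtr0_norm ep) powRM ?normr_ge0 ?ltW //.
  have -> : expR (sexp kap * T y) `^ (sexp kap)^-1 = expR (T y).
    by rewrite -expRM mulrAC mulfV ?sexp_neq0 // mul1r.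
  rewrite !actZ !scalerA; congr (_ *: _); ring.
(* The exponential factor is positive, so y and F y lie on the same side of the sphere. *)
have sg : (kap < kf y /\ kap < kf (F y)) \/ (kf y < kap /\ kf (F y) < kap).
  case: (ltgtP (kf y) kap) ky => // h _; [right|left]; split => //.
    by rewrite -subr_lt0 -(pmulr_llt0 _ ep) Hk subr_lt0.
  by rewrite -subr_gt0 -(pmulr_lgt0 _ ep) Hk subr_gt0.
case: sk L0 L1 U0 U1 sg => -> L0 L1 U0 U1 [[s0 s1]|[s0 s1]].
- apply: (@act_outer _ _ _ _ _ _ 0) => //; rewrite PE (_ : intv 0 = 0) ?scaler0 ?addr0 //.
  by apply/rowP => i; rewrite !mxE.
- by apply: act_inner => //; left; rewrite /shell s0 s1; split; apply/andP; split => //; lra.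
- by apply: act_inner => //; left; rewrite /shell s0 s1 /=; split; lra.
- by apply: act_inner => //; right.
Qed.

(** A lift solved in the coordinate is matched with [rho] through [act_rel]. In the outer region y
    and F y may leave the half-open box, and the resulting translations of [Px] are absorbed in the
    lattice vector. *)
Lemma rho_lift g x0 : hbox x0 -> @SLZ n g -> exists F, [/\ analytic_map F x0,
  F x0 = tb (rho lam g (torus_proj x0)),
  \forall y \near x0, torus_proj (F y) = rho lam g (torus_proj y) & lift_spec g x0 F].
Proof.
move=> hx0 hg; have tx : tb (torus_proj x0) = x0 by rewrite tb_proj bxr_id.
have := rho_rel lamP n3 (torus_proj x0) hg; rewrite tx.
set x1 := tb _; have hx1 : hbox x1 := hbox_tb _.
have bx0 := hbox_inbox hx0; have bx1 := hbox_inbox hx1.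
have fin (F : 'rV[R]_n -> 'rV[R]_n) : (\forall y \near x0, act_rel g (bxr y) (bxr (F y))) ->
    \forall y \near x0, torus_proj (F y) = rho lam g (torus_proj y).
  apply: nearS => y r; rewrite -[LHS]proj_bxr; apply/esym/(rhoP lamP n3); first exact: hbox_bxr.
  by rewrite tb_proj.
have fin' (F : 'rV[R]_n -> 'rV[R]_n) : {for x0, continuous F} -> F x0 = x1 -> kf x0 <= 0 -> kf x1 <= 0 ->
    (\forall y \near x0, act_rel g y (F y)) -> \forall y \near x0, torus_proj (F y) = rho lam g (torus_proj y).
  move=> cF F0 k0 k1 r; apply: fin.
  have h0 := near_hbox bx0 k0.
  have h1 : \forall y \near x0, hbox (F y).
    by apply: (near_continuous cF); rewrite F0; exact: near_hbox.
  by apply: nearS (nearI r (nearI h0 h1)) => y [r1 [h2 h3]]; rewrite !bxr_id.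
case=> [m o0 o1 e|kap c sk k0 k1 c0 e|r e].
- have [F [aF F0 nF]] := generic_local_lift bx0 bx1 (or_introl o0) (or_introl o1) e.
  exists F; split => //; last by apply: lift_generic nF; left.
  apply: fin; have cF := analytic_map_continuous aF.
  have n0 := near_Px_bxr lam n3 hx0 o0.
  have n1 : \forall y \near x0, outer (bxr (F y)) /\ exists m, Px (bxr (F y)) = Px (F y) + per *: intv m.
    by apply: (near_continuous (P := fun z => outer (bxr z) /\ exists m, Px (bxr z) = Px z + per *: intv m) cF); rewrite F0; exact: near_Px_bxr.
  have := nearI nF (nearI n0 n1); apply: nearS => y [E [[oy [p pE]] [oF [q qE]]]].
  (* The lattice vector collects the translation m at x0, the wrapping q of the image and the
     wrapping p of the source, moved by g. *)
  apply: (@act_outer _ _ _ _ _ _ (m + q - p *m g^T)) => //.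
  rewrite qE E pE actD actZ act_intv intvB intvD !(scalerDr, scalerN).
  by rewrite [RHS]addrACA addrC; apply/rowP => i; rewrite !mxE; ring.
- have [dw dwP] := is_derive_wgt sk.
  have [F [T [aF aT F0 nk nq]]] := sphere_local_lift lamP n3 (sexp kap) sk (wgt_gt0 sk) dwP (fun x => analytic_wgt sk) bx0 bx1 k0 k1 c0 e.
  exists F; split => //; last exact: (lift_sphere sk k0 aT nk nq).
  have kk : kap <= 0 by case/andP: (sphere_kap n3 sk).
  apply: fin' => //; [exact: analytic_map_continuous|by rewrite k0|by rewrite k1|].
  by apply: near_sphere_rel nk nq => //; [rewrite F0|exact: analytic_map_continuous].
- have e' : Px x1 = act g (Px x0) + 0 by rewrite addr0.
  have [F [aF F0 nF]] : exists F, [/\ analytic_map F x0, F x0 = x1 & \forall y \near x0, Px (F y) = act g (Px y) + 0].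
    by apply: generic_local_lift => //; case: r => -[]; tauto.
  exists F; split => //; last by apply: lift_generic nF; case: r => -[]; tauto.
  have cF := analytic_map_continuous aF.
  case: r => -[r0 r1].
    have [/andP[l0 u0] /andP[l1 u1]] := (r0, r1).
    apply: fin' => //; [exact: ltW|exact: ltW|].
    have n0 : \forall y \near x0, shell y.
      by have := nearI (near_kf_gt l0) (near_kf_lt u0); apply: nearS => y [h1 h2]; apply/andP.
    have n1 : \forall y \near x0, shell (F y).
      apply: (near_continuous (P := fun z => shell z) cF); rewrite F0.
      by have := nearI (near_kf_gt l1) (near_kf_lt u1); apply: nearS => y [h1 h2]; apply/andP.
    have := nearI nF (nearI n0 n1); apply: nearS => y [E [s0 s1]].
    by apply: act_inner; [left|rewrite E addr0].
  have c0 : kf x0 <= 0 by move: r0; move: b0; rewrite /center; lra.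
  have c1 : kf x1 <= 0 by move: r1 b0; rewrite /center; lra.
  apply: fin' => //.
  have n0 := near_kf_lt r0.
  have n1 : \forall y \near x0, center (F y) by apply: (near_continuous (P := fun z => center z) cF); rewrite F0; exact: near_kf_lt r1.
  have := nearI nF (nearI n0 n1); apply: nearS => y [E [s0 s1]].
  by apply: act_inner; [right|rewrite E addr0].
Qed.

Lemma rho_torus_class (r : regularity R) g : @SLZ n g -> regularity_gt 0 r -> torus_class r (rho lam g).
Proof.
move=> hg hr x; have [m xm] := bxr_int x.
have [F [aF _ nF _]] := rho_lift (hbox_bxr x) hg.
have pm y : torus_proj (y + intv m) = torus_proj y by apply/torus_projP; exists m.
pose G y := F (intv m + y).
have aG : analytic_map G x by move=> i; apply: (@analytic_at_translation _ _ (fun y => F y 0 i)); rewrite addrC -xm.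
have c0 : {for x, continuous (fun y : 'rV[R]_n => intv m + y)}.
  have [d _] := translation_diff (intv m) x; exact: differentiable_continuous d.
have nG : \forall y \near x, torus_proj (G y) = rho lam g (torus_proj y).
  rewrite xm addrC in nF; have := near_continuous (f := fun y : 'rV[R]_n => intv m + y) c0 nF.
  by apply: nearS => y; rewrite /G => ->; rewrite addrC pm.
have := nearI nG (analytic_map_near aG); rewrite /prop_near1 nbhsE => -[U [oU Ux] US].
exists U, G; split => //; first by apply: analytic_class_on => // y /US[].
by move=> y /US[].
Qed.

Lemma rho_torus_diffeo (r : regularity R) g : @SLZ n g -> regularity_gt 0 r -> torus_diffeo r (rho lam g).
Proof.
move=> hg hr; have gu := SLZ_unit hg.
have hi : @SLZ n (invmx g).
  rewrite /SLZ /= det_inv hg; exact: invr1.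
split; first exact: rho_torus_class.
exists (rho lam (invmx g)); split; first exact: rho_torus_class.
- by move=> t; rewrite -(rho_comp lamP n3) // mulVmx // rho1.
- by move=> t; rewrite -(rho_comp lamP n3) // mulmxV // rho1.
Qed.

End Lift.

(** * Differentials at fixed points *)

Section DiffTools.
Context {R : realType}.

Lemma near_diff (V W : normedModType R) (f g : V -> W) x v : differentiable f x -> differentiable g x ->
  (\forall y \near x, f y = g y) -> 'd f x v = 'd g x v.
Proof. by move=> df dg fg; rewrite -!deriveE //; exact: near_eq_derive. Qed.

Lemma diffZ_at (V W : normedModType R) (f : V -> W) x a v : 'd f x (a *: v) = a *: 'd f x v.
Proof. exact: linearZ. Qed.

Lemma diffD_cst (V W : normedModType R) (f : V -> W) c x v : differentiable f x ->
  differentiable (fun y => f y + c) x /\ 'd (fun y => f y + c) x v = 'd f x v.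
Proof.
move=> df; have dc : differentiable (fun _ : V => c) x by [].
split; first exact: differentiableD.
have /(congr1 (fun h => h v)) e := diffD df dc; apply: etrans e _.
exact: etrans (congr1 (fun w => 'd f x v + w) (diff_cst_at c x v)) (addr0 _).
Qed.

Lemma diff_act n (g : 'M[int]_n) m (A : 'rV[R]_m -> 'rV[R]_n) x v : analytic_map A x ->
  analytic_map (fun y => act g (A y)) x /\ 'd (fun y => act g (A y)) x v = act g ('d A x v).
Proof.
move=> aA; have dA := analytic_map_diff aA; split; first exact: analytic_map_mulmx.
have [dL eL] := @linear_diff R n 'rV[R]_n (mulmxr (map_mx intr g)^T) (A x).
exact: etrans (diff_comp_at (g := mulmxr (map_mx intr g)^T) v dA dL) (eL _).
Qed.

Lemma diff_scale_at n m (f : 'rV[R]_m -> R) (A : 'rV[R]_m -> 'rV[R]_n) x v : analytic_at f x -> analytic_map A x ->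
  analytic_map (fun y => f y *: A y) x /\ 'd (fun y => f y *: A y) x v = 'd f x v *: A x + f x *: 'd A x v.
Proof.
move=> af aA; have aS : analytic_map (fun y => f y *: A y) x.
  move=> j; apply: (@eq_analytic_at _ _ (fun y => f y * A y 0 j)) => [y|]; first by rewrite [RHS]mxE.
  by apply: analytic_atM => //; exact: aA.
split => //; apply/rowP => j.
apply: etrans (esym (coord_diff j v (analytic_map_diff aS))) _.
have -> : (fun y => (f y *: A y) 0 j) = (fun y => f y * A y 0 j) by apply/funext => y; rewrite [LHS]mxE.
apply: etrans (diffM_at v af (aA j)) _; rewrite mxE; congr (_ + _); first by rewrite [RHS]mxE.
by rewrite [RHS]mxE; congr (_ * _); exact: coord_diff j v (analytic_map_diff aA).
Qed.

Lemma diff_fixed (V W : normedModType R) (F : V -> V) (P Q : V -> W) x v : differentiable F x -> F x = x ->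
  differentiable P x -> differentiable Q x -> (\forall y \near x, P (F y) = Q y) -> 'd P x ('d F x v) = 'd Q x v.
Proof.
move=> dF F0 dP dQ PQ; have dPF : differentiable P (F x) by rewrite F0.
have := near_diff v (differentiable_comp_at dF dPF) dQ PQ.
by rewrite (diff_comp_at v dF dPF) F0.
Qed.

End DiffTools.

(** * Eigenvalues of the action at fixed points *)

Section Eigenvalues.
Context {R : realType} {n : nat}.
Variable lam : R.
Hypothesis lamP : 1 < lam < 3 / 2.
Hypothesis n3 : (3 <= n)%N.
Implicit Types x y p v : 'rV[R]_n.
Implicit Types g h : 'M[int]_n.
Local Notation b := (@gb R n).
Local Notation fE := (fE lam b).
Local Notation Px := (Px lam).
Local Notation Qx := (Qx lam).
Local Notation sphere_level := (@sphere_level R n).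
Local Notation wgt := (@wgt R n lam).
Local Notation sexp := (sexp lam).
Let bP : 0 < b <= 1 / 768 := gbP n3.
Let b0 : 0 < b := gb_gt0 n3.

Definition eigval g (mu : R) : Prop := exists2 w : 'rV[R]_n, w <> 0 & act g w = mu *: w.

Let WQ kap y := wgt kap (kf y) *: Qx y.

Lemma analytic_WQ kap x : sphere_level kap -> inbox x -> kf x = kap -> analytic_map (WQ kap) x.
Proof.
move=> sk bx kx j.
apply: (@eq_analytic_at _ _ (fun y => wgt kap (kf y) * Qx y 0 j)) => [y|]; first by rewrite [RHS]mxE.
by apply: analytic_atM; [exact: (analytic_wgt lam n3 sk)|exact: (analytic_Qx lam n3 bx j)].
Qed.

Lemma diff_WQ kap x v j : sphere_level kap -> inbox x -> kf x = kap -> dkf x v = 0 ->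
  ('d (WQ kap) x v) 0 j = wgt kap kap * (fQu lam b (x 0 j) (kf x) * v 0 j).
Proof.
move=> sk bx kx dk0; rewrite -(coord_diff j v (analytic_map_diff (analytic_WQ sk bx kx))).
have -> : (fun y => WQ kap y 0 j) = (fun y => wgt kap (kf y) * Qx y 0 j).
  by apply/funext => y; rewrite [LHS]mxE.
rewrite (diffM_at v (analytic_wgt lam n3 sk kx) (analytic_Qx lam n3 bx j)).
rewrite (diff_Qx lam n3 v j bx) dk0 mulr0 addr0 kx.
have [dw] := is_derive_wgt lam n3 sk; rewrite -{1}kx => dwP.
have [dk _] := analytic_at_diff (analytic_kf x).
have [_ ->] := diff_comp_scalar v dk dwP.
by rewrite diff_kf dk0 mulr0 mul0r add0r.
Qed.

Lemma WQ_kernel kap x v t : sphere_level kap -> inbox x -> kf x = kap -> dkf x v = 0 ->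
  'd (WQ kap) x v = t *: WQ kap x -> v = 0.
Proof.
move=> sk bx kx dk0 e.
have kk : - (2 * b) < kf x <= 0 by rewrite kx; exact: sphere_kap.
have [//|_ //] := Qx_kernel lamP n3 (t := t) bx kk dk0.
move=> i; have w0 : wgt kap kap != 0 by rewrite gt_eqF // (wgt_gt0 lam n3).
  apply: (mulfI w0).
have := diff_WQ i sk bx kx dk0; rewrite e => <-; rewrite /WQ !mxE kx; ring.
Qed.

(** On a sphere, mu is the eigenvalue of the fixed direction. The transverse eigenvalue is a power
    of mu, and the tangential ones are quotients of eigenvalues of g by mu, as for the action on the
    sphere of directions. *)
Variant fixed_spec g x0 (xi : R) : Prop :=
| fixed_one : xi = 1 -> fixed_spec g x0 xi
| fixed_eig : eigval g xi -> fixed_spec g x0 xi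
| fixed_sphere kap mu : sphere_level kap -> 0 < mu -> eigval g mu ->
    xi = mu `^ sexp kap \/ eigval g (xi * mu) -> fixed_spec g x0 xi.

Lemma sphere_relations g x0 F kap T v : sphere_level kap -> inbox x0 -> kf x0 = kap -> analytic_at T x0 ->
  analytic_map F x0 -> F x0 = x0 ->
  (\forall y \near x0, (kf (F y) - kap) * expR (sexp kap * T y) = kf y - kap) ->
  (\forall y \near x0, WQ kap (F y) = expR (T y) *: act g (WQ kap y)) ->
  [/\ WQ kap x0 = expR (T x0) *: act g (WQ kap x0),
      dkf x0 ('d F x0 v) * expR (sexp kap * T x0) = dkf x0 v &
      'd (WQ kap) x0 ('d F x0 v) = expR (T x0) *: ('d T x0 v *: act g (WQ kap x0) + act g ('d (WQ kap) x0 v))].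
Proof.
move=> sk bx kx aT aF F0 nk nq; split.
- by have := nbhs_singleton nq; rewrite F0.
- have dF := analytic_map_diff aF.
  have akx : analytic_at (fun y => kf y - kap) x0 by apply: analytic_atB; [exact: analytic_kf|exact: analytic_at_cst].
  have dk (u : 'rV[R]_n) : 'd (fun y => kf y - kap) x0 u = dkf x0 u.
    have [d1 _] := analytic_at_diff (analytic_kf x0).
    have d2 : differentiable (fun _ : 'rV[R]_n => kap) x0 by [].
    by rewrite (diffB_at u d1 d2) diff_cst_at subr0 diff_kf.
  have akF : analytic_at (fun y => kf (F y) - kap) x0.
    by apply: (analytic_map_comp (F := fun y => kf y - kap) _ aF); rewrite F0.
  have [ae _] := diff_expR_at v (analytic_atM (analytic_at_cst (sexp kap) x0) aT).
  have aM := analytic_atM akF ae.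
  have [d1 _] := analytic_at_diff aM; have [d2 _] := analytic_at_diff akx.
  have := near_diff v d1 d2 nk; rewrite dk (diffM_at v akF ae) F0 kx subrr mul0r addr0 => <-.
  have [d3 _] := analytic_at_diff akF.
  have := diff_fixed v dF F0 d2 d3; rewrite dk => -> //; exact: filterE.
- have aW := analytic_WQ sk bx kx; have dF := analytic_map_diff aF.
  have dW := analytic_map_diff aW.
  have [aA dA] := diff_act g v aW.
  have [ae de] := diff_expR_at v aT.
  have [aE dE] := diff_scale_at v ae aA.
  apply: etrans (diff_fixed v dF F0 dW (analytic_map_diff aE) nq) _; apply: etrans dE _.
  apply: etrans (f_equal2 (fun s w => s *: act g (WQ kap x0) + expR (T x0) *: w) de dA) _.
  move: (act g (WQ kap x0)) ('d T x0 v) (act g _) => W t u.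
  by rewrite scalerDr scalerA.
Qed.

(** Off the spheres the differential of [Px] conjugates that of F to g. On a sphere, a vector
    transverse to it has eigenvalue mu^s. A tangent one is sent by the differential of [WQ] to a
    vector a with g a = xi mu a modulo [WQ], and a multiple of [WQ] corrects it to an
    eigenvector. *)
Lemma fixed_eigen g x0 F v xi : @SLZ n g -> hbox x0 -> analytic_map F x0 -> F x0 = x0 -> lift_spec lam g x0 F ->
  v <> 0 -> 'd F x0 v = xi *: v -> fixed_spec g x0 xi.
Proof.
move=> hg hx aF F0 sp v0 ev; have bx := hbox_inbox hx; have dF := analytic_map_diff aF.
case: sp => [c r nP|kap T sk kx aT nk nq].
  have [k0 kb0] := region_neq n3 r.
  have aP := analytic_Px lam n3 bx k0 kb0; have dP := analytic_map_diff aP.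
  apply: fixed_eig; exists ('d Px x0 v).
    move=> d0; apply: v0; apply: (Px_kernel lamP n3 bx r) => i.
    by rewrite (coord_diff i v dP) d0 mxE.
  have [aA dA] := diff_act g v aP.
  have [dAc eAc] := diffD_cst c v (analytic_map_diff aA).
  have E : 'd Px x0 (xi *: v) = 'd (fun y => act g (Px y) + c) x0 v by rewrite -ev; exact: diff_fixed.
  exact: etrans (esym dA) (etrans (esym eAc) (etrans (esym E) (diffZ_at _ _ _ _))).
have [e1 e2 e3] := sphere_relations v sk bx kx aT aF F0 nk nq.
pose mu := expR (- T x0); have mu0 : 0 < mu := expR_gt0 _.
have emu : expR (T x0) = mu^-1 by rewrite /mu expRN invrK.
have W0 : WQ kap x0 <> 0.
  have kk : - (2 * b) < kf x0 by rewrite kx; case/andP: (sphere_kap n3 sk).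
  move=> /eqP; rewrite scaler_eq0 kx gt_eqF ?(wgt_gt0 lam n3) //= => /eqP.
  exact: (Qx_neq0 lamP n3 bx kk).
have gW : act g (WQ kap x0) = mu *: WQ kap x0.
  by rewrite [in RHS]e1 emu scalerA mulfV ?scale1r // lt0r_neq0.
have eig : eigval g mu by exists (WQ kap x0).
have [x1|x1] := eqVneq xi 1; first exact: fixed_one.
apply: (fixed_sphere _ sk mu0 eig).
have [dk0|dk0] := eqVneq (dkf x0 v) 0; last first.
  left; move: e2; rewrite ev.
  have -> : dkf x0 (xi *: v) = xi * dkf x0 v.
    by rewrite /dkf mulr_sumr; apply: eq_bigr => i _; rewrite mxE; move: (pi : R) => q; ring.
  have -> : expR (sexp kap * T x0) = (mu `^ sexp kap)^-1.
    by rewrite /mu -expRM mulNr expRN invrK mulrC.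
  move=> h; have m0 : mu `^ sexp kap != 0 by rewrite gt_eqF // powR_gt0.
  by apply: (mulIf dk0); rewrite -{2}h; field.
right.
pose a := 'd (WQ kap) x0 v; pose dt := 'd T x0 v.
have kera t : a = t *: WQ kap x0 -> False.
  by move=> h; apply: v0; exact: (WQ_kernel sk bx kx dk0 h).
have {}e3 : xi *: a = expR (T x0) *: (dt *: act g (WQ kap x0) + act g a).
  exact: etrans (esym (etrans (congr1 ('d (WQ kap) x0) ev) (diffZ_at (WQ kap) x0 xi v))) e3.
move: a dt kera e3; rewrite emu gW; move: (WQ kap x0) gW => W gW a dt kera e3.
(* Solves d (1 - xi) = dt, which makes a + d W an eigenvector for xi mu; the case xi = 1 has been
   set aside for this division. *)
pose d := dt / (1 - xi).
exists (a + d *: W).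
  by move=> /eqP; rewrite addr_eq0 -scaleNr => /eqP; exact: kera.
have m0 := lt0r_neq0 mu0; have xi1 : 1 - xi != 0 by rewrite subr_eq0 eq_sym.
rewrite actD actZ gW.
have -> : act g a = mu *: (xi *: a) - (dt * mu) *: W.
  by rewrite e3 (scalerA mu mu^-1) mulfV // scale1r scalerA [X in X - _]addrC addrK.
apply/rowP => i; rewrite !mxE /d; move: (a 0 i) (W 0 i) => A D.
by field.
Qed.

Lemma dkf_neq0 x : inbox x -> kf x = 0 -> exists v, dkf x v != 0.
Proof.
move=> bx k0; have [|i xi] := @nonzero_coord R n x; first by rewrite k0 oppr_lt0 mulr_gt0.
exists (delta_mx 0 i); rewrite /dkf (bigD1 i) //= big1 => [|j /negPf ji]; last by rewrite !mxE ji mulr0.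
rewrite addr0 !mxE !eqxx mulr1; apply: mulf_neq0; first by rewrite mulf_neq0 // gt_eqF // pi_gt0.
have d := dom_box i bx; have d' := dom_normr d.
have [x0|x0] := ltP 0 (x 0 i); first by rewrite gt_eqF // (st_ball n3 d) // k0.
have s0 : 0 < st (- x 0 i).
  by apply: (st_ball n3 (domN d)); rewrite ?k0 // oppr_gt0 lt_neqAle xi.
by rewrite -oppr_eq0 -stN gt_eqF.
Qed.

(** The form l is a left eigenvector, so the matrix of L - xi is singular. *)
Lemma right_eigenvector (L : {linear 'rV[R]_n -> 'rV[R]_n}) (l : {linear 'rV[R]_n -> R^o}) xi v0 :
  l v0 != 0 -> (forall v, l (L v) = xi * l v) -> exists2 v, v <> 0 & L v = xi *: v.
Proof.
move=> l0 h; pose M := lin1_mx L - xi%:M; pose c : 'cV[R]_n := \col_i l (delta_mx 0 i).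
have lc v : (v *m c) 0 0 = l v.
  rewrite mxE {2}(row_sum_delta v) linear_sum; apply: eq_bigr => i _.
  by rewrite linearZ mxE.
have MM v : v *m M = L v - xi *: v by rewrite mulmxBr mul_rV_lin1 mul_mx_scalar.
have Mc : M *m c = 0.
  apply/row_matrixP => i; rewrite row_mul row0; apply/rowP => j; rewrite !ord1 [RHS]mxE lc rowE MM.
  by rewrite linearB linearZ /= h subrr.
have /det0P[v v0' vM] : \det M == 0.
  rewrite -det_tr; apply/det0P; exists c^T.
    apply: contra l0 => /eqP c0; rewrite -lc -(trmxK c) c0 trmx0 mulmx0 mxE //.
  by rewrite -trmx_mul Mc trmx0.
exists v; first exact/eqP.
by apply/eqP; rewrite -subr_eq0 -MM vM.
Qed.

(** At the point of the outer sphere over an eigenvector for chi, the fixed-point equation gives exp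
    (T x) = 1 / chi, and dkf is multiplied by exp (- T x / lam). The form dkf is a left eigenvector,
    which [right_eigenvector] turns into a vector. *)
Lemma sphere_eigenvector g chi : @SLZ n g -> eigval g chi -> 0 < chi ->
  exists x0 F v, [/\ hbox x0, analytic_map F x0, F x0 = x0 /\ rho lam g (torus_proj x0) = torus_proj x0,
    \forall y \near x0, torus_proj (F y) = rho lam g (torus_proj y) &
    v <> 0 /\ 'd F x0 v = chi `^ lam^-1 *: v].
Proof.
move=> hg [p p0 ep] c0.
have [x [c [bx kx cc Qx0]]] := sphere_exists lamP n3 (or_introl erefl) p0.
have hx : hbox x.
  move=> i; have := ball_lt bP (dom_box i bx); rewrite kx => /(_ (lexx 0)).
  by rewrite ltr_norml => /andP[/ltW -> ->].
have QE : act g (Qx x) = chi *: Qx x by rewrite Qx0 actZ ep scalerA mulrC -scalerA.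
have fx : rho lam g (torus_proj x) = torus_proj x.
  apply: (rhoP lamP n3) => //; rewrite tb_proj bxr_id //.
  apply: (@act_sphere _ _ _ _ _ _ 0 chi^-1) => //; [by left|by rewrite invr_gt0|].
  by rewrite QE scalerA mulVf ?scale1r // lt0r_neq0.
have [F [aF F0 nF sp]] := rho_lift lamP n3 hx hg.
rewrite fx tb_proj bxr_id // in F0.
case: sp => [d r _|kap T sk kx' aT nk nq].
  by have [] := region_neq n3 r; rewrite kx eqxx.
have k0 : kap = 0 by rewrite -kx'.
rewrite {}k0 in sk kx' nk nq *.
have [v0 dv0] := dkf_neq0 bx kx.
have [e1 _ _] := sphere_relations 0 sk bx kx aT aF F0 nk nq.
have W0 : WQ 0 x <> 0.
  move=> /eqP; rewrite scaler_eq0 kx gt_eqF ?(wgt_gt0 lam n3) //= => /eqP.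
  by apply: (Qx_neq0 lamP n3 bx); rewrite kx oppr_lt0 mulr_gt0.
have eT : expR (T x) * chi = 1.
  have gW : act g (WQ 0 x) = chi *: WQ 0 x by rewrite /WQ !actZ QE !scalerA mulrC.
  have /eqP : (expR (T x) * chi - 1) *: WQ 0 x = 0 by rewrite scalerBl -scalerA -gW -e1 scale1r subrr.
  by rewrite scaler_eq0 subr_eq0 => /orP[|] /eqP.
have dk u : dkf x ('d F x u) = chi `^ lam^-1 * dkf x u.
  have [_ e2 _] := sphere_relations u sk bx kx aT aF F0 nk nq.
  rewrite -e2 sexp0.
  have -> : expR (lam^-1 * T x) = (chi `^ lam^-1)^-1.
    have -> : T x = - ln chi.
      have := congr1 (@ln R) eT; rewrite lnM ?posrE ?expR_gt0 // expRK ln1 => /eqP.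
      by rewrite addr_eq0 => /eqP.
    by rewrite mulrN expRN /powR gt_eqF.
  by rewrite mulrCA mulfV ?mulr1 // gt_eqF // powR_gt0.
pose l u : R^o := 'd (@kf R n) x u.
have [v vn0 ev] : exists2 v, v <> 0 & 'd F x v = chi `^ lam^-1 *: v.
  apply: (@right_eigenvector ('d F x) ('d (@kf R n) x) _ v0) => [|u].
    by rewrite diff_kf.
  by rewrite !diff_kf dk.
by exists x, F, v.
Qed.

End Eigenvalues.

(** * Lifts of torus maps and invariance under conjugacy *)

Section TorusLifts.
Context {R : realType} {n : nat}.
Implicit Types x y : 'rV[R]_n.
Implicit Types F G : 'rV[R]_n -> 'rV[R]_n.
Implicit Types f : torus R n -> torus R n.

Lemma torus_proj_intv x m : torus_proj (x + intv m) = torus_proj x.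
Proof. by apply/torus_projP; exists m. Qed.

(** Near x the difference of the two lifts is an integer vector of norm at most 1 / 2. *)
Lemma lift_unique F G x : {for x, continuous F} -> {for x, continuous G} -> F x = G x ->
  (\forall y \near x, torus_proj (F y) = torus_proj (G y)) -> \forall y \near x, F y = G y.
Proof.
move=> cF cG FG nFG.
have cFG : {for x, continuous (fun y => F y - G y)} by exact: (continuousB cF cG).
have n1 : \forall y \near x, `|F y - G y| <= 1 / 2.
  apply: (near_continuous (P := fun z : 'rV[R]_n => `|z| <= 1 / 2) cFG); rewrite FG subrr.
  by apply: near0_norm_le; rewrite divr_gt0.
apply: nearS (nearI nFG n1) => y [/torus_projP[m e] h].
have e' := e; apply: etrans e' _; rewrite -[RHS]addr0; congr (_ + _); apply/rowP => i; rewrite !mxE.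
have := le_trans (coord_le_norm (F y - G y) i) h.
rewrite e addrAC subrr add0r mxE; case: (m 0 i) => k.
  by case: k => // k; rewrite ger0_norm // -[(Posz k.+1)%:~R]/(k.+1%:R) => hk; have h1 : 1 <= k.+1%:R :> R by [rewrite ler1n]; lra.
rewrite NegzE mulrNz normrN ger0_norm // -[(Posz k.+1)%:~R]/(k.+1%:R) => hk; have h1 : 1 <= k.+1%:R :> R by [rewrite ler1n]; lra.
Qed.

Lemma C1_lift f x y : torus_class (Cfin (1 : R)) f -> f (torus_proj x) = torus_proj y ->
  exists F, [/\ F x = y, differentiable F x & \forall z \near x, torus_proj (F z) = f (torus_proj z)].
Proof.
move=> /(_ x)[U [F [oU Ux cF lF]]] fx.
have [m e] : exists m, F x = y + intv m by apply/torus_projP; rewrite lF.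
have dF : differentiable F x by move: cF; rewrite /= truncn1 => -[/(_ x Ux)].
exists (fun z => F z - intv m); split; first by rewrite e addrK.
  by apply: differentiableB.
have := open_nbhs_nbhs (conj oU Ux); apply: nearS => z Uz.
by rewrite -lF // -intvN torus_proj_intv.
Qed.

(** The differential of a lift h of the conjugacy intertwines those of F1 and F2. It is injective at
    x because a lift of the inverse is a left inverse of h near x. *)
Lemma C1_conjugate_eigenvalue (f f' phi1 phi2 : torus R n -> torus R n) x y F1 F2 v xi :
  torus_class (Cfin (1 : R)) f -> torus_class (Cfin (1 : R)) f' -> cancel f f' -> f \o phi1 = phi2 \o f ->
  f (torus_proj x) = torus_proj y -> F1 x = x -> F2 y = y -> differentiable F1 x -> differentiable F2 y ->
  (\forall z \near x, torus_proj (F1 z) = phi1 (torus_proj z)) ->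
  (\forall z \near y, torus_proj (F2 z) = phi2 (torus_proj z)) ->
  v <> 0 -> 'd F1 x v = xi *: v -> exists2 w, w <> 0 & 'd F2 y w = xi *: w.
Proof.
move=> cf cf' ff' conj fx F1x F2y dF1 dF2 n1 n2 v0 ev.
have [h [hx dh nh]] := C1_lift cf fx.
have [k [ky dk nk]] : exists k, [/\ k y = x, differentiable k y & \forall z \near y, torus_proj (k z) = f' (torus_proj z)].
  by apply: C1_lift => //; rewrite -fx ff'.
have ch := differentiable_continuous dh.
have dkh : differentiable k (h x) by rewrite hx.
have dF2h : differentiable F2 (h x) by rewrite hx.
have dhF1 : differentiable h (F1 x) by rewrite F1x.
have c1 := differentiable_continuous dF1.
exists ('d h x v).
  move=> d0; apply: v0.
  have nid : \forall z \near x, k (h z) = z.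
    apply: (@lift_unique (fun z => k (h z)) id) => //; last 2 first.
    - by rewrite hx ky.
    - have nkh : \forall z \near x, torus_proj (k (h z)) = f' (torus_proj (h z)).
        by apply: (near_continuous (P := fun u => torus_proj (k u) = f' (torus_proj u)) ch); rewrite hx.
      by apply: nearS (nearI nh nkh) => z [e1 ->]; rewrite e1 ff'.
    by apply: differentiable_continuous; exact: differentiable_comp_at.
  have did : differentiable (id : 'rV[R]_n -> 'rV[R]_n) x by [].
  have := near_diff v (differentiable_comp_at dh dkh) did nid.
  move=> e; have e3 : 'd k (h x) ('d h x v) = 'd id x v := etrans (esym (diff_comp_at v dh dkh)) e.
  have e4 : 'd id x v = 0 := etrans (esym e3) (etrans (congr1 ('d k (h x)) d0) (linear0 _)).
  apply/rowP => i; rewrite -[LHS](diff_coord x v i).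
  exact: etrans (coord_diff i v did) (congr1 (fun u : 'rV[R]_n => u 0 i) e4).
have nc : \forall z \near x, h (F1 z) = F2 (h z).
  apply: (@lift_unique (fun z => h (F1 z)) (fun z => F2 (h z))); last 2 first.
  - by rewrite F1x hx F2y.
  - have m1 : \forall z \near x, torus_proj (h (F1 z)) = f (torus_proj (F1 z)).
      by apply: (near_continuous (P := fun u => torus_proj (h u) = f (torus_proj u)) c1); rewrite F1x.
    have m2 : \forall z \near x, torus_proj (F2 (h z)) = phi2 (torus_proj (h z)).
      by apply: (near_continuous (P := fun u => torus_proj (F2 u) = phi2 (torus_proj u)) ch); rewrite hx.
    apply: nearS (nearI (nearI n1 nh) (nearI m1 m2)) => z [[e1 e2] [-> ->]].
    rewrite e1 e2; exact: (congr1 (fun p => p (torus_proj z)) conj).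
  - by apply: differentiable_continuous; exact: differentiable_comp_at.
  - by apply: differentiable_continuous; exact: differentiable_comp_at.
have := near_diff v (differentiable_comp_at dF1 dhF1) (differentiable_comp_at dh dF2h) nc.
move=> e; have e5 := etrans (etrans (esym (diff_comp_at v dF1 dhF1)) e) (diff_comp_at v dh dF2h).
 rewrite F1x hx in e5.
exact: etrans (esym e5) (etrans (congr1 ('d h x) ev) (diffZ_at _ _ _ _)).
Qed.

End TorusLifts.

(** * A hyperbolic matrix and its powers *)

Section Unipotent.
Context {R : realType} {n : nat}.
Hypothesis n3 : (3 <= n)%N.
Implicit Types w : 'rV[R]_n.

Let i0 : 'I_n := Ordinal (ltn_trans (isT : 0 < 2)%N n3).
Let i1 : 'I_n := Ordinal (ltn_trans (isT : 1 < 2)%N n3).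

Let i01 : (i0 == i1) = false. Proof. by []. Qed.
Let i10 : (i1 == i0) = false. Proof. by []. Qed.

Definition shear : 'M[int]_n := 1%:M + delta_mx i1 i0.
(* [[2, 1], [1, 1]] extended by the identity. *)
Definition hyperbolic : 'M[int]_n := shear^T *m shear.

Lemma det_shear : \det shear = 1.
Proof.
rewrite det_trig.
  by rewrite big1 // => i _; rewrite !mxE eqxx; case: eqP => // ->; rewrite i10 addr0.
apply/is_trig_mxP => i j ij; rewrite !mxE.
have -> : (i == j) = false by apply/negbTE; rewrite neq_ltn ij.
rewrite add0r; case: (i =P i1) => [ei|//]; case: (j =P i0) => [ej|//].
by move: ij; rewrite ei ej.
Qed.

Lemma hyperbolic_SLZ : @SLZ n hyperbolic.
Proof. by rewrite /SLZ /= det_mulmx det_tr det_shear. Qed.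

Lemma hyperbolicE w : act hyperbolic w = w + (w 0 i0 + w 0 i1) *: delta_mx 0 i0 + w 0 i0 *: delta_mx 0 i1.
Proof.
have T : (map_mx intr hyperbolic)^T = (map_mx intr shear)^T *m map_mx intr shear :> 'M[R]_n.
  by rewrite !map_trmx -map_mxM trmx_mul trmxK.
have S (u : 'rV[R]_n) : u *m map_mx intr shear = u + u 0 i1 *: delta_mx 0 i0.
  rewrite /shear map_mxD map_mx1 map_delta_mx mulmxDr mulmx1; congr (_ + _).
  apply/rowP => j; rewrite !mxE (bigD1 i1) //= big1 => [|k /negPf ki]; last by rewrite mxE ki mulr0.
  by rewrite !mxE eqxx addr0.
have S' (u : 'rV[R]_n) : u *m (map_mx intr shear)^T = u + u 0 i0 *: delta_mx 0 i1.
  rewrite /shear map_mxD map_mx1 map_delta_mx linearD /= trmx1 trmx_delta mulmxDr mulmx1; congr (_ + _).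
  apply/rowP => j; rewrite !mxE (bigD1 i0) //= big1 => [|k /negPf ki]; last by rewrite mxE ki mulr0.
  by rewrite !mxE eqxx addr0.
rewrite /act T mulmxA S' S; apply/rowP => j; rewrite !mxE ?eqxx ?i10 ?i01 /=; ring.
Qed.

Definition hpow m : 'M[int]_n := iter m (mulmx hyperbolic) 1%:M.

Lemma hpowD k m : hpow (k + m) = hpow k *m hpow m.
Proof. by elim: k => [|k IH]; [rewrite mul1mx|rewrite /hpow iterD /= -/(hpow _) -mulmxA -IH /hpow iterD]. Qed.

Lemma hpow_SLZ m : @SLZ n (hpow m).
Proof.
elim: m => [|m IH]; first by rewrite /SLZ /= det1.
by rewrite /SLZ /hpow /= det_mulmx -/(hpow m) IH hyperbolic_SLZ.
Qed.

Lemma act_hpowS m w : act (hpow m.+1) w = act hyperbolic (act (hpow m) w).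
Proof. exact: actM. Qed.

Definition golden : R := (1 + Num.sqrt 5) / 2.

Lemma golden_sq : golden ^+ 2 = golden + 1.
Proof.
have h : Num.sqrt 5 ^+ 2 = 5 :> R by apply: sqr_sqrtr.
rewrite /golden; move: (Num.sqrt _) h => s h.
by apply: (@mulfI _ 4) => //; rewrite (_ : 4 * ((1 + s) / 2) ^+ 2 = (1 + s) ^+ 2); [rewrite sqrrD h; field|field].
Qed.

Lemma golden_gt1 : 1 < golden.
Proof.
have : 1 < Num.sqrt 5 :> R by rewrite -[X in X < _]sqrtr1 ltr_sqrt // ltr1n.
rewrite /golden; lra.
Qed.

(** For a^2 = a + 1 this linear form is a left eigenvector of [hyperbolic] with eigenvalue a + 1.
    The two roots are the golden ratio and its conjugate [1 - golden]. *)
Definition hfun (a : R) w := a * w 0 i0 + w 0 i1.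

Lemma hfun_hpow a m w : a ^+ 2 = a + 1 -> hfun a (act (hpow m) w) = (a + 1) ^+ m * hfun a w.
Proof.
move=> a2; elim: m => [|m IH]; first by rewrite /hpow /= act1 mul1r.
rewrite act_hpowS exprS -mulrA -IH; move: (act _ w) => u.
rewrite /hfun hyperbolicE !mxE !eqxx i01 i10 /= !mulr0 !mulr1 ?addr0 ?add0r.
rewrite (_ : (a + 1) * _ = (a ^+ 2 + a) * u 0 i0 + (a + 1) * u 0 i1); last by ring.
by rewrite a2; ring.
Qed.

Lemma hpow_rest m w j : j != i0 -> j != i1 -> act (hpow m) w 0 j = w 0 j.
Proof.
move=> /negPf j0 /negPf j1; elim: m => [|m IH]; first by rewrite /hpow /= act1.
by rewrite act_hpowS -[RHS]IH; move: (act _ w) => u; rewrite hyperbolicE !mxE j0 j1 andbF !mulr0 !addr0.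
Qed.

(** An eigenvector on which one of the two forms [hfun] does not vanish has the corresponding
    eigenvalue. If both vanish, it has a nonzero coordinate outside the first two, and there the
    matrix acts as the identity. *)
Lemma hpow_eigval m (mu : R) : eigval (hpow m) mu ->
  [\/ mu = (golden + 1) ^+ m, mu = (golden + 1) ^- m | mu = 1].
Proof.
move=> [w w0 e]; pose psi := 1 - golden.
have psi2 : psi ^+ 2 = psi + 1.
  by have := golden_sq; rewrite /psi sqrrB expr1n mul1r => ->; ring.
have inv : (psi + 1) = (golden + 1)^-1.
  have g1 := golden_gt1; have g0 : golden + 1 != 0 by rewrite gt_eqF //; lra.
  apply: (mulIf g0); rewrite mulVf //.
  rewrite (_ : _ * _ = 2 + golden - golden ^+ 2); last by rewrite /psi; ring.
  by rewrite golden_sq; ring.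
have S a : a ^+ 2 = a + 1 -> hfun a w != 0 -> mu = (a + 1) ^+ m.
  move=> a2 h; apply: (mulIf h); rewrite -hfun_hpow // e /hfun !mxE; ring.
have [f0|f0] := eqVneq (hfun golden w) 0; last by constructor 1; exact: S golden_sq f0.
have [p0|p0] := eqVneq (hfun psi w) 0; last first.
  by constructor 2; rewrite (S _ psi2 p0) inv exprVn.
constructor 3.
have w00 : w 0 i0 = 0.
  have : (golden - psi) * w 0 i0 = 0 by rewrite mulrBl -(addrK (w 0 i1) (golden * _)) -/(hfun _ w) f0 sub0r; move/eqP: p0; rewrite /hfun addr_eq0 => /eqP ->; rewrite opprK; ring.
  move/eqP; rewrite mulf_eq0 => /orP[|/eqP//]; rewrite gt_eqF // /psi; have := golden_gt1; lra.
have w01 : w 0 i1 = 0 by move: f0; rewrite /hfun w00 mulr0 add0r.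
have [j wj] : exists j, w 0 j != 0.
  apply: contrapT => /forallNP h; apply: w0; apply/rowP => j; rewrite mxE.
  by have /negP := h j; rewrite negbK => /eqP.
have j0 : j != i0 by apply: contraNneq wj => ->; rewrite w00.
have j1 : j != i1 by apply: contraNneq wj => ->; rewrite w01.
by apply: (mulIf wj); rewrite mul1r -{2}(hpow_rest m w j0 j1) e mxE.
Qed.

Lemma hpow_golden m : @eigval R n (hpow m) ((golden + 1) ^+ m).
Proof.
exists (golden *: delta_mx 0 i0 + delta_mx 0 i1).
  by move/rowP/(_ i1); rewrite !mxE !eqxx i10 mulr0 add0r => /eqP; rewrite oner_eq0.
elim: m => [|m IH]; first by rewrite /hpow /= act1 scale1r.
rewrite act_hpowS IH actZ exprSr -scalerA; congr (_ *: _); rewrite hyperbolicE.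
apply/rowP => j; rewrite !mxE !eqxx i01 i10 /= !mulr0 !mulr1 !(add0r, addr0).
have := golden_sq; case: (j == i0); case: (j == i1); rewrite /= ?mulr0 ?mulr1 ?addr0 ?add0r; move: golden => a; rewrite expr2 => h; lra.
Qed.

(** Finitely many cosets and infinitely many powers: two powers share a coset, and their quotient
    lies in G. *)
Lemma finite_index_hpow (G : set 'M[int]_n) : SLZ_subgroup G -> finite_index G ->
  exists2 m, (0 < m)%N & G (hpow m).
Proof.
move=> [GS G1 GM GV] fin.
pose C k : set 'M[int]_n := [set hpow k *m h | h in G].
have [i [j [ij eC]]] : exists i j, (i < j)%N /\ C i = C j.
  apply: contrapT => h; apply: infinite_nat.
  have -> : [set: nat] = C @^-1` [set [set g *m h | h in G] | g in @SLZ n].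
    by apply/seteqP; split => k // _; exists (hpow k) => //; exact: hpow_SLZ.
  apply: finite_preimage => // i j _ _ e; case: (ltngtP i j) => // ij; case: h.
    by exists i, j.
  by exists j, i.
exists (j - i)%N; first by rewrite subn_gt0.
have : C j (hpow j) by exists 1%:M => //; rewrite mulmx1.
rewrite -eC => -[g Gg]; rewrite -{1}(subnKC (ltnW ij)) hpowD => /(congr1 (mulmx (invmx (hpow i)))).
by rewrite !(mulKmx (SLZ_unit (hpow_SLZ i))) => <-.
Qed.

End Unipotent.

(** * Recovering the parameter from the conjugacy class *)

Section Rigidity.
Context {R : realType} {n : nat}.
Hypothesis n3 : (3 <= n)%N.

(** The exponent 1 / lam1 lies strictly between 2 / 3 and 1, hence is positive and no integer. Among
    the exponents that can occur for lam2 it can therefore only be 1 / lam2. *)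
Lemma conjugate_exponent (lam1 lam2 : R) g (chi : R) (f f' : torus R n -> torus R n) :
  1 < lam1 < 3 / 2 -> 1 < lam2 < 3 / 2 -> @SLZ n g -> 1 < chi ->
  eigval g chi -> (forall mu : R, @eigval R n g mu -> [\/ mu = chi, mu = chi^-1 | mu = 1]) ->
  torus_class (Cfin (1 : R)) f -> torus_class (Cfin (1 : R)) f' -> cancel f f' ->
  f \o rho lam1 g = rho lam2 g \o f -> lam1 = lam2.
Proof.
move=> l1 l2 hg c1 eg eigs cf cf' ff' conj.
have c0 : 0 < chi by lra.
have [x [F1 [v [hx aF1 [F1x fx] nF1 [v0 ev]]]]] := sphere_eigenvector l1 n3 hg eg c0.
pose y := tb (f (torus_proj x)); have hy : hbox y := hbox_tb _.
have ey : f (torus_proj x) = torus_proj y by rewrite tbK.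
have fy : rho lam2 g (torus_proj y) = torus_proj y.
  by rewrite -ey -[LHS]/((rho lam2 g \o f) (torus_proj x)) -conj /= fx.
have [F2 [aF2 F2y nF2 sp]] := rho_lift l2 n3 hy hg.
rewrite fy tb_proj bxr_id // in F2y.
have [w w0 ew] := C1_conjugate_eigenvalue cf cf' ff' conj ey F1x F2y (analytic_map_diff aF1) (analytic_map_diff aF2) nF1 nF2 v0 ev.
have lc : 0 < ln chi by rewrite ln_gt0.
have inj (s t : R) : chi `^ s = chi `^ t -> s = t.
  by move=> /(congr1 (@ln R)); rewrite !ln_powR => /(mulIf (lt0r_neq0 lc)).
have ex (mu : R) : @eigval R n g mu -> exists2 e : R, mu = chi `^ e & [\/ e = 1, e = -1 | e = 0].
  move=> /eigs[] ->; [exists 1; last by constructor 1|exists (-1); last by constructor 2|exists 0; last by constructor 3].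
  - by rewrite powRr1 // ltW.
  - by rewrite powR_inv1 // ltW.
  - by rewrite powRr0.
have b1 : 2 / 3 < lam1^-1 < 1.
  case/andP: l1 => h1 h2; apply/andP; split; last by rewrite invf_lt1 //; lra.
  by rewrite -(invf_div 3 2) ltf_pV2 ?posrE; lra.
have b2 : 2 / 3 < lam2^-1 < 1.
  case/andP: l2 => h1 h2; apply/andP; split; last by rewrite invf_lt1 //; lra.
  by rewrite -(invf_div 3 2) ltf_pV2 ?posrE; lra.
have := fixed_eigen l2 n3 hg hy aF2 F2y sp w0 ew.
case=> [e|/ex[e /inj E []]|kap mu sk mu0 /ex[e -> he]].
- have : lam1^-1 = 0 by apply: inj; rewrite e powRr0.
  by lra.
- by move=> e'; lra.
- by move=> e'; lra.
- by move=> e'; lra.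
case=> [h|/ex[e2]].
  have : lam1^-1 = e * sexp lam2 kap by apply: inj; rewrite h powRrM.
  rewrite /sexp; case: (kap == 0) => E.
    case: he E => -> E; [by apply: invr_inj; rewrite E mul1r|lra|lra].
  by case: he E => -> E; lra.
rewrite -powRD; last by rewrite lt0r_neq0 // implybT.
by move=> /inj E he2; case: he2 E => -> E; case: he E => -> E; lra.
Qed.

End Rigidity.

(** Makes equal actions conjugate, so that rigidity also shows that different parameters give
    different actions. *)
Lemma id_torus_diffeo (R : realType) n (r : regularity R) : regularity_gt 0 r -> torus_diffeo r (@id (torus R n)).
Proof.
move=> r0; have c : torus_class r (@id (torus R n)).
  move=> x; exists setT, id; split => //; first exact: openT.
  by apply: analytic_class_on => // y _ i; exact: analytic_at_coord.
by split => //; exists id.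
Qed.

Theorem theorem3p2 (R : realType) (n : nat) (hn : (3 <= n)%N)
    (Gamma : set 'M[int]_n) (Gamma_subgroup : SLZ_subgroup Gamma)
    (Gamma_index : finite_index Gamma)
    (r : regularity R) (hr : regularity_gt 2 r) :
  exists A : set (Gamma -> torus R n -> torus R n),
    [/\ ~ countable A,
        forall rho, A rho -> torus_action r rho &
        forall rho1 rho2, A rho1 -> A rho2 -> rho1 <> rho2 ->
          ~ C1_conjugate rho1 rho2].
Proof.
have [GS G1 GM GV] := Gamma_subgroup.
have hG (g : Gamma) : @SLZ n (val g) by apply: GS; exact: set_mem (valP g).
have r0 : regularity_gt 0 r by case: (r) hr => //= s; apply: lt_trans.
have [m m0 Gm] := finite_index_hpow hn Gamma_subgroup Gamma_index.
pose act_of (lam : R) (g : Gamma) := rho lam (val g) : torus R n -> torus R n.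
pose I := `]1, (3 / 2)[%classic : set R.
have IP lam : I lam -> 1 < lam < 3 / 2 by rewrite /I /= in_itv.
have rigid lam1 lam2 : I lam1 -> I lam2 -> C1_conjugate (act_of lam1) (act_of lam2) -> lam1 = lam2.
  move=> /IP l1 /IP l2 [f [[cf [f' [cf' ff' _]]] conj]].
  have g1 := @golden_gt1 R; have g0 : golden + 1 != 0 :> R by rewrite gt_eqF //; lra.
  apply: (conjugate_exponent hn l1 l2 (hpow_SLZ hn m) _ (hpow_golden hn m) (@hpow_eigval R n hn m) cf cf' ff').
    have p1 : 1 < golden + 1 :> R by lra.
    by rewrite exprn_egt1 // -lt0n.
  exact: (conj (exist _ (hpow hn m) (mem_set Gm))).
exists (act_of @` I); split.
- have inj : {in I &, injective act_of}.
    move=> lam1 lam2 /set_mem I1 /set_mem I2 e; apply: rigid => //; rewrite e.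
    by exists id; split; [exact: (@id_torus_diffeo R n (Cfin 1) ltr01)|].
  (* By injectivity the interval of parameters would be countable, hence of Lebesgue measure 0,
     while its length is 1 / 2. *)
  rewrite (eq_countable (inj_card_eq inj)) => cI.
  have := countable_lebesgue_measure0 cI; rewrite /I lebesgue_measure_itv /= lte_fin.
  have h : 1 < 3 / 2 :> R by lra.
  by rewrite h -EFinD => -[]; lra.
- move=> _ [lam /IP Il <-]; split => [g|g h k e].
    exact: rho_torus_diffeo.
  by apply/funext => t; rewrite /act_of e (rho_comp Il hn).
- move=> _ _ [lam1 I1 <-] [lam2 I2 <-] ne conj; apply: ne.
  by rewrite (rigid _ _ I1 I2 conj).
Qed.
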